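(* Let $\Omega$ be a domain in $\mathbb{C}^n$, let $\alpha\in(0,1)$, let $\lambda>0$ be a constant, and let $f\in\mathcal{C}^{\alpha}(\Omega)$ satisfy $f\ge\lambda$ on $\Omega$. Let $u\in PSH(\Omega)\cap\mathcal{C}(\Omega)$ be a weak solution of the complex Monge-Ampère equation $$\det(u_{i\bar j})=f\quad\text{in }\Omega .$$ Put $$\beta_0=\beta_0(n,\alpha)=1-\frac{\alpha}{n(2+\alpha)-1},$$ and suppose that $u\in\mathcal{C}^{1,\beta}(\Omega)$ for some $\beta\in(\beta_0,1)$. Then $u\in\mathcal{C}^{1,1}(\Omega)$. Furthermore, for every relatively compact subset $K$ of $\Omega$, the $\mathcal{C}^{1,1}$ norm of $u$ on $K$ is bounded by a constant depending only on $n,\alpha,\beta,\lambda,\|u\|_{\mathcal{C}^{1,\beta}(\Omega)},\|f\|_{\mathcal{C}^{\alpha}(\Omega)}$ and the distance from $K$ to $\partial\Omega$.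
   Context: $PSH(\Omega)$ denotes the plurisubharmonic functions on $\Omega$, and $u_{i\bar j}=\partial^2u/\partial z_i\partial\bar z_j$. For continuous plurisubharmonic $u$, ''weak solution'' of $\det(u_{i\bar j})=f$ is meant in the sense of Bedford-Taylor: the Monge-Ampère measure of $u$, normalized so that it equals $\det(u_{i\bar j})$ times Lebesgue measure when $u$ is $\mathcal{C}^2$, equals $f$ times Lebesgue measure. Identify $\mathbb{C}^n=\mathbb{R}^{2n}$, with $\nabla^k$ the real $k$-th order derivative. For an integer $k\ge0$ and $\gamma\in(0,1]$, $\mathcal{C}^{k,\gamma}(\Omega)$ is the space of $\mathcal{C}^k$ functions whose $k$-th derivatives are (locally) Hölder continuous with exponent $\gamma$ in $\Omega$ (Lipschitz if $\gamma=1$); $\mathcal{C}^{\gamma}=\mathcal{C}^{0,\gamma}$ for $\gamma\in(0,1)$. For a set $E$, $\|u\|_{\mathcal{C}^{k,\gamma}(E)}=\sum_{i=0}^k\sup_E|\nabla^iu|+\sup_{x\ne y\in E}\frac{|\nabla^ku(x)-\nabla^ku(y)|}{|x-y|^\gamma}$. The quantitative estimate is understood when the norms over $\Omega$ on which the constant depends are finite. *)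

(* Defs.v *)
From HB Require Import structures.
From mathcomp Require Import all_boot all_order all_algebra.
From mathcomp Require Import all_classical all_reals all_analysis.
From mathcomp Require Import complex.
Set Implicit Arguments.
Unset Strict Implicit.
Unset Printing Implicit Defensive.
Import Order.TTheory GRing.Theory Num.Theory numFieldNormedType.Exports.
Local Open Scope classical_set_scope.
Local Open Scope ring_scope.

(* Lebesgue measure on 'rV[R]_m: the m-fold product of the one-dimensional
   Lebesgue measure on m-tuples, transported to row vectors, whose sigma-algebra
   is the one generated by the coordinates (the Borel sets). *)

Definition pushforward_measure d1 d2 (T1 : measurableType d1)
    (T2 : measurableType d2) (R : realType) (mu : {measure set T1 -> \bar R})
    (f : T1 -> T2) (mf : measurable_fun setT f) :
    {measure set T2 -> \bar R} :=
  measure_function_pushforward__canonical__measure_function_Measure mu mf.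

Definition cons_pair (R : realType) (m : nat)
    (p : measurableTypeR R * m.-tuple (measurableTypeR R)) :
  m.+1.-tuple (measurableTypeR R) := [tuple of p.1 :: p.2].

Lemma measurable_cons_pair (R : realType) (m : nat) :
  measurable_fun setT (@cons_pair R m).
Proof. exact: (measurable_cons measurable_fst measurable_snd). Qed.

Definition lebesgue_cons (R : realType) (m : nat)
    (mu : {sigma_finite_measure set (m.-tuple (measurableTypeR R)) -> \bar R})
    : set (m.+1.-tuple (measurableTypeR R)) -> \bar R :=
  pushforward (lebesgue_measure \x mu)%E (@cons_pair R m).

Section lebesgue_cons_measure.
Context (R : realType) (m : nat).
Variable mu : {sigma_finite_measure set (m.-tuple (measurableTypeR R)) -> \bar R}.

Let lc0 : lebesgue_cons mu set0 = 0%E.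
Proof. exact: (measure0 (pushforward_measure (lebesgue_measure \x mu)%E (@measurable_cons_pair R m))). Qed.

Let lc_ge0 A : (0 <= lebesgue_cons mu A)%E.
Proof. exact: (measure_ge0 (pushforward_measure (lebesgue_measure \x mu)%E (@measurable_cons_pair R m))). Qed.

Let lc_sigma : semi_sigma_additive (lebesgue_cons mu).
Proof. exact: (@measure_semi_sigma_additive _ _ _ (pushforward_measure (lebesgue_measure \x mu)%E (@measurable_cons_pair R m))). Qed.

HB.instance Definition _ :=
  isMeasure.Build _ _ _ (lebesgue_cons mu) lc0 lc_ge0 lc_sigma.

Let lc_sigma_finite : sigma_finite setT (lebesgue_cons mu).
Proof.
pose g := fun t : m.+1.-tuple (measurableTypeR R) =>
  (thead t, [tuple of behead t]).
have mg : measurable_fun setT g.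
  apply: measurable_fun_pair; first exact: measurable_tnth.
  exact: measurable_behead.
have gK : cancel (@cons_pair R m) g.
  move=> [x t]; rewrite /cons_pair /g /= theadE; congr pair.
  exact/val_inj.
have /sigma_finiteP[F [FT ndF Foo]] := sigma_finiteT (@lebesgue_measure R).
have /sigma_finiteP[G [GT ndG Goo]] := sigma_finiteT mu.
exists (fun i => g @^-1` (F i `*` G i)).
  apply/esym; rewrite -subTset => t _.
  have [k _ Fk] : (\bigcup_k F k) (g t).1 by rewrite -FT.
  have [l _ Gl] : (\bigcup_l G l) (g t).2 by rewrite -GT.
  exists (maxn k l) => //; split.
  - by move: Fk; exact/subsetPset/ndF/leq_maxl.
  - by move: Gl; exact/subsetPset/ndG/leq_maxr.
move=> i; have [mF Fi] := Foo i; have [mG Gi] := Goo i.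
have mFG : measurable (F i `*` G i) by exact: measurableX.
split; first by rewrite -[X in measurable X]setTI; exact: mg.
rewrite /lebesgue_cons /pushforward -comp_preimage.
rewrite (_ : g \o _ = id); last exact/funext.
by rewrite preimage_id product_measure1E// lte_mul_pinfty// ge0_fin_numE.
Qed.

HB.instance Definition _ :=
  Measure_isSigmaFinite.Build _ _ _ (lebesgue_cons mu) lc_sigma_finite.

End lebesgue_cons_measure.

Fixpoint lebesgue_tuple (R : realType) (m : nat) :
    {sigma_finite_measure set (m.-tuple (measurableTypeR R)) -> \bar R} :=
  match m with
  | 0 => (\d_ ([tuple] : 0.-tuple (measurableTypeR R)) : set _ -> \bar R)
  | k.+1 => (lebesgue_cons (@lebesgue_tuple R k) : set _ -> \bar R)
  end.

Definition measure_rV_display : measure_display -> measure_display.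
Proof. exact. Qed.

Section measurable_rV.
Context {R : realType}.
Variable m : nat.

Let coors : 'I_m -> 'rV[R]_m -> measurableTypeR R := fun i x => x ord0 i.

Let rV_set0 : g_sigma_preimage coors set0.
Proof. exact: sigma_algebra0. Qed.

Let rV_setC A : g_sigma_preimage coors A -> g_sigma_preimage coors (~` A).
Proof. exact: sigma_algebraC. Qed.

Let rV_bigcup (F : _^nat) : (forall i, g_sigma_preimage coors (F i)) ->
  g_sigma_preimage coors (\bigcup_i (F i)).
Proof. exact: sigma_algebra_bigcup. Qed.

HB.instance Definition _ := @isMeasurable.Build
  (measure_rV_display default_measure_display)
  'rV[R]_m (g_sigma_preimage coors) rV_set0 rV_setC rV_bigcup.

End measurable_rV.

Definition row_of_tuple (R : realType) (m : nat)
    (t : m.-tuple (measurableTypeR R)) : 'rV[R]_m := \row_i tnth t i.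

Lemma measurable_row_of_tuple (R : realType) (m : nat) :
  measurable_fun setT (@row_of_tuple R m).
Proof.
move=> _ Y mY; rewrite setTI.
suff : preimage_set_system setT (@row_of_tuple R m) measurable
    `<=` measurable by apply; exists Y; rewrite ?setTI.
rewrite -g_sigma_preimage_comp.
set F := (X in g_sigma_preimage X).
rewrite (_ : F = fun i t => tnth t i) //.
by apply/funext => i; apply/funext => t; rewrite /F /= mxE.
Qed.

Definition lebesgue_rV (R : realType) (m : nat) :
    {measure set 'rV[R]_m -> \bar R} :=
  pushforward_measure
    (@lebesgue_tuple R m) (@measurable_row_of_tuple R m).

(* C^n is R^(2n): the point with real part x and imaginary part y is
   row_mx x y, so that z_i = x_i + i y_i has real coordinates number
   lshift n i and rshift n i. *)
Notation Cspace R n := ('rV[R]_(n + n)).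

Definition enorm (R : realType) (m : nat) (x : 'rV[R]_m) : R :=
  Num.sqrt (\sum_(i < m) x ord0 i ^+ 2).

(* Multiplication of the vector w of C^n by e^(it). *)
Definition crot (R : realType) (n : nat) (t : R) (w : Cspace R n) :
    Cspace R n :=
  row_mx (cos t *: lsubmx w - sin t *: rsubmx w)
         (sin t *: lsubmx w + cos t *: rsubmx w).

Definition is_domain (R : realType) (m : nat) (Omega : set 'rV[R]_m) : Prop :=
  [/\ open Omega, connected Omega & Omega !=set0].

(* Iterated partial derivatives; |nabla^k u| is the Euclidean norm of the
   family of all the partial derivatives of order k. *)

Definition dpart (R : realType) (m : nat) (s : seq 'I_m) (u : 'rV[R]_m -> R) :
    'rV[R]_m -> R :=
  foldr (fun (i : 'I_m) (g : 'rV[R]_m -> R) (x : 'rV[R]_m) =>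
           'D_(delta_mx ord0 i) g x) u s.

Definition is_Ck (R : realType) (m k : nat) (Omega : set 'rV[R]_m)
    (u : 'rV[R]_m -> R) : Prop :=
  (forall (s : seq 'I_m) (x : 'rV[R]_m), (size s <= k)%N -> Omega x ->
     {for x, continuous (dpart s u)}) /\
  (forall (s : seq 'I_m) (i : 'I_m) (x : 'rV[R]_m), (size s < k)%N ->
     Omega x -> derivable (dpart s u) x (delta_mx ord0 i)).

Definition tensor_norm (R : realType) (m k : nat) (a : seq 'I_m -> R) : R :=
  Num.sqrt (\sum_(s : k.-tuple 'I_m) a s ^+ 2).

Definition nabla_norm (R : realType) (m k : nat) (u : 'rV[R]_m -> R)
    (x : 'rV[R]_m) : R :=
  tensor_norm k (fun s => dpart s u x).

Definition nabla_dist (R : realType) (m k : nat) (u : 'rV[R]_m -> R)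
    (x y : 'rV[R]_m) : R :=
  tensor_norm k (fun s => dpart s u x - dpart s u y).

(* C^(k,gamma)(Omega), with the local (i.e. on compact subsets) Hoelder
   condition on the derivatives of order k. *)
Definition holder_class (R : realType) (m k : nat) (gamma : R)
    (Omega : set 'rV[R]_m) (u : 'rV[R]_m -> R) : Prop :=
  is_Ck k Omega u /\
  forall K : set 'rV[R]_m, compact K -> K `<=` Omega ->
    exists M : R, forall x y : 'rV[R]_m, K x -> K y ->
      nabla_dist k u x y <= M * enorm (x - y) `^ gamma.

(* Supremum of a set of nonnegative numbers; the empty set has supremum 0
   rather than -oo. *)
Definition sup_ge0 (R : realType) (A : set (\bar R)) : \bar R :=
  ereal_sup (0%E |` A).

Definition holder_norm (R : realType) (m k : nat) (gamma : R)
    (E : set 'rV[R]_m) (u : 'rV[R]_m -> R) : \bar R :=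
  (\sum_(i < k.+1) sup_ge0 [set (nabla_norm i u x)%:E | x in E] +
   sup_ge0 [set (nabla_dist k u p.1 p.2 / enorm (p.1 - p.2) `^ gamma)%:E |
            p in [set p : 'rV[R]_m * 'rV[R]_m |
                  [/\ E p.1, E p.2 & p.1 != p.2]]])%E.

(* Plurisubharmonic functions: upper semicontinuous, not identically -oo, with
   the sub-mean value inequality on the closed complex discs of Omega. *)
Definition psh (R : realType) (n : nat) (Omega : set (Cspace R n))
    (u : Cspace R n -> \bar R) : Prop :=
  [/\ (forall z, Omega z -> (u z < +oo)%E),
      (exists2 z, Omega z & u z != -oo%E),
      (forall (z : Cspace R n) (a : R), Omega z -> (u z < a%:E)%E ->
         \forall y \near z, (u y < a%:E)%E) &
      (forall z w : Cspace R n,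
         (forall r t : R, 0 <= r <= 1 -> Omega (z + r *: crot t w)) ->
         ((2 * pi)%:E * u z <=
          \int[lebesgue_measure]_(t in `[0%R, (2 * pi)%R]) u (z + crot t w)%R)%E)].

Definition Cc (R : realType) (m : nat) (Omega : set 'rV[R]_m)
    (phi : 'rV[R]_m -> R) : Prop :=
  continuous phi /\
  exists K : set 'rV[R]_m,
    [/\ compact K, K `<=` Omega & forall x, ~ K x -> phi x = 0].

Definition Cc_smooth (R : realType) (m : nat) (Omega : set 'rV[R]_m)
    (phi : 'rV[R]_m -> R) : Prop :=
  Cc Omega phi /\ forall k : nat, is_Ck k setT phi.

(* Distributions of order zero on Omega, i.e. complex Radon measures, given by
   their action on the real-valued functions of C_c(Omega). *)
Definition order_zero (R : realType) (m : nat) (Omega : set 'rV[R]_m)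
    (L : ('rV[R]_m -> R) -> R[i]) : Prop :=
  (forall (a : R) (phi psi : 'rV[R]_m -> R), Cc Omega phi -> Cc Omega psi ->
     L (fun x => a * phi x + psi x) = a%:C%C * L phi + L psi) /\
  (forall K : set 'rV[R]_m, compact K -> K `<=` Omega ->
     exists c : R, forall (phi : 'rV[R]_m -> R) (M : R), continuous phi ->
       (forall x, ~ K x -> phi x = 0) -> (forall x, `|phi x| <= M) ->
       `|L phi| <= (c * M)%:C%C).

(* Real and imaginary parts of
   d^2 phi / dz_i d(conj z_j)
     = (1/4) (d/dx_i - 'i d/dy_i) (d/dx_j + 'i d/dy_j) phi. *)

Definition ddbar_re (R : realType) (n : nat) (i j : 'I_n)
    (phi : Cspace R n -> R) (x : Cspace R n) : R :=
  (dpart [:: lshift n i; lshift n j] phi x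
   + dpart [:: rshift n i; rshift n j] phi x) / 4.

Definition ddbar_im (R : realType) (n : nat) (i j : 'I_n)
    (phi : Cspace R n -> R) (x : Cspace R n) : R :=
  (dpart [:: lshift n i; rshift n j] phi x
   - dpart [:: rshift n i; lshift n j] phi x) / 4.

Definition pos_in (n : nat) (I : {set 'I_n}) (i : 'I_n) : nat :=
  #|[set k in I | (k < i)%N]%SET|.

(* The inductive definition of Bedford and Taylor of the positive currents
   T_0 = 1, T_(k+1) = d dbar (u T_k), where u T_k makes sense because T_k is of
   order zero. For #|I| = #|J| = k, T I J is the coefficient of T_k at
   E(I, J) := dz_(i_1) ^ dzbar_(j_1) ^ ... ^ dz_(i_k) ^ dzbar_(j_k), where
   i_1 < ... < i_k and j_1 < ... < j_k enumerate I and J. As E is alternating in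
   the i's and in the j's separately,
     T I J = \sum_(i in I, j in J) (-1)^(pos i + pos j)
               d_i dbar_j (u T (I \ i) (J \ j))
   in the sense of distributions; the value on the complex test function
   d_i dbar_j phi is obtained from its real and imaginary parts. When u is of
   class C^2, T I J is k! times the minor det(u_(i jbar))_(i in I, j in J)
   times Lebesgue measure. *)
Definition MA_currents (R : realType) (n : nat) (Omega : set (Cspace R n))
    (u : Cspace R n -> R)
    (T : {set 'I_n} -> {set 'I_n} -> (Cspace R n -> R) -> R[i]) : Prop :=
  [/\ (forall I J : {set 'I_n}, #|I| = #|J| -> order_zero Omega (T I J)),
      (forall phi, Cc Omega phi ->
         T finset.set0 finset.set0 phi =
           (\int[lebesgue_rV R (n + n)]_(x in Omega) phi x)%:C%C) &
      (forall (I J : {set 'I_n}) phi, #|I| = #|J| -> (0 < #|I|)%N ->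
         Cc_smooth Omega phi ->
         T I J phi =
           \sum_(i in I) \sum_(j in J) (-1) ^+ (pos_in I i + pos_in J j) *
             (T (I :\ i)%SET (J :\ j)%SET (fun x => u x * ddbar_re i j phi x)
              + 'i%C *
                T (I :\ i)%SET (J :\ j)%SET
                  (fun x => u x * ddbar_im i j phi x)))].

(* mu is the Monge-Ampere measure of u on Omega: the Radon measure
   T_n / n!, equal to det(u_(i jbar)) times Lebesgue measure for u of class
   C^2. Only the restriction of mu to Omega matters. *)
Definition MA_measure (R : realType) (n : nat) (Omega : set (Cspace R n))
    (u : Cspace R n -> R) (mu : {measure set (Cspace R n) -> \bar R}) : Prop :=
  (forall K : set (Cspace R n), compact K -> K `<=` Omega ->
     (mu K < +oo)%E) /\
  exists2 T, MA_currents Omega u T &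
    forall phi, Cc Omega phi ->
      T [set: 'I_n]%SET [set: 'I_n]%SET phi =
        (n`!%:R * \int[mu]_(x in Omega) phi x)%:C%C.

Definition MA_weak_solution (R : realType) (n : nat)
    (Omega : set (Cspace R n)) (u f : Cspace R n -> R) : Prop :=
  exists2 mu : {measure set (Cspace R n) -> \bar R}, MA_measure Omega u mu &
    forall A : set (Cspace R n), measurable A -> A `<=` Omega ->
      mu A = (\int[lebesgue_rV R (n + n)]_(x in A) (f x)%:E)%E.

(* Equal to +oo when K or the boundary of Omega is empty. *)
Definition dist_boundary (R : realType) (m : nat) (K Omega : set 'rV[R]_m) :
    \bar R :=
  ereal_inf [set (enorm (p.1 - p.2))%:E |
             p in K `*` (closure Omega `&` closure (~` Omega))].

Definition beta0 (R : realType) (n : nat) (alpha : R) : R :=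
  1 - alpha / (n%:R * (2 + alpha) - 1).

(* Main.v *)
Require Import Defs.
From HB Require Import structures.
From mathcomp Require Import all_boot all_order all_algebra.
From mathcomp Require Import all_classical all_reals all_analysis.
From mathcomp Require Import measurable_realfun.
From mathcomp Require Import complex ring lra zify.
Set Implicit Arguments.
Unset Strict Implicit.
Unset Printing Implicit Defensive.
Import Order.TTheory GRing.Theory Num.Theory numFieldNormedType.Exports.
Local Open Scope classical_set_scope.
Local Open Scope ring_scope.

(* The goal is a bound on second differences of [u] that is uniform in the scale. After a cutoff,
   [u] has a first-order Taylor estimate with remainder of order [b = 1 + beta] ([tay]). The
   quantity [Tq u e s x] is [s ^ -2] times the excess of an average of [u] around [x], taken against
   the nonnegative kernel [pk 2 e] at scale [s], over the mass of the kernel times [u x]. It is a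
   nonnegative term, by subharmonicity, plus half the second derivative in the direction [e] of a
   mollification of [u] ([TqE], [avg_ge]). An upper bound on [Tq], uniform in [s], thus bounds the
   pure second derivatives of mollifications from above; as their Laplacian is nonnegative, the
   whole Hessian is bounded ([hess_bound]), and in the limit the gradient of [u] is Lipschitz. The
   Taylor estimate alone gives [Tq] of order [s ^ (b - 2)]. The heart of the proof is that passing
   from scale [2 r] to scale [r] costs at most a constant times [r ^ kp] with [kp > 0]
   ([main_step]); these losses are summable over dyadic scales ([iter_T]).

   For one step, the derivative of such an average in the scale is an average against the Laplacian
   of a similar kernel. Hence the difference of [Tq] at scales [r] and [2 r] is, up to small errors,
   a combination of differences of Laplacians of averages of [u] against probability kernels
   ([T_decomp]). To see that these Laplacians nearly agree, take a maximum point of a weighted mean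
   of the averages minus [u] minus a small quadratic penalty. There the penalized mean touches [u]
   from below, so the determinant of its complex Hessian is at most [f] ([Vdet]). On the other hand
   every average inherits the lower bound of [f] in the form of an arithmetic-geometric inequality
   ([Smaj_cv]). Since the n-th root of the determinant is concave, this near equality forces the
   traces of all the averaged Hessians to be close to their mean ([trace_close], [trace_at_max]).
   The exponent [alpha] enters through the oscillation of [f], and [beta] through the a priori size
   of the traces; [kappa_arith] checks that [beta > beta0] leaves room for a positive [kp].

   The facts used about [u] are of viscosity type: a smooth function touching [u] from below has
   determinant at most [f], one touching from above has determinant at least [f] ([touching]). They
   follow from the definition of Bedford and Taylor: the Monge-Ampere measures of mollifications at
   scales [2 ^ -j] converge weakly with a geometric rate ([MAd_convergence]), and smooth functions
   are compared by an integration by parts ([comparison]). Linear inequalities valid for functions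
   touching from above pass to averages of [u] by means of a discrete heat flow ([parabolic]). All
   constants depend only on the listed bounds, which gives both the qualitative and the quantitative
   statement after localization. *)
Tactic Notation "ext" ident(x) := apply/funext => x.
Tactic Notation "ebig" ident(i) := apply: eq_bigr => i _.
Ltac clra := clear; lra.

Lemma rV_norm_le {R : realType} m (x : 'rV[R]_m) (e : R) :
 0 <= e -> (forall i, `|x ord0 i| <= e) -> `|x| <= e.
Proof.
move=> e0 H; rewrite [leLHS]/Num.Def.normr /= mx_normrE.
by apply/bigmax_leP; split => // -[i j] _ /=; rewrite ord1.
Qed.

Lemma rV_coord_le {R : realType} m (x : 'rV[R]_m) i : `|x ord0 i| <= `|x|.
Proof.
rewrite [leRHS]/Num.Def.normr /= mx_normrE.
by apply/bigmax_geP; right => /=; exists (ord0, i).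
Qed.

(** * Translation invariance of Lebesgue measure on row vectors; measurability of continuous
    functions *)

Section integral_translation.
Context {R : realType}.
Local Notation mR := (measurableTypeR R).

Lemma lebesgue_measure_shift (a : R) (A : set mR) : measurable A ->
 lebesgue_measure ((fun x : mR => (x + a)%R : mR) @^-1` A) = lebesgue_measure A.
Proof.
move=> mA.
have ms : measurable_fun setT (fun x : mR => (x + a)%R : mR).
 exact: measurable_funD.
rewrite [RHS](@lebesgue_measure_unique R (pushforward_measure lebesgue_measure ms)) //.
move=> X [[b c] /= _ <-].
rewrite /pushforward_measure /= /pushforward /=.
rewrite (_ : _ @^-1` _ = [set` `](b - a)%R, (c - a)%R]]); last first.
 by apply/seteqP; split => x /=; rewrite !in_itv /= ltrBlDr lerBrDr.
rewrite !lebesgue_measure_itv /= !lte_fin ltrD2r.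
by case: ifP => // _; rewrite -EFinB; congr EFin; rewrite opprB addrA subrK.
Qed.

Lemma ge0_integral_shift (a : R) (f : mR -> \bar R) :
 measurable_fun setT f -> (forall x, 0 <= f x)%E ->
 (\int[lebesgue_measure]_x f (x + a)%R = \int[lebesgue_measure]_x f x)%E.
Proof.
move=> mf f0.
have ms : measurable_fun setT (fun x : mR => (x + a)%R : mR).
 exact: measurable_funD.
transitivity (\int[pushforward_measure lebesgue_measure ms]_x f x)%E.
 by rewrite /pushforward_measure /= ge0_integral_pushforward.
apply: eq_measure_integral => A mA _.
exact: lebesgue_measure_shift.
Qed.

Definition tuple_add (m : nat) (t s : m.-tuple mR) : m.-tuple mR :=
 [tuple (tnth t i + tnth s i)%R | i < m].

Lemma measurable_tuple_add m (s : m.-tuple mR) :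
 measurable_fun setT (fun t => tuple_add t s).
Proof.
apply/measurable_fun_tnthP => i.
rewrite (_ : _ \o _ = (fun t : m.-tuple mR => (tnth t i + tnth s i)%R)); last first.
 by ext t => /=; rewrite tnth_mktuple.
by apply: measurable_funD => //; exact: measurable_tnth.
Qed.

Lemma tuple_add_cons m (x y : R) (t s : m.-tuple mR) :
 tuple_add (cons_pair (x, t)) (cons_pair (y, s)) =
 cons_pair ((x + y)%R : mR, tuple_add t s).
Proof.
apply: eq_from_tnth => i; rewrite tnth_mktuple /cons_pair /=.
case: (unliftP ord0 i) => [j ->|->]; last by rewrite !tnth0.
by rewrite !tnthS tnth_mktuple.
Qed.

(** Tonelli splits off the first coordinate: the remaining ones are translated by induction, the
    first one by [ge0_integral_shift]. *)
Lemma ge0_integral_tuple_shift (m : nat) (s : m.-tuple mR)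
  (f : m.-tuple mR -> \bar R) :
 measurable_fun setT f -> (forall x, 0 <= f x)%E ->
 (\int[lebesgue_tuple R m]_t f (tuple_add t s) =
 \int[lebesgue_tuple R m]_t f t)%E.
Proof.
elim: m s f => [|m IH] s f mf f0.
 apply: eq_integral => t _; congr f.
 by apply: eq_from_tnth => -[].
have mfs : measurable_fun setT (fun t => f (tuple_add t s)).
 exact: measurableT_comp mf (measurable_tuple_add s).
have E g : measurable_fun setT g -> (forall x, 0 <= g x)%E -> (\int[lebesgue_tuple R
 m.+1]_t g t = \int[lebesgue_measure]_x \int[lebesgue_tuple R m]_t g (cons_pair (x,
 t)))%E.
 move=> mg g0 /=.
 rewrite (ge0_integral_pushforward (@measurable_cons_pair R m)) //.
 rewrite preimage_setT fubini_tonelli1 //; last by move=> x; exact: g0.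
 exact: measurableT_comp mg (@measurable_cons_pair R m).
rewrite !E //.
have -> : s = cons_pair (thead s, [tuple of behead s]).
 by rewrite /cons_pair /=; exact: tuple_eta.
set y := thead s; set s' := [tuple of behead s].
have mfc x : measurable_fun setT (fun t => f (cons_pair (x, t))).
 apply: measurableT_comp mf _.
 apply: measurableT_comp (@measurable_cons_pair R m) _.
 exact: pair1_measurable.
transitivity (\int[lebesgue_measure]_x (fun x => \int[lebesgue_tuple R m]_t f (cons_pair
 (x, t))) (x + y)%R)%E.
 apply: eq_integral => x _ /=.
 rewrite -[RHS](IH s') //.
 by apply: eq_integral => t _; rewrite tuple_add_cons.
apply: (@ge0_integral_shift y (fun x => \int[lebesgue_tuple R m]_t f (cons_pair (x,
 t)))%E) => [|x]; last exact: integral_ge0.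
apply: (@measurable_fun_fubini_tonelli_F _ _ _ _ _ _ (fun z => f (cons_pair z))) => //.
exact: measurableT_comp mf (@measurable_cons_pair R m).
Qed.

Lemma measurable_rVP d (T : measurableType d) (m : nat) (g : T -> 'rV[R]_m) :
 (forall i, measurable_fun setT (fun t => g t ord0 i : mR)) ->
 measurable_fun setT g.
Proof.
move=> mg _ Y mY; rewrite setTI.
suff : preimage_set_system setT g measurable `<=` measurable.
 by apply; exists Y; rewrite ?setTI.
rewrite -g_sigma_preimage_comp.
apply: smallest_sub; first exact: sigma_algebra_measurable.
case: m g mg {Y mY} => [|m] g mg; first by rewrite big_ord0.
rewrite -bigcup_mkord_ord => A [i /= im [B mB <-]]; exact: (mg (inord i)).
Qed.

Lemma measurable_coord (m : nat) (i : 'I_m) :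
 measurable_fun setT (fun x : 'rV[R]_m => x ord0 i : mR).
Proof.
move=> _ B mB; rewrite setTI; apply: sub_sigma_algebra.
case: m i => [[] []//|m i].
rewrite -bigcup_mkord_ord; exists i; first exact: ltn_ord.
by exists B => //; rewrite setTI inord_val.
Qed.

Lemma ge0_integral_rV_shift (m : nat) (a : 'rV[R]_m) (f : 'rV[R]_m -> \bar R) :
 measurable_fun setT f -> (forall x, 0 <= f x)%E ->
 (\int[lebesgue_rV R m]_x f (x + a)%R = \int[lebesgue_rV R m]_x f x)%E.
Proof.
move=> mf f0.
have ma : measurable_fun setT (fun x : 'rV[R]_m => x + a).
 apply: measurable_rVP => i.
 rewrite (_ : (fun _ => _) = (fun x : 'rV[R]_m => x ord0 i + a ord0 i)); last first.
  by ext x; rewrite mxE.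
 by apply: measurable_funD => //; exact: measurable_coord.
rewrite /lebesgue_rV /pushforward_measure /=.
rewrite !ge0_integral_pushforward //; last exact: measurableT_comp mf ma.
rewrite preimage_setT -[RHS](@ge0_integral_tuple_shift m [tuple (a ord0 i : mR) | i <
 m]) //.
 2: exact: measurableT_comp mf (@measurable_row_of_tuple R m).
- apply: eq_integral => t _ /=; congr f.
 by apply/rowP => i; rewrite !mxE !tnth_mktuple.
- by move=> t; exact: f0.
- exact: measurable_row_of_tuple.
- exact: measurable_row_of_tuple.
Qed.

(** The sigma-algebra is the one generated by the coordinates, so [f] is exhibited as a pointwise
    limit of its values at the lattice points obtained by rounding [x] down to multiples of
    [1 / (k + 1)]. Each approximation takes countably many values and is constant on half-open
    boxes. *)
Lemma continuous_measurable_rV (m : nat) (f : 'rV[R]_m -> R) :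
 continuous f -> measurable_fun setT (f : 'rV[R]_m -> mR).
Proof.
move=> cf.
pose fl (k : nat) (x : 'rV[R]_m) : 'rV[int]_m := \row_i Num.floor (k.+1%:R * x ord0 i).
pose bk (k : nat) (v : 'rV[int]_m) : 'rV[R]_m := \row_i ((v ord0 i)%:~R / k.+1%:R).
apply: (@measurable_realfun.measurable_fun_cvg _ _ _ _ (fun k x => f (bk k (fl k x)))).
- move=> k _ Y mY; rewrite setTI.
 rewrite (_ : _ @^-1` Y = \bigcup_v ([set x | fl k x = v] `&` [set _ | Y (f (bk k
  v))])); last first.
  apply/seteqP; split => [x Yx|x [v _ /= [<-]]] //=.
  by exists (fl k x).
 apply: countable_bigcupT_measurable; first exact: countableP.
 move=> v; apply: measurableI; last first.
  have [Yv|Yv] := pselect (Y (f (bk k v))).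
   by rewrite (_ : [set _ | _] = setT) //; apply/seteqP; split.
  by rewrite (_ : [set _ | _] = set0) //; apply/seteqP; split.
 rewrite (_ : [set _ | _] = \bigcap_(i in [set: 'I_m]) (fun x : 'rV[R]_m => x ord0 i :
  mR) @^-1` `[((v ord0 i)%:~R / k.+1%:R)%R, ((v ord0 i + 1)%:~R / k.+1%:R)%R[); last
  first.
  have E (x : 'rV[R]_m) i : (Num.floor (k.+1%:R * x ord0 i) = v ord0 i) <-> ((v ord0
   i)%:~R / k.+1%:R <= x ord0 i < (v ord0 i + 1)%:~R / k.+1%:R).
   rewrite ler_pdivrMr ?ltr0n // ltr_pdivlMr ?ltr0n // ![x ord0 i * _]mulrC.
   by split => [<-|/floor_def //]; first exact: floor_itv.
  apply/seteqP; split => [x vE i _ /=|x H /=].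
   by rewrite in_itv /=; apply/E; rewrite -vE mxE.
  by apply/rowP => i; rewrite mxE; apply/E; have := H i I; rewrite /= in_itv.
 apply: fin_bigcap_measurable => // i _.
 by rewrite -[X in measurable X]setTI; apply: measurable_coord.
- move=> x _; apply: continuous_cvg; first exact: cf.
 apply/cvgrPdist_le => e e0.
 near=> k.
 apply: rV_norm_le => [|j]; first exact: ltW.
 rewrite !mxE /=.
 have k0 : (0 : R) < k.+1%:R by rewrite ltr0n.
 have := floor_itv (k.+1%:R * x ord0 j) => /andP[h1 h2].
 have ek : 1 <= e * k.+1%:R.
  rewrite -ler_pdivrMr // mul1r; near: k.
  exact: (filterS (fun n => @ltW _ _ _ _) (near_infty_natSinv_lt (PosNum e0))).
 rewrite ger0_norm ?subr_ge0; last by rewrite ler_pdivrMr // [leRHS]mulrC.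
 rewrite -(ler_pM2r k0) mulrBl divfK ?gt_eqF // [x ord0 j * _]mulrC.
 move: h2; rewrite intrD; lra.
Unshelve. all: by end_near.
Qed.

End integral_translation.

(** * The Euclidean norm, compared with the maximum norm that defines the topology *)

Section euclidean.
Context {R : realType} {N : nat}.
Local Notation E := 'rV[R]_N.
Implicit Types x y z : E.

Definition dot x y : R := \sum_i x ord0 i * y ord0 i.

Lemma dotC x y : dot x y = dot y x.
Proof. by ebig i; rewrite mulrC. Qed.

Lemma dotDl x y z : dot (x + y) z = dot x z + dot y z.
Proof. by rewrite -big_split; ebig i; rewrite mxE mulrDl. Qed.

Lemma dotDr x y z : dot x (y + z) = dot x y + dot x z.
Proof. by rewrite dotC dotDl !(dotC x). Qed.

Lemma dotZl a x y : dot (a *: x) y = a * dot x y.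
Proof. by rewrite mulr_sumr; ebig i; rewrite mxE mulrA. Qed.

Lemma dotZr a x y : dot x (a *: y) = a * dot x y.
Proof. by rewrite dotC dotZl dotC. Qed.

Lemma dotNl x y : dot (- x) y = - dot x y.
Proof. by rewrite -scaleN1r dotZl mulN1r. Qed.

Lemma dotNr x y : dot x (- y) = - dot x y.
Proof. by rewrite dotC dotNl dotC. Qed.

Lemma dot_ge0 x : 0 <= dot x x.
Proof. by apply: sumr_ge0 => i _; rewrite -expr2 sqr_ge0. Qed.

Lemma enormE x : enorm x = Num.sqrt (dot x x).
Proof. by congr Num.sqrt; ebig i; rewrite expr2. Qed.

Lemma enorm_ge0 x : 0 <= enorm x.
Proof. exact: sqrtr_ge0. Qed.

Lemma enorm_sqr x : enorm x ^+ 2 = dot x x.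
Proof. by rewrite enormE sqr_sqrtr // dot_ge0. Qed.

Lemma enorm0 : enorm (0 : E) = 0.
Proof.
rewrite enormE /dot big1 ?sqrtr0 // => i _.
by rewrite mxE mul0r.
Qed.

Lemma enormZ a x : enorm (a *: x) = `|a| * enorm x.
Proof.
rewrite !enormE dotZl dotZr mulrA -expr2 sqrtrM ?sqr_ge0 //.
by rewrite sqrtr_sqr.
Qed.

Lemma enormN x : enorm (- x) = enorm x.
Proof. by rewrite -scaleN1r enormZ normrN normr1 mul1r. Qed.

Lemma enormB x y : enorm (x - y) = enorm (y - x).
Proof. by rewrite -enormN opprB. Qed.

Lemma coord_le_enorm x i : `|x ord0 i| <= enorm x.
Proof.
rewrite enormE -sqrtr_sqr ler_wsqrtr // /dot (bigD1 i) //= expr2 lerDl.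
by apply: sumr_ge0 => j _; rewrite -expr2 sqr_ge0.
Qed.

Lemma norm_le_enorm x : `|x| <= enorm x.
Proof. by apply: rV_norm_le => [|i]; rewrite ?enorm_ge0 ?coord_le_enorm. Qed.

Lemma enorm_eq0 x : enorm x = 0 -> x = 0.
Proof.
by move=> x0; apply/eqP; rewrite -normr_le0 -x0 norm_le_enorm.
Qed.

Lemma dot_le x y : `|dot x y| <= enorm x * enorm y.
Proof.
rewrite -[leRHS]ger0_norm ?mulr_ge0 ?enorm_ge0 // -ler_sqr ?nnegrE ?normr_ge0 //.
rewrite !real_normK ?num_real // exprMn !enorm_sqr.
have [y0|yn0] := eqVneq (dot y y) 0.
 have -> : y = 0 by apply: enorm_eq0; rewrite enormE y0 sqrtr0.
 by rewrite -[0](scale0r y) !dotZr !mul0r expr0n !mulr0.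
have yp : 0 < dot y y by rewrite lt_neqAle eq_sym yn0 dot_ge0.
have := dot_ge0 (x - (dot x y / dot y y) *: y).
rewrite dotDl !dotDr !dotNl !dotNr !dotZl !dotZr (dotC y x).
have := divfK yn0 (dot x y); set t := _ / _ => tE.
rewrite -tE; nra.
Qed.

Lemma ler_enormD x y : enorm (x + y) <= enorm x + enorm y.
Proof.
rewrite -ler_sqr ?nnegrE ?addr_ge0 ?enorm_ge0 // sqrrD !enorm_sqr dotDl !dotDr.
by have := dot_le x y; rewrite ler_norml (dotC y x) => /andP[_]; lra.
Qed.

Lemma ler_enormB x y z : enorm (x - z) <= enorm (x - y) + enorm (y - z).
Proof. by rewrite (le_trans _ (ler_enormD _ _)) // addrA subrK. Qed.

Lemma enorm_dist x y : `|enorm x - enorm y| <= enorm (x - y).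
Proof.
have := ler_enormD (x - y) y; have := ler_enormD (y - x) x.
by rewrite !subrK -(enormB x y) ler_norml; lra.
Qed.

Lemma enorm_le_sum x : enorm x <= \sum_i `|x ord0 i|.
Proof.
have {1}-> : x = \sum_i x ord0 i *: delta_mx ord0 i by rewrite -row_sum_delta.
have E1 i : enorm (delta_mx ord0 i : E) = 1.
 rewrite enormE /dot (bigD1 i) //= !mxE !eqxx mulr1 big1 ?addr0 ?sqrtr1 //.
 by move=> j ji; rewrite !mxE (negbTE ji) mulr0.
elim/big_ind2 : _ => [|x1 a x2 b h1 h2|i _]; first by rewrite enorm0.
 by rewrite (le_trans (ler_enormD _ _)) // lerD.
by rewrite enormZ E1 mulr1.
Qed.

Lemma enorm_delta i : enorm (delta_mx ord0 i : E) = 1.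
Proof.
rewrite enormE /dot (bigD1 i) //= !mxE !eqxx mulr1 big1 ?addr0 ?sqrtr1 //.
by move=> j ji; rewrite !mxE (negbTE ji) mulr0.
Qed.

Lemma enorm_le_norm x : enorm x <= N%:R * `|x|.
Proof.
apply: (le_trans (enorm_le_sum x)).
apply: (@le_trans _ _ (\sum_(i < N) `|x|)).
 by apply: ler_sum => i _; exact: rV_coord_le.
by rewrite sumr_const card_ord mulr_natl.
Qed.

(** The topology comes from the maximum norm, which is at most the Euclidean norm, itself at most
    [N] times the maximum norm. *)
Lemma nbhs_enormP x (A : set E) :
 nbhs x A <-> exists2 e : R, 0 < e & forall y, enorm (y - x) < e -> A y.
Proof.
split=> [/nbhs_ballP[e /= e0 H]|[e e0 H]].
 exists e => // y yx; apply: H; rewrite -ball_normE /= distrC.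
 exact: le_lt_trans (norm_le_enorm _) yx.
apply/nbhs_ballP; exists (e / N.+1%:R); first by rewrite /= divr_gt0.
move=> y; rewrite -ball_normE /= distrC ltr_pdivlMr // => h; apply: H.
apply: le_lt_trans (enorm_le_norm _) _; apply: le_lt_trans h.
by rewrite mulrC ler_wpM2l // ler_nat.
Qed.

Lemma cont_enormP (f : E -> R) x : {for x, continuous f} <->
 forall e, 0 < e -> exists2 d, 0 < d & forall y, enorm (y - x) < d -> `|f y - f x| < e.
Proof.
split=> [cf e e0|H].
 have /cvgrPdist_lt/(_ e e0)/nbhs_enormP[d d0 dH] := cf.
 by exists d => // y /dH; rewrite distrC.
apply: (proj2 (@cvgrPdist_lt R R^o E (nbhs x) _ f (f x))) => e e0.
apply/nbhs_enormP.
by have [d d0 dH] := H e e0; exists d => // y /dH; rewrite distrC.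
Qed.

Lemma continuous_enorm : continuous (@enorm R N).
Proof.
move=> x; apply/cont_enormP => e e0; exists e => // y h.
exact: le_lt_trans (enorm_dist _ _) h.
Qed.

Lemma continuous_enormB c : continuous (fun x => enorm (x - c)).
Proof.
move=> x; apply/cont_enormP => e e0; exists e => // y h.
by apply: le_lt_trans (enorm_dist _ _) _; rewrite opprB addrA subrK.
Qed.

Lemma compact_cball c r : compact [set x : E | enorm (x - c) <= r].
Proof.
apply: bounded_closed_compact.
 exists (`|c| + `|r|); split; first by rewrite num_real.
 move=> M hM x /= hx; apply: le_trans (ltW hM).
 rewrite -[x](subrK c) addrC (le_trans (ler_normD _ _)) // lerD //.
 exact: le_trans (norm_le_enorm _) (le_trans hx (ler_norm r)).
rewrite (_ : [set _ | _] = (fun x => enorm (x - c)) @^-1` [set t | t <= r]) //.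
by apply: closed_comp => [x _|]; [exact: continuous_enormB|exact: closed_le].
Qed.

(** Heine-Cantor in a form that compares points of [K] also with nearby points outside [K]; for
    this, continuity is asked in the ambient space at the points of [K]. *)
Lemma unif_cont_compact (K : set E) (f : E -> R) e : compact K ->
 (forall x, K x -> {for x, continuous f}) -> 0 < e ->
 exists2 d, 0 < d & forall x y, K x -> enorm (y - x) < d -> `|f y - f x| < e.
Proof.
move=> cK cf e0.
have /compact_near_coveringP/(_ R (0^'+) (fun d x => forall y, enorm (y - x) < d -> `|f
 y - f x| < e) _) : compact K := cK.
case.
 move=> x Kx.
 have /(cont_enormP _ _)/(_ _ (divr_gt0 e0 (ltr0Sn _ 1)))[d d0 dH] := cf x Kx.
 exists ([set y | enorm (y - x) < d / 2], [set t | t < d / 2]) => /=.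
  split; first by apply/nbhs_enormP; exists (d / 2) => //; rewrite divr_gt0.
  by apply: nbhs_right_lt; rewrite divr_gt0.
 move=> [y t] /= [yx td] z zy.
 have h1 : enorm (z - x) < d by have := ler_enormB z y x; lra.
 have h2 : enorm (y - x) < d by lra.
 rewrite (le_lt_trans (ler_distD (f x) _ _)) // [X in _ + X]distrC.
 by have := dH _ h1; have := dH _ h2; lra.
move=> d /= d0 H.
exists (d / 2) => [|x y Kx yx]; first by rewrite divr_gt0.
apply: (H (d / 2)) => //=; last by rewrite divr_gt0.
by rewrite sub0r normrN gtr0_norm ?divr_gt0 // ltr_pdivrMr // ltr_pMr // ltr1n.
Qed.

Lemma compact_bound (K : set E) (f : E -> R) : compact K ->
 (forall x, K x -> {for x, continuous f}) ->
 exists2 M, 0 <= M & forall x, K x -> `|f x| <= M.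
Proof.
move=> cK cf.
have [K0|/set0P/negP/negPn/eqP->] := pselect (K !=set0); last by exists 0.
have [|c _ H] := @compact_EVT_max _ R (fun x => `|f x|) _ K0 cK.
 apply: continuous_in_subspaceT => x /set_mem Kx.
 by apply: continuous_comp; [exact: cf|exact: norm_continuous].
by exists `|f c| => // x Kx; apply: H; exact: mem_set.
Qed.

End euclidean.

(* Closes goals [0 <= t] and [0 < t] by recursion on the structure of t. *)
Ltac pos := solve [ done | apply: ltW; assumption | exact: enorm_ge0 | exact: powR_ge0 | exact: sqr_ge0 | exact: dot_ge0 |
 first [apply: mulr_ge0 | apply: divr_ge0 | apply: exprn_ge0 | apply: sumr_ge0 => ? _ | rewrite invr_ge0 |
  apply: mulr_gt0 | apply: divr_gt0 | apply: exprn_gt0 | rewrite invr_gt0 | apply: powR_gt0 |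
  rewrite subr_ge0 | rewrite subr_gt0 | apply: addr_ge0]; pos | apply: ltr_wpDl; pos | apply: ltr_wpDr; pos ].

Lemma choice2 {R : realType} (T : Type) (P : R -> Prop) (Q : T -> R -> Prop) :
 (forall i, exists2 s, P s & Q i s) -> {f : T -> R & forall i, P (f i) /\ Q i (f i)}.
Proof. by move=> H; have [f Hf] := choice (fun i => let: ex_intro2 s a b := H i in
 ex_intro _ s (conj a b)); exists f. Qed.

Lemma le_of_eq d (T : porderType d) (a b : T) : a = b -> (a <= b)%O. Proof. by move->. Qed.

Lemma sum_const {R : realType} m (a : R) : \sum_(i < m) a = m%:R * a.
Proof. by rewrite sumr_const card_ord mulr_natl. Qed.

Lemma powR_mono {R : realType} (r x y : R) : 0 <= r -> 0 <= x -> x <= y -> x `^ r <= y `^ r.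
Proof. by move=> *; apply: ge0_ler_powR; rewrite ?nnegrE //; apply: le_trans (_ : x <=
 _). Qed.

Notation de := (delta_mx ord0).

(** * Algebra of continuous real functions *)

Section continuity.
Context {R : realType} {T : topologicalType}.
Implicit Types f g : T -> R.

Lemma cont_cst (a : R) : continuous (fun _ : T => a).
Proof. by move=> x; exact: cvg_cst. Qed.

Lemma contD f g : continuous f -> continuous g -> continuous (fun x => f x + g x).
Proof. by move=> cf cg x; apply: cvgD; [exact: cf|exact: cg]. Qed.

Lemma contB f g : continuous f -> continuous g -> continuous (fun x => f x - g x).
Proof. by move=> cf cg x; apply: cvgB; [exact: cf|exact: cg]. Qed.

Lemma contM f g : continuous f -> continuous g -> continuous (fun x => f x * g x).
Proof. by move=> cf cg x; apply: cvgM; [exact: cf|exact: cg]. Qed.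

Lemma cont_sum (I : Type) (s : seq I) (P : pred I) (F : I -> T -> R) :
 (forall i, continuous (F i)) -> continuous (fun x => \sum_(i <- s | P i) F i x).
Proof.
move=> cF; elim: s => [|i s IH].
 by under eq_fun do rewrite big_nil; exact: cont_cst.
case Pi: (P i); under eq_fun do rewrite big_cons Pi; last exact: IH.
exact: contD.
Qed.

End continuity.

(** * Integration of continuous functions with compact support *)

Section compactly_supported_integral.
Context {R : realType} {N : nat}.
Local Notation E := 'rV[R]_N.
Local Notation mu := (lebesgue_rV R N).
Implicit Types (f g phi : E -> R).

Definition supp_ball phi (c : E) (r : R) := forall x, r < enorm (x - c) -> phi x = 0.

Definition Cc0 phi := continuous phi /\ exists r, supp_ball phi 0 r.

Definition Int phi : R := (\int[mu]_x phi x)%R.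

Lemma supp_ball0 phi c r : supp_ball phi c r -> supp_ball phi 0 (r + enorm c).
Proof.
by move=> H x; rewrite subr0 => h; apply: H; have := ler_enormD (x - c) c; rewrite
 subrK; lra.
Qed.

Lemma Cc0_ball phi c r : continuous phi -> supp_ball phi c r -> Cc0 phi.
Proof. by move=> cp /supp_ball0 H; split=> //; exists (r + enorm c). Qed.

Let cube (m : nat) (r : R) : set (m.-tuple (measurableTypeR R)) :=
 [set t | forall i, `|tnth t i| <= r].

Let measurable_cube m r : measurable (@cube m r).
Proof.
rewrite (_ : cube _ = \bigcap_(i in [set: 'I_m]) (fun t => tnth t i) @^-1` `[-r,
 r]%classic); last first.
 apply/seteqP; split=> t H i /=; first by rewrite in_itv /= -ler_norml H.
 by have := H i I; rewrite /= in_itv /= -ler_norml.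
apply: fin_bigcap_measurable => // i _.
by rewrite -[X in measurable X]setTI; apply: measurable_tnth.
Qed.

Let measure_cube m r : 0 <= r -> lebesgue_tuple R m (@cube m r) = ((r *+ 2) ^+ m)%:E.
Proof.
move=> r0; elim: m => [|m IH].
 rewrite expr0 /= diracE mem_set //.
 by case.
have -> : lebesgue_tuple R m.+1 (@cube m.+1 r) = (lebesgue_measure \x lebesgue_tuple R
 m)%E (`[-r, r]%classic `*` @cube m r).
 rewrite /= /lebesgue_cons /pushforward; congr (_ _).
 apply/seteqP; split=> [[x t] /= H|[x t] /= [h1 h2] i].
  split; first by have := H ord0; rewrite /cons_pair /= tnth0 in_itv /= ler_norml.
  by move=> i; have := H (lift ord0 i); rewrite /cons_pair /= tnthS.
 rewrite /cons_pair /=; case: (unliftP ord0 i) => [j ->|->].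
  by rewrite tnthS; exact: h2.
 by rewrite tnth0; move: h1; rewrite in_itv /= ler_norml.
rewrite product_measure1E; [|exact: measurable_itv|exact: measurable_cube].
rewrite IH (_ : (_ `[(- r)%R, r]%classic) = lebesgue_measure `[(- r)%R, r]%classic) //.
rewrite lebesgue_measure_itv /= lte_fin.
case: ifP => [_|/negbT]; first by rewrite -EFinB opprK -mulr2n -EFinM exprS.
rewrite -leNgt => h; have -> : r = 0 by lra.
by rewrite mul0e mul0rn expr0n.
Qed.

Let rcube (r : R) : set E := [set x | forall i, `|x ord0 i| <= r].

Let measurable_rcube r : measurable (rcube r).
Proof.
rewrite (_ : rcube _ = \bigcap_(i in [set: 'I_N]) (fun x : E => x ord0 i :
 measurableTypeR R) @^-1` `[-r, r]%classic); last first.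
 apply/seteqP; split=> t H i /=; first by rewrite in_itv /= -ler_norml H.
 by have := H i I; rewrite /= in_itv /= -ler_norml.
apply: fin_bigcap_measurable => // i _.
by rewrite -[X in measurable X]setTI; apply: measurable_coord.
Qed.

Let measure_rcube r : 0 <= r -> mu (rcube r) = ((r *+ 2) ^+ N)%:E.
Proof.
move=> r0; rewrite -(@measure_cube N r r0) /lebesgue_rV /pushforward_measure /=
 /pushforward.
congr (_ _); apply/seteqP; split=> t H i; have := H i; first by rewrite mxE.
by rewrite mxE.
Qed.

(** Volume of the cube of half-side [r] around the ball of radius [r], negative radii counting as
    zero. It stands in for the volume of the ball in all bounds. *)
Definition vol (r : R) : R := (Num.max r 0 *+ 2) ^+ N.

Lemma vol_ge0 r : 0 <= vol r.
Proof. by rewrite exprn_ge0 // mulrn_wge0 // le_max lexx orbT. Qed.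

Lemma bounded_integral phi r M : continuous phi -> supp_ball phi 0 r ->
 (forall x, `|phi x| <= M) -> mu.-integrable setT (EFin \o phi) /\
 (\int[mu]_x `|phi x|%:E <= (M * vol r)%:E)%E.
Proof.
move=> cp sp bp.
have mp : measurable_fun setT phi by exact: continuous_measurable_rV.
have M0 : 0 <= M by exact: le_trans (normr_ge0 _) (bp 0).
pose r' := Num.max r 0.
have r0 : 0 <= r' by rewrite le_max lexx orbT.
have H : (\int[mu]_x `|phi x|%:E <= (M * vol r)%:E)%E.
 apply: (@le_trans _ _ (\int[mu]_(x in rcube r') M%:E)%E).
  rewrite integral_mkcond [leRHS]integral_mkcond; apply: ge0_le_integral => //.
  - by move=> x _; rewrite patch_setT.
  - rewrite patch_setT; apply/measurable_EFinP.
   exact: measurableT_comp.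
  - by apply/(measurable_restrictT _ (measurable_rcube _)); exact: measurable_cst.
  - move=> x _; rewrite patch_setT patchE.
   have [_|/negP nx] := boolP (x \in rcube r'); first by rewrite lee_fin.
   rewrite sp ?normr0 // subr0 ltNge; apply/negP => h; apply: nx; apply/mem_set => i.
   apply: le_trans (coord_le_enorm _ _) (le_trans h _).
   by rewrite le_max lexx.
 by rewrite integral_cst // measure_rcube // -EFinM.
split=> //; apply/integrableP; split; first exact/measurable_EFinP.
exact: le_lt_trans H (ltry _).
Qed.

Lemma Cc0_bounded phi : Cc0 phi -> exists2 M, 0 <= M & forall x, `|phi x| <= M.
Proof.
move=> [cp [r sp]].
have [|M M0 MH] := compact_bound (@compact_cball R N 0 r) (f := phi).
 by move=> x _; exact: cp.
exists M => // x; have [|h] := leP (enorm (x - 0)) r; first exact: MH.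
by rewrite sp // normr0.
Qed.

Lemma Cc0_integrable phi : Cc0 phi -> mu.-integrable setT (EFin \o phi).
Proof.
move=> pc; have [M _ MH] := Cc0_bounded pc; have [cp [r sp]] := pc.
exact: (bounded_integral cp sp MH).1.
Qed.

Lemma Cc0D f g : Cc0 f -> Cc0 g -> Cc0 (fun x => f x + g x).
Proof.
move=> [cf [r sf]] [cg [s sg]]; split; first exact: contD.
exists (Num.max r s) => x; rewrite gt_max => /andP[h1 h2].
by rewrite sf // sg // addr0.
Qed.

Lemma Cc0M f g : continuous f -> Cc0 g -> Cc0 (fun x => f x * g x).
Proof.
move=> cf [cg [s sg]]; split; first exact: contM.
by exists s => x h; rewrite sg // mulr0.
Qed.

Lemma Cc0Mr f g : Cc0 f -> continuous g -> Cc0 (fun x => f x * g x).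
Proof.
move=> cf cg; have := Cc0M cg cf; congr Cc0.
by ext x; rewrite mulrC.
Qed.

Lemma Cc0Z a f : Cc0 f -> Cc0 (fun x => a * f x).
Proof. by move=> cf; apply: (@Cc0M (fun=> a)) => //; exact: cont_cst. Qed.

Lemma Cc0N f : Cc0 f -> Cc0 (fun x => - f x).
Proof.
by move=> /(Cc0Z (-1)); congr Cc0; ext x; rewrite mulN1r.
Qed.

Lemma Cc0B f g : Cc0 f -> Cc0 g -> Cc0 (fun x => f x - g x).
Proof. by move=> cf /Cc0N; exact: Cc0D. Qed.

Lemma Cc0_0 : Cc0 (fun=> 0).
Proof. by split; [exact: cont_cst|exists 0]. Qed.

Lemma Cc0_sum (I : Type) (s : seq I) (P : pred I) (F : I -> E -> R) :
 (forall i, Cc0 (F i)) -> Cc0 (fun x => \sum_(i <- s | P i) F i x).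
Proof.
move=> cF; elim: s => [|i s IH].
 by have := Cc0_0; congr Cc0; ext x; rewrite big_nil.
have [Pi|Pi] := boolP (P i).
 by have := Cc0D (cF i) IH; congr Cc0; ext x; rewrite big_cons Pi.
by move: IH; congr Cc0; ext x; rewrite big_cons (negbTE Pi).
Qed.

Lemma Cc0_norm f : Cc0 f -> Cc0 (fun x => `|f x|).
Proof.
move=> [cf [r sf]]; split.
 by move=> x; apply: continuous_comp; [exact: cf|exact: norm_continuous].
by exists r => x h; rewrite sf // normr0.
Qed.

Lemma cont_shift f (a : E) : continuous f -> continuous (fun x : E => f (x + a)).
Proof.
move=> cf x; apply/cont_enormP => e e0.
have /(cont_enormP _ _)/(_ _ e0)[d d0 dH] := cf (x + a).
by exists d => // y yx; apply: dH; rewrite opprD addrACA subrr addr0.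
Qed.

Lemma Cc0_shift f a : Cc0 f -> Cc0 (fun x => f (x + a)).
Proof.
move=> [cf [r sf]]; apply: (@Cc0_ball _ (-a) r); first exact: cont_shift.
by move=> x; rewrite opprK => h; rewrite sf // subr0.
Qed.

Lemma IntD f g : Cc0 f -> Cc0 g -> Int (fun x => f x + g x) = Int f + Int g.
Proof. by move=> cf cg; rewrite /Int RintegralD //; exact: Cc0_integrable. Qed.

Lemma IntZ a f : Cc0 f -> Int (fun x => a * f x) = a * Int f.
Proof. by move=> cf; rewrite /Int RintegralZl //; exact: Cc0_integrable. Qed.

Lemma IntN f : Cc0 f -> Int (fun x => - f x) = - Int f.
Proof.
by move=> cf; rewrite -mulN1r -IntZ //; congr Int; ext x; rewrite mulN1r.
Qed.

Lemma IntB f g : Cc0 f -> Cc0 g -> Int (fun x => f x - g x) = Int f - Int g.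
Proof. by move=> cf cg; rewrite (IntD cf (Cc0N cg)) IntN. Qed.

Lemma Int0 : Int (fun=> 0) = 0.
Proof.
by have := IntZ 0 Cc0_0; rewrite !mul0r.
Qed.

Lemma Int_sum (I : Type) (s : seq I) (P : pred I) (F : I -> E -> R) :
 (forall i, Cc0 (F i)) ->
 Int (fun x => \sum_(i <- s | P i) F i x) = \sum_(i <- s | P i) Int (F i).
Proof.
move=> cF; elim: s => [|i s IH].
 by rewrite big_nil; under eq_fun do rewrite big_nil; exact: Int0.
rewrite big_cons -IH; case: ifP => Pi; last first.
 by congr Int; ext x; rewrite big_cons Pi.
rewrite -IntD //; last exact: Cc0_sum.
by congr Int; ext x; rewrite big_cons Pi.
Qed.

Lemma Int_ge0 f : (forall x, 0 <= f x) -> 0 <= Int f.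
Proof. by move=> f0; apply: Rintegral_ge0. Qed.

Lemma Int_le f g : Cc0 f -> Cc0 g -> (forall x, f x <= g x) -> Int f <= Int g.
Proof.
move=> cf cg fg; rewrite -subr_ge0 -IntB //; apply: Int_ge0 => x.
by pos.
Qed.

Lemma Int_norm f : Cc0 f -> `|Int f| <= Int (fun x => `|f x|).
Proof.
move=> cf; have cn := Cc0_norm cf.
rewrite ler_norml -(IntN cn); apply/andP; split; apply: Int_le => //.
- exact: Cc0N.
- by move=> x; rewrite lerNl ler_normr orbC lexx.
- by move=> x; exact: ler_norm.
Qed.

(** Translation invariance is available for nonnegative functions, so [f] is split into its positive
    and negative parts, which are again continuous with compact support. *)
Lemma Int_shift f a : Cc0 f -> Int (fun x => f (x + a)) = Int f.
Proof.
move=> cf.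
have H g : Cc0 g -> (forall x, 0 <= g x) -> Int (fun x => g (x + a)) = Int g.
 move=> cg g0; rewrite /Int /Rintegral; congr fine.
 apply: (@ge0_integral_rV_shift R N a (EFin \o g)).
  by apply/measurable_EFinP; apply: continuous_measurable_rV; case: cg.
 by [].
pose p x := (`|f x| + f x) / 2; pose q x := (`|f x| - f x) / 2.
have cp : Cc0 p.
 apply: Cc0Mr; last exact: cont_cst.
 by apply: Cc0D => //; exact: Cc0_norm.
have cq : Cc0 q.
 apply: Cc0Mr; last exact: cont_cst.
 by apply: Cc0B => //; exact: Cc0_norm.
have fpq : f = (fun x => p x - q x).
 by ext x; rewrite /p /q; lra.
rewrite {1}fpq (IntB (Cc0_shift a cp) (Cc0_shift a cq)) !H //.
- by rewrite -IntB // -fpq.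
- by move=> x; rewrite /q; have := ler_norm (f x); lra.
- by move=> x; rewrite /p; have := ler_norm (- f x); rewrite normrN; lra.
Qed.

Lemma Int_bound f c r M : continuous f -> supp_ball f c r ->
 (forall x, `|f x| <= M) -> `|Int f| <= M * vol r.
Proof.
move=> cf sf fM; have cc := Cc0_ball cf sf.
rewrite -(Int_shift c cc).
apply: le_trans (Int_norm (Cc0_shift c cc)) _.
have s1 : supp_ball (fun x => f (x + c)) 0 r.
 by move=> x; rewrite subr0 => h; apply: sf; rewrite addrK.
have [_ H] := bounded_integral (cont_shift (a := c) cf) s1 (fun x => fM (x + c)).
rewrite -lee_fin (le_trans _ H) // /Int /Rintegral fineK //.
by apply: integrable_fin_num => //; apply: Cc0_integrable; apply/Cc0_norm/Cc0_shift.
Qed.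

(** By continuity the translated function is at least [f x0 / 2] on a small cube around the origin,
    whose volume is positive. *)
Lemma Int_gt0 f x0 : Cc0 f -> (forall x, 0 <= f x) -> 0 < f x0 -> 0 < Int f.
Proof.
move=> cf f0 fx0; have cf1 := Cc0_shift x0 cf; rewrite -(Int_shift x0 cf).
have := cf1.1; move=> /(_ 0)/(cont_enormP _ _)/(_ _ (divr_gt0 fx0 (ltr0Sn _ 1)))[d d0
 dH].
pose r := d / (2 * N.+1%:R).
have r0 : 0 < r by pos.
have H x : rcube r x -> f x0 / 2 <= f (x + x0).
 move=> hx; have := dH x; rewrite subr0 add0r.
 case/(_ _)/Wrap => [|/ltW]; last by rewrite ler_norml; lra.
 apply: le_lt_trans (enorm_le_sum x) _.
 apply: (@le_lt_trans _ _ (\sum_(i < N) r)); first by apply: ler_sum => i _; exact: hx.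
 rewrite sum_const /r mulrA ltr_pdivrMr ?mulr_gt0 //.
 rewrite mulrC ltr_pM2l // mulrC; have : N%:R < (N.+1%:R : R) by rewrite ltr_nat.
 by have : (0 : R) < N.+1%:R by []; lra.
apply: (@lt_le_trans _ _ (f x0 / 2 * (r *+ 2) ^+ N)).
 by pos.
rewrite -lee_fin /Int /Rintegral fineK; last first.
 by apply: integrable_fin_num => //; apply: Cc0_integrable.
rewrite EFinM -(measure_rcube (ltW r0)) -integral_cst // integral_mkcond.
apply: ge0_le_integral => //.
- by move=> x _; apply: erestrict_ge0 => y _; rewrite lee_fin divr_ge0 // ltW.
- by apply/(measurable_restrictT _ (measurable_rcube _)); exact: measurable_cst.
- by apply/measurable_EFinP; apply: continuous_measurable_rV; case: cf1.
- move=> x _; rewrite patchE.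
 have [/set_mem h|_] := boolP (x \in rcube r); rewrite lee_fin //.
 exact: H.
Qed.

End compactly_supported_integral.

(** * Directional derivatives and the mean value theorem on the unit interval *)

Section directional_derivatives.
Context {R : realType} {V : normedModType R}.

Lemma is_deriveP (f : V -> R) (x v : V) (d : R) :
 (forall e, 0 < e -> exists2 r, 0 < r & forall h, h != 0 -> `|h| < r ->
  `|(f (x + h *: v) - f x) / h - d| <= e) -> is_derive x v f d.
Proof.
move=> H.
have C : (fun h => h^-1 *: ((f \o shift x) (h *: v) - f x)) @ 0^' --> d.
 apply/cvgrPdist_le => e e0; have [r r0 rH] := H e e0.
 exists r => // h; rewrite /= sub0r normrN => hr h0.
 have := rH h h0 hr; rewrite distrC /shift [x + _]addrC.
 by rewrite [_ / h]mulrC.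
by split; [apply/cvg_ex; exists d|exact/cvg_lim].
Qed.

Lemma derive_line (f : V -> R) (x v : V) (t : R) : derivable f (x + t *: v) v ->
 is_derive t 1 (fun s : R => f (x + s *: v)) ('D_v f (x + t *: v)).
Proof.
move=> df; set g := fun s : R => _.
have E : (fun h : R => h^-1 *: ((g \o shift t) (h *: 1) - g t)) = (fun h => h^-1 *: ((f
 \o shift (x + t *: v)) (h *: v) - f (x + t *: v))).
 ext h; rewrite /g /shift; congr (_ *: (f _ - _)).
 by rewrite scalerDl [h *: 1]mulr1 addrCA.
split; first by rewrite /derivable E.
by rewrite /derive E.
Qed.

End directional_derivatives.

Section mean_value.
Context {R : realType}.

Lemma mvt01 (g dg : R -> R) : (forall t : R, 0 <= t <= 1 -> is_derive t 1 g (dg t)) ->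
 exists2 t : R, 0 <= t <= 1 & g 1 - g 0 = dg t.
Proof.
move=> H.
have [t||t] := @MVT_segment R g dg 0 1 ler01.
- by rewrite in_itv => /andP[t0 t1]; apply: H; rewrite !ltW.
- by apply: derivable_within_continuous => t; rewrite in_itv => /H[].
- by rewrite in_itv => t01 ->; exists t => //; rewrite subr0 mulr1.
Qed.

End mean_value.

(** * Smooth functions and their partial derivatives *)

HB.lock Definition pdiff (R : realType) (N : nat) (f : 'rV[R]_N -> R) : Prop := forall i
 x, derivable f x (de i).

HB.lock Definition smooth (R : realType) (N : nat) (f : 'rV[R]_N -> R) : Prop := forall
 k, is_Ck k setT f.

Section smooth.
Context {R : realType} {N : nat}.
Local Notation E := 'rV[R]_N.
Implicit Types (f g : E -> R) (x y v : E).

Definition D (i : 'I_N) f : E -> R := fun x => 'D_(de i) f x.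

Lemma pdiffP f : pdiff f <-> forall i x, derivable f x (de i).
Proof. by rewrite pdiff.unlock. Qed.

Lemma smoothP f : smooth f <-> forall k, is_Ck k setT f.
Proof. by rewrite smooth.unlock. Qed.

Lemma dpart_rcons s i f : dpart (rcons s i) f = dpart s (D i f).
Proof. by rewrite /dpart foldr_rcons. Qed.

(** In [dpart] the last index of the list is differentiated first, so lists are taken apart at their
    end. This recursion is behind the closure properties of [is_Ck] and [smooth]. *)
Lemma is_CkS k f : is_Ck k.+1 setT f <->
 [/\ continuous f, pdiff f & forall i, is_Ck k setT (D i f)].
Proof.
split=> [[H1 H2]|[cf /pdiffP df H]].
 split=> [x||i]; [exact: (H1 [::])|by apply/pdiffP => i x; exact: (H2 [::])|].
 split=> [s x sk _|s j x sk _]; rewrite -dpart_rcons.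
  by apply: H1 => //; rewrite size_rcons.
 by apply: H2 => //; rewrite size_rcons.
split=> [s x|s i x]; case/lastP: s => [|s j].
- by move=> _ _; exact: cf.
- by rewrite size_rcons dpart_rcons => sk _; apply: (H j).1.
- by [].
- by rewrite size_rcons dpart_rcons => sk _; apply: (H j).2.
Qed.

Lemma is_Ck_cont k f : is_Ck k setT f -> continuous f.
Proof. by move=> [H _] x; exact: (H [::]). Qed.

Lemma is_Ck0 f : is_Ck 0 setT f <-> continuous f.
Proof.
split=> [|cf]; first exact: is_Ck_cont.
by split=> [[|] // x _ _|//]; exact: cf.
Qed.

Lemma is_CkW k f : is_Ck k.+1 setT f -> is_Ck k setT f.
Proof.
by move=> [H1 H2]; split=> [s x sk|s i x sk]; [apply: H1|apply: H2]; exact: leqW.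
Qed.

Lemma smooth_cont f : smooth f -> continuous f.
Proof. by move=> /smoothP/(_ 0%N)/is_Ck_cont. Qed.

Lemma smooth_pd f : smooth f -> pdiff f.
Proof. by move=> /smoothP/(_ 1%N)/is_CkS[]. Qed.

Lemma smoothD f i : smooth f -> smooth (D i f).
Proof. by move=> /smoothP sf; apply/smoothP => k; have /is_CkS[_ _] := sf k.+1. Qed.

Lemma D_cst (a : R) i : D i (fun=> a) = fun=> 0.
Proof. by ext x; rewrite /D derive_cst. Qed.

Lemma D_add f g i : pdiff f -> pdiff g ->
 D i (fun x => f x + g x) = fun x => D i f x + D i g x.
Proof. by move=> /pdiffP df /pdiffP dg; ext x; exact: (deriveD (df i x) (dg i x)). Qed.

Lemma DZ (a : R) f i : pdiff f -> D i (fun x => a * f x) = fun x => a * D i f x.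
Proof. by move=> /pdiffP df; ext x; exact: (deriveZ a (df i x)). Qed.

Lemma D_mul f g i : pdiff f -> pdiff g ->
 D i (fun x => f x * g x) = fun x => D i f x * g x + f x * D i g x.
Proof.
move=> /pdiffP df /pdiffP dg; ext x; rewrite [LHS](deriveM (df i x) (dg i x)).
by rewrite addrC; congr (_ + _); rewrite mulrC.
Qed.

Lemma pdiffD f g : pdiff f -> pdiff g -> pdiff (fun x => f x + g x).
Proof. by move=> /pdiffP df /pdiffP dg; apply/pdiffP => i x; exact: (derivableD (df i x)
 (dg i x)). Qed.

Lemma pdiffM f g : pdiff f -> pdiff g -> pdiff (fun x => f x * g x).
Proof. by move=> /pdiffP df /pdiffP dg; apply/pdiffP => i x; exact: (derivableM (df i x)
 (dg i x)). Qed.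

Lemma pdiff_cst (a : R) : pdiff (fun _ : E => a).
Proof. by apply/pdiffP => i x; exact: derivable_cst. Qed.

Lemma is_Ck_cst k (a : R) : is_Ck k setT (fun _ : E => a).
Proof.
elim: k a => [|k IH] a; first by apply/is_Ck0; exact: cont_cst.
apply/is_CkS; split=> [||i]; [exact: cont_cst|exact: pdiff_cst|].
by rewrite D_cst.
Qed.

Lemma is_CkD k f g : is_Ck k setT f -> is_Ck k setT g ->
 is_Ck k setT (fun x => f x + g x).
Proof.
elim: k f g => [|k IH] f g; first by move=> /is_Ck0 cf /is_Ck0 cg; apply/is_Ck0/contD.
move=> /is_CkS[cf df Hf] /is_CkS[cg dg Hg]; apply/is_CkS; split=> [||i].
- exact: contD.
- exact: pdiffD.
- by rewrite D_add //; exact: IH.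
Qed.

Lemma is_CkM k f g : is_Ck k setT f -> is_Ck k setT g ->
 is_Ck k setT (fun x => f x * g x).
Proof.
elim: k f g => [|k IH] f g; first by move=> /is_Ck0 cf /is_Ck0 cg; apply/is_Ck0/contM.
move=> Hf' Hg'; have /is_CkS[cf df Hf] := Hf'; have /is_CkS[cg dg Hg] := Hg'.
apply/is_CkS; split=> [||i].
- exact: contM.
- exact: pdiffM.
- by rewrite D_mul //; apply: is_CkD; apply: IH => //; exact: is_CkW.
Qed.

Lemma smooth_cst (a : R) : smooth (fun _ : E => a).
Proof. by apply/smoothP => k; exact: is_Ck_cst. Qed.

Lemma smooth_add f g : smooth f -> smooth g -> smooth (fun x => f x + g x).
Proof. by move=> /smoothP sf /smoothP sg; apply/smoothP => k; exact: is_CkD. Qed.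

Lemma smooth_mul f g : smooth f -> smooth g -> smooth (fun x => f x * g x).
Proof. by move=> /smoothP sf /smoothP sg; apply/smoothP => k; exact: is_CkM. Qed.

Lemma smoothZ (a : R) f : smooth f -> smooth (fun x => a * f x).
Proof. by move=> sf; apply: smooth_mul => //; exact: smooth_cst. Qed.

Lemma smooth_opp f : smooth f -> smooth (fun x => - f x).
Proof.
by move=> /(smoothZ (-1)); congr smooth; ext x; rewrite mulN1r.
Qed.

Lemma smooth_sub f g : smooth f -> smooth g -> smooth (fun x => f x - g x).
Proof. by move=> sf /smooth_opp; exact: smooth_add. Qed.

Lemma smooth_sum (I : Type) (s : seq I) (P : pred I) (F : I -> E -> R) :
 (forall i, smooth (F i)) -> smooth (fun x => \sum_(i <- s | P i) F i x).
Proof.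
move=> cF; elim: s => [|i s IH].
 by under eq_fun do rewrite big_nil; exact: smooth_cst.
case Pi: (P i); under eq_fun do rewrite big_cons Pi; last exact: IH.
exact: smooth_add.
Qed.

Lemma D_opp f i : pdiff f -> D i (fun x => - f x) = fun x => - D i f x.
Proof.
by move=> /pdiffP df; ext x; exact: (deriveN (df i x)).
Qed.

Lemma D_sub f g i : smooth f -> smooth g ->
 D i (fun x => f x - g x) = fun x => D i f x - D i g x.
Proof.
move=> sf sg; rewrite D_add; [|exact: smooth_pd|exact/smooth_pd/smooth_opp].
by rewrite D_opp //; exact: smooth_pd.
Qed.

Lemma D_sum (I : Type) (s : seq I) (P : pred I) (F : I -> E -> R) i :
 (forall j, smooth (F j)) ->
 D i (fun x => \sum_(j <- s | P j) F j x) = fun x => \sum_(j <- s | P j) D i (F j) x.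
Proof.
move=> cF; elim: s => [|j s IH].
 under eq_fun do rewrite big_nil; rewrite D_cst.
 by ext x; rewrite big_nil.
ext x; rewrite big_cons.
case Pi: (P j); under [X in D i X]eq_fun do rewrite big_cons Pi; last by rewrite IH.
rewrite D_add ?IH //; [exact: smooth_pd|].
exact/smooth_pd/smooth_sum.
Qed.

Lemma D_coord i j : D i (fun x : E => x ord0 j) = fun=> (i == j)%:R.
Proof.
ext x; rewrite /D.
suff H : is_derive x (de i) (fun x : E => x ord0 j) (i == j)%:R by rewrite derive_val.
apply: is_deriveP => e e0; exists 1 => // h h0 _.
rewrite !mxE eqxx addrAC subrr add0r [_ * h^-1]mulrC mulKf // eq_sym subrr normr0.
exact: ltW.
Qed.

Lemma pdiff_coord j : pdiff (fun x : E => x ord0 j).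
Proof.
apply/pdiffP => i x.
suff H : is_derive x (de i) (fun x : E => x ord0 j) (i == j)%:R by [].
apply: is_deriveP => e e0; exists 1 => // h h0 _.
rewrite !mxE eqxx addrAC subrr add0r [_ * h^-1]mulrC mulKf // eq_sym subrr normr0.
exact: ltW.
Qed.

Lemma cont_coord j : continuous (fun x : E => x ord0 j).
Proof.
move=> x; apply/cont_enormP => e e0; exists e => // y h.
by rewrite (le_lt_trans _ h) // (le_trans _ (coord_le_enorm _ j)) // !mxE.
Qed.

Lemma smooth_coord j : smooth (fun x : E => x ord0 j).
Proof.
apply/smoothP => -[|k]; first by apply/is_Ck0; exact: cont_coord.
apply/is_CkS; split=> [||i]; [exact: cont_coord|exact: pdiff_coord|].
by rewrite D_coord; exact: is_Ck_cst.
Qed.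

Lemma derive_shift f a x v : derivable f (x + a) v ->
 is_derive x v (fun y => f (y + a)) ('D_v f (x + a)).
Proof.
have E' : (fun h : R => h^-1 *: (((fun y => f (y + a)) \o shift x) (h *: v) - f (x +
 a))) = (fun h => h^-1 *: ((f \o shift (x + a)) (h *: v) - f (x + a))).
 by ext h; rewrite /shift /= addrA.
by split; rewrite /derivable /derive E'.
Qed.

Lemma D_shift f a i : pdiff f -> D i (fun x => f (x + a)) = fun x => D i f (x + a).
Proof.
move=> /pdiffP df; ext x; have H := derive_shift (df i (x + a)).
by rewrite /D derive_val.
Qed.

Lemma smooth_shift f a : smooth f -> smooth (fun x => f (x + a)).
Proof.
move=> sf; apply/smoothP => k; elim: k f sf => [|k IH] f sf.
 apply/is_Ck0; exact: (@cont_shift _ _ f a (smooth_cont sf)).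
have df := smooth_pd sf; have /pdiffP df' := df.
apply/is_CkS; split=> [||i].
- by exact: (@cont_shift _ _ f a (smooth_cont sf)).
- by apply/pdiffP => i x; have [] := derive_shift (df' i (x + a)).
- by rewrite D_shift //; apply: IH; exact: smoothD.
Qed.

End smooth.

Lemma addrBl {V : zmodType} (x y : V) : x + y - x = y.
Proof. by rewrite addrC addKr. Qed.

Lemma subACA {V : zmodType} (a b c d : V) : a - b - (c - d) = a - c - (b - d).
Proof. by rewrite !opprB addrACA [RHS]addrACA [- b - c]addrC. Qed.

(** * Derivatives along lines, symmetry of second derivatives, second differences *)

Section smooth_along_lines.
Context {R : realType} {N : nat}.
Local Notation E := 'rV[R]_N.
Implicit Types (f g : E -> R) (x y v : E).

Definition C1at f (A : set E) :=
 forall i x, A x -> derivable f x (de i) /\ {for x, continuous (D i f)}.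

Lemma smooth_C1at f A : smooth f -> C1at f A.
Proof.
move=> sf i x _; split; first by move/smooth_pd/pdiffP: sf; exact.
by apply: smooth_cont; exact: smoothD.
Qed.

Let part y (k : nat) : E := \row_i (if (i < k)%N then y ord0 i else 0).

(** The mean value theorem is applied on the edges of the path from [x] to [x + y] that changes one
    coordinate at a time. The displacement of any point of the path arises from [y] by shrinking
    coordinates, so the path stays within [enorm y] of [x]. *)
Lemma mvt_coords f x y (d : R) : enorm y <= d ->
 (forall i z, enorm (z - x) <= d -> derivable f z (de i)) ->
 exists2 zeta : 'I_N -> E, forall i, enorm (zeta i - x) <= enorm y &
  f (x + y) - f x = \sum_i y ord0 i * D i f (zeta i).
Proof.
move=> yd df.
have step (i : 'I_N) : exists z, enorm (z - x) <= enorm y /\ f (x + part y i.+1) - f (x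
 + part y i) = y ord0 i * D i f z.
 pose g (t : R) := f (x + part y i + t *: de i).
 have pE (t : R) : 0 <= t <= 1 -> enorm (part y i + (t * y ord0 i) *: de i : E) <= enorm
  y.
  move=> /andP[t0 t1]; rewrite !enormE ler_wsqrtr // /dot; apply: ler_sum => j _.
  rewrite !mxE eqxx /=; have [->|ji] := eqVneq j i.
   by rewrite ltnn add0r mulr1 -!expr2 exprMn ler_piMl ?sqr_ge0 // expr_le1.
  by rewrite mulr0 addr0; case: ifP => // _; rewrite mulr0 -expr2 sqr_ge0.
 have [t t01 tE] : exists2 t : R, 0 <= t <= 1 & g (1 * y ord0 i) - g (0 * y ord0 i) = y
  ord0 i * D i f (x + part y i + (t * y ord0 i) *: de i).
  apply: (mvt01 (g := fun t => g (t * y ord0 i)) (dg := fun t => y ord0 i * D i f (x +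
   part y i + (t * y ord0 i) *: de i))).
  move=> t t01.
  have d1 : is_derive (t * y ord0 i) 1 g (D i f (x + part y i + (t * y ord0 i) *: de
   i)).
   apply: derive_line; apply: df; rewrite -(addrA x) addrBl.
   exact: le_trans (pE _ t01) yd.
  have d2 : is_derive t (1 : R) (fun t : R => t * y ord0 i) (y ord0 i).
   apply: is_deriveP => e e0; exists 1 => // h h0 _.
   rewrite -mulrBl addrAC subrr add0r [h *: 1]mulr1 [h * _]mulrC mulfK // subrr normr0.
   exact: ltW.
  have := @is_derive1_comp _ g (fun t : R => t * y ord0 i) t _ _ d1 d2.
  by rewrite mulrC.
 exists (x + part y i + (t * y ord0 i) *: de i); split.
  by rewrite -(addrA x) addrBl; exact: pE.
 rewrite -tE /g mul0r scale0r addr0 mul1r; congr (f _ - _); rewrite -addrA; congr (_ +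
  _).
 apply/rowP => j; rewrite !mxE eqxx /= ltnS leq_eqVlt.
 have [ji|ji] := eqVneq j i; first by rewrite ji eqxx ltnn /= add0r mulr1.
 by rewrite val_eqE (negbTE ji) /= mulr0 addr0.
have [z zH] := choice step.
exists z => [i|]; first by case: (zH i).
have -> : \sum_i y ord0 i * D i f (z i) = \sum_(i < N) (f (x + part y i.+1) - f (x +
 part y i)).
 by ebig i; rewrite (zH i).2.
rewrite -(big_mkord xpredT (fun i => f (x + part y i.+1) - f (x + part y i))).
rewrite telescope_sumr //; congr (f _ - f _).
 by congr (_ + _); apply/rowP => i; rewrite mxE ltn_ord.
by apply/rowP => i; rewrite !mxE addr0.
Qed.

Definition DL f v x : R := \sum_i v ord0 i * D i f x.

(** Continuous partial derivatives yield directional ones: by [mvt_coords] an increment is a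
    combination of partial derivatives at nearby points, and these are close to their values at the
    base point. *)
Lemma derive_along f (A : set E) x v (t : R) : C1at f A -> nbhs (x + t *: v) A ->
 is_derive t (1 : R) (fun s : R => f (x + s *: v)) (DL f v (x + t *: v)).
Proof.
move=> cf /nbhs_enormP[r r0 rA]; apply: is_deriveP => e e0.
set a := x + t *: v.
pose S := 1 + \sum_i `|v ord0 i|.
have S0 : 0 < S by pos.
have e1 : 0 < e / S by pos.
have /choice[dl dlH] : forall i, exists d, 0 < d /\ forall y, enorm (y - a) < d -> `|D i
 f y - D i f a| < e / S.
 move=> i; have Aa : A a by apply: rA; rewrite subrr enorm0.
 have /cont_enormP/(_ _ e1)[d d0 dH] := (cf i a Aa).2.
 by exists d.
pose m := \big[Num.min/(r / 2)]_i dl i.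
have m0 : 0 < m.
 apply/bigmin_gtP; split; first by pos.
 by move=> i _; case: (dlH i).
exists (m / (1 + enorm v)) => [|h h0 hm].
 by pos.
have hv : enorm (h *: v) < m.
 rewrite enormZ; move: hm; rewrite ltr_pdivlMr ?ltr_pwDl ?enorm_ge0 // => hm.
 by apply: le_lt_trans hm; rewrite ler_wpM2l // lerDr.
have mr : m <= r / 2 by apply/bigmin_leP; left.
have Hd i y : enorm (y - a) <= r / 2 -> derivable f y (de i).
 move=> yr; apply: (cf i y _).1; apply: rA; apply: le_lt_trans yr _.
 by rewrite ltr_pdivrMr // ltr_pMr // ltr1n.
have [z zx zE] := mvt_coords (ltW (lt_le_trans hv mr)) Hd.
rewrite [h *: 1]mulr1 scalerDl addrA zE.
rewrite mulr_suml /DL -sumrB.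
apply: le_trans (ler_norm_sum _ _ _) _.
apply: (@le_trans _ _ (\sum_i `|v ord0 i| * (e / S))).
 apply: ler_sum => i _; rewrite mxE.
 have -> : h * v ord0 i * D i f (z i) / h - v ord0 i * D i f a = v ord0 i * (D i f (z i)
  - D i f a) by field.
 rewrite normrM ler_wpM2l // ltW //.
 apply: (dlH i).2; apply: le_lt_trans (zx i) _; apply: lt_le_trans hv _.
 by apply/bigmin_leP; right; exists i.
rewrite -mulr_suml mulrA ler_pdivrMr // mulrC ler_wpM2l ?ltW // /S; lra.
Qed.

Lemma derive_along_smooth f x v (t : R) : smooth f ->
 is_derive t (1 : R) (fun s : R => f (x + s *: v)) (DL f v (x + t *: v)).
Proof.
by move=> sf; apply: (@derive_along f setT); [exact: smooth_C1at|exact: filterT].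
Qed.

Lemma smooth_DL f v : smooth f -> smooth (DL f v).
Proof. by move=> sf; apply: smooth_sum => i; apply: smoothZ; exact: smoothD. Qed.

(** The second difference of [f] over a small square is [h * h] times either mixed derivative, each
    taken at some nearby point; continuity then identifies the two at [x]. *)
Lemma D_comm f i j : smooth f -> D i (D j f) = D j (D i f).
Proof.
move=> sf; ext x; apply/eqP; rewrite -subr_eq0 -normr_le0.
apply/ler_addgt0Pl => e e0; rewrite addr0.
have sij := smoothD i (smoothD j sf); have sji := smoothD j (smoothD i sf).
have e2 : 0 < e / 2 by pos.
have /cont_enormP/(_ _ e2)[d1 d10 d1H] := smooth_cont sij (x := x).
have /cont_enormP/(_ _ e2)[d2 d20 d2H] := smooth_cont sji (x := x).
pose h := Num.min d1 d2 / 3.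
have m0 : 0 < Num.min d1 d2 by rewrite lt_min d10.
have h0 : 0 < h by pos.
have key k l : exists z : E, enorm (z - x) < Num.min d1 d2 /\ f (x + h *: de k + h *: de
 l) - f (x + h *: de k) - (f (x + h *: de l) - f x) = h * h * D l (D k f) z.
 pose u : E := de k; pose w : E := de l.
 have DLd g q : DL g (h *: (de q : E)) = fun y => h * D q g y.
  ext y; rewrite /DL (bigD1 q) //= !mxE !eqxx mulr1 big1 ?addr0 //.
  by move=> p pq; rewrite !mxE (negbTE pq) mulr0 mul0r.
 have [t t01] : exists2 t : R, 0 <= t <= 1 & (f (x + h *: w + 1 *: (h *: u)) - f (x + 1
  *: (h *: u))) - (f (x + h *: w + 0 *: (h *: u)) - f (x + 0 *: (h *: u))) = DL f (h *:
  u) (x + h *: w + t *: (h *: u)) - DL f (h *: u) (x + t *: (h *: u)).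
  apply: (mvt01 (g := fun t => f (x + h *: w + t *: (h *: u)) - f (x + t *: (h *: u)))
   (dg := fun t => DL f (h *: u) (x + h *: w + t *: (h *: u)) - DL f (h *: u) (x + t *:
   (h *: u)))) => t _.
  by apply: is_deriveB; exact: derive_along_smooth.
 rewrite !scale1r !scale0r !addr0 => H1.
 have sg := smooth_DL (h *: u) sf.
 have [s s01] : exists2 s : R, 0 <= s <= 1 & DL f (h *: u) (x + t *: (h *: u) + 1 *: (h
  *: w)) - DL f (h *: u) (x + t *: (h *: u) + 0 *: (h *: w)) = DL (DL f (h *: u)) (h *:
  w) (x + t *: (h *: u) + s *: (h *: w)).
  apply: (mvt01 (g := fun s => DL f (h *: u) (x + t *: (h *: u) + s *: (h *: w))) (dg :=
   fun s => DL (DL f (h *: u)) (h *: w) (x + t *: (h *: u) + s *: (h *: w)))) => s _.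
  exact: derive_along_smooth.
 rewrite scale1r scale0r addr0 => H2.
 exists (x + t *: (h *: u) + s *: (h *: w)); split.
  rewrite -(addrA x) addrBl; apply: le_lt_trans (ler_enormD _ _) _.
  rewrite !enormZ !enorm_delta.
  have [/andP[t0 t1] /andP[s0 s1]] := (t01, s01).
  rewrite (ger0_norm (ltW h0)) (ger0_norm t0) (ger0_norm s0).
  have h3 : h * 3 = Num.min d1 d2 by rewrite divfK.
  have th : t * h <= h by rewrite ler_piMl // ltW.
  have sh : s * h <= h by rewrite ler_piMl // ltW.
  by move: th sh h3 h0; clra.
 have -> : h * h * D l (D k f) (x + t *: (h *: u) + s *: (h *: w)) = DL (DL f (h *: u))
  (h *: w) (x + t *: (h *: u) + s *: (h *: w)).
  rewrite DLd [DL f _]DLd DZ ?mulrA //.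
  exact/smooth_pd/smoothD.
 rewrite -H2 [x + _ + h *: w]addrAC -H1 -/u -/w [x + h *: w + _]addrAC; ring.
have [z1 [z1x E1]] := key j i; have [z2 [z2x E2]] := key i j.
have EE : D i (D j f) z1 = D j (D i f) z2.
 have hh : h * h != 0 by rewrite mulf_neq0 // gt_eqF.
 apply: (mulfI hh); rewrite -[LHS]E1 -[RHS]E2 subACA.
 by congr (f _ - _ - _); rewrite addrAC.
have A1 := d1H z1; have A2 := d2H z2.
move: z1x z2x; rewrite !lt_min => /andP[/A1 B1 _] /andP[_ /A2 B2].
move: B1 B2; rewrite EE; move: (D j (D i f) z2) (D i (D j f) x) (D j (D i f) x) => p q
 s.
by clear; rewrite !ltr_norml ler_norml; lra.
Qed.

(** The Hessian quadratic form of [f] at [x], in the direction [v]. *)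
Definition HF f v x : R := DL (DL f v) v x.

Lemma HFE f v x : smooth f ->
 HF f v x = \sum_i \sum_j v ord0 i * v ord0 j * D i (D j f) x.
Proof.
move=> sf; ebig i; rewrite /DL D_sum; last first.
 by move=> j; apply: smoothZ; exact: smoothD.
rewrite mulr_sumr; ebig j.
by rewrite DZ ?mulrA //; exact/smooth_pd/smoothD.
Qed.

Lemma second_diff f x v (H e : R) : smooth f ->
 (forall t : R, `|t| <= 1 -> `|HF f v (x + t *: v) - H| <= e) ->
 `|f (x + v) + f (x - v) - 2 * f x - H| <= e.
Proof.
move=> sf hH.
(* Two applications of the mean value theorem to [f (x + t v) + f (x - t v) - c t ^ 2]. The constant
   [c] is later [H - e] and [H + e], which fixes the sign of the right-hand side. *)
have key (c : R) : exists t s : R, [/\ 0 <= t <= 1, -1 <= s <= 1 & f (x + v) + f (x - v)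
 - 2 * f x - c = 2 * t * (HF f v (x + s *: v) - c)].
 have [t t01] : exists2 t : R, 0 <= t <= 1 & (f (x + 1 *: v) + f (x + 1 *: (- v)) - c *
  (1 * 1)) - (f (x + 0 *: v) + f (x + 0 *: (- v)) - c * (0 * 0)) = DL f v (x + t *: v) +
  DL f (- v) (x + t *: (- v)) - c * (t + t).
  apply: (mvt01 (g := fun t => f (x + t *: v) + f (x + t *: (- v)) - c * (t * t)) (dg :=
   fun t => DL f v (x + t *: v) + DL f (- v) (x + t *: (- v)) - c * (t + t))) => t _.
  apply: is_deriveB; first by apply: is_deriveD; exact: derive_along_smooth.
  apply: is_deriveP => e' e0; exists (e' / (1 + `|c|)).
   by pos.
  move=> h h0; rewrite ltr_pdivlMr // => he; rewrite [h *: 1]mulr1.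
  have -> : (c * ((t + h) * (t + h)) - c * (t * t)) / h - c * (t + t) = c * h by field.
  rewrite normrM; have := normr_ge0 h; have := normr_ge0 c; nra.
 rewrite !scale1r !scale0r !addr0 !mulr0 !mulr1 subr0 => H1.
 have DN : DL f (- v) (x + t *: - v) = - DL f v (x - t *: v).
  by rewrite /DL -sumrN scalerN; ebig i; rewrite mxE mulNr.
 have [s s01] : exists2 s : R, 0 <= s <= 1 & DL f v (x - t *: v + 1 *: ((2 * t) *: v)) -
  DL f v (x - t *: v + 0 *: ((2 * t) *: v)) = DL (DL f v) ((2 * t) *: v) (x - t *: v + s
  *: ((2 * t) *: v)).
  apply: (mvt01 (g := fun s => DL f v (x - t *: v + s *: ((2 * t) *: v))) (dg := fun s
   => DL (DL f v) ((2 * t) *: v) (x - t *: v + s *: ((2 * t) *: v)))) => s _.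
  by apply: derive_along_smooth; exact: smooth_DL.
 rewrite scale1r scale0r addr0.
 have -> : x - t *: v + (2 * t) *: v = x + t *: v.
  by rewrite -addrA -scaleNr -scalerDl; congr (_ + _ *: _); ring.
 have -> : x - t *: v + s *: ((2 * t) *: v) = x + (2 * t * s - t) *: v.
  by rewrite -addrA scalerA -scaleNr -scalerDl; congr (_ + _ *: _); ring.
 have -> : DL (DL f v) ((2 * t) *: v) (x + (2 * t * s - t) *: v) = 2 * t * HF f v (x +
  (2 * t * s - t) *: v).
  by rewrite /HF {1}/DL mulr_sumr; ebig i; rewrite mxE mulrA.
 move=> H2; exists t, (2 * t * s - t); split => //; first by apply/andP; split; nra.
 transitivity (f (x + v) + f (x - v) - c - (f x + f x)); first by ring.
 rewrite H1; lra.
rewrite ler_norml; apply/andP; split.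
 have [t [s [t01 s01 E]]] := key (H - e).
 have := hH s; rewrite !ler_norml => /(_ s01) /andP[h1 _].
 have : 0 <= 2 * t * (HF f v (x + s *: v) - (H - e)) by apply: mulr_ge0; lra.
 by rewrite -E; lra.
have [t [s [t01 s01 E]]] := key (H + e).
have := hH s; rewrite !ler_norml => /(_ s01) /andP[_ h1].
have : 0 <= 2 * t * ((H + e) - HF f v (x + s *: v)) by apply: mulr_ge0; lra.
by lra.
Qed.

End smooth_along_lines.

(** * Integration by parts and averages against smooth kernels *)

Section convolution.
Context {R : realType} {N : nat}.
Local Notation E := 'rV[R]_N.
Implicit Types (f g phi psi : E -> R) (x y v : E).

Lemma D_supp_ball phi i c r : supp_ball phi c r -> supp_ball (D i phi) c r.
Proof.
move=> sp x xr; rewrite /D.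
suff H : is_derive x (de i) phi 0 by rewrite derive_val.
apply: is_deriveP => e e0; exists (enorm (x - c) - r); first by pos.
move=> h h0 hr; rewrite !sp ?subrr ?mul0r ?subrr ?normr0 ?ltW //.
have := ler_enormB x (x + h *: de i) c.
by rewrite opprD addNKr enormN enormZ enorm_delta mulr1; lra.
Qed.

Lemma Cc0_D phi i : Cc0 phi -> continuous (D i phi) -> Cc0 (D i phi).
Proof. by move=> [_ [r sp]] cD; split=> //; exists r; exact: D_supp_ball. Qed.

Lemma Cc0_unif phi e : Cc0 phi -> 0 < e ->
 exists2 d, 0 < d & forall x y, enorm (y - x) < d -> `|phi y - phi x| < e.
Proof.
move=> [cp [r sp]] e0.
have [|d d0 dH] := unif_cont_compact (@compact_cball R N 0 (r + 1)) _ e0 (f := phi).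
 by move=> x _; exact: cp.
exists (Num.min d 1) => [|x y]; first by rewrite lt_min d0 ltr01.
rewrite lt_min => /andP[yd y1].
have [xr|xr] := leP (enorm (x - 0)) (r + 1); first exact: dH.
rewrite !sp ?subrr ?normr0 //; first by lra.
by have := ler_enormB x y 0; rewrite (enormB x y); lra.
Qed.

Definition C1 f := [/\ continuous f, pdiff f & forall i, continuous (D i f)].

Lemma smooth_C1 f : smooth f -> C1 f.
Proof.
move=> sf; split; [exact: smooth_cont|exact: smooth_pd|].
by move=> i; apply: smooth_cont; exact: smoothD.
Qed.

Lemma C1_mul f g : C1 f -> C1 g -> C1 (fun x => f x * g x).
Proof.
move=> [cf df Df] [cg dg Dg]; split; [exact: contM|exact: pdiffM|move=> i].
by rewrite D_mul //; apply: contD; apply: contM.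
Qed.

Lemma C1_at f A : C1 f -> C1at f A.
Proof. by move=> [_ /pdiffP df Df] i x _; split; [exact: df|exact: Df]. Qed.

Lemma mvt_line f x v : C1 f -> exists2 t : R, 0 <= t <= 1 &
 f (x + v) - f x = DL f v (x + t *: v).
Proof.
move=> cf.
have [t t01 H] : exists2 t : R, 0 <= t <= 1 & f (x + 1 *: v) - f (x + 0 *: v) = DL f v
 (x + t *: v).
 apply: (mvt01 (g := fun t => f (x + t *: v)) (dg := fun t => DL f v (x + t *: v))) => t
  _.
 by apply: (@derive_along _ _ _ setT); [exact: C1_at|exact: filterT].
by exists t => //; rewrite -H scale1r scale0r addr0.
Qed.

Lemma DL_delta f i (h : R) : DL f (h *: de i) = fun x => h * D i f x.
Proof.
ext x; rewrite /DL (bigD1 i) //= !mxE !eqxx mulr1 big1 ?addr0 //.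
by move=> j ji; rewrite !mxE (negbTE ji) mulr0 mul0r.
Qed.

Lemma diff_quot_unif phi i e : Cc0 phi -> C1 phi -> 0 < e ->
 exists2 d, 0 < d & forall h : R, `|h| < d -> forall x,
  `|phi (x + h *: de i) - phi x - h * D i phi x| <= e * `|h|.
Proof.
move=> cp c1 e0; have [_ _ Dc] := c1.
have [d d0 dH] := Cc0_unif (Cc0_D cp (Dc i)) e0.
exists d => // h hd x.
have [t /andP[t0 t1] ->] := mvt_line x (h *: de i) c1.
rewrite DL_delta -mulrBr normrM mulrC ler_wpM2r // ltW // dH // addrBl.
rewrite !enormZ enorm_delta mulr1 ger0_norm //; apply: le_lt_trans hd.
by rewrite ler_piMl.
Qed.

(** The difference quotients have integral zero by translation invariance, and they converge to the
    derivative uniformly and within a fixed ball. *)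
Lemma Int_D phi i : Cc0 phi -> C1 phi -> Int (D i phi) = 0.
Proof.
move=> cp c1; have [_ [r sp]] := cp; have [cphi _ Dc] := c1.
have cD := Cc0_D cp (Dc i).
apply/eqP; rewrite -normr_le0; apply/ler_addgt0Pl => e e0; rewrite addr0.
pose V := @vol R N (r + 1) + 1.
have V1 : 0 < V by rewrite ltr_wpDl // vol_ge0.
have [d d0 dH] := diff_quot_unif i cp c1 (divr_gt0 e0 V1).
pose h := Num.min d 1 / 2.
have m0 : 0 < Num.min d 1 by rewrite lt_min d0 ltr01.
have h0 : 0 < h by pos.
have hm : h < Num.min d 1 by rewrite ltr_pdivrMr // ltr_pMr // ltr1n.
have [hd h1] : h < d /\ h < 1 by move: hm; rewrite lt_min => /andP[].
have cs := Cc0_shift (h *: de i) cp.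
have Hb : `|Int (fun x => phi (x + h *: de i) - phi x - h * D i phi x)| <= e / V * h *
 @vol R N (r + 1).
 apply: (@Int_bound _ _ _ 0).
 - by case: (Cc0B (Cc0B cs cp) (Cc0Z h cD)).
 - move=> x; rewrite subr0 => xr.
  have h2 := ler_enormD (x + h *: de i) (- (h *: de i)).
  rewrite addrK enormN enormZ enorm_delta mulr1 gtr0_norm // in h2.
  rewrite sp; last by rewrite subr0; lra.
  rewrite sp; last by rewrite subr0; lra.
  by rewrite (D_supp_ball i sp) ?mulr0 ?subr0 //; lra.
 - by move=> x; have := dH h; rewrite gtr0_norm; exact.
rewrite (IntB (Cc0B cs cp) (Cc0Z h cD)) (IntB cs cp) Int_shift // subrr sub0r in Hb.
rewrite normrN IntZ // normrM gtr0_norm // in Hb.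
rewrite -(ler_pM2l h0) (le_trans Hb) // [_ * h]mulrC -mulrA ler_pM2l //.
by rewrite mulrAC ler_pdivrMr // ler_wpM2l /V; lra.
Qed.

Lemma Int_ibp f g i : C1 f -> C1 g -> Cc0 g ->
 Int (fun x => f x * D i g x) = - Int (fun x => D i f x * g x).
Proof.
move=> c1f c1g cg; have [cf df Df] := c1f; have [_ dg Dg] := c1g.
have c1 := Cc0M (Df i) cg; have c2 := Cc0M cf (Cc0_D cg (Dg i)).
have := Int_D i (Cc0M cf cg) (C1_mul c1f c1g).
by rewrite D_mul // (IntD c1 c2) => /eqP; rewrite addrC addr_eq0 => /eqP.
Qed.

(** Convolution with the reflected kernel: by [cvE] it averages the values [g (x + y)] with weight
    [psi y], and every derivative falls on the kernel with a minus sign. *)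
Definition cv g psi x : R := Int (fun y => g y * psi (y - x)).

Lemma cvE g psi x : continuous g -> Cc0 psi ->
 cv g psi x = Int (fun y => g (x + y) * psi y).
Proof.
move=> cg cp; rewrite /cv.
have c1 : Cc0 (fun y => g y * psi (y - x)) by apply: Cc0M => //; exact: Cc0_shift.
by rewrite -(Int_shift x c1); congr Int; ext y; rewrite addrK addrC.
Qed.

Lemma Cc0_cv_int g psi x : continuous g -> Cc0 psi -> Cc0 (fun y => g y * psi (y - x)).
Proof. by move=> cg cp; apply: Cc0M => //; exact: Cc0_shift. Qed.

Let local_bound g (psi : E -> R) x r : continuous g -> exists2 M : R, 0 < M &
 forall chi e, continuous chi -> supp_ball chi x r -> 0 <= e -> (forall y, `|chi y| <= e) ->
 `|Int (fun y => g y * chi y)| <= M * e.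
Proof.
move=> cg; have [|M M0 MH] := compact_bound (@compact_cball R N x r) (f := g).
 by move=> y _; exact: cg.
exists (M * @vol R N r + 1); first by rewrite ltr_wpDl // mulr_ge0 // vol_ge0.
move=> chi e cc sc e0 ce.
apply: (@le_trans _ _ (M * e * vol r)).
 apply: (@Int_bound _ _ _ x); first exact: contM.
 - by move=> y yr; rewrite sc // mulr0.
 - move=> y; have [yr|yr] := leP (enorm (y - x)) r; last by rewrite sc // mulr0 normr0
  mulr_ge0.
  by rewrite normrM ler_pM // MH.
by rewrite mulrAC ler_wpM2r; lra.
Qed.

Lemma cont_cv g psi : continuous g -> Cc0 psi -> continuous (cv g psi).
Proof.
move=> cg cp x; apply/cont_enormP => e e0; have [cpsi [r sp]] := cp.
have [M M0 MH] := local_bound psi x (r + 1) cg.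
have [d d0 dH] := Cc0_unif cp (divr_gt0 e0 (addr_gt0 M0 M0)).
exists (Num.min d 1) => [|y]; first by rewrite lt_min d0 ltr01.
rewrite lt_min => /andP[yd y1].
rewrite /cv -IntB; [|exact: Cc0_cv_int|exact: Cc0_cv_int].
have -> : (fun z => g z * psi (z - y) - g z * psi (z - x)) = (fun z => g z * (psi (z -
 y) - psi (z - x))) by ext z; rewrite mulrBr.
apply: le_lt_trans (MH _ (e / (M + M)) _ _ _ _) _.
- by apply: contB; exact: cont_shift.
- move=> z zr; have h1 := ler_enormB z y x.
 by rewrite !sp ?subrr // subr0; lra.
- by pos.
- move=> z; rewrite ltW // dH //.
 by rewrite opprB addrC subrKA enormB.
- by rewrite mulrA ltr_pdivrMr ?addr_gt0 //; nra.
Qed.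

Lemma is_derive_cv g psi i x : continuous g -> Cc0 psi -> C1 psi ->
 is_derive x (de i) (cv g psi) (cv g (fun y => - D i psi y) x).
Proof.
move=> cg cp c1; apply: is_deriveP => e e0; have [cpsi [r sp]] := cp.
have [_ _ Dc] := c1; have cD := Cc0_D cp (Dc i).
have [M M0 MH] := local_bound psi x (r + 1) cg.
have [d d0 dH] := diff_quot_unif i cp c1 (divr_gt0 e0 M0).
exists (Num.min d 1); first by rewrite lt_min d0 ltr01.
move=> h h0; rewrite lt_min => /andP[hd h1].
have hp : 0 < `|h| by rewrite normr_gt0.
rewrite -(ler_pM2r hp) -normrM mulrBl divfK //.
pose chi z := psi (z - x + (- h) *: de i) - psi (z - x) - (- h) * D i psi (z - x).
have -> : cv g psi (x + h *: de i) - cv g psi x - cv g (fun y => - D i psi y) x * h =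
 Int (fun z => g z * chi z).
 have c1' := Cc0_cv_int (x + h *: de i) cg cp.
 have c2' := Cc0_cv_int x cg cp.
 have c3' := Cc0_cv_int x cg (Cc0N cD).
 rewrite [_ * h]mulrC /cv -(IntZ h c3') -(IntB c1' c2') -(IntB (Cc0B c1' c2') (Cc0Z h
  c3')).
 by congr Int; ext z; rewrite /chi opprD addrA scaleNr; ring.
apply: le_trans (MH chi (e / M * `|h|) _ _ _ _) _.
- apply: contB; last by apply: contM; [exact: cont_cst|exact: cont_shift].
 apply: contB; last exact: cont_shift.
 under eq_fun do rewrite -addrA.
 exact: cont_shift.
- move=> z zr.
 have h2 := ler_enormD (z - x + - h *: de i) (h *: de i).
 rewrite scaleNr subrK enormZ enorm_delta mulr1 in h2.
 rewrite /chi sp; last by rewrite subr0 scaleNr; lra.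
 rewrite sp; last by rewrite subr0; lra.
 rewrite (D_supp_ball i sp) ?mulr0 ?subr0 //; lra.
- by pos.
- by move=> z; have := dH (- h) _ (z - x); rewrite normrN; exact.
- by rewrite mulrA [M * _]mulrC divfK ?gt_eqF.
Qed.

Definition Ccs psi := smooth psi /\ exists r, supp_ball psi 0 r.

Lemma Ccs_Cc0 psi : Ccs psi -> Cc0 psi.
Proof. by move=> [sp H]; split=> //; exact: smooth_cont. Qed.

Lemma Ccs_ball psi c r : smooth psi -> supp_ball psi c r -> Ccs psi.
Proof. by move=> cp /supp_ball0 H; split=> //; exists (r + enorm c). Qed.

Lemma CcsD psi i : Ccs psi -> Ccs (D i psi).
Proof.
by move=> [sp [r rH]]; split; [exact: smoothD|exists r; exact: D_supp_ball].
Qed.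

Lemma Ccs_mul f psi : smooth f -> Ccs psi -> Ccs (fun x => f x * psi x).
Proof.
move=> sf [sp [r rH]]; split; first exact: smooth_mul.
by exists r => x h; rewrite rH // mulr0.
Qed.

Lemma CcsZ a psi : Ccs psi -> Ccs (fun x => a * psi x).
Proof. by apply: Ccs_mul; exact: smooth_cst. Qed.

Lemma Ccs_opp psi : Ccs psi -> Ccs (fun x => - psi x).
Proof.
by move=> /(CcsZ (-1)); congr Ccs; ext x; rewrite mulN1r.
Qed.

Lemma Ccs_add f psi : Ccs f -> Ccs psi -> Ccs (fun x => f x + psi x).
Proof.
move=> [sf [r rH]] [sp [s sH]]; split; first exact: smooth_add.
exists (Num.max r s) => x; rewrite gt_max => /andP[h1 h2].
by rewrite rH // sH // addr0.
Qed.

Lemma Ccs_sum (I : Type) (s : seq I) (P : pred I) (F : I -> E -> R) :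
 (forall i, Ccs (F i)) -> Ccs (fun x => \sum_(i <- s | P i) F i x).
Proof.
move=> cF; elim: s => [|i s IH].
 under eq_fun do rewrite big_nil.
 by split; [exact: smooth_cst|exists 0].
case Pi: (P i); under eq_fun do rewrite big_cons Pi; last exact: IH.
exact: Ccs_add.
Qed.

Lemma pdiff_cv g psi : continuous g -> Ccs psi -> pdiff (cv g psi).
Proof.
move=> cg cs; apply/pdiffP => i x.
by have [] := @is_derive_cv g psi i x cg (Ccs_Cc0 cs) (smooth_C1 cs.1).
Qed.

Lemma D_cv g psi i : continuous g -> Ccs psi ->
 D i (cv g psi) = cv g (fun y => - D i psi y).
Proof.
move=> cg cs; ext x.
have H := @is_derive_cv g psi i x cg (Ccs_Cc0 cs) (smooth_C1 cs.1).
by rewrite /D derive_val.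
Qed.

Lemma smooth_cv g psi : continuous g -> Ccs psi -> smooth (cv g psi).
Proof.
move=> cg cs; apply/smoothP => k; elim: k psi cs => [|k IH] psi cs.
 by apply/is_Ck0/cont_cv => //; exact: Ccs_Cc0.
apply/is_CkS; split=> [||i].
- by apply: cont_cv => //; exact: Ccs_Cc0.
- exact: pdiff_cv.
- by rewrite D_cv //; apply: IH; apply/Ccs_opp/CcsD.
Qed.

Lemma D2_cv g psi i j : continuous g -> Ccs psi ->
 D i (D j (cv g psi)) = cv g (D i (D j psi)).
Proof.
move=> cg cs; rewrite D_cv // D_cv //; last by apply/Ccs_opp/CcsD.
congr cv; ext y; rewrite D_opp ?opprK //.
by apply: smooth_pd; apply: smoothD; exact: cs.1.
Qed.

Lemma cv_sum (I : Type) (s : seq I) (P : pred I) (F : I -> E -> R) g x :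
 continuous g -> (forall i, Cc0 (F i)) ->
 cv g (fun y => \sum_(i <- s | P i) F i y) x = \sum_(i <- s | P i) cv g (F i) x.
Proof.
move=> cg cF; rewrite /cv -Int_sum; last by move=> i; exact: Cc0_cv_int.
by congr Int; ext y; rewrite mulr_sumr.
Qed.

Lemma cv_add g f psi x : continuous g -> Cc0 f -> Cc0 psi ->
 cv g (fun y => f y + psi y) x = cv g f x + cv g psi x.
Proof.
move=> cg cf cp; rewrite /cv -IntD; [|exact: Cc0_cv_int|exact: Cc0_cv_int].
by congr Int; ext y; rewrite mulrDr.
Qed.

Lemma cv_scale g psi a x : continuous g -> Cc0 psi ->
 cv g (fun y => a * psi y) x = a * cv g psi x.
Proof.
move=> cg cp; rewrite /cv -IntZ; last exact: Cc0_cv_int.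
by congr Int; ext y; rewrite mulrCA.
Qed.

Lemma cv_sub g f psi x : continuous g -> Cc0 f -> Cc0 psi ->
 cv g (fun y => f y - psi y) x = cv g f x - cv g psi x.
Proof.
move=> cg cf cp; rewrite /cv -IntB; [|exact: Cc0_cv_int|exact: Cc0_cv_int].
by congr Int; ext y; rewrite mulrBr.
Qed.

Lemma Ccs_HF psi v : Ccs psi -> Ccs (HF psi v).
Proof.
move=> cs; apply: Ccs_sum => i; apply: CcsZ; apply: CcsD.
by apply: Ccs_sum => j; apply: CcsZ; exact: CcsD.
Qed.

Lemma HF_cv g psi v x : continuous g -> Ccs psi ->
 HF (cv g psi) v x = cv g (HF psi v) x.
Proof.
move=> cg cs; rewrite HFE; last exact: smooth_cv.
have -> : HF psi v = fun y => \sum_i \sum_j v ord0 i * v ord0 j * D i (D j psi) y.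
 by ext y; rewrite HFE //; exact: cs.1.
have c2 i j : Cc0 (fun y => v ord0 i * v ord0 j * D i (D j psi) y).
 by apply: Cc0Z; apply: Ccs_Cc0; apply: CcsD; exact: CcsD.
rewrite cv_sum //; last by move=> i; exact: Cc0_sum.
ebig i; rewrite cv_sum //; ebig j.
have cD : Cc0 (D i (D j psi)) by apply: Ccs_Cc0; apply: CcsD; exact: CcsD.
by rewrite (cv_scale _ _ cg cD) (D2_cv _ _ cg cs).
Qed.

End convolution.

(** * The flat functions p(1/x) exp(-1/x) *)

Section flat_exponential.
Context {R : realType}.
Implicit Types (p : {poly R}) (x : R).

Definition fexp p x : R := if x <= 0 then 0 else p.[x^-1] * expR (- x^-1).

(** With [y = 1 / x], the derivative of p(y) exp(-y) in [x] is y^2 (p(y) - p'(y)) exp(-y); so the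
    functions [fexp p] are stable under differentiation. *)
Definition fder p : {poly R} := 'X^2 * (p - p^`()).

Lemma fexp0 p x : x <= 0 -> fexp p x = 0.
Proof. by rewrite /fexp => ->. Qed.

Lemma fexpE p x : 0 < x -> fexp p x = p.[x^-1] * expR (- x^-1).
Proof. by rewrite /fexp ltNge => /negbTE ->. Qed.

Lemma pow_expR_le k (y : R) : 0 < y -> y ^+ k * expR (- y) <= k.+1%:R ^+ k.+1 / y.
Proof.
move=> y0; rewrite ler_pdivlMr // mulrAC -exprSr expRN ler_pdivrMr ?expR_gt0 //.
have -> : expR y = expR (y / k.+1%:R) ^+ k.+1.
 by rewrite -expRM_natl -mulr_natl mulrC divfK // pnatr_eq0.
rewrite -exprMn; apply: lerXn2r; rewrite ?nnegrE ?mulr_ge0 ?expR_ge0 ?(ltW y0) //.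
rewrite -[leLHS](@divfK _ k.+1%:R) ?pnatr_eq0 // mulrC ler_wpM2l //.
by apply: le_trans (expR_ge1Dx _); rewrite lerDr.
Qed.

(** The exponential beats every polynomial. Applied to ['X * p], which by [fexp_mulX] represents the
    difference quotient of [fexp p] at the origin, the bound shows that this quotient tends to
    zero. *)
Lemma fexp_le p : exists2 C : R, 0 <= C & forall x, `|fexp p x| <= C * `|x|.
Proof.
exists (\sum_(i < size p) `|p`_i| * i.+1%:R ^+ i.+1).
 by pos.
move=> x; have [x0|x0] := leP x 0.
 by rewrite fexp0 // normr0 mulr_ge0 // sumr_ge0 // => i _; rewrite mulr_ge0 //
  exprn_ge0.
rewrite fexpE // horner_coef mulr_suml (gtr0_norm x0) mulr_suml.
apply: le_trans (ler_norm_sum _ _ _) _; apply: ler_sum => i _.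
rewrite -mulrA normrM -mulrA ler_wpM2l // ger0_norm.
 by have := @pow_expR_le i x^-1; rewrite invr_gt0 invrK; exact.
by pos.
Qed.

Lemma fexp_mulX p x : x != 0 -> fexp p x / x = fexp ('X * p) x.
Proof.
move=> xn0; have [x0|x0] := leP x 0; first by rewrite !fexp0 // mul0r.
by rewrite !fexpE // hornerM hornerX; ring.
Qed.

Lemma is_derive_fexp p x : is_derive x (1 : R) (fexp p) (fexp (fder p) x).
Proof.
have [x0|x0|->] := ltgtP x 0.
- rewrite fexp0 ?ltW //; apply: is_deriveP => e e0; exists (- x); first by rewrite
 oppr_gt0.
 move=> h h0; rewrite ltr_norml => /andP[_ hx]; rewrite [h *: 1]mulr1.
 by rewrite !fexp0 ?subrr ?mul0r ?subrr ?normr0 ?ltW //; lra.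
- have xn0 : x != 0 by rewrite gt_eqF.
 pose F := (fun y : R => p.[y^-1] * expR (- y^-1)).
 have dF : is_derive x (1 : R) F (fexp (fder p) x).
  have d1 : is_derive x (1 : R) (fun y : R => y^-1) (- x^-2).
   have := @is_deriveV R id x 1 1 xn0 _.
   by move=> /(_ (is_derive_id _ _)) /is_derive_eq; apply; rewrite [_ *: _]mulr1.
  have d2 : is_derive x (1 : R) (fun y : R => p.[y^-1]) (p^`().[x^-1] * (- x^-2)).
   exact: (@is_derive1_comp R (horner p) (fun y : R => y^-1) x _ _ (is_derive_poly _ _)
    d1).
  have d3 : is_derive x (1 : R) (fun y : R => expR (- y^-1)) (expR (- x^-1) * (- (-
   x^-2))).
   exact: (@is_derive1_comp R expR (fun y : R => - y^-1) x _ _ (is_derive_expR _)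
    (is_deriveN d1)).
  have := is_deriveM d2 d3; rewrite fexpE // /fder hornerM hornerXn hornerD hornerN.
  move=> /is_derive_eq; apply.
  rewrite /GRing.scale /= -!exprVn; ring.
 apply: near_eq_is_derive dF.
 by near=> y; rewrite /F fexpE //; near: y; exact: lt_nbhsr.
- rewrite fexp0 //; apply: is_deriveP => e e0.
 have [C C0 CH] := fexp_le ('X * p).
 exists (e / (C + 1)); first by pos.
 move=> h h0; rewrite ltr_pdivlMr ?ltr_wpDl // => he.
 rewrite add0r [h *: 1]mulr1 [fexp p 0]fexp0 // !subr0 fexp_mulX //.
 by apply: le_trans (CH h) _; have := normr_ge0 h; nra.
Unshelve. all: by end_near.
Qed.

(** [fexp (fpoly j)] is the derivative of order [j] of exp(-1/x). *)
Definition fpoly j : {poly R} := iter j fder 1.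

Lemma fpoly_horner x : [/\ (fpoly 1).[x] = x ^+ 2, (fpoly 2).[x] = x ^+ 3 * (x - 2) &
 (fpoly 3).[x] = x ^+ 4 * (x ^+ 2 - 6 * x + 6)].
Proof.
have fS j : fpoly j.+1 = fder (fpoly j) by [].
have e1 : fpoly 1 = 'X^2 by rewrite fS /fder derivC subr0 mulr1.
have e2 : fpoly 2 = 'X^2 * ('X^2 - ('X + 'X)).
 by rewrite fS e1 /fder derivXn mulr2n.
have e3 : fpoly 3 = 'X^2 * ('X^2 * ('X^2 - ('X + 'X)) - (('X + 'X) * ('X^2 - ('X + 'X))
 + 'X^2 * ('X + 'X - (1 + 1)))).
 by rewrite fS e2 /fder derivM derivB derivD derivXn derivX mulr2n.
by split; rewrite ?e1 ?e2 ?e3 !hornerE /=; ring.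
Qed.

(** At [y = 1 / x >= 6] the polynomials of orders 0 to 3 are nonnegative, the last one because of
    its factor y^2 - 6 y + 6. This explains the squared radius [6^-1] of the kernels [radial]. *)
Lemma fexp_fpoly_ge0 j x : (j <= 3)%N -> x <= 6^-1 -> 0 <= fexp (fpoly j) x.
Proof.
move=> j3 x6; have [x0|x0] := leP x 0; first by rewrite fexp0.
rewrite fexpE // mulr_ge0 ?expR_ge0 //.
have y6 : 6 <= x^-1 by rewrite -[6]invrK lef_pV2 ?posrE ?invr_gt0.
have [h1 h2 h3] := fpoly_horner x^-1.
move: j3; rewrite leq_eqVlt ltnS leq_eqVlt ltnS leq_eqVlt ltnS leqn0 => /or4P[] /eqP ->.
- by rewrite h3; apply: mulr_ge0; [apply: exprn_ge0|]; nra.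
- by rewrite h2; apply: mulr_ge0; [apply: exprn_ge0|]; lra.
- by rewrite h1 sqr_ge0.
- by rewrite hornerC.
Qed.

Lemma fexp_fpoly_gt0 j : (j <= 2)%N -> 0 < fexp (fpoly j) 6^-1.
Proof.
move=> j3; rewrite fexpE ?invr_gt0 // mulr_gt0 ?expR_gt0 // invrK.
have [h1 h2 h3] := fpoly_horner 6.
move: j3; rewrite leq_eqVlt ltnS leq_eqVlt ltnS leqn0 => /or3P[] /eqP ->.
- by rewrite h2; apply: mulr_gt0; [apply: exprn_gt0|]; lra.
- by rewrite h1 exprn_gt0.
- by rewrite hornerC.
Qed.

End flat_exponential.

(** * Radial kernels, dilations and the derivative in the scale *)

Section scaled_kernels.
Context {R : realType} {N : nat}.
Local Notation E := 'rV[R]_N.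
Implicit Types (f g psi : E -> R) (x y v : E) (p : {poly R}) (s : R).

Lemma is_derive_from_line f x v (d : R) :
 is_derive (0 : R) (1 : R) (fun t : R => f (x + t *: v)) d -> is_derive x v f d.
Proof.
set g := fun t : R => _.
have E' : (fun h : R => h^-1 *: ((g \o shift 0) (h *: 1) - g 0)) = (fun h => h^-1 *: ((f
 \o shift x) (h *: v) - f x)).
 ext h; rewrite /g /shift /= scale0r !addr0 [h *: 1]mulr1.
 by rewrite [x + _]addrC.
by move=> [H1 H2]; split; [move: H1|move: H2]; rewrite /derivable /derive E'.
Qed.

Lemma is_derive_chain (h : R -> R) f x v (df dh : R) : is_derive x v f df ->
 is_derive (f x) (1 : R) h dh -> is_derive x v (h \o f) (df * dh).
Proof.
move=> [f1 f2] H; apply: is_derive_from_line.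
have x0 : x + (0 : R) *: v = x by rewrite scale0r addr0.
have f3 : derivable f (x + (0 : R) *: v) v by rewrite x0.
have := derive_line f3; rewrite x0 f2 => H1.
rewrite -x0 in H; rewrite mulrC.
exact: (@is_derive1_comp R h (fun t : R => f (x + t *: v)) 0 _ _ H H1).
Qed.

Lemma is_derive_dilate f x v (c : R) : derivable f (c *: x) v ->
 is_derive x v (fun y => f (c *: y)) (c * 'D_v f (c *: x)).
Proof.
move=> df; apply: is_derive_from_line.
have -> : (fun t : R => f (c *: (x + t *: v))) = (fun t : R => f (c *: x + (t * c) *:
 v)).
 by ext t; rewrite scalerDr scalerA [c * t]mulrC.
have x0 : c *: x + ((0 : R) * c) *: v = c *: x by rewrite mul0r scale0r addr0.
have f3 : derivable f (c *: x + ((0 : R) * c) *: v) v by rewrite x0.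
have := derive_line f3; rewrite x0 => H1.
have d2 : is_derive (0 : R) (1 : R) (fun t : R => t * c) c.
 apply: is_deriveP => e e0; exists 1 => // h h0 _.
 by rewrite mul0r subr0 add0r [h *: 1]mulr1 [h * _]mulrC mulfK // subrr normr0 ltW.
rewrite mulrC.
exact: (@is_derive1_comp R (fun t : R => f (c *: x + t *: v)) (fun t : R => t * c) 0 _ _
 H1 d2).
Qed.

Lemma smooth_dilate f (c : R) : smooth f -> smooth (fun x => f (c *: x)).
Proof.
move=> sf; apply/smoothP => k; elim: k f sf => [|k IH] f sf.
 apply/is_Ck0 => x; apply/cont_enormP => e e0.
 have /cont_enormP/(_ _ e0)[d d0 dH] := smooth_cont sf (x := c *: x).
 exists (d / (`|c| + 1)) => [|y]; first by pos.
 rewrite ltr_pdivlMr // => h; apply: dH.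
 rewrite -scalerBr enormZ; apply: le_lt_trans h.
 by rewrite mulrC ler_wpM2l ?enorm_ge0 // lerDl.
have /pdiffP df := smooth_pd sf.
have cf : continuous (fun x => f (c *: x)) by exact/(is_Ck_cont (IH f sf)).
apply/is_CkS; split; [exact: cf|by apply/pdiffP => i x; have [] := is_derive_dilate (df
 i (c *: x))|move=> i].
have -> : D i (fun x => f (c *: x)) = fun x => c * D i f (c *: x).
 by ext x; have H := is_derive_dilate (df i (c *: x)); rewrite /D derive_val.
by apply: is_CkM; [exact: is_Ck_cst|apply: IH; exact: smoothD].
Qed.

Lemma D_dilate f (c : R) i : smooth f -> D i (fun x => f (c *: x)) = fun x => c * D i f (c *: x).
Proof.
move=> sf; ext x; have /pdiffP df := smooth_pd sf.
have H := is_derive_dilate (df i (c *: x)).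
by rewrite /D derive_val.
Qed.

Lemma smooth_dot : smooth (fun y : E => dot y y).
Proof. by apply: smooth_sum => i; apply: smooth_mul; exact: smooth_coord. Qed.

Lemma D_dot i : D i (fun y : E => dot y y) = fun y => 2 * y ord0 i.
Proof.
rewrite D_sum; last by move=> j; apply: smooth_mul; exact: smooth_coord.
ext y; rewrite (bigD1 i) // big1.
 by rewrite D_mul ?D_coord; [rewrite eqxx /=; ring|exact: pdiff_coord|exact:
  pdiff_coord].
move=> j ji; rewrite D_mul ?D_coord; [|exact: pdiff_coord|exact: pdiff_coord].
by rewrite eq_sym (negbTE ji) mul0r mulr0 addr0.
Qed.

Definition radial p y : R := fexp p (6^-1 - dot y y).

Let smooth_rho : smooth (fun y : E => 6^-1 - dot y y).
Proof. by apply: smooth_sub; [exact: smooth_cst|exact: smooth_dot]. Qed.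

Let is_derive_radial p i y : is_derive y (de i) (radial p)
 (- 2 * y ord0 i * radial (fder p) y).
Proof.
apply: (@is_derive_chain (fexp p) (fun y : E => 6^-1 - dot y y)); last exact:
 is_derive_fexp.
have /pdiffP dr := smooth_pd smooth_rho.
have := derivableP (dr i y); rewrite -/(D i _ y).
by rewrite (D_sub i (smooth_cst _) smooth_dot) D_cst D_dot sub0r mulNr.
Qed.

Lemma D_radial p i : D i (radial p) = fun y => - 2 * y ord0 i * radial (fder p) y.
Proof.
by ext y; have H := is_derive_radial p i y; rewrite /D derive_val.
Qed.

Lemma cont_fexp p : continuous (fexp p).
Proof.
move=> x; apply: differentiable_continuous; apply/derivable1_diffP.
by have [] := is_derive_fexp p x.
Qed.

Lemma is_derive_fexp_comp p f i x : smooth f ->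
 is_derive x (de i) (fun x => fexp p (f x)) (D i f x * fexp (fder p) (f x)).
Proof.
move=> /smooth_pd/pdiffP sf; apply: (@is_derive_chain (fexp p)); last exact:
 is_derive_fexp.
exact: (@DeriveDef _ _ _ _ _ _ _ (sf i x) erefl).
Qed.

Lemma D_fexp p f i : smooth f ->
 D i (fun x => fexp p (f x)) = fun x => D i f x * fexp (fder p) (f x).
Proof.
move=> sf; ext x; have H := is_derive_fexp_comp p i x sf.
by rewrite /D derive_val.
Qed.

Lemma smooth_fexp p f : smooth f -> smooth (fun x => fexp p (f x)).
Proof.
move=> sf; apply/smoothP => k; elim: k p => [|k IH] p.
 apply/is_Ck0 => x.
 apply: (@continuous_comp _ _ _ f (fexp p)); last exact: cont_fexp.
 exact: (smooth_cont sf).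
apply/is_CkS; split => [||i].
- exact: is_Ck_cont (IH p).
- by apply/pdiffP => i x; have [] := is_derive_fexp_comp p i x sf.
- rewrite D_fexp //; apply: is_CkM => //.
 by have /smoothP := smoothD i sf; exact.
Qed.

Lemma smooth_radial p : smooth (radial p).
Proof. exact: smooth_fexp. Qed.

Lemma D2_radial p i j y : D i (D j (radial p)) y =
 4 * y ord0 i * y ord0 j * radial (fder (fder p)) y - 2 * (i == j)%:R * radial (fder p) y.
Proof.
rewrite D_radial D_mul;
 [|exact/smooth_pd/smoothZ/smooth_coord|exact/smooth_pd/smooth_radial].
rewrite DZ; last exact: pdiff_coord.
rewrite D_coord D_radial; ring.
Qed.

Definition Lap f y : R := \sum_i D i (D i f) y.

Lemma Lap_radial p y : Lap (radial p) y =
 4 * dot y y * radial (fder (fder p)) y - 2 * N%:R * radial (fder p) y.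
Proof.
rewrite /Lap; under eq_bigr do rewrite D2_radial eqxx mulr1.
rewrite sumrB sum_const; congr (_ - _); last by ring.
rewrite -mulr_suml /dot mulr_sumr; congr (_ * _).
by ebig i; rewrite mulrA.
Qed.

Lemma HF_radial p v y : HF (radial p) v y =
 4 * dot y v ^+ 2 * radial (fder (fder p)) y - 2 * dot v v * radial (fder p) y.
Proof.
rewrite HFE; last exact: smooth_radial.
set a := radial (fder (fder p)) y; set b := radial (fder p) y.
have -> : \sum_i \sum_j v ord0 i * v ord0 j * D i (D j (radial p)) y = \sum_i (4 * (y
 ord0 i * v ord0 i) * dot y v * a - 2 * (v ord0 i * v ord0 i) * b).
 ebig i.
 under eq_bigr do rewrite D2_radial -/a -/b mulrBr.
 rewrite sumrB; congr (_ - _).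
  rewrite -[4 * _ * dot y v]mulrA /dot !mulr_sumr mulr_suml.
  ebig j; ring.
 rewrite (bigD1 i) // eqxx big1; first by rewrite /=; ring.
 by move=> j ji; rewrite eq_sym (negbTE ji) mulr0 mul0r mulr0.
rewrite sumrB; congr (_ - _).
 rewrite -!mulr_suml -mulr_sumr -/(dot y v) expr2; ring.
by rewrite -mulr_suml -mulr_sumr.
Qed.

Lemma supp_radial p : supp_ball (radial p) 0 2^-1.
Proof.
move=> y; rewrite subr0 => h; rewrite /radial fexp0 // -enorm_sqr.
by have : 0 < 2^-1 :> R; nra.
Qed.

Lemma Ccs_radial p : Ccs (radial p).
Proof. by split; [exact: smooth_radial|exists 2^-1; exact: supp_radial]. Qed.

(** Generator of dilations: by [is_derive_scl], differentiating [scl m s psi] in [s] gives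
    [scl m.+1 s (Euler m psi)]. For [m = N] it is minus the divergence of [y psi]. *)
Definition Euler (m : nat) psi y : R := - m%:R * psi y - \sum_i y ord0 i * D i psi y.

(** The field [y * radial (fder p)] is minus half the gradient of [radial p], and [Euler N] takes
    minus the divergence. So changing the scale of an average amounts to averaging a Laplacian, the
    mechanism behind [T_decomp]. *)
Lemma Euler_radial p y : Euler N (radial (fder p)) y = Lap (radial p) y / 2.
Proof.
rewrite /Euler Lap_radial.
under eq_bigr do rewrite D_radial mulrA.
rewrite -mulr_suml.
have -> : \sum_(i < N) y ord0 i * (- 2 * y ord0 i) = - 2 * dot y y.
 by rewrite /dot mulr_sumr; ebig i; ring.
by field.
Qed.

Lemma Ccs_Euler m psi : Ccs psi -> Ccs (Euler m psi).
Proof.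
move=> cs; apply: Ccs_add; first exact: CcsZ.
apply: Ccs_opp; apply: Ccs_sum => i; apply: Ccs_mul; first exact: smooth_coord.
exact: CcsD.
Qed.

Lemma Euler_D m psi i : smooth psi -> Euler m.+1 (D i psi) = D i (Euler m psi).
Proof.
move=> sp; have s1 j : smooth (fun y : E => y ord0 j * D j psi y).
 by apply: smooth_mul; [exact: smooth_coord|exact: smoothD].
rewrite /Euler D_sub; [|exact: smoothZ|exact: smooth_sum].
rewrite DZ ?D_sum //; last exact: smooth_pd.
ext y.
have -> : \sum_j D i (fun y : E => y ord0 j * D j psi y) y = D i psi y + \sum_j y ord0 j
 * D j (D i psi) y.
 have -> : D i psi y = \sum_j (i == j)%:R * D j psi y.
  rewrite (bigD1 i) //= eqxx mul1r big1 ?addr0 // => j ji.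
  by rewrite eq_sym (negbTE ji) mul0r.
 rewrite -big_split; ebig j.
 by rewrite D_mul ?D_coord ?(D_comm i j sp) //; [exact:
  pdiff_coord|exact/smooth_pd/smoothD].
by rewrite -natr1; ring.
Qed.

(** The exponent is kept free: [m = N] preserves the integral, and each derivative of the kernel
    raises it by one. *)
Definition scl (m : nat) s psi y : R := s^-1 ^+ m * psi (s^-1 *: y).

Lemma scl1 m psi : scl m 1 psi = psi.
Proof. by ext y; rewrite /scl invr1 expr1n mul1r scale1r. Qed.

Lemma smooth_scl m s psi : smooth psi -> smooth (scl m s psi).
Proof. by move=> sp; apply: smoothZ; exact: smooth_dilate. Qed.

Lemma D_scl m s psi i : smooth psi -> D i (scl m s psi) = scl m.+1 s (D i psi).
Proof.
move=> sp; rewrite /scl DZ; last exact/smooth_pd/smooth_dilate.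
by rewrite D_dilate //; ext y; rewrite exprSr mulrA.
Qed.

Lemma D2_scl m s psi i j : smooth psi ->
 D i (D j (scl m s psi)) = scl m.+2 s (D i (D j psi)).
Proof. by move=> sp; rewrite (D_scl _ _ _ sp) (D_scl _ _ _ (smoothD j sp)). Qed.

Lemma HF_scl m s psi v : smooth psi -> HF (scl m s psi) v = scl m.+2 s (HF psi v).
Proof.
move=> sp; ext y; rewrite (HFE _ _ (smooth_scl m s sp)).
rewrite {2}/scl (HFE _ _ sp) mulr_sumr; ebig i.
rewrite mulr_sumr; ebig j.
by rewrite (D2_scl _ _ _ _ sp) {1}/scl mulrCA.
Qed.

Lemma Lap_scl m s psi : smooth psi -> Lap (scl m s psi) = scl m.+2 s (Lap psi).
Proof.
move=> sp; ext y; rewrite {2}/scl /Lap mulr_sumr.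
by ebig i; rewrite (D2_scl _ _ _ _ sp).
Qed.

Lemma supp_scl m s psi r : 0 < s -> supp_ball psi 0 r -> supp_ball (scl m s psi) 0 (r * s).
Proof.
move=> s0 sp y; rewrite subr0 => h; rewrite /scl sp ?mulr0 // subr0 enormZ.
by rewrite gtr0_norm ?invr_gt0 // mulrC ltr_pdivlMr.
Qed.

Lemma Ccs_scl m s psi : 0 < s -> Ccs psi -> Ccs (scl m s psi).
Proof.
move=> s0 [sp [r rH]]; split; first exact: smooth_scl.
by exists (r * s); exact: supp_scl.
Qed.

Lemma is_derive_scl m s psi y : 0 < s -> smooth psi ->
 is_derive s (1 : R) (fun s => scl m s psi y) (scl m.+1 s (Euler m psi) y).
Proof.
move=> s0 sp; have sn0 : s != 0 by rewrite gt_eqF.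
have d1 : is_derive s (1 : R) (fun s : R => s^-1) (- s^-2).
 have := @is_deriveV R id s 1 1 sn0 _.
 by move=> /(_ (is_derive_id _ _)) /is_derive_eq; apply; rewrite [_ *: _]mulr1.
have d2 : is_derive s (1 : R) (fun s : R => psi (s^-1 *: y)) (DL psi y (s^-1 *: y) * -
 s^-2).
 apply: (@is_derive1_comp R (fun t : R => psi (t *: y)) (fun s : R => s^-1) s) => //.
 have := derive_along_smooth 0 y s^-1 sp; rewrite add0r.
 by under eq_fun do rewrite add0r.
have d3 : is_derive s (1 : R) (fun s : R => s^-1 ^+ m) (m%:R * s^-1 ^+ m.-1 * - s^-2).
 by have := @is_deriveX R R (fun s : R => s^-1) m s 1 _ d1; rewrite fctE.
have := is_deriveM d3 d2; move=> /is_derive_eq; apply.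
rewrite /scl /Euler /GRing.scale /=.
have -> : DL psi y (s^-1 *: y) = s * \sum_i (s^-1 *: y) ord0 i * D i psi (s^-1 *: y).
 rewrite /DL mulr_sumr; ebig i; rewrite mxE mulrA mulrA mulfV // mul1r //.
set T := \sum_i _; rewrite -exprVn.
have ss : s^-1 * s = 1 by rewrite mulVf.
move: (psi _) T ss => c T; move: (s^-1) => i is1; clear -is1.
case: m => [|m].
 by transitivity (- (i * s) * i * T); [ring|rewrite is1; ring].
rewrite !exprS; transitivity (- i * i * i ^+ m * (m.+1%:R * c + (i * s) * T)); first by
 ring.
by rewrite is1; ring.
Qed.

Lemma scl_bound m s psi : Ccs psi -> exists2 B, 0 <= B &
 forall a s y, 0 < a -> a <= s -> `|scl m s psi y| <= a^-1 ^+ m * B.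
Proof.
move=> /Ccs_Cc0/Cc0_bounded[B B0 BH]; exists B => // a t y a0 at_.
have t0 := lt_le_trans a0 at_.
rewrite /scl normrM ler_pM // normrX ger0_norm ?invr_ge0 ?(ltW t0) //.
by apply: lerXn2r; rewrite ?nnegrE ?invr_ge0 ?(ltW a0) ?(ltW t0) // lef_pV2.
Qed.

(* Riemann sums of the fundamental theorem of calculus in the scale, uniformly in y. *)
Lemma scl_riemann m psi (a b : R) : 0 < a -> a <= b -> Ccs psi ->
 exists2 C, 0 <= C & forall M : nat, (0 < M)%N -> forall y,
  `|scl m b psi y - scl m a psi y - \sum_(j < M) (b - a) / M%:R *
    scl m.+1 (a + j%:R * ((b - a) / M%:R)) (Euler m psi) y| <= C / M%:R.
Proof.
move=> a0 ab cs; have c1 := Ccs_Euler m cs; have c2 := Ccs_Euler m.+1 c1.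
have [B B0 BH] := scl_bound m.+2 a c2.
pose C := a^-1 ^+ m.+2 * B; have C0 : 0 <= C by rewrite mulr_ge0 // exprn_ge0 //
 invr_ge0 ltW.
exists ((b - a) ^+ 2 * C) => [|M M0 y]; first by pos.
have Mp : 0 < M%:R :> R by rewrite ltr0n.
set h := (b - a) / M%:R.
have h0 : 0 <= h by pos.
have mvt n (chi : E -> R) s t : Ccs chi -> 0 < s -> 0 <= t -> exists2 z, s <= z <= s + t
 & scl n (s + t) chi y - scl n s chi y = t * scl n.+1 z (Euler n chi) y.
 move=> cc s0 t0.
 have [z /andP[z0 z1] zE] : exists2 z : R, 0 <= z <= 1 & scl n (s + 1 * t) chi y - scl n
  (s + 0 * t) chi y = t * scl n.+1 (s + z * t) (Euler n chi) y.
  apply: (mvt01 (g := fun z => scl n (s + z * t) chi y) (dg := fun z => t * scl n.+1 (s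
   + z * t) (Euler n chi) y)) => z /andP[z0 z1].
  have zt : 0 < s + z * t by pos.
  have d1 := is_derive_scl n y zt cc.1.
  have d2 : is_derive z (1 : R) (fun z : R => s + z * t) t.
   apply: is_deriveP => e e0; exists 1 => // k k0 _.
   have -> : (s + (z + k *: 1) * t - (s + z * t)) / k = t.
    by rewrite [k *: 1]mulr1; field.
   by rewrite subrr normr0 ltW.
  have := @is_derive1_comp R (fun s => scl n s chi y) (fun z : R => s + z * t) z _ _ d1
   d2.
  by rewrite mulrC.
 exists (s + z * t); first by rewrite lerDl mulr_ge0 // lerD2l ler_piMl.
 by rewrite -zE mul1r mul0r addr0.
have -> : scl m b psi y - scl m a psi y = \sum_(j < M) (scl m (a + j.+1%:R * h) psi y -
 scl m (a + j%:R * h) psi y).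
 rewrite -(big_mkord xpredT (fun j => scl m (a + j.+1%:R * h) psi y - scl m (a + j%:R *
  h) psi y)).
 rewrite telescope_sumr //; congr (scl _ _ _ _ - scl _ _ _ _).
  by rewrite /h [M%:R * _]mulrC divfK ?gt_eqF // addrC subrK.
 by rewrite mul0r addr0.
rewrite -sumrB; apply: le_trans (ler_norm_sum _ _ _) _.
apply: (@le_trans _ _ (\sum_(j < M) h * (h * C))); last first.
 rewrite sum_const /h.
 have -> : M%:R * ((b - a) / M%:R * ((b - a) / M%:R * C)) = (b - a) ^+ 2 * C / M%:R.
  by field; rewrite gt_eqF.
 by [].
apply: ler_sum => j _; set s := a + j%:R * h.
have s0 : a <= s by rewrite lerDl mulr_ge0.
have sp : 0 < s by pos.
have -> : a + j.+1%:R * h = s + h by rewrite -natr1 mulrDl mul1r addrA.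
have [z /andP[z1 z2] ->] := mvt m psi s h cs sp h0.
rewrite -mulrBr normrM ger0_norm // ler_wpM2l //.
have zs0 : 0 <= z - s by pos.
have [w /andP[w1 w2]] := mvt m.+1 (Euler m psi) s (z - s) c1 sp zs0.
rewrite [s + (z - s)]addrC subrK => ->; rewrite normrM ger0_norm //.
apply: ler_pM => //; first by rewrite lerBlDl.
by apply: BH => //; exact: le_trans w1.
Qed.

Lemma small_inv (C e : R) : 0 < e -> exists2 M : nat, (0 < M)%N & C / M%:R <= e.
Proof.
move=> e0; pose M := (Num.trunc (`|C| / e)).+1.
exists M => //; rewrite ler_pdivrMr //.
have : `|C| / e < M%:R by rewrite truncnS_gt // divr_ge0 ltW.
rewrite ltr_pdivrMr // mulrC => h; apply: le_trans (ler_norm C) (ltW h).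
Qed.

Lemma Int_EulerN psi : Ccs psi -> forall s, 0 < s -> Int (scl N.+1 s (Euler N psi)) = 0.
Proof.
move=> cs s s0.
have cy i : Ccs (fun y : E => y ord0 i * psi y) by apply: Ccs_mul => //; exact:
 smooth_coord.
have -> : Euler N psi = fun y => \sum_i - D i (fun y : E => y ord0 i * psi y) y.
 ext y; rewrite /Euler.
 rewrite [RHS](eq_bigr (fun i => - psi y - y ord0 i * D i psi y)); last first.
  move=> i _; rewrite D_mul ?D_coord ?eqxx ?mul1r ?opprD //; first exact: pdiff_coord.
  exact: smooth_pd cs.1.
 by rewrite big_split !sumrN sumr_const card_ord mulNr mulr_natl.
have -> : scl N.+1 s (fun y => \sum_i - D i (fun y : E => y ord0 i * psi y) y) = fun y
 => \sum_i - D i (scl N s (fun y : E => y ord0 i * psi y)) y.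
 ext y; rewrite {1}/scl mulr_sumr; ebig i.
 by rewrite D_scl /scl ?mulrN //; exact: (cy i).1.
rewrite Int_sum; last first.
 by move=> i; apply: Cc0N; apply: Ccs_Cc0; apply: CcsD; exact: Ccs_scl.
rewrite big1 // => i _; have c1 := Ccs_scl N s0 (cy i).
rewrite IntN; last exact/Ccs_Cc0/CcsD.
by rewrite Int_D ?oppr0 //; [exact: Ccs_Cc0|exact: smooth_C1 c1.1].
Qed.

(** The derivative of the integral in the scale is the integral of a divergence, hence zero. The
    Riemann sums of [scl_riemann] replace the integral over the scales. *)
Lemma Int_scl_mono psi (a b : R) : Ccs psi -> 0 < a -> a <= b ->
 Int (scl N b psi) = Int (scl N a psi).
Proof.
move=> cs a0 ab; have b0 := lt_le_trans a0 ab.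
have [C C0 CH] := scl_riemann N a0 ab cs.
have [_ [r rH]] := cs.
have [r1 r1H] := (Ccs_Euler N cs).2.
pose rr := Num.max `|r| `|r1| * b.
have suppb m s chi r2 : 0 < s -> s <= b -> `|r2| <= Num.max `|r| `|r1| -> supp_ball chi
 0 r2 -> supp_ball (scl m s chi) 0 rr.
 move=> s0 sb r2m sc y yr; apply: (supp_scl m s0 sc); apply: le_lt_trans yr.
 apply: le_trans (ler_norm _) _; rewrite normrM ler_pM // gtr0_norm //.
apply/eqP; rewrite -subr_eq0 -normr_le0; apply/ler_addgt0Pl => e e0; rewrite addr0.
have V0 : 0 < @vol R N rr + 1 by rewrite ltr_wpDl // vol_ge0.
have [M M0 MH] := small_inv C (divr_gt0 e0 V0).
have Mp : 0 < M%:R :> R by rewrite ltr0n.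
set h := (b - a) / M%:R in CH.
have sjp (j : 'I_M) : 0 < a + j%:R * h by pos.
have sjb (j : 'I_M) : a + j%:R * h <= b.
 rewrite -lerBrDl /h mulrC -mulrA ler_piMr ?subr_ge0 // mulrC ler_pdivrMr // mul1r
  ler_nat.
 exact: ltnW.
have cj (j : 'I_M) : Cc0 (fun y => h * scl N.+1 (a + j%:R * h) (Euler N psi) y).
 by apply: Cc0Z; apply: Ccs_Cc0; apply: Ccs_scl => //; exact: Ccs_Euler.
have cb : Cc0 (scl N b psi) by apply/Ccs_Cc0/Ccs_scl.
have ca : Cc0 (scl N a psi) by apply/Ccs_Cc0/Ccs_scl.
have cs1 : Cc0 (fun y => \sum_(j < M) h * scl N.+1 (a + j%:R * h) (Euler N psi) y).
 exact: Cc0_sum.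
have : Int (fun y => scl N b psi y - scl N a psi y - \sum_(j < M) h * scl N.+1 (a + j%:R
 * h) (Euler N psi) y) = Int (scl N b psi) - Int (scl N a psi).
 rewrite (IntB (Cc0B cb ca) cs1) (IntB cb ca) (Int_sum _ _ cj) big1 ?subr0 // => j _.
 rewrite IntZ; last by apply: Ccs_Cc0; apply: Ccs_scl => //; exact: Ccs_Euler.
 by rewrite Int_EulerN ?mulr0.
move=> <-.
apply: (@le_trans _ _ (C / M%:R * @vol R N rr)).
 apply: (@Int_bound _ _ _ 0); first by case: (Cc0B (Cc0B cb ca) cs1).
  move=> y yr.
  rewrite (suppb N b psi r) ?le_max ?lexx // (suppb N a psi r) ?le_max ?lexx //.
  rewrite big1 ?subr0 // => j _.
  by rewrite (suppb N.+1 _ (Euler N psi) r1) ?mulr0 ?le_max ?lexx ?orbT.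
 by move=> y; exact: CH.
apply: (@le_trans _ _ (e / (@vol R N rr + 1) * @vol R N rr)).
 by rewrite ler_wpM2r // vol_ge0.
rewrite mulrAC ler_pdivrMr // ler_wpM2l; lra.
Qed.

Lemma Int_scl psi s : Ccs psi -> 0 < s -> Int (scl N s psi) = Int psi.
Proof.
move=> cs s0; rewrite -[in RHS](scl1 N psi).
have [s1|/ltW s1] := leP s 1; last exact: Int_scl_mono.
by rewrite [RHS](Int_scl_mono cs s0 s1).
Qed.

End scaled_kernels.

(** * Mixed discriminants of complex matrices *)

Section mixed_discriminants.
Context {C : numClosedFieldType} {n : nat}.
Local Notation mat := ('I_n -> 'I_n -> C).
Local Notation vec := ('I_n -> C).
Implicit Types (I J : {set 'I_n}) (W : mat) (Ws : seq mat) (x : vec) (xs : seq vec).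
Local Open Scope set_scope.
Local Open Scope ring_scope.

Definition psgn I (i : 'I_n) : C := (-1) ^+ pos_in I i.

Lemma psgn_swap I i i' : i \in I -> i' \in I -> i != i' ->
 psgn I i * psgn (I :\ i) i' = - (psgn I i' * psgn (I :\ i') i).
Proof.
wlog lt_ii : i i' / (i < i')%N => [H iI i'I ii'|iI i'I _].
 have [lt|lt|/val_inj/eqP] := ltngtP i i'; first exact: H.
  by rewrite [in RHS]H ?opprK // eq_sym.
 by rewrite (negbTE ii').
rewrite /psgn -!exprD.
have -> : pos_in (I :\ i')%SET i = pos_in I i.
 apply: eq_card => k; rewrite !inE; case: eqP => // ->.
 by rewrite [(i' < i)%N]ltnNge (ltnW lt_ii) !andbF.
have -> : pos_in I i' = (pos_in (I :\ i)%SET i').+1.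
 rewrite /pos_in (cardsD1 i) !inE iI lt_ii add1n; congr _.+1.
 by apply: eq_card => k; rewrite !inE andbA.
by rewrite addSn exprS mulN1r opprK addnC.
Qed.

Lemma setD1C I (i i' : 'I_n) : (I :\ i :\ i')%SET = (I :\ i' :\ i)%SET.
Proof. by apply/setP => k; rewrite !inE andbCA. Qed.

Lemma sum_swap I (F : 'I_n -> 'I_n -> C) :
 \sum_(i in I) \sum_(i' in (I :\ i)%SET) psgn I i * psgn (I :\ i) i' * F i i' =
 - \sum_(i in I) \sum_(i' in (I :\ i)%SET) psgn I i * psgn (I :\ i) i' * F i' i.
Proof.
rewrite (exchange_big_dep (mem I)) /=; last by move=> i i' _; rewrite !inE => /andP[].
rewrite -sumrN; apply: eq_bigr => i iI; rewrite -sumrN; apply: eq_big => [i'|i'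
 /andP[]].
 by rewrite !inE iI andbT andbC eq_sym.
rewrite !inE => i'I /andP[ii' _].
by rewrite (psgn_swap i'I iI) ?mulNr // eq_sym.
Qed.

(** Coefficient at [I], [J] of the product of the forms of bidegree (1, 1) with matrices [Ws], in
    the sign convention of [MA_currents], expanded along the first factor. For equal factors it is a
    factorial times a minor. *)
Fixpoint Mc I J Ws : C :=
 if Ws is W :: Ws' then
  \sum_(i in I) \sum_(j in J) psgn I i * psgn J j *
   (W i j * Mc (I :\ i) (J :\ j) Ws')
 else 1.

Lemma Mc2E I J A B Ws : Mc I J (A :: B :: Ws) =
 \sum_(i in I) \sum_(i' in (I :\ i)%SET) psgn I i * psgn (I :\ i) i' *
 \sum_(j in J) \sum_(j' in (J :\ j)%SET) psgn J j * psgn (J :\ j) j' *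
  (A i j * B i' j' * Mc (I :\ i :\ i')%SET (J :\ j :\ j')%SET Ws).
Proof.
rewrite /=; ebig i.
rewrite (eq_bigr (fun j => \sum_(i' in (I :\ i)%SET) \sum_(j' in (J :\ j)%SET) psgn I i
 * psgn (I :\ i) i' * (psgn J j * psgn (J :\ j) j' * (A i j * B i' j' * Mc (I :\ i :\
 i')%SET (J :\ j :\ j')%SET Ws)))); last first.
 move=> j _; rewrite mulrA mulr_sumr; ebig i'.
 rewrite mulr_sumr; ebig j'; ring.
rewrite exchange_big; ebig i'; rewrite mulr_sumr.
by ebig j; rewrite mulr_sumr.
Qed.

(** Exchanging the two removed rows costs a sign, and exchanging the two removed columns costs
    another. *)
Lemma Mc_swap I J A B Ws : Mc I J (A :: B :: Ws) = Mc I J (B :: A :: Ws).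
Proof.
rewrite !Mc2E sum_swap -sumrN; ebig i; rewrite -sumrN.
ebig i'; rewrite -mulrN; congr (_ * _).
rewrite sum_swap opprK; ebig j; ebig j'.
by rewrite (setD1C I) (setD1C J); congr (_ * _); rewrite mulrC [B _ _ * _]mulrC mulrC.
Qed.

Lemma Mc_sub I J A B Ws :
 Mc I J ((fun i j => A i j - B i j) :: Ws) = Mc I J (A :: Ws) - Mc I J (B :: Ws).
Proof.
rewrite -sumrB; ebig i; rewrite -sumrB; ebig j.
by rewrite -mulrBr -mulrBl.
Qed.

Fixpoint tele (V W : mat) k : seq (seq mat) :=
 if k is k'.+1 then nseq k' V :: [seq W :: L | L <- tele V W k'] else [::].

(** Multilinearity and symmetry factor the difference of two powers: each term is [V - W] times
    [k - 1] factors equal to [V] or [W]. *)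
Lemma Mc_tele I J V W k : Mc I J (nseq k V) - Mc I J (nseq k W) =
 \sum_(L <- tele V W k) Mc I J ((fun i j => V i j - W i j) :: L).
Proof.
elim: k I J => [|k IH] I J; first by rewrite big_nil subrr.
rewrite [tele _ _ _]/= big_cons big_map Mc_sub.
have -> : Mc I J (V :: nseq k V) - Mc I J (W :: nseq k W) = (Mc I J (V :: nseq k V) - Mc
 I J (W :: nseq k V)) + (Mc I J (W :: nseq k V) - Mc I J (W :: nseq k W)) by rewrite
 addrA subrK.
congr (_ + _).
rewrite (eq_bigr (fun L => Mc I J (W :: (fun i j => V i j - W i j) :: L))); last first.
 by move=> L _; rewrite Mc_swap.
rewrite -sumrB exchange_big; ebig i.
rewrite -sumrB exchange_big; ebig j.
by rewrite -mulrBr -mulrBr IH !mulr_sumr.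
Qed.

(** Determinant of the vectors [xs] on the rows [I], expanded along the first vector. *)
Fixpoint Drec I xs : C :=
 if xs is x :: xs' then \sum_(i in I) psgn I i * (x i * Drec (I :\ i)%SET xs') else 1.

Lemma Drec_swap I x y xs : Drec I (x :: y :: xs) = - Drec I (y :: x :: xs).
Proof.
have E a b : Drec I (a :: b :: xs) = \sum_(i in I) \sum_(i' in (I :\ i)%SET) psgn I i *
 psgn (I :\ i) i' * (a i * b i' * Drec (I :\ i :\ i')%SET xs).
 rewrite /=; ebig i; rewrite mulrA mulr_sumr; ebig i'; ring.
rewrite !E sum_swap; congr (- _); ebig i; ebig i'.
by rewrite (setD1C I) [x _ * _]mulrC.
Qed.

Lemma Drec_eq I x xs : List.In x xs -> Drec I (x :: xs) = 0.
Proof.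
elim: xs I => //= y xs IH I [->|xxs].
 have : Drec I [:: x, x & xs] *+ 2 == 0 by rewrite mulr2n {1}Drec_swap addNr.
 by rewrite mulrn_eq0 => /eqP.
rewrite -[LHS]/(Drec I [:: x, y & xs]) Drec_swap /= big1 ?oppr0 // => i _.
by have -> := IH (I :\ i)%SET xxs; rewrite !mulr0.
Qed.

Lemma Drec_nuniq (x : 'I_n -> vec) I g : ~~ uniq g -> Drec I (map x g) = 0.
Proof.
elim: g I => //= k g IH I; rewrite negb_and negbK => /orP[kg|/IH H].
 apply: (@Drec_eq I (x k)); apply: List.in_map.
 by elim: g kg {IH} => // a g IH; rewrite inE => /predU1P[->|/IH]; [left|right].
by rewrite big1 // => i _; rewrite H !mulr0.
Qed.

Lemma conj_psgn I i : (psgn I i)^* = psgn I i.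
Proof. by rewrite /psgn rmorphXn rmorphN1. Qed.

Definition rank1 (x : vec) : mat := fun i j => x i * (x j)^*.

(* A family of positive combinations of rank one matrices expands the mixed
 discriminants into squared moduli of determinants. *)
Definition wsum (s : seq (C * seq vec)) I J : C :=
 \sum_(c <- s) c.1 * (Drec I c.2 * (Drec J c.2)^*).

Lemma Mc_wsum_cons (K : finType) (c : K -> C) (x : K -> vec) Ws s I J :
 (forall I J, Mc I J Ws = wsum s I J) ->
 Mc I J ((fun i j => \sum_k c k * rank1 (x k) i j) :: Ws) =
 wsum [seq (c k * t.1, x k :: t.2) | k <- enum K, t <- s] I J.
Proof.
move=> H; rewrite /wsum big_allpairs_dep big_enum.
have -> : \sum_(k : K) \sum_(t <- s) (c k * t.1) * (Drec I (x k :: t.2) * (Drec J (x k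
 :: t.2))^*) = \sum_(k : K) \sum_(t <- s) \sum_(i in I) \sum_(j in J) psgn I i * psgn J
 j * (c k * rank1 (x k) i j * (t.1 * (Drec (I :\ i)%SET t.2 * (Drec (J :\ j)%SET
 t.2)^*))).
 ebig k; ebig t => /=.
 rewrite rmorph_sum mulr_suml mulr_sumr; ebig i.
 rewrite !mulr_sumr; ebig j.
 rewrite !rmorphM /= conj_psgn /rank1; ring.
rewrite (eq_bigr (fun k => \sum_(i in I) \sum_(j in J) psgn I i * psgn J j * (c k *
 rank1 (x k) i j * Mc (I :\ i) (J :\ j) Ws))); last first.
 move=> k _; rewrite exchange_big; ebig i.
 rewrite exchange_big; ebig j.
 by rewrite H /wsum !mulr_sumr.
rewrite [RHS]exchange_big; ebig i.
rewrite [RHS]exchange_big; ebig j.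
by rewrite mulr_suml mulr_sumr.
Qed.

Definition cone (W : mat) := exists (c : 'I_n -> C) (x : 'I_n -> vec),
 (forall k, 0 <= c k) /\ W = fun i j => \sum_k c k * rank1 (x k) i j.

(** Expanding every factor into rank one matrices turns the diagonal coefficients into nonnegative
    combinations of squared moduli of determinants. *)
Lemma Mc_cone_ge0 I Ws : (forall W, List.In W Ws -> cone W) -> 0 <= Mc I I Ws.
Proof.
move=> H; have [s [s0 sE]] : exists s : seq (C * seq vec), (forall t, t \in [seq c.1 | c
 <- s] -> 0 <= t) /\ forall I J, Mc I J Ws = wsum s I J.
 elim: Ws H => [|W Ws IH] H.
  exists [:: (1, [::])]; split=> [t|K J]; first by rewrite inE => /eqP ->; exact: ler01.
  by rewrite /wsum big_seq1 rmorph1 !mulr1.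
 have [|s [s0 sE]] := IH; first by move=> A AW; apply: H; right.
 have [c [x [c0 ->]]] := H W (or_introl erefl).
 exists [seq (c k * t.1, x k :: t.2) | k <- enum 'I_n, t <- s]; split=> [t|K J].
  rewrite map_allpairs => /allpairsP[[k u] [_ us ->]].
  by rewrite mulr_ge0 // s0 //; apply/mapP; exists u.
 exact: Mc_wsum_cons.
rewrite sE /wsum big_seq; apply: sumr_ge0 => t ts.
by rewrite mulr_ge0 ?mul_conjC_ge0 // s0 //; apply/mapP; exists t.
Qed.

Lemma Mc_id I : Mc I I (nseq #|I| (fun i j => (i == j)%:R)) = (#|I|)`!%:R.
Proof.
move: {2}#|I| (erefl #|I|) => k; elim: k I => [|k IH] I cI; rewrite cI //=.
rewrite (eq_bigr (fun _ => k`!%:R)); last first.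
 move=> i iI; rewrite (bigD1 i) //= big1 ?addr0; last first.
  by move=> j /andP[_ ji]; rewrite eq_sym (negbTE ji) mul0r mulr0.
 rewrite eqxx mul1r -expr2 /psgn -exprM mulnC exprM sqrrN expr1n expr1n mul1r.
 have cIi : #|(I :\ i)%SET| = k by move: cI; rewrite (cardsD1 i) iI => -[].
 by rewrite -cIi IH cIi.
by rewrite sumr_const cI -mulrnA factS mulnC.
Qed.

Fixpoint words k : seq (seq 'I_n) :=
 if k is k'.+1 then [seq a :: g | a <- enum 'I_n, g <- words k'] else [:: [::]].

Lemma size_words k g : g \in words k -> size g = k.
Proof.
elim: k g => [|k IH] g; first by rewrite inE => /eqP ->.
by move=> /allpairsP[[a h] [_ /IH <- ->]].
Qed.

Lemma Mc_diag (lam : 'I_n -> C) (x : 'I_n -> vec) k I J :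
 Mc I J (nseq k (fun i j => \sum_a lam a * rank1 (x a) i j)) =
 \sum_(g <- words k) (\prod_(a <- g) lam a) * (Drec I (map x g) * (Drec J (map x g))^*).
Proof.
have -> : \sum_(g <- words k) (\prod_(a <- g) lam a) * (Drec I (map x g) * (Drec J (map
 x g))^*) = wsum [seq (\prod_(a <- g) lam a, map x g) | g <- words k] I J.
 by rewrite /wsum big_map.
elim: k I J => [|k IH] I J.
 by rewrite /wsum big_seq1 big_nil rmorph1 !mulr1.
rewrite -[nseq k.+1 _]/(_ :: nseq k _) (Mc_wsum_cons lam x I J IH).
rewrite /wsum map_allpairs allpairs_mapr.
congr bigop; rewrite /allpairs_dep; congr flatten; apply: eq_map => a; apply: eq_map =>
 g.
by rewrite big_cons.
Qed.

(** In the expansion over words of eigenvectors only words without repetition survive, and each of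
    them uses every eigenvalue exactly once. The product of the eigenvalues factors out, and what
    remains is the value for the identity matrix, computed in [Mc_id]. *)
Lemma Mc_diag_full (lam : 'I_n -> C) (x : 'I_n -> vec) :
 (forall i j, \sum_a rank1 (x a) i j = (i == j)%:R) ->
 Mc finset.setT finset.setT (nseq n (fun i j => \sum_a lam a * rank1 (x a) i j)) =
 n`!%:R * \prod_a lam a.
Proof.
move=> xu; have := Mc_id finset.setT; rewrite cardsT card_ord.
have -> : (fun i j : 'I_n => (i == j)%:R : C) = fun i j => \sum_a 1 * rank1 (x a) i j.
 ext i; ext j; rewrite -xu.
 by ebig a; rewrite mul1r.
rewrite !Mc_diag => <-; rewrite mulr_suml; apply: eq_big_seq => g /size_words sg.
have [ug|nug] := boolP (uniq g); last by rewrite Drec_nuniq // !mul0r !mulr0 mul0r.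
rewrite [X in _ = X * _ * _]big1 // mul1r mulrC; congr (_ * _).
rewrite -[RHS]big_enum; apply: perm_big.
apply: uniq_perm => //; first exact: enum_uniq.
have gsub : {subset g <= enum 'I_n} by move=> a _; rewrite mem_enum.
by have [] := uniq_min_size ug gsub; rewrite ?sg ?size_enum_ord.
Qed.

End mixed_discriminants.

(** * The Levi form, the complex Hessian matrix and its determinant *)

Section levi_forms.
Context {R : realType} {n : nat}.
Local Notation E := 'rV[R]_(n + n).
Local Notation C := R[i].
Implicit Types (H : 'I_(n + n) -> 'I_(n + n) -> R) (v : E).

Definition zc v (i : 'I_n) : C := Complex (v ord0 (lshift n i)) (v ord0 (rshift n i)).

(** Multiplication by the imaginary unit. *)
Definition Jc v : E := row_mx (- rsubmx v) (lsubmx v).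

Definition qf H v : R := \sum_a \sum_b v ord0 a * v ord0 b * H a b.

(** The matrix of the derivatives along z_i and conj z_j, computed from the real Hessian [H] in the
    convention of [ddbar_re] and [ddbar_im]. *)
Definition cmat H (i j : 'I_n) : C :=
 Complex ((H (lshift n i) (lshift n j) + H (rshift n i) (rshift n j)) / 4)
     ((H (lshift n i) (rshift n j) - H (rshift n i) (lshift n j)) / 4).

End levi_forms.

(** For symmetric [H] this is the Hermitian form of [cmat H] at the complex vector [zc v], by
    [leviE]. *)
HB.lock Definition levi (R : realType) (n : nat) (H : 'I_(n + n) -> 'I_(n + n) -> R) (v
 : 'rV[R]_(n + n)) : R := (qf H v + qf H (Jc v)) / 4.

(* The determinant of the complex Hessian, as a normalized mixed discriminant. *)
HB.lock Definition MAd (R : realType) (n : nat) (H : 'I_(n + n) -> 'I_(n + n) -> R) : R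
 := complex.Re (Mc finset.setT finset.setT (nseq n (cmat H))) / n`!%:R.

Section levi_forms.
Context {R : realType} {n : nat}.
Local Notation E := 'rV[R]_(n + n).
Local Notation C := R[i].
Implicit Types (H : 'I_(n + n) -> 'I_(n + n) -> R) (v : E) (xi : 'I_n -> E).

Definition symH H := forall a b, H a b = H b a.

Lemma cmat_conj H i j : symH H -> (cmat H j i)^*%C = cmat H i j.
Proof.
move=> sH; rewrite /cmat /=; rewrite (sH (lshift n j) (lshift n i)) (sH (rshift n j)
 (rshift n i)).
by rewrite (sH (lshift n j) (rshift n i)) (sH (rshift n j) (lshift n i)) -mulNr opprB.
Qed.

Lemma sum_antisym (F : 'I_n -> 'I_n -> R) : (forall i j, F i j = - F j i) ->
 \sum_i \sum_j F i j = 0.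
Proof.
move=> Fa; have : \sum_i \sum_j F i j = - \sum_i \sum_j F i j.
 rewrite {1}exchange_big -sumrN; ebig i; rewrite -sumrN.
 by ebig j.
lra.
Qed.

Lemma Re_sum (I : finType) (F : I -> C) : complex.Re (\sum_i F i) = \sum_i complex.Re (F i).
Proof. exact: (raddf_sum (@complex.Re R : Rcomplex R -> R)). Qed.

Lemma Im_sum (I : finType) (F : I -> C) : complex.Im (\sum_i F i) = \sum_i complex.Im (F i).
Proof. exact: (raddf_sum (@complex.Im R : Rcomplex R -> R)). Qed.

Lemma leviE H v : symH H ->
 \sum_i \sum_j cmat H i j * (zc v i * (zc v j)^*%C) = (levi H v)%:C%C.
Proof.
move=> sH; apply/eqP; rewrite eq_complex; apply/andP; split; apply/eqP; last first.
 rewrite Im_sum; under eq_bigr do rewrite Im_sum.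
 apply: sum_antisym => i j /=.
 rewrite (sH (lshift n j) (lshift n i)) (sH (rshift n j) (rshift n i)).
 rewrite (sH (lshift n j) (rshift n i)) (sH (rshift n j) (lshift n i)); ring.
rewrite Re_sum; under eq_bigr do rewrite Re_sum.
rewrite levi.unlock /qf !big_split_ord /= -!big_split mulr_suml; ebig i.
rewrite !big_split_ord /= -!big_split mulr_suml; ebig j => /=.
rewrite /Jc !row_mxEl !row_mxEr !mxE; by field.
Qed.

Definition uframe xi :=
 forall k l, \sum_i zc (xi k) i * (zc (xi l) i)^*%C = (k == l)%:R.

Lemma uframe_dual xi : uframe xi ->
 forall i j, \sum_k zc (xi k) i * (zc (xi k) j)^*%C = (i == j)%:R.
Proof.
move=> ux i j.
pose P : 'M[C]_n := \matrix_(k, i) zc (xi k) i.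
pose Q : 'M[C]_n := \matrix_(i, k) (zc (xi k) i)^*%C.
have PQ : P *m Q = 1%:M.
 apply/matrixP => k l; rewrite !mxE -ux; ebig a; rewrite !mxE //.
have /matrixP/(_ j i) := mulmx1C PQ; rewrite !mxE => H.
rewrite eq_sym -[RHS]/((j == i)%:R : C) -H; ebig k; rewrite !mxE mulrC //.
Qed.

Lemma levi_trace H xi : symH H -> uframe xi ->
 \sum_l levi H (xi l) = (\sum_a H a a) / 4.
Proof.
move=> sH ux; apply: (@complexI R); rewrite rmorph_sum /=.
under eq_bigr do rewrite -leviE //.
rewrite exchange_big; under eq_bigr do rewrite exchange_big.
rewrite (eq_bigr (fun i => cmat H i i)); last first.
 move=> i _; rewrite (bigD1 i) //= [X in _ + X]big1 ?addr0.
  by rewrite -mulr_sumr uframe_dual // eqxx mulr1.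
 by move=> j ji; rewrite -mulr_sumr uframe_dual // eq_sym (negbTE ji) mulr0.
apply/eqP; rewrite eq_complex Re_sum Im_sum; apply/andP; split; apply/eqP.
 by rewrite big_split_ord mulrDl !mulr_suml -big_split /=; ebig i; rewrite -mulrDl.
by rewrite big1 // => i _ /=; rewrite sH subrr mul0r.
Qed.

Definition vec_of (z : 'I_n -> C) : E :=
 row_mx (\row_i complex.Re (z i)) (\row_i complex.Im (z i)).

Lemma zc_vec_of z i : zc (vec_of z) i = z i.
Proof. by rewrite /zc /vec_of row_mxEl row_mxEr !mxE; case: (z i). Qed.

Lemma conjCE (z : C) : (z^*)%R = z^*%C. Proof. by []. Qed.

Lemma rank1E (z : 'I_n -> C) i j : rank1 (fun i => (z i)^*%C) i j = (z i)^*%C * z j.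
Proof. by rewrite /rank1; congr (_ * _); exact: conjcK. Qed.

Lemma conjCM (x y : C) : ((x * y)^*%C = x^*%C * y^*%C)%R. Proof. exact: (rmorphM (@conjc
 R)). Qed.

(** Unitary diagonalization of the Hermitian matrix [cmat H]; the rows of the diagonalizing matrix
    are read as real vectors. *)
Lemma spectral_frame H : symH H -> exists xi (lam : 'I_n -> R),
 [/\ uframe xi, cmat H = (fun i j => \sum_a (lam a)%:C%C * ((zc (xi a) i)^*%C * zc (xi a) j))
  & forall a, levi H (xi a) = lam a].
Proof.
move=> sH; pose A : 'M[C]_n := \matrix_(i, j) cmat H i j.
have Ah : A \is hermsymmx.
 apply/is_hermitianmxP; rewrite expr0 scale1r; apply/matrixP => i j.
 by rewrite !mxE /= conjCE cmat_conj.
have /orthomx_spectralP := hermitian_normalmx Ah.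
have := hermitian_spectral_diag_real Ah; have := spectral_unitarymx A.
set P := spectralmx A; set d := spectral_diag A => uP dr AE.
rewrite invmx_unitary // in AE.
pose xi k := vec_of (P k); pose lam a := complex.Re (d ord0 a).
have dE a : d ord0 a = (lam a)%:C%C.
 have /mxOverP/(_ ord0 a) := dr; rewrite /lam => /complex_realP[k ->]; by [].
have ux : uframe xi.
 move=> k l; have /unitarymxP/matrixP/(_ k l) := uP; rewrite !mxE => <-.
 by ebig i; rewrite !mxE !zc_vec_of.
have cE : cmat H = (fun i j => \sum_a (lam a)%:C%C * ((zc (xi a) i)^*%C * zc (xi a) j)).
 ext i; ext j.
 have /matrixP/(_ i j) := AE; rewrite !mxE => ->.
 ebig a; rewrite mul_mx_diag !mxE dE !zc_vec_of.
 rewrite conjCE; ring.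
exists xi, lam; split=> // a; apply: (@complexI R); rewrite -leviE // cE.
transitivity (\sum_b (lam b)%:C%C * ((\sum_i zc (xi a) i * (zc (xi b) i)^*%C) * (\sum_j
 zc (xi b) j * (zc (xi a) j)^*%C))).
 rewrite [RHS](eq_bigr (fun b => \sum_i \sum_j (lam b)%:C%C * (zc (xi a) i * (zc (xi b)
  i)^*%C * (zc (xi b) j * (zc (xi a) j)^*%C)))); last first.
  by move=> b _; rewrite mulr_suml mulr_sumr; ebig i; rewrite !mulr_sumr.
 rewrite [RHS]exchange_big; ebig i; rewrite [RHS]exchange_big; ebig j.
 rewrite mulr_suml; ebig b; ring.
rewrite (bigD1 a) //= !ux eqxx !mulr1 big1 ?addr0 // => b ba.
by rewrite !ux eq_sym (negbTE ba) mul0r mulr0.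
Qed.

Lemma rank1_frame xi (lam : 'I_n -> R) :
 (fun i j => \sum_a (lam a)%:C%C * ((zc (xi a) i)^*%C * zc (xi a) j)) =
 (fun i j => \sum_a (lam a)%:C%C * rank1 (fun i => (zc (xi a) i)^*%C) i j).
Proof.
by ext i; ext j; ebig a; rewrite rank1E.
Qed.

Lemma natC k : (k%:R : C) = (k%:R : R)%:C%C.
Proof. by rewrite rmorph_nat. Qed.

Lemma MAd_eigen H xi (lam : 'I_n -> R) : uframe xi ->
 cmat H = (fun i j => \sum_a (lam a)%:C%C * ((zc (xi a) i)^*%C * zc (xi a) j)) ->
 MAd H = \prod_a lam a /\
 Mc finset.setT finset.setT (nseq n (cmat H)) = (n`!%:R * \prod_a lam a)%:C%C.
Proof.
move=> ux cE.
have E1 : Mc finset.setT finset.setT (nseq n (cmat H)) = (n`!%:R * \prod_a lam a)%:C%C.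
 rewrite cE rank1_frame (Mc_diag_full (fun a => (lam a)%:C%C) (x := fun a i => (zc (xi
  a) i)^*%C)).
  by rewrite natC -rmorph_prod -rmorphM.
 move=> i j; transitivity (\sum_a zc (xi a) j * (zc (xi a) i)^*%C).
  by ebig a; rewrite rank1E mulrC.
 by rewrite uframe_dual // eq_sym.
by split=> //; rewrite MAd.unlock E1 mulrC mulKf // pnatr_eq0 -lt0n fact_gt0.
Qed.

Lemma Mc_MAd H : symH H ->
 Mc finset.setT finset.setT (nseq n (cmat H)) = (n`!%:R * MAd H)%:C%C.
Proof.
by move=> /spectral_frame[xi [lam [ux cE _]]]; have [-> ->] := MAd_eigen ux cE.
Qed.

Lemma cone_cmat H : symH H -> (forall v, 0 <= levi H v) -> cone (cmat H).
Proof.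
move=> sH pH; have [xi [lam [ux cE lE]]] := spectral_frame sH.
exists (fun a => (lam a)%:C%C), (fun a i => (zc (xi a) i)^*%C); split; last by rewrite
 cE rank1_frame.
move=> a.
by rewrite ler0c -lE.
Qed.

Lemma MAd_ge0 H : symH H -> (forall v, 0 <= levi H v) -> 0 <= MAd H.
Proof.
move=> sH pH; have [xi [lam [ux cE lE]]] := spectral_frame sH.
have [-> _] := MAd_eigen ux cE; apply: prodr_ge0 => a _; by rewrite -lE.
Qed.

(* Weighted arithmetic-geometric mean inequality: the weights
 |<xi_l, eta_a>|^2 of the Levi form in two unitary frames are doubly
 stochastic, and x >= g (1 + ln (x / g)). *)
Lemma levi_AGM H xi (d : 'I_n -> R) : (0 < n)%N -> symH H -> (forall v, 0 <= levi H v) ->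
 uframe xi -> (forall l, 0 < d l) ->
 n%:R ^+ n * ((\prod_l d l) * MAd H) <= (\sum_l d l * levi H (xi l)) ^+ n.
Proof.
move=> n0 sH pH ux d0; have [eta [lam [ue cE lE]]] := spectral_frame sH.
have [-> _] := MAd_eigen ue cE.
have l0 a : 0 <= lam a by rewrite -lE.
have S0 : 0 <= \sum_l d l * levi H (xi l).
 by apply: sumr_ge0 => l _; rewrite mulr_ge0 // ltW.
(* With a zero eigenvalue the left-hand side vanishes; otherwise logarithms of the eigenvalues can
   be taken. *)
have [/existsP[a /eqP la]|] := boolP [exists a, lam a == 0].
 by rewrite [\prod_a lam a](bigD1 a) //= la mul0r !mulr0 exprn_ge0.
rewrite negb_exists => /forallP nl.
have lp a : 0 < lam a by rewrite lt_neqAle eq_sym nl l0.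
have np : 0 < n%:R :> R by rewrite ltr0n.
pose w l a := \sum_i zc (xi l) i * (zc (eta a) i)^*%C.
pose p l a : R := complex.Re (w l a * (w l a)^*%C).
have pE l a : w l a * (w l a)^*%C = (p l a)%:C%C.
 by rewrite /p; case: (w l a) => x y; simpc; congr Complex; ring.
have p0 l a : 0 <= p l a.
 by rewrite /p; case: (w l a) => x y /=; rewrite mulrN opprK addr_ge0 // -expr2 sqr_ge0.
have wE l a : (p l a)%:C%C = \sum_i \sum_j zc (xi l) i * (zc (eta a) i)^*%C * (zc (eta
 a) j * (zc (xi l) j)^*%C).
 have wc : (w l a)^*%C = \sum_j zc (eta a) j * (zc (xi l) j)^*%C.
  rewrite /w (rmorph_sum (@conjc R)); ebig i.
  by apply: etrans (conjCM _ _) _; rewrite conjcK mulrC.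
 rewrite -pE wc /w mulr_suml; ebig i; rewrite mulr_sumr //.
have lv l : levi H (xi l) = \sum_a lam a * p l a.
 apply: (@complexI R); rewrite -leviE // cE rmorph_sum /=.
 rewrite [RHS](eq_bigr (fun a => \sum_i \sum_j (lam a)%:C%C * (zc (xi l) i * (zc (eta a)
  i)^*%C * (zc (eta a) j * (zc (xi l) j)^*%C)))); last first.
  move=> a _; rewrite rmorphM /= wE mulr_sumr.
  by ebig i; rewrite !mulr_sumr.
 rewrite [RHS]exchange_big /=; ebig i.
 rewrite [RHS]exchange_big /=; ebig j.
 rewrite mulr_suml; ebig a; ring.
have pr l : \sum_a p l a = 1.
 apply: (@complexI R); rewrite rmorph_sum rmorph1 /=.
 have := ux l l; rewrite eqxx mulr1n => <-.
 rewrite (eq_bigr (fun a => \sum_i \sum_j (zc (xi l) i * (zc (xi l) j)^*%C) * (zc (eta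
  a) j * (zc (eta a) i)^*%C))); last first.
  move=> a _; rewrite wE; ebig i; ebig j; ring.
 rewrite exchange_big /=; ebig i; rewrite exchange_big /=.
 rewrite (bigD1 i) //= -mulr_sumr uframe_dual // eqxx mulr1 [X in _ + X]big1 ?addr0 //
  => j ji.
 by rewrite -mulr_sumr uframe_dual // (negbTE ji) mulr0.
have pc a : \sum_l p l a = 1.
 apply: (@complexI R); rewrite rmorph_sum rmorph1 /=.
 have := ue a a; rewrite eqxx mulr1n => <-.
 rewrite (eq_bigr (fun l => \sum_i \sum_j (zc (eta a) j * (zc (eta a) i)^*%C) * (zc (xi
  l) i * (zc (xi l) j)^*%C))); last first.
  move=> l _; rewrite wE; ebig i; ebig j; ring.
 rewrite exchange_big /=; ebig i; rewrite exchange_big /=.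
 rewrite (bigD1 i) //= -mulr_sumr uframe_dual // eqxx mulr1 [X in _ + X]big1 ?addr0 //
  => j ji.
 by rewrite -mulr_sumr uframe_dual // eq_sym (negbTE ji) mulr0.
(* [g ^+ n] is the product of all the [d l] and all the [lam a], so the claim is the n-th power of
   [lower] below. *)
pose g := expR ((\sum_l ln (d l) + \sum_a ln (lam a)) / n%:R).
have gp : 0 < g by exact: expR_gt0.
have gn : g ^+ n = (\prod_l d l) * \prod_a lam a.
 rewrite /g -expRM_natl [_ * (_ / _)]mulrC divfK ?gt_eqF // expRD.
 rewrite !expR_sum; congr (_ * _); ebig l; rewrite lnK // posrE //.
have lower : n%:R * g <= \sum_l d l * levi H (xi l).
 rewrite -ler_pdivlMr // mulr_suml.
 apply: (@le_trans _ _ (\sum_l \sum_a p l a * (1 + (ln (d l) + ln (lam a) - ln g))));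
  last first.
  apply: ler_sum => l _; rewrite lv mulr_sumr mulr_suml; apply: ler_sum => a _.
  have -> : d l * (lam a * p l a) / g = p l a * (d l * lam a / g) by ring.
  rewrite ler_wpM2l // -lnM ?posrE // -ln_div ?posrE ?mulr_gt0 //.
  have := @le_ln1Dx R (d l * lam a / g - 1).
  rewrite [1 + (_ - 1)]addrC subrK => H1.
  rewrite addrC -lerBrDr; apply: H1.
  by rewrite ltrBrDl subrr divr_gt0 // mulr_gt0.
 have -> : \sum_l \sum_a p l a * (1 + (ln (d l) + ln (lam a) - ln g)) = \sum_l ((1 - ln
  g + ln (d l)) * 1) + \sum_a (ln (lam a) * 1).
  rewrite [X in _ = _ + X](eq_bigr (fun a => \sum_l ln (lam a) * p l a)); last first.
   by move=> a _; rewrite -mulr_sumr pc.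
  rewrite [X in _ = _ + X]exchange_big /= -big_split /=; ebig l.
  rewrite -[X in _ = _ * X + _](pr l) mulr_sumr -big_split /=; ebig a; ring.
 under eq_bigr do rewrite mulr1; under [X in _ <= _ + X]eq_bigr do rewrite mulr1.
 rewrite big_split /= sumr_const card_ord /g expRK -[X in _ <= X + _ + _]mulr_natl.
 by apply: le_of_eq; field; rewrite gt_eqF.
rewrite -gn -exprMn; apply: lerXn2r => //; rewrite ?nnegrE //.
by pos.
Qed.

End levi_forms.

Ltac gen_D := repeat match goal with |- context [D ?a ?f ?x] => generalize (D a f x) end; clear.

(** * Complex derivatives and integration by parts for mixed discriminants *)

Section complex_calculus.
Context {R : realType} {n : nat}.
Local Notation E := 'rV[R]_(n + n).
Local Notation C := R[i].
Implicit Types (F G : E -> C) (g phi : E -> R) (s : R) (I J : {set 'I_n}).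

#[local] Opaque smooth Int D.

Lemma ReD (x y : C) : complex.Re (x + y) = complex.Re x + complex.Re y. Proof. by case:
 x; case: y. Qed.
Lemma ImD (x y : C) : complex.Im (x + y) = complex.Im x + complex.Im y. Proof. by case:
 x; case: y. Qed.
Lemma ReM (x y : C) : complex.Re (x * y) = complex.Re x * complex.Re y - complex.Im x * complex.Im y.
Proof. by case: x; case: y. Qed.
Lemma ImM (x y : C) : complex.Im (x * y) = complex.Re x * complex.Im y + complex.Im x * complex.Re y.
Proof. by case: x => a b; case: y. Qed.
Lemma cplx_eq (x y : C) : complex.Re x = complex.Re y -> complex.Im x = complex.Im y -> x = y.
Proof. by case: x => a b; case: y => c d /= -> ->. Qed.

Definition cRe F x := complex.Re (F x).
Definition cIm F x := complex.Im (F x).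
Definition csm F := smooth (cRe F) /\ smooth (cIm F).
Definition ccs F := Ccs (cRe F) /\ Ccs (cIm F).

Lemma cReM F G : cRe (fun x => F x * G x) = fun x => cRe F x * cRe G x - cIm F x * cIm G x.
Proof. by ext x; rewrite /cRe ReM. Qed.
Lemma cImM F G : cIm (fun x => F x * G x) = fun x => cRe F x * cIm G x + cIm F x * cRe G x.
Proof. by ext x; rewrite /cIm ImM. Qed.
Lemma cReD F G : cRe (fun x => F x + G x) = fun x => cRe F x + cRe G x.
Proof. by ext x; rewrite /cRe ReD. Qed.
Lemma cImD F G : cIm (fun x => F x + G x) = fun x => cIm F x + cIm G x.
Proof. by ext x; rewrite /cIm ImD. Qed.
Lemma cRe_sum (T : finType) (P : pred T) (F : T -> E -> C) :
 cRe (fun x => \sum_(i | P i) F i x) = fun x => \sum_(i | P i) cRe (F i) x.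
Proof. by ext x; rewrite /cRe (raddf_sum (@complex.Re R : Rcomplex R -> R)). Qed.
Lemma cIm_sum (T : finType) (P : pred T) (F : T -> E -> C) :
 cIm (fun x => \sum_(i | P i) F i x) = fun x => \sum_(i | P i) cIm (F i) x.
Proof. by ext x; rewrite /cIm (raddf_sum (@complex.Im R : Rcomplex R -> R)). Qed.

Lemma cIm_real g : cIm (fun x => (g x)%:C%C) = fun=> 0. Proof. by []. Qed.
Lemma cRe_real g : cRe (fun x => (g x)%:C%C) = g. Proof. by []. Qed.

Lemma csm_cst (c : C) : csm (fun=> c). Proof. split; exact: smooth_cst. Qed.
Lemma csm_real g : smooth g -> csm (fun x => (g x)%:C%C).
Proof. by move=> sg; split; [exact: sg|exact: smooth_cst]. Qed.
Lemma csmM F G : csm F -> csm G -> csm (fun x => F x * G x).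
Proof.
move=> [? ?] [? ?]; split; rewrite ?cReM ?cImM.
 by apply: smooth_sub; exact: smooth_mul.
by apply: smooth_add; exact: smooth_mul.
Qed.
Lemma csm_sum (T : finType) (P : pred T) (F : T -> E -> C) :
 (forall i, csm (F i)) -> csm (fun x => \sum_(i | P i) F i x).
Proof. by move=> H; split; rewrite ?cRe_sum ?cIm_sum; apply: smooth_sum => i; case: (H
 i). Qed.

Lemma ccs_csm F : ccs F -> csm F. Proof. by move=> [[? _] [? _]]. Qed.
Lemma ccs_real g : Ccs g -> ccs (fun x => (g x)%:C%C).
Proof. by move=> sg; split; [exact: sg|split; [exact: smooth_cst|exists 0]]. Qed.
Lemma ccsM F G : csm F -> ccs G -> ccs (fun x => F x * G x).
Proof.
move=> [? ?] [? ?]; split; rewrite ?cReM ?cImM; apply: Ccs_add; rewrite -?[fun x => -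
 _]/(fun x => - (_ x)); try exact: Ccs_mul.
by apply: Ccs_opp; exact: Ccs_mul.
Qed.
Lemma ccsMr F G : ccs F -> csm G -> ccs (fun x => F x * G x).
Proof.
move=> F0 G0; have -> : (fun x => F x * G x) = fun x => G x * F x by ext x; rewrite
 mulrC.
exact: ccsM.
Qed.
Lemma ccsD F G : ccs F -> ccs G -> ccs (fun x => F x + G x).
Proof. by move=> [? ?] [? ?]; split; rewrite ?cReD ?cImD; exact: Ccs_add. Qed.
Lemma ccs_sum (T : finType) (P : pred T) (F : T -> E -> C) :
 (forall i, ccs (F i)) -> ccs (fun x => \sum_(i | P i) F i x).
Proof. by move=> H; split; rewrite ?cRe_sum ?cIm_sum; apply: Ccs_sum => i; case: (H i). Qed.

(* [dzs 1 i] and [dzs (-1) i] are the derivatives along z_i and conj z_i. *)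
Definition dzs s (i : 'I_n) F x : C :=
 Complex (2^-1 * (D (lshift n i) (cRe F) x + s * D (rshift n i) (cIm F) x))
     (2^-1 * (D (lshift n i) (cIm F) x - s * D (rshift n i) (cRe F) x)).

Lemma cRe_dzs s i F : cRe (dzs s i F) =
 fun x => 2^-1 * (D (lshift n i) (cRe F) x + s * D (rshift n i) (cIm F) x).
Proof. by []. Qed.
Lemma cIm_dzs s i F : cIm (dzs s i F) =
 fun x => 2^-1 * (D (lshift n i) (cIm F) x - s * D (rshift n i) (cRe F) x).
Proof. by []. Qed.

Lemma csm_dzs s i F : csm F -> csm (dzs s i F).
Proof.
move=> [P Q]; split; rewrite ?cIm_dzs; apply: smoothZ.
 by apply: smooth_add; [exact: smoothD|apply: smoothZ; exact: smoothD].
by apply: smooth_sub; [exact: smoothD|apply: smoothZ; exact: smoothD].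
Qed.
Lemma ccs_dzs s i F : ccs F -> ccs (dzs s i F).
Proof.
move=> [P Q]; split; rewrite ?cIm_dzs; apply: CcsZ; apply: Ccs_add.
- exact: CcsD.
- by apply: CcsZ; exact: CcsD.
- exact: CcsD.
- by apply: Ccs_opp; apply: CcsZ; exact: CcsD.
Qed.

Lemma dzs_cst s i (c : C) : dzs s i (fun=> c) = fun=> 0.
Proof.
ext x; apply: cplx_eq => /=; rewrite /cRe /cIm !D_cst; ring.
Qed.

Lemma dzs_mul s i F G x : csm F -> csm G ->
 dzs s i (fun x => F x * G x) x = dzs s i F x * G x + F x * dzs s i G x.
Proof.
move=> [sP sQ] [sP' sQ'].
have dP := smooth_pd sP; have dQ := smooth_pd sQ.
have dP' := smooth_pd sP'; have dQ' := smooth_pd sQ'.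
rewrite /dzs cReM cImM.
rewrite !D_sub; try exact: smooth_mul.
rewrite !D_add; try exact: pdiffM.
rewrite !D_mul //.
rewrite -[F x](cplx_eq (x := Complex (cRe F x) (cIm F x))) // -[G x](cplx_eq (x :=
 Complex (cRe G x) (cIm G x))) //.
move: (D _ (cRe F) x) (D _ (cIm F) x) (D _ (cRe G) x) (D _ (cIm G) x) (D _ (cRe F) x) (D
 _ (cIm F) x) (D _ (cRe G) x) (D _ (cIm G) x) (cRe F x) (cIm F x) (cRe G x) (cIm G x).
by move=> a1 a2 a3 a4 a5 a6 a7 a8 b1 b2 b3 b4; apply: cplx_eq => /=; ring.
Qed.

Lemma dzs_sum s i (T : finType) (P : pred T) (F : T -> E -> C) x :
 (forall k, csm (F k)) ->
 dzs s i (fun x => \sum_(k | P k) F k x) x = \sum_(k | P k) dzs s i (F k) x.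
Proof.
move=> H; have HP k : smooth (cRe (F k)) by case: (H k).
have HQ k : smooth (cIm (F k)) by case: (H k).
apply: cplx_eq.
 rewrite (raddf_sum (@complex.Re R : Rcomplex R -> R)) /= cRe_sum cIm_sum !D_sum //.
 by rewrite mulr_sumr -big_split mulr_sumr.
rewrite (raddf_sum (@complex.Im R : Rcomplex R -> R)) /= cRe_sum cIm_sum !D_sum //.
by rewrite mulr_sumr -sumrB mulr_sumr.
Qed.

Lemma dzs_scale s i (c : C) F x : csm F ->
 dzs s i (fun x => c * F x) x = c * dzs s i F x.
Proof.
move=> sF; rewrite dzs_mul; [|exact: csm_cst|exact: sF].
by rewrite dzs_cst mul0r add0r.
Qed.

Lemma D_lin a (b c : E -> R) (t : R) : smooth b -> smooth c ->
 D a (fun x => 2^-1 * (b x + t * c x)) = fun x => 2^-1 * (D a b x + t * D a c x).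
Proof.
move=> sb sc; have pb := smooth_pd sb; have pc := smooth_pd sc.
have pt := smooth_pd (smoothZ t sc).
rewrite DZ; last exact: pdiffD.
by rewrite D_add // DZ.
Qed.

Lemma D_cRe_dzs a t j F : csm F -> D a (cRe (dzs t j F)) =
 fun x => 2^-1 * (D a (D (lshift n j) (cRe F)) x + t * D a (D (rshift n j) (cIm F)) x).
Proof. by move=> [sP sQ]; rewrite cRe_dzs D_lin; [|exact: smoothD|exact: smoothD]. Qed.

Lemma D_cIm_dzs a t j F : csm F -> D a (cIm (dzs t j F)) =
 fun x => 2^-1 * (D a (D (lshift n j) (cIm F)) x - t * D a (D (rshift n j) (cRe F)) x).
Proof.
move=> [sP sQ]; rewrite cIm_dzs.
have -> : (fun x => 2^-1 * (D (lshift n j) (cIm F) x - t * D (rshift n j) (cRe F) x)) =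
 fun x => 2^-1 * (D (lshift n j) (cIm F) x + (- t) * D (rshift n j) (cRe F) x).
 by ext y; rewrite mulNr.
rewrite D_lin; [|exact: smoothD|exact: smoothD].
by ext y; rewrite mulNr.
Qed.

Lemma Re_dzs s i F x : complex.Re (dzs s i F x) =
 2^-1 * (D (lshift n i) (cRe F) x + s * D (rshift n i) (cIm F) x).
Proof. by []. Qed.
Lemma Im_dzs s i F x : complex.Im (dzs s i F x) =
 2^-1 * (D (lshift n i) (cIm F) x - s * D (rshift n i) (cRe F) x).
Proof. by []. Qed.

#[local] Opaque dzs cRe cIm.

Lemma dzs_comm s t i j F : csm F -> dzs s i (dzs t j F) = dzs t j (dzs s i F).
Proof.
move=> sF; have [sP sQ] := sF; ext x.
have P1 := D_comm (lshift n j) (lshift n i) sP; have P2 := D_comm (rshift n j) (rshift n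
 i) sP.
have P3 := D_comm (lshift n j) (rshift n i) sP; have P4 := D_comm (rshift n j) (lshift n
 i) sP.
have Q1 := D_comm (lshift n j) (lshift n i) sQ; have Q2 := D_comm (rshift n j) (rshift n
 i) sQ.
have Q3 := D_comm (lshift n j) (rshift n i) sQ; have Q4 := D_comm (rshift n j) (lshift n
 i) sQ.
have A a t' j' := congr1 (fun h => h x) (D_cRe_dzs a t' j' sF).
have B a t' j' := congr1 (fun h => h x) (D_cIm_dzs a t' j' sF).
apply: cplx_eq.
 apply: etrans (Re_dzs _ _ _ _) _; apply: etrans _ (esym (Re_dzs _ _ _ _)).
 rewrite (A (lshift n i) t j) (B (rshift n i) t j) (A (lshift n j) s i) (B (rshift n j)
  s i) P1 P2 Q3 Q4.
 by gen_D => *; ring.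
apply: etrans (Im_dzs _ _ _ _) _; apply: etrans _ (esym (Im_dzs _ _ _ _)).
rewrite (B (lshift n i) t j) (A (rshift n i) t j) (B (lshift n j) s i) (A (rshift n j) s
 i) Q1 Q2 P3 P4.
by gen_D => *; ring.
Qed.

Definition IntC F : C := Complex (Int (cRe F)) (Int (cIm F)).

Lemma IntC_dzs s i F : ccs F -> IntC (dzs s i F) = 0.
Proof.
move=> [cP cQ]; have CP a := Ccs_Cc0 (CcsD a cP); have CQ a := Ccs_Cc0 (CcsD a cQ).
have ZP a : Int (D a (cRe F)) = 0 by apply: Int_D; [exact: Ccs_Cc0|apply: smooth_C1;
 case: cP].
have ZQ a : Int (D a (cIm F)) = 0 by apply: Int_D; [exact: Ccs_Cc0|apply: smooth_C1;
 case: cQ].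
apply: cplx_eq => /=; rewrite IntZ.
- by rewrite IntD ?IntZ ?ZP ?ZQ //; [ring|exact: Cc0Z].
- by apply: Cc0D => //; exact: Cc0Z.
- by rewrite IntB ?IntZ ?ZP ?ZQ //; [ring|exact: Cc0Z].
- by apply: Cc0B => //; exact: Cc0Z.
Qed.

Lemma IntC_add F G : ccs F -> ccs G -> IntC (fun x => F x + G x) = IntC F + IntC G.
Proof.
move=> [? ?] [? ?]; apply: cplx_eq; rewrite /=.
 by rewrite cReD IntD //; exact: Ccs_Cc0.
by rewrite cImD IntD //; exact: Ccs_Cc0.
Qed.

Lemma IntC_scale (c : C) F : ccs F -> IntC (fun x => c * F x) = c * IntC F.
Proof.
move=> [cP cQ]; have P0 := Ccs_Cc0 cP; have Q0 := Ccs_Cc0 cQ.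
apply: cplx_eq; rewrite ?ReM ?ImM /=.
 by rewrite cReM IntB ?IntZ //; exact: Cc0Z.
by rewrite cImM IntD ?IntZ //; exact: Cc0Z.
Qed.

Lemma IntC_sum (T : finType) (P : pred T) (F : T -> E -> C) : (forall i, ccs (F i)) ->
 IntC (fun x => \sum_(i | P i) F i x) = \sum_(i | P i) IntC (F i).
Proof.
move=> H; apply: cplx_eq.
 rewrite (raddf_sum (@complex.Re R : Rcomplex R -> R)) /= cRe_sum Int_sum // => i.
 by apply: Ccs_Cc0; case: (H i).
rewrite (raddf_sum (@complex.Im R : Rcomplex R -> R)) /= cIm_sum Int_sum // => i.
by apply: Ccs_Cc0; case: (H i).
Qed.

#[local] Transparent cRe cIm.
Lemma IntC0 : IntC (fun=> 0) = 0.
Proof. by apply: cplx_eq; rewrite /cRe /cIm /= Int0. Qed.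

Lemma nC_IntC_le F a b : `|Int (cRe F)| <= a -> `|Int (cIm F)| <= b ->
 `|complex.Re (IntC F)| + `|complex.Im (IntC F)| <= a + b.
Proof. by move=> *; exact: lerD. Qed.

#[local] Opaque csm ccs Ccs IntC psgn cRe cIm.

Definition fmat := 'I_n -> 'I_n -> E -> C.

Definition mcf I J (Ws : seq fmat) x : C := Mc I J [seq (fun i j => W i j x) | W : fmat <- Ws].

Lemma mcfE I J W Ws : mcf I J (W :: Ws) =
 fun x => \sum_(i in I) \sum_(j in J) psgn I i * psgn J j *
   (W i j x * mcf (I :\ i) (J :\ j) Ws x).
Proof. by []. Qed.

Lemma mcf_nil I J : mcf I J [::] = fun=> 1.
Proof. by []. Qed.

Definition msm (Ws : seq fmat) := forall W, List.In W Ws -> forall i j, csm (W i j).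

Lemma csm_mcf Ws I J : msm Ws -> csm (mcf I J Ws).
Proof.
elim: Ws I J => [|W Ws IH] I J H; first exact: csm_cst.
rewrite mcfE; apply: csm_sum => i; apply: csm_sum => j; apply: csmM; first exact:
 csm_cst.
apply: csmM; first by apply: H; left.
by apply: IH => W' W'i; apply: H; right.
Qed.

Lemma mcf_tr I J Ws : mcf I J Ws = mcf J I [seq (fun i j => W j i) | W : fmat <- Ws].
Proof.
ext x; elim: Ws I J => [|W Ws IH] I J //.
rewrite map_cons !mcfE exchange_big; ebig j; ebig i.
by rewrite IH [psgn I i * _]mulrC.
Qed.

#[local] Opaque mcf Mc.

(** Each factor is a closed form in the variables z_i (for [s = 1]) or conj z_i (for [s = -1]), the
    row index carrying the differential. *)
Definition rowc s (Ws : seq fmat) := forall W, List.In W Ws ->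
 (forall i j, csm (W i j)) /\ forall i i' j x, dzs s i (W i' j) x = dzs s i' (W i j) x.

Lemma rowc_msm s Ws : rowc s Ws -> msm Ws.
Proof. by move=> H W /H[]. Qed.

(** A product of closed forms is closed: the terms that differentiate the first factor cancel in
    pairs, by the symmetry in [rowc] and the antisymmetry of the signs, and the others vanish by
    induction. *)
Lemma mcf_closed s Ws I J x : rowc s Ws ->
 \sum_(i in I) psgn I i * dzs s i (mcf (I :\ i)%SET J Ws) x = 0.
Proof.
elim: Ws I J => [|W Ws IH] I J H.
 by rewrite big1 // => i _; rewrite mcf_nil dzs_cst mulr0.
have [W1 W2] : (forall i j, csm (W i j)) /\ forall i i' j x, dzs s i (W i' j) x = dzs s
 i' (W i j) x.
 by apply: H; left.
have Hs : rowc s Ws by move=> W' W'i; apply: H; right.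
have Hm I' J' : csm (mcf I' J' Ws) by apply: csm_mcf; exact: rowc_msm Hs.
pose F i i' := \sum_(j in J) psgn J j * (dzs s i (W i' j) x * mcf (I :\ i :\ i')%SET (J
 :\ j)%SET Ws x).
pose G i i' := \sum_(j in J) psgn J j * (W i' j x * dzs s i (mcf (I :\ i :\ i')%SET (J
 :\ j)%SET Ws) x).
have EQ : \sum_(i in I) psgn I i * dzs s i (mcf (I :\ i)%SET J (W :: Ws)) x = (\sum_(i
 in I) \sum_(i' in (I :\ i)%SET) psgn I i * psgn (I :\ i) i' * F i i') + (\sum_(i in I)
 \sum_(i' in (I :\ i)%SET) psgn I i * psgn (I :\ i) i' * G i i').
 rewrite -big_split /=; apply: eq_bigr => i iI.
 rewrite -big_split mcfE dzs_sum; last first.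
  by move=> k; apply: csm_sum => j; do 2?[apply: csmM => //]; exact: csm_cst.
 rewrite mulr_sumr; ebig i'.
 rewrite dzs_sum; last by move=> k; do 2?[apply: csmM => //]; exact: csm_cst.
 rewrite /F /G !mulr_sumr -big_split /=; ebig j.
 rewrite dzs_scale; last exact: csmM.
 rewrite dzs_mul //; ring.
rewrite EQ; have -> : \sum_(i in I) \sum_(i' in (I :\ i)%SET) psgn I i * psgn (I :\ i)
 i' * F i i' = 0.
 have : \sum_(i in I) \sum_(i' in (I :\ i)%SET) psgn I i * psgn (I :\ i) i' * F i i' = -
  \sum_(i in I) \sum_(i' in (I :\ i)%SET) psgn I i * psgn (I :\ i) i' * F i i'.
  rewrite {1}sum_swap; congr (- _); ebig i; ebig i'.
  by congr (_ * _); ebig j; rewrite W2 setD1C.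
 by move=> /eqP; rewrite -addr_eq0 -mulr2n mulrn_eq0 => /eqP.
rewrite add0r sum_swap big1 ?oppr0 // => i _.
rewrite /G (eq_bigr (fun i' => \sum_(j in J) (psgn I i * psgn J j * W i j x) * (psgn (I
 :\ i) i' * dzs s i' (mcf (I :\ i :\ i')%SET (J :\ j)%SET Ws) x))).
 rewrite exchange_big big1 // => j _.
 by rewrite -mulr_sumr IH // mulr0.
move=> i' _; rewrite mulr_sumr; ebig j; rewrite setD1C; ring.
Qed.

(** Stokes' formula against a closed form: the derivatives of the coefficients [mcf] sum to zero by
    [mcf_closed], so only [Phi] and [G] get differentiated. *)
Lemma IntC_parts s Ws I J Phi G : rowc s Ws -> ccs Phi -> csm G ->
 \sum_(i in I) psgn I i * IntC (fun x => Phi x * dzs s i G x * mcf (I :\ i)%SET J Ws x) =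
 - \sum_(i in I) psgn I i * IntC (fun x => dzs s i Phi x * G x * mcf (I :\ i)%SET J Ws x).
Proof.
move=> rW cP sG; pose M i := mcf (I :\ i)%SET J Ws.
have sM i : csm (M i) by apply: csm_mcf; exact: rowc_msm rW.
have sP := ccs_csm cP.
have cPG : ccs (fun x => Phi x * G x) by exact: ccsMr.
apply/eqP; rewrite -addr_eq0 -big_split /=.
have Z : \sum_(i in I) psgn I i * IntC (fun x => Phi x * G x * dzs s i (M i) x) = 0.
 have cPM i : ccs (fun x => Phi x * G x * dzs s i (M i) x).
  by apply: ccsMr; [exact: cPG|apply: csm_dzs; exact: sM].
 have cPM' i : ccs (fun x => psgn I i * (Phi x * G x * dzs s i (M i) x)).
  by apply: ccsM; [exact: csm_cst|exact: cPM].
 transitivity (\sum_(i in I) IntC (fun x => psgn I i * (Phi x * G x * dzs s i (M i)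
  x))).
  by ebig i; rewrite (IntC_scale _ (cPM i)).
 rewrite -(IntC_sum _ cPM').
 have -> : (fun x => \sum_(i in I) psgn I i * (Phi x * G x * dzs s i (M i) x)) = fun=>
  0.
  ext x; transitivity ((Phi x * G x) * \sum_(i in I) psgn I i * dzs s i (M i) x).
   by rewrite mulr_sumr; ebig i; rewrite mulrCA.
  by rewrite mcf_closed // mulr0.
 exact: IntC0.
apply/eqP; transitivity (- \sum_(i in I) psgn I i * IntC (fun x => Phi x * G x * dzs s i
 (M i) x)).
2: by rewrite Z oppr0.
rewrite -sumrN; ebig i.
have c1 : ccs (fun x => Phi x * dzs s i G x * M i x).
 by apply: ccsMr; [apply: ccsMr; [exact: cP|exact: csm_dzs]|exact: sM].
have c2 : ccs (fun x => dzs s i Phi x * G x * M i x).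
 by apply: ccsMr; [apply: ccsMr; [exact: ccs_dzs|exact: sG]|exact: sM].
have c3 : ccs (fun x => Phi x * G x * dzs s i (M i) x).
 by apply: ccsMr; [exact: cPG|apply: csm_dzs; exact: sM].
have c4 : ccs (fun x => Phi x * G x * M i x) by apply: ccsMr; [exact: cPG|exact: sM].
have EQ := IntC_dzs s i c4.
have EF : dzs s i (fun x => Phi x * G x * M i x) = fun x => (Phi x * dzs s i G x * M i x
 + dzs s i Phi x * G x * M i x) + Phi x * G x * dzs s i (M i) x.
 ext x; rewrite (dzs_mul s i x (ccs_csm cPG) (sM i)) (dzs_mul s i x sP sG).
 by congr (_ + _); rewrite mulrDl addrC.
rewrite EF (IntC_add (ccsD c1 c2) c3) (IntC_add c1 c2) in EQ.
by rewrite -mulrDr -mulrN; congr (_ * _); apply/eqP; rewrite -addr_eq0; apply/eqP.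
Qed.

Definition cHess g (i j : 'I_n) : E -> C := dzs 1 i (dzs (-1) j (fun x => (g x)%:C%C)).

Definition Hs g x (a b : 'I_(n + n)) : R := D a (D b g) x.

Lemma cHessE g i j x : smooth g -> cHess g i j x = cmat (Hs g x) i j.
Proof.
move=> sg; have sC := csm_real sg; rewrite /cHess.
have r0 := cIm_real g; have r1 := cRe_real g.
have Z a b : D a (D b (fun=> 0 : R)) x = 0 by rewrite !D_cst.
have A a t' j' := congr1 (fun h => h x) (D_cRe_dzs a t' j' sC).
have B a t' j' := congr1 (fun h => h x) (D_cIm_dzs a t' j' sC).
apply: cplx_eq.
 apply: etrans (Re_dzs _ _ _ _) _.
 rewrite (A (lshift n i) (-1) j) (B (rshift n i) (-1) j) r0 r1 !Z /cmat /Hs [RHS]/=.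
 by gen_D => *; field.
apply: etrans (Im_dzs _ _ _ _) _.
rewrite (B (lshift n i) (-1) j) (A (rshift n i) (-1) j) r0 r1 !Z /cmat /Hs [RHS]/=.
by gen_D => *; field.
Qed.

Lemma csm_cHess g i j : smooth g -> csm (cHess g i j).
Proof. by move=> sg; do 2!apply: csm_dzs; exact: csm_real. Qed.

Lemma rowc_cHess (gs : seq (E -> R)) : (forall g, List.In g gs -> smooth g) ->
 rowc 1 (map cHess gs).
Proof.
move=> H W /List.in_map_iff[g [<- /H sg]]; split=> [i j|i i' j x]; first exact:
 csm_cHess.
by rewrite /cHess (dzs_comm 1 1 i i' (csm_dzs (-1) j (csm_real sg))).
Qed.

Lemma rowc_cHess_tr (gs : seq (E -> R)) : (forall g, List.In g gs -> smooth g) ->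
 rowc (-1) [seq (fun i j => W j i) | W : fmat <- map cHess gs].
Proof.
move=> H W /List.in_map_iff[W' [<- /List.in_map_iff[g [<- /H sg]]]]; split=> [i j|i i' j
 x].
 exact: csm_cHess.
have sC := csm_real sg.
rewrite /cHess (dzs_comm (-1) 1 i j (csm_dzs (-1) i' sC)) (dzs_comm (-1) 1 i' j (csm_dzs
 (-1) i sC)).
by rewrite (dzs_comm (-1) (-1) i i' sC).
Qed.

(** The derivative along z_i moves from [g] to [phi], the product of the other complex Hessians
    being closed. *)
Lemma IntC_hess1 I J phi g (gs : seq (E -> R)) :
 Ccs phi -> smooth g -> (forall g, List.In g gs -> smooth g) ->
 IntC (fun x => (phi x)%:C%C * mcf I J (cHess g :: map cHess gs) x) =
 - \sum_(i in I) \sum_(j in J) psgn I i * (psgn J j *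
  IntC (fun x => dzs 1 i (fun x => (phi x)%:C%C) x * dzs (-1) j (fun x => (g x)%:C%C) x *
          mcf (I :\ i) (J :\ j) (map cHess gs) x)).
Proof.
move=> cphi sg sgs; have cP := ccs_real cphi; have sG := csm_real sg.
have rW := rowc_cHess sgs.
have sM I' J' : csm (mcf I' J' (map cHess gs)) by apply: csm_mcf; exact: rowc_msm rW.
have sH i j := csm_cHess i j sg.
have cc i j : ccs (fun x => (phi x)%:C%C * cHess g i j x * mcf (I :\ i) (J :\ j) (map
 cHess gs) x).
 by apply: ccsMr; [apply: ccsMr; [exact: cP|exact: sH]|exact: sM].
have cc' i j : ccs (fun x => (psgn J j * psgn I i) * ((phi x)%:C%C * cHess g i j x * mcf
 (I :\ i) (J :\ j) (map cHess gs) x)).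
 by apply: ccsM; [exact: csm_cst|exact: cc].
have E1 : (fun x => (phi x)%:C%C * mcf I J (cHess g :: map cHess gs) x) = fun x =>
 \sum_(j in J) \sum_(i in I) (psgn J j * psgn I i) * ((phi x)%:C%C * cHess g i j x * mcf
 (I :\ i) (J :\ j) (map cHess gs) x).
 ext x; rewrite mcfE exchange_big mulr_sumr; ebig j.
 rewrite mulr_sumr; ebig i.
 move: (psgn J j) (psgn I i) ((phi x)%:C%C) (cHess g i j x) (mcf _ _ _ _); clear.
 by move=> p q r c m; rewrite mulrCA [q * p]mulrC !mulrA.
rewrite E1 (IntC_sum _ (fun j => ccs_sum _ (fun i => cc' i j))) exchange_big -sumrN.
transitivity (\sum_(j in J) psgn J j * \sum_(i in I) psgn I i * IntC (fun x => (phi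
 x)%:C%C * dzs 1 i (dzs (-1) j (fun x => (g x)%:C%C)) x * mcf (I :\ i) (J :\ j) (map
 cHess gs) x)).
 ebig j; rewrite (IntC_sum _ (fun i => cc' i j)) mulr_sumr.
 by ebig i; rewrite (IntC_scale _ (cc i j)) mulrA.
transitivity (\sum_(j in J) - \sum_(i in I) psgn I i * (psgn J j * IntC (fun x => dzs 1
 i (fun x => (phi x)%:C%C) x * dzs (-1) j (fun x => (g x)%:C%C) x * mcf (I :\ i) (J :\
 j) (map cHess gs) x))).
 ebig j.
 have -> := IntC_parts I (J :\ j)%SET rW cP (csm_dzs (-1) j sG).
 by rewrite mulrN mulr_sumr; congr (- _); ebig i; rewrite mulrCA.
by [].
Qed.

(** A second integration by parts, in the conjugate variables and on transposed matrices, removes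
    the last derivative from [g]. The result is the smooth counterpart of the recursion that defines
    [MA_currents]. *)
Lemma IntC_hess2 I J phi g (gs : seq (E -> R)) :
 Ccs phi -> smooth g -> (forall g, List.In g gs -> smooth g) ->
 IntC (fun x => (phi x)%:C%C * mcf I J (cHess g :: map cHess gs) x) =
 \sum_(i in I) \sum_(j in J) psgn I i * (psgn J j *
  IntC (fun x => (g x)%:C%C * cHess phi i j x *
          mcf (I :\ i) (J :\ j) (map cHess gs) x)).
Proof.
move=> cphi sg sgs; rewrite (IntC_hess1 _ _ cphi sg sgs) -sumrN; ebig i.
have cP := ccs_real cphi; have sG := csm_real sg.
(* Now the derivative of [phi] along z_i plays the role of the test function, and [g] that of the
   differentiated factor. *)
have := IntC_parts J (I :\ i)%SET (rowc_cHess_tr sgs) (ccs_dzs 1 i cP) sG.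
set K := (X in X = _ -> _); set L := (X in _ = - X -> _) => KL.
transitivity (- (psgn I i * K)).
 rewrite /K mulr_sumr; congr (- _); ebig j.
 by rewrite (mcf_tr (I :\ i)%SET).
rewrite KL mulrN opprK /L mulr_sumr; ebig j.
rewrite -mcf_tr; congr (_ * (_ * IntC _)); ext x.
by rewrite (dzs_comm (-1) 1 j i (ccs_csm cP)) [_ * (g x)%:C%C]mulrC.
Qed.

#[local] Transparent IntC Mc psgn cRe cIm.

(* A submultiplicative norm on C that only involves real numbers. *)
Definition nC (z : C) : R := `|complex.Re z| + `|complex.Im z|.

Lemma nC_ge0 z : 0 <= nC z. Proof. by pos. Qed.
Lemma nC0 : nC 0 = 0. Proof. by rewrite /nC normr0 addr0. Qed.
Lemma nCD x y : nC (x + y) <= nC x + nC y.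
Proof.
rewrite /nC ReD ImD; have := ler_normD (complex.Re x) (complex.Re y).
have := ler_normD (complex.Im x) (complex.Im y); lra.
Qed.
Lemma nCN x : nC (- x) = nC x. Proof. by case: x => a b; rewrite /nC !normrN. Qed.
Lemma nCM x y : nC (x * y) <= nC x * nC y.
Proof.
case: x => a b; case: y => c d; rewrite /nC.
have h1 := ler_normB (a * c) (b * d); have h2 := ler_normD (a * d) (b * c).
rewrite !normrM in h1 h2; nra.
Qed.
Lemma nC_sum (T : finType) (P : pred T) (F : T -> C) :
 nC (\sum_(i | P i) F i) <= \sum_(i | P i) nC (F i).
Proof.
elim/big_rec2: _ => [|i x y _ H]; first by rewrite nC0.
by apply: le_trans (nCD _ _) _; rewrite lerD2l.
Qed.
Lemma nC_psgn I i z : nC (psgn I i * z) = nC z.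
Proof. by rewrite /psgn -signr_odd; case: (odd _); rewrite ?mul1r // mulN1r nCN. Qed.
Lemma nC_real (a : R) : nC a%:C%C = `|a|. Proof. by rewrite /nC normr0 addr0. Qed.

Lemma sumr_const_le I (a : R) : 0 <= a -> \sum_(i in I) a <= n%:R * a.
Proof.
move=> a0; rewrite sumr_const -[a *+ _]mulr_natl; apply: ler_wpM2r => //.
by rewrite ler_nat -[leqRHS]card_ord max_card.
Qed.

Lemma nC_Mc (Ws : seq ('I_n -> 'I_n -> C)) I J (B : R) : 0 <= B ->
 (forall W, List.In W Ws -> forall i j, nC (W i j) <= B) ->
 nC (Mc I J Ws) <= ((n * n)%:R * B) ^+ size Ws.
Proof.
move=> B0; elim: Ws I J => [|W Ws IH] I J H; first by rewrite expr0 /nC normr1 normr0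
 addr0.
apply: le_trans (nC_sum _ _) _.
have K0 : 0 <= ((n * n)%:R * B) ^+ size Ws by pos.
have le1 i j : nC (psgn I i * psgn J j * (W i j * Mc (I :\ i) (J :\ j) Ws)) <= B * ((n *
 n)%:R * B) ^+ size Ws.
 rewrite -mulrA !nC_psgn; apply: le_trans (nCM _ _) _.
 apply: ler_pM; rewrite ?nC_ge0 //; first by apply: H; left.
 by apply: IH => W' ?; apply: H; right.
apply: le_trans (_ : \sum_(i in I) n%:R * (B * ((n * n)%:R * B) ^+ size Ws) <= _).
 apply: ler_sum => i _; apply: le_trans (nC_sum _ _) _.
 apply: le_trans (ler_sum _ (fun j _ => le1 i j)) _.
 exact: sumr_const_le (mulr_ge0 B0 K0).
apply: le_trans (sumr_const_le _ _) _; first by pos.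
by rewrite exprS; move: (_ ^+ _) => K; rewrite natrM !mulrA.
Qed.

Lemma nC_IntC F c r (M : R) : continuous (cRe F) -> continuous (cIm F) ->
 (forall x, r < enorm (x - c) -> F x = 0) -> (forall x, nC (F x) <= M) ->
 nC (IntC F) <= 2 * (M * vol (N := n + n) r).
Proof.
move=> cR cI F0 FM; rewrite mulr_natl mulr2n; apply: nC_IntC_le.
 apply: (Int_bound (c := c)) => // [x /F0 Fx|x]; first by rewrite /cRe Fx.
 by apply: le_trans (FM x); rewrite lerDl.
apply: (Int_bound (c := c)) => // [x /F0 Fx|x]; first by rewrite /cIm Fx.
by apply: le_trans (FM x); rewrite lerDr.
Qed.

End complex_calculus.

(** * Convergence of Monge-Ampere measures of smooth approximations, with rates *)

Section bt_convergence.
Context {R : realType} {n : nat}.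
Local Notation N := (n + n)%N.
Local Notation E := 'rV[R]_(n + n).
Local Notation C := R[i].
Implicit Types (g phi u v w : E -> R) (I J : {set 'I_n}).

#[local] Opaque smooth Int D csm ccs Ccs IntC psgn cRe cIm mcf Mc dzs.

Fixpoint teleT (T : Type) (v w : T) k : seq (seq T) :=
 if k is k'.+1 then nseq k' v :: [seq w :: L | L <- teleT v w k'] else [::].

Lemma tele_map (T : Type) (f : T -> 'I_n -> 'I_n -> C) (v w : T) k :
 tele (f v) (f w) k = [seq map f L | L <- teleT v w k].
Proof.
elim: k => //= k ->; rewrite map_nseq -!map_comp; congr (_ :: _).
Qed.

Lemma size_teleT (T : Type) (v w : T) k : size (teleT v w k) = k.
Proof. by elim: k => //= k IH; rewrite size_map IH. Qed.

Lemma teleTP (T : Type) (v w : T) k L : List.In L (teleT v w k) ->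
 size L = k.-1 /\ (forall a, List.In a L -> a = v \/ a = w).
Proof.
elim: k L => // k IH L [<-|].
 rewrite size_nseq; split=> // a.
 by elim: k {IH} => // k IH [->|/IH]; [left|].
move=> /(@List.in_map_iff _ _ (cons w))[L' [<- /[dup] L'k /IH[sL' HL']]] /=.
split; last by move=> a [<-|/HL']; [right|].
by rewrite sL'; case: k L'k {IH sL' HL'}.
Qed.

Lemma nC_sum_seq (T : Type) (s : seq T) (F : T -> C) (K : R) :
 (forall x, List.In x s -> nC (F x) <= K) -> nC (\sum_(x <- s) F x) <= (size s)%:R * K.
Proof.
elim: s => [|x s IH] H; first by rewrite big_nil nC0 mul0r.
rewrite big_cons -natr1 mulrDl mul1r addrC; apply: le_trans (nCD _ _) _.
apply: lerD; last by apply: H; left.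
by apply: IH => y ys; apply: H; right.
Qed.

Lemma IntC_sum_seq (T : Type) (s : seq T) (F : T -> E -> C) : (forall x, List.In x s -> ccs (F x)) ->
 ccs (fun x => \sum_(i <- s) F i x) /\
 IntC (fun x => \sum_(i <- s) F i x) = \sum_(i <- s) IntC (F i).
Proof.
elim: s => [|a s IH] H.
 have -> : (fun x => \sum_(i <- [::]) F i x) = fun=> 0 by ext x; rewrite big_nil.
 rewrite big_nil IntC0; split=> //.
 have := @ccs_real R n (fun=> 0); apply; split; [exact: smooth_cst|by exists 0].
have [|c1 c2] := IH; first by move=> x xs; apply: H; right.
have ca : ccs (F a) by apply: H; left.
have -> : (fun x => \sum_(i <- a :: s) F i x) = fun x => F a x + \sum_(i <- s) F i x.
 by ext x; rewrite big_cons.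
by rewrite big_cons -c2; split; [exact: ccsD|exact: IntC_add].
Qed.

Lemma cHess_sub v w i j x : smooth v -> smooth w ->
 cHess (fun x => v x - w x) i j x = cHess v i j x - cHess w i j x.
Proof.
move=> sv sw; rewrite (cHessE _ _ _ (smooth_sub sv sw)) (cHessE _ _ _ sv) (cHessE _ _ _
 sw) /cmat /Hs.
have EE a b : D a (D b (fun x => v x - w x)) x = D a (D b v) x - D a (D b w) x.
 by rewrite (D_sub b sv sw) (D_sub a (smoothD b sv) (smoothD b sw)).
have sC (a b c d : R) : (Complex a b : C) - Complex c d = Complex (a - c) (b - d) by [].
rewrite (EE (lshift n i) (lshift n j)) (EE (rshift n i) (rshift n j)) (EE (lshift n i)
 (rshift n j)).
rewrite (EE (rshift n i) (lshift n j)) sC; congr Complex; gen_D => *; ring.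
Qed.

Lemma mcf_tele I J v w k x : smooth v -> smooth w ->
 mcf I J (nseq k (cHess v)) x - mcf I J (nseq k (cHess w)) x =
 \sum_(L <- teleT v w k) mcf I J (cHess (fun x => v x - w x) :: map cHess L) x.
Proof.
move=> sv sw; pose f (a : E -> R) : 'I_n -> 'I_n -> C := fun i j => cHess a i j x.
have E1 a : mcf I J (nseq k (cHess a)) x = Mc I J (nseq k (f a)).
 by rewrite -[LHS]/(Mc I J [seq (fun i j => W i j x) | W : fmat <- nseq k (cHess a)])
  map_nseq.
transitivity (Mc I J (nseq k (f v)) - Mc I J (nseq k (f w))).
 by congr (_ - _); exact: E1.
rewrite (Mc_tele I J (f v) (f w) k) (tele_map f v w k) big_map; ebig L.
have -> : mcf I J (cHess (fun x => v x - w x) :: map cHess L) x = Mc I J (f (fun x => v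
 x - w x) :: map f L).
 rewrite -[LHS]/(Mc I J (f (fun x => v x - w x) :: [seq (fun i j => W i j x) | W : fmat
  <- map cHess L])).
 by rewrite -map_comp.
congr (Mc I J (_ :: _)); ext i; ext j.
by rewrite /f cHess_sub.
Qed.

Lemma csm_mcfH I J (gs : seq (E -> R)) : (forall g, List.In g gs -> smooth g) ->
 csm (mcf I J (map cHess gs)).
Proof. by move=> H; apply: csm_mcf; exact: rowc_msm (rowc_cHess H). Qed.

Lemma smooth_nseq k u : smooth u -> forall g, List.In g (nseq k u) -> smooth g.
Proof. by move=> su g; elim: k => [[]|k IH [<-|/IH]]. Qed.

Lemma IntC_tele I J phi v w k : Ccs phi -> smooth v -> smooth w ->
 IntC (fun x => (phi x)%:C%C * mcf I J (nseq k (cHess v)) x) -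
 IntC (fun x => (phi x)%:C%C * mcf I J (nseq k (cHess w)) x) =
 \sum_(L <- teleT v w k)
  IntC (fun x => (phi x)%:C%C * mcf I J (cHess (fun x => v x - w x) :: map cHess L) x).
Proof.
move=> cp sv sw; have cP := ccs_real cp.
have c1 u : smooth u -> ccs (fun x => (phi x)%:C%C * mcf I J (nseq k (cHess u)) x).
 by move=> su; apply: ccsMr; [exact: cP|rewrite -map_nseq; apply: csm_mcfH; exact:
  smooth_nseq].
have sL L : List.In L (teleT v w k) -> forall g, List.In g L -> smooth g.
 by move=> iL g gL; have [_ H] := teleTP iL; case: (H g gL) => ->.
have cL L : List.In L (teleT v w k) -> ccs (fun x => (phi x)%:C%C * mcf I J (cHess (fun
 x => v x - w x) :: map cHess L) x).
 move=> iL; apply: ccsMr; first exact: cP.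
 rewrite -[_ :: _]/(map cHess ((fun x => v x - w x) :: L)); apply: csm_mcfH => g [<-|].
  exact: smooth_sub.
 exact: sL.
have [_ <-] := IntC_sum_seq cL.
have cN : ccs (fun x => (-1) * ((phi x)%:C%C * mcf I J (nseq k (cHess w)) x)).
 by apply: ccsM; [exact: csm_cst|exact: c1].
rewrite -mulN1r -(IntC_scale _ (c1 w sw)) -(IntC_add (c1 v sv) cN); congr IntC; ext x.
by rewrite mulN1r -mulrN -mulrDr mcf_tele // mulr_sumr.
Qed.

Definition C2b phi (M : R) := [/\ forall x, `|phi x| <= M, forall a x, `|D a phi x| <= M
 & forall a b x, `|D a (D b phi) x| <= M].

Lemma C2b_ge0 phi M : C2b phi M -> 0 <= M.
Proof. by move=> [/(_ 0) H _ _]; exact: le_trans H. Qed.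

Lemma C2b_mul u phi a b : smooth u -> smooth phi -> C2b u a -> C2b phi b ->
 C2b (fun x => u x * phi x) (4 * (a * b)).
Proof.
move=> su sp ub pb; have a0 := C2b_ge0 ub; have b0 := C2b_ge0 pb.
case: ub => u0 u1 u2; case: pb => p0 p1 p2.
have du := smooth_pd su; have dp := smooth_pd sp.
have ab : 0 <= a * b by pos.
have M (x y : R) : `|x| <= a -> `|y| <= b -> `|x * y| <= a * b.
 by move=> ? ?; rewrite normrM ler_pM.
split=> [x|i x|i j x].
- by have := M _ _ (u0 x) (p0 x); lra.
- rewrite D_mul //; apply: le_trans (ler_normD _ _) _.
 have := M _ _ (u1 i x) (p0 x); have := M _ _ (u0 x) (p1 i x); lra.
have -> : D j (fun x => u x * phi x) = fun x => D j u x * phi x + u x * D j phi x by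
 rewrite D_mul.
have su' := smoothD j su; have sp' := smoothD j sp.
have du' := smooth_pd su'; have dp' := smooth_pd sp'.
have -> : D i (fun x => D j u x * phi x + u x * D j phi x) x = (D i (D j u) x * phi x +
 D j u x * D i phi x) + (D i u x * D j phi x + u x * D i (D j phi) x).
 by rewrite (D_add i (pdiffM du' dp) (pdiffM du dp')) (D_mul i du' dp) (D_mul i du dp').
have := M _ _ (u2 i j x) (p0 x); have := M _ _ (u1 j x) (p1 i x).
have := M _ _ (u1 i x) (p1 j x); have := M _ _ (u0 x) (p2 i j x).
move: (D i (D j u) x * phi x) (D j u x * D i phi x) (D i u x * D j phi x) (u x * D i (D
 j phi) x).
move=> t1 t2 t3 t4; rewrite !ler_norml; lra.
Qed.

Lemma nC_cHess g M i j x : smooth g -> C2b g M -> nC (cHess g i j x) <= M.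
Proof.
move=> sg [_ _ H]; rewrite cHessE // /nC /cmat /Hs.
have := H (lshift n i) (lshift n j) x; have := H (rshift n i) (rshift n j) x.
have := H (lshift n i) (rshift n j) x; have := H (rshift n i) (lshift n j) x.
gen_D => a b c d; rewrite !ler_norml => /andP[? ?] /andP[? ?] /andP[? ?] /andP[? ?].
have h1 : `|(a + b) / 4| <= M / 2 by rewrite ler_norml; apply/andP; split; lra.
have h2 : `|(c - d) / 4| <= M / 2 by rewrite ler_norml; apply/andP; split; lra.
lra.
Qed.

Lemma cHess_supp phi i j c r x : supp_ball phi c r -> r < enorm (x - c) -> smooth phi -> cHess phi i j x = 0.
Proof.
move=> sp rx sm; rewrite cHessE // /cmat /Hs.
have Z a b : D a (D b phi) x = 0 by apply: (D_supp_ball a (D_supp_ball b sp)).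
by rewrite !Z addr0 subr0 mul0r.
Qed.

Lemma nC_mcf I J (gs : seq (E -> R)) B x : 0 <= B -> (forall g, List.In g gs -> smooth g /\ C2b g B) ->
 nC (mcf I J (map cHess gs) x) <= ((n * n)%:R * B) ^+ size gs.
Proof.
move=> B0 H.
have := @nC_Mc R n [seq (fun i j => W i j x) | W : fmat <- map cHess gs] I J B B0.
rewrite !size_map; apply=> W /List.in_map_iff[F [<- /List.in_map_iff[g [<- /H[sg bg]]]]]
 i j.
exact: nC_cHess.
Qed.

Lemma cont_csm (F : E -> C) : csm F -> continuous (cRe F) /\ continuous (cIm F).
Proof. by move=> [a b]; split; exact: smooth_cont. Qed.

(* One telescoping term after integrating by parts twice. *)
Lemma hess2_bound I J phi g (gs : seq (E -> R)) c r M A B :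
 Ccs phi -> supp_ball phi c r -> C2b phi M -> smooth g -> (forall x, `|g x| <= A) -> 0 <= B ->
 (forall h, List.In h gs -> smooth h /\ C2b h B) ->
 nC (IntC (fun x => (phi x)%:C%C * mcf I J (cHess g :: map cHess gs) x)) <=
 n%:R * (n%:R * (2 * (A * M * ((n * n)%:R * B) ^+ size gs * vol (N := n + n) r))).
Proof.
move=> cp sp bp sg gA B0 Hgs; have sgs h : List.In h gs -> smooth h by move=> /Hgs[].
have A0 : 0 <= A by exact: le_trans (gA 0).
have M0 := C2b_ge0 bp.
have K0 : 0 <= ((n * n)%:R * B) ^+ size gs by pos.
have T0 : 0 <= 2 * (A * M * ((n * n)%:R * B) ^+ size gs * vol (N := n + n) r).
 by rewrite mulr_ge0 // mulr_ge0 ?vol_ge0 // !mulr_ge0.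
rewrite (IntC_hess2 I J cp sg sgs); apply: le_trans (nC_sum _ _) _.
apply: le_trans _ (sumr_const_le I (mulr_ge0 (ler0n _ _) T0)); apply: ler_sum => i _.
apply: le_trans (nC_sum _ _) _; apply: le_trans _ (sumr_const_le J T0); apply: ler_sum
 => j _.
rewrite !nC_psgn.
have smp : smooth phi by have [] := cp.
have cs : csm (fun x => (g x)%:C%C * cHess phi i j x * mcf (I :\ i) (J :\ j) (map cHess
 gs) x).
 apply: csmM; first by apply: csmM; [exact: csm_real|exact: csm_cHess].
 exact: csm_mcfH.
have [c1 c2] := cont_csm cs.
apply: (nC_IntC (c := c)) c1 c2 _ _ => x.
 by move=> rx; rewrite (cHess_supp _ _ sp rx smp) mulr0 mul0r.
apply: le_trans (nCM _ _) _; apply: ler_pM; rewrite ?nC_ge0 //; last exact: nC_mcf.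
apply: le_trans (nCM _ _) _; apply: ler_pM; rewrite ?nC_ge0 ?nC_real //.
exact: nC_cHess.
Qed.

Lemma nC_le_norm (z : C) (a : R) : `|z| <= a%:C%C -> nC z <= 2 * a.
Proof.
case: z => x y; rewrite normc_def lecR => H.
have hx : `|x| <= a.
 by apply: le_trans H; rewrite -sqrtr_sqr ler_wsqrtr // lerDl sqr_ge0.
have hy : `|y| <= a.
 by apply: le_trans H; rewrite -sqrtr_sqr ler_wsqrtr // lerDr sqr_ge0.
rewrite /nC; lra.
Qed.

Lemma nC_i (z : C) : nC ('i%C * z) = nC z.
Proof. by case: z => x y; rewrite /nC /= !mul0r !mul1r !(sub0r, add0r, addr0) normrN
 addrC. Qed.

Definition cvz (F : nat -> C) := forall e : R, 0 < e ->
 exists J0 : nat, forall j, (J0 <= j)%N -> nC (F j) <= e.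

Lemma cvz_add F G : cvz F -> cvz G -> cvz (fun j => F j + G j).
Proof.
move=> HF HG e e0; have e2 : 0 < e / 2 by pos.
have [J1 H1] := HF _ e2; have [J2 H2] := HG _ e2; exists (maxn J1 J2) => j.
rewrite geq_max => /andP[/H1 h1 /H2 h2]; apply: le_trans (nCD _ _) _.
by rewrite [leRHS](splitr e) lerD.
Qed.

Lemma cvz_sum (I : Type) (s : seq I) (P : pred I) (F : I -> nat -> C) :
 (forall i, P i -> cvz (F i)) -> cvz (fun j => \sum_(i <- s | P i) F i j).
Proof.
move=> H; elim: s => [|i s IH].
 by move=> e e0; exists 0%N => j _; rewrite big_nil nC0 ltW.
case Pi: (P i) => e e0.
 have [J0 HJ] := cvz_add (H i Pi) IH e0; exists J0 => j /HJ.
 by rewrite big_cons Pi.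
by have [J0 HJ] := IH e e0; exists J0 => j /HJ; rewrite big_cons Pi.
Qed.

Lemma cvz_geo F (K x : R) : 0 <= K -> 0 <= x < 1 -> (forall j, nC (F j) <= K * x ^+ j) -> cvz F.
Proof.
move=> K0 /andP[x0 x1] H e e0.
have : (fun j => x ^+ j) @ \oo --> (0 : R) by apply: cvg_expr; rewrite ger0_norm.
move=> /cvgrPdist_le /(_ (e / (K + 1))) [|J0 _ HJ]; first by pos.
exists J0 => j Jj; apply: le_trans (H j) _.
have := HJ j Jj; rewrite sub0r normrN ger0_norm ?exprn_ge0 // => hx.
apply: le_trans (ler_wpM2l K0 hx) _.
by rewrite mulrCA ler_piMr ?(ltW e0) // ler_pdivrMr ?mul1r ?lerDl // ltr_wpDl.
Qed.

(** The geometric steps are summed up to an index at which the distance to [T] is as small as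
    desired. *)
Lemma geo_lim (m : nat -> C) (T : C) (K x : R) : 0 <= K -> 0 <= x < 1 ->
 (forall j, nC (m j - m j.+1) <= K * x ^+ j) -> cvz (fun j => m j - T) ->
 forall j, nC (m j - T) <= K / (1 - x) * x ^+ j.
Proof.
move=> K0 /andP[x0 x1] H HT j.
have y0 : 0 < 1 - x by pos.
have tel l : nC (m j - m (j + l)%N) <= K / (1 - x) * (x ^+ j - x ^+ (j + l)).
 elim: l => [|l IH]; first by rewrite addn0 !subrr mulr0 nC0.
 have -> : m j - m (j + l.+1)%N = (m j - m (j + l)%N) + (m (j + l)%N - m (j + l).+1).
  by rewrite addnS addrA subrK.
 apply: le_trans (nCD _ _) _; have := H (j + l)%N; move: IH.
 rewrite addnS exprS.
 have -> : K / (1 - x) * (x ^+ j - x * x ^+ (j + l)) = K / (1 - x) * (x ^+ j - x ^+ (j +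
  l)) + K * x ^+ (j + l) by field; rewrite gt_eqF.
 exact: lerD.
apply/ler_addgt0Pr => e e0; have [J0 HJ] := HT e e0.
have -> : m j - T = (m j - m (j + J0)%N) + (m (j + J0)%N - T) by rewrite addrA subrK.
apply: le_trans (nCD _ _) _; apply: lerD; last by apply: HJ; exact: leq_addl.
apply: le_trans (tel J0) _; rewrite ler_wpM2l ?divr_ge0 ?(ltW y0) //.
by rewrite gerBl exprn_ge0.
Qed.

Lemma le_sum1 (T : finType) (F : T -> R) i : (forall i, 0 <= F i) -> F i <= \sum_i F i.
Proof. by move=> F0; rewrite (bigD1 i) // lerDl sumr_ge0. Qed.

Lemma Ccs_C2b phi : Ccs phi -> exists2 M, 0 <= M & C2b phi M.
Proof.
move=> cp.
pose G1 x := \sum_a `|D a phi x|; pose G2 x := \sum_a \sum_b `|D a (D b phi) x|.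
pose G x := `|phi x| + (G1 x + G2 x).
have cG : Cc0 G.
 apply: Cc0D; first by apply: Cc0_norm; exact: Ccs_Cc0.
 apply: Cc0D; apply: Cc0_sum => a; first by apply: Cc0_norm; apply: Ccs_Cc0; exact:
  CcsD.
 by apply: Cc0_sum => b; apply: Cc0_norm; apply: Ccs_Cc0; apply: CcsD; exact: CcsD.
have [M M0 HM] := Cc0_bounded cG; exists M; first exact: M0.
have s1 x : 0 <= G1 x by pos.
have s2 x : 0 <= G2 x by pos.
have HG x : G x <= M by apply: le_trans (HM x); exact: ler_norm.
split=> [x|a x|a b x]; apply: le_trans (HG x).
- by move: (s1 x) (s2 x); rewrite /G; lra.
- have := le_sum1 (F := fun a => `|D a phi x|) a (fun a => normr_ge0 _); rewrite -/(G1
 x).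
 by move: (normr_ge0 (phi x)) (s2 x); rewrite /G; lra.
- have h1 := le_sum1 (F := fun b => `|D a (D b phi) x|) b (fun b => normr_ge0 _).
 have h2 := le_sum1 (F := fun a => \sum_b `|D a (D b phi) x|) a (fun a => sumr_ge0 _
  (fun b _ => normr_ge0 _)).
 have := le_trans h1 h2; rewrite -/(G2 x).
 by move: (normr_ge0 (phi x)) (s1 x); rewrite /G; lra.
Qed.

Lemma Int_cond (Omega : set E) phi : (forall x, ~ Omega x -> phi x = 0) ->
 (\int[lebesgue_rV R N]_(x in Omega) phi x)%R = Int phi.
Proof.
move=> H; rewrite Rintegral_mkcond; congr Rintegral; ext x.
rewrite patchE; case: ifPn => // /negP xO; rewrite H // => xO'; apply: xO.
by rewrite inE.
Qed.

Lemma ddbarE i j phi x : smooth phi ->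
 cHess phi i j x = (ddbar_re i j phi x)%:C%C + 'i%C * (ddbar_im i j phi x)%:C%C.
Proof.
move=> sp; rewrite cHessE //; apply: cplx_eq; rewrite /=.
 by rewrite mul0r mul1r subrr addr0.
by rewrite mul0r mul1r !add0r.
Qed.

Lemma ddbar_reE i j phi : ddbar_re i j phi =
 fun x => 4^-1 * (D (lshift n i) (D (lshift n j) phi) x + D (rshift n i) (D (rshift n j) phi) x).
Proof. by ext x; rewrite mulrC. Qed.

Lemma ddbar_imE i j phi : ddbar_im i j phi =
 fun x => 4^-1 * (D (lshift n i) (D (rshift n j) phi) x + - D (rshift n i) (D (lshift n j) phi) x).
Proof. by ext x; rewrite mulrC. Qed.

Lemma Ccs_ddbar i j phi : Ccs phi -> Ccs (ddbar_re i j phi) /\ Ccs (ddbar_im i j phi).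
Proof.
move=> cp; rewrite ddbar_reE ddbar_imE; split; apply: CcsZ; apply: Ccs_add.
- by apply: CcsD; exact: CcsD.
- by apply: CcsD; exact: CcsD.
- by apply: CcsD; exact: CcsD.
- by apply: Ccs_opp; apply: CcsD; exact: CcsD.
Qed.

Lemma supp_ddbar i j phi c r : supp_ball phi c r ->
 supp_ball (ddbar_re i j phi) c r /\ supp_ball (ddbar_im i j phi) c r.
Proof.
move=> sp; have Z a b x : r < enorm (x - c) -> D a (D b phi) x = 0.
 exact: (D_supp_ball a (D_supp_ball b sp)).
by rewrite ddbar_reE ddbar_imE; split=> x rx; rewrite !Z // ?oppr0 addr0 mulr0.
Qed.

#[local] Transparent psgn.

Lemma symH_Hs w x : smooth w -> symH (Hs w x).
Proof. by move=> sw a b; rewrite /Hs D_comm. Qed.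

Lemma mcf_MAd w x : smooth w ->
 mcf [set: 'I_n] [set: 'I_n] (nseq n (cHess w)) x = (n`!%:R * MAd (Hs w x))%:C%C.
Proof.
move=> sw; rewrite -(Mc_MAd (symH_Hs x sw)).
rewrite -[LHS]/(Mc [set: 'I_n] [set: 'I_n] [seq (fun i j => W i j x) | W : fmat <- nseq
 n (cHess w)]).
rewrite map_nseq; congr (Mc _ _ (nseq n _)); ext i; ext j.
exact: cHessE.
Qed.

Lemma smooth_MAd w : smooth w -> smooth (fun x => MAd (Hs w x)).
Proof.
move=> sw; have [sR _] : csm (mcf [set: 'I_n] [set: 'I_n] (nseq n (cHess w))).
 by rewrite -map_nseq; apply: csm_mcfH; exact: smooth_nseq.
have -> : (fun x => MAd (Hs w x)) = fun x => n`!%:R^-1 * cRe (mcf [set: 'I_n] [set: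
 'I_n] (nseq n (cHess w))) x.
 ext x; have -> : cRe (mcf [set: 'I_n] [set: 'I_n] (nseq n (cHess w))) x = n`!%:R * MAd
  (Hs w x) by rewrite -[LHS]/(complex.Re (mcf _ _ _ x)) mcf_MAd.
 by rewrite mulKf // pnatr_eq0 -lt0n fact_gt0.
exact: smoothZ.
Qed.

(** * Induction on the degree of the currents, along approximations with geometric bounds *)

Section limit.
Variables (Omega : set E) (u0 u : E -> R) (z0 : E) (r1 : R).
Variable (T : {set 'I_n} -> {set 'I_n} -> (E -> R) -> C).
Variables (us : nat -> E -> R) (A h : R).
Hypothesis n0 : (0 < n)%N.
Hypothesis MT : MA_currents Omega u0 T.
Hypothesis uu0 : forall x, enorm (x - z0) <= r1 -> u x = u0 x.
Hypothesis r1O : forall x, enorm (x - z0) <= r1 -> Omega x.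
Hypothesis cu : continuous u.
Hypothesis sus : forall j, smooth (us j).
Hypothesis h1 : 1 <= h.
Hypothesis hn : h ^+ n < 4.
Hypothesis usu : forall j x, `|us j x - u x| <= A * (h / 4) ^+ j.
Hypothesis usb : forall j, C2b (us j) (A * h ^+ j).

Let A0 : 0 <= A. Proof. by have := C2b_ge0 (usb 0); rewrite expr0 mulr1. Qed.
Let h0 : 0 <= h. Proof. exact: le_trans h1. Qed.

Let Cc_ball phi : continuous phi -> supp_ball phi z0 r1 -> Cc Omega phi.
Proof.
move=> cp sp; split=> //; exists [set x | enorm (x - z0) <= r1]; split.
- exact: compact_cball.
- exact: r1O.
- by move=> x /negP; rewrite -ltNge; exact: sp.
Qed.

Let mk I J k phi j := IntC (fun x => (phi x)%:C%C * mcf I J (nseq k (cHess (us j))) x).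

Let pw j k : (h / 4) ^+ j * (h ^+ j) ^+ k = (h ^+ k.+1 / 4) ^+ j.
Proof. by rewrite -exprM mulnC exprM -exprMn mulrAC -exprS. Qed.

Let cst k := k.+1%:R * (n%:R * (n%:R * (2 * (2 * A * ((n * n)%:R * (A * h)) ^+ k * vol (N := n + n) r1)))).

Let cst_ge0 k : 0 <= cst k.
Proof.
have K0 : 0 <= ((n * n)%:R * (A * h)) ^+ k by pos.
by rewrite /cst mulr_ge0 // mulr_ge0 // mulr_ge0 // mulr_ge0 // mulr_ge0 ?vol_ge0 //
 mulr_ge0 // mulr_ge0.
Qed.

Let h4 : h / 4 <= 1.
Proof.
rewrite ler_pdivrMr // mul1r; apply: ltW; apply: le_lt_trans hn.
by move: n0; case: n => // n' _; rewrite exprS ler_peMr // exprn_ege1.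
Qed.

(** After two integrations by parts, a telescoping term is bounded by the distance of consecutive
    approximations, of order [(h / 4) ^+ j], times [k] Hessians of size [h ^+ j]; together this is
    [(h ^+ k.+1 / 4) ^+ j] by [pw]. *)
Let mk_step I J k phi M j : Ccs phi -> supp_ball phi z0 r1 -> C2b phi M ->
 nC (mk I J k.+1 phi j - mk I J k.+1 phi j.+1) <= cst k * M * (h ^+ k.+1 / 4) ^+ j.
Proof.
move=> cp sp bp; rewrite /mk IntC_tele //.
have B1 : C2b (us j) (A * h * h ^+ j).
 have [b0 b1 b2] := usb j.
 have le : A * h ^+ j <= A * h * h ^+ j.
  by rewrite ler_wpM2r ?exprn_ge0 // ler_peMr.
 by split=> *; apply: le_trans le.
have B2 : C2b (us j.+1) (A * h * h ^+ j) by have := usb j.+1; rewrite exprS mulrA.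
have B0 := C2b_ge0 B1.
have dA x : `|us j x - us j.+1 x| <= 2 * A * (h / 4) ^+ j.
 have -> : us j x - us j.+1 x = (us j x - u x) - (us j.+1 x - u x) by ring.
 apply: le_trans (ler_normB _ _) _; rewrite -mulrA mulr_natl mulr2n; apply: lerD => //.
 apply: le_trans (usu _ _) _; rewrite exprSr mulrA ler_piMr //.
 by pos.
apply: le_trans (nC_sum_seq (K := n%:R * (n%:R * (2 * (2 * A * (h / 4) ^+ j * M * ((n *
 n)%:R * (A * h * h ^+ j)) ^+ k * vol (N := n + n) r1)))) _) _; last first.
 rewrite size_teleT -pw /cst; rewrite [X in X ^+ k]mulrA [(_ * h ^+ j) ^+ k]exprMn.
 by apply: le_of_eq; ring.
move=> L iL; have [sL HL] := teleTP iL.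
have -> : k = size L by [].
apply: (hess2_bound I J cp sp bp (smooth_sub (sus j) (sus j.+1)) dA B0) => g gL.
by case: (HL g gL) => ->; split.
Qed.

Let T_lin I J phi psi : #|I| = #|J| -> Cc Omega phi -> Cc Omega psi ->
 T I J (fun x => psi x - phi x) = T I J psi - T I J phi.
Proof.
move=> cIJ cp cs; have [H _ _] := MT; have [Hl _] := H I J cIJ.
have -> : (fun x => psi x - phi x) = fun x => -1 * phi x + psi x.
 by ext x; rewrite mulN1r addrC.
by rewrite Hl // rmorphN1 mulN1r addrC.
Qed.

Let T_bound I J : #|I| = #|J| -> exists2 c, 0 <= c & forall phi M, continuous phi ->
 supp_ball phi z0 r1 -> (forall x, `|phi x| <= M) -> nC (T I J phi) <= c * M.
Proof.
move=> cIJ; have [H _ _] := MT; have [_ Hb] := H I J cIJ.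
have [c Hc] := Hb _ (@compact_cball R (n + n) z0 r1) r1O.
exists (2 * `|c|) => [|phi M cp sp pM]; first by [].
have M0 : 0 <= M by exact: le_trans (pM 0).
apply: le_trans (nC_le_norm (Hc phi M cp _ pM)) _.
 by move=> x /negP; rewrite -ltNge; exact: sp.
by rewrite -mulrA ler_wpM2l // ler_wpM2r // ler_norm.
Qed.

(** A rate is carried along, linear in the [C2b] bound of the test function, because in the next
    degree the test functions contain [us j], whose second derivatives grow like [h ^+ j]. *)
Let claim k := forall I J, #|I| = k -> #|J| = k ->
 exists2 K, 0 <= K & forall phi M j, Ccs phi -> supp_ball phi z0 r1 -> C2b phi M ->
  nC (mk I J k phi j - T I J phi) <= K * M * (h ^+ k / 4) ^+ j.

Let claim0 : claim 0.
Proof.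
move=> I J /cards0_eq -> /cards0_eq ->; exists 0 => // phi M j cp sp bp.
have [_ H0 _] := MT.
have cph : continuous phi by have [sm _] := cp; exact: smooth_cont.
rewrite /mk H0; last exact: Cc_ball.
have -> : (fun x => (phi x)%:C%C * mcf finset.set0 finset.set0 (nseq 0 (cHess (us j)))
 x) = fun x => (phi x)%:C%C by ext x; rewrite mcf_nil mulr1.
rewrite Int_cond; last first.
 by move=> x xO; apply: sp; rewrite ltNge; apply/negP => /r1O.
have -> : IntC (fun x => (phi x)%:C%C) = (Int phi)%:C%C.
 by apply: cplx_eq => //; rewrite -[RHS](@Int0 R (n + n)).
by rewrite subrr nC0 !mul0r.
Qed.

(** The smooth form tested on [us j * psi] is close to the current on the same function by the claim
    in degree [k], whose rate beats the growth of [us j]. Replacing [us j] by [u] then costs little,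
    as the current has order zero and the convergence is uniform. *)
Let term k I J psi : #|I| = k -> #|J| = k -> (k < n)%N -> claim k -> Ccs psi -> supp_ball psi z0 r1 ->
 cvz (fun j => mk I J k (fun x => us j x * psi x) j - T I J (fun x => u0 x * psi x)).
Proof.
move=> cI cJ kn Hk cps sps; have [K K0 HK] := Hk I J cI cJ.
have cIJ : #|I| = #|J| by rewrite cI cJ.
have [c c0 Hc] := T_bound cIJ; have [M M0 bM] := Ccs_C2b cps.
have sm : smooth psi by have [] := cps.
have cpsi := smooth_cont sm.
have hk : h ^+ k.+1 < 4 by apply: le_lt_trans hn; exact: ler_weXn2l.
have yx : 0 <= h ^+ k.+1 / 4 < 1 by rewrite divr_ge0 ?exprn_ge0 // ltr_pdivrMr ?mul1r.
apply: (cvz_geo (K := K * (4 * (A * M)) + c * (A * M)) _ yx) => [|j].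
 by pos.
have E0 : (fun x => u0 x * psi x) = fun x => u x * psi x.
 ext x; have [le|lt] := leP (enorm (x - z0)) r1; first by rewrite uu0.
 by rewrite sps // !mulr0.
rewrite E0.
have spu v : supp_ball (fun x => v x * psi x) z0 r1 by move=> x /sps ->; rewrite mulr0.
have c1 : Cc Omega (fun x => us j x * psi x).
 by apply: Cc_ball => //; apply: contM => //; exact: smooth_cont.
have c2 : Cc Omega (fun x => u x * psi x) by apply: Cc_ball => //; exact: contM.
have -> : mk I J k (fun x => us j x * psi x) j - T I J (fun x => u x * psi x) = (mk I J
 k (fun x => us j x * psi x) j - T I J (fun x => us j x * psi x)) + T I J (fun x => us j
 x * psi x - u x * psi x).
 by rewrite T_lin // addrA subrK.
apply: le_trans (nCD _ _) _; rewrite mulrDl; apply: lerD.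
 apply: le_trans (HK _ _ j (Ccs_mul (sus j) cps) (spu _) (C2b_mul (sus j) sm (usb j)
  bM)) _.
 have -> : K * (4 * (A * h ^+ j * M)) * (h ^+ k / 4) ^+ j = K * (4 * (A * M)) * (h ^+ j
  * (h ^+ k / 4) ^+ j).
  by ring.
 by rewrite -exprMn [h * (_ / _)]mulrA -exprS.
apply: le_trans (Hc _ (A * (h / 4) ^+ j * M) _ _ _) _.
- by apply: contB; case: c1; case: c2.
- by move=> x /sps ->; rewrite !mulr0 subrr.
- by move=> x; rewrite -mulrBl normrM ler_pM; case: bM.
have -> : c * (A * (h / 4) ^+ j * M) = c * (A * M) * (h / 4) ^+ j by ring.
rewrite ler_wpM2l //; first by pos.
apply: lerXn2r; rewrite ?nnegrE ?divr_ge0 ?exprn_ge0 //.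
by rewrite ler_wpM2r // exprS ler_peMr // exprn_ege1.
Qed.

(** By [mk_step] the increments in [j] decay geometrically, so the limit is approached at that rate
    once it is identified. It is identified by the recursion shared by smooth forms and currents,
    whose terms converge by [term]. *)
Let claimS k : (k < n)%N -> claim k -> claim k.+1.
Proof.
move=> kn Hk I J cI cJ.
have hk : h ^+ k.+1 < 4 by apply: le_lt_trans hn; exact: ler_weXn2l.
have yx : 0 <= h ^+ k.+1 / 4 < 1 by rewrite divr_ge0 ?exprn_ge0 // ltr_pdivrMr ?mul1r.
have y0 : 0 < 1 - h ^+ k.+1 / 4 by move: yx => /andP[_]; rewrite subr_gt0.
exists (cst k / (1 - h ^+ k.+1 / 4)) => [|phi M j cp sp bp]; first by pos.
have M0 := C2b_ge0 bp.
rewrite [_ / _ * M]mulrAC; apply: geo_lim => // [|i|]; first exact: mulr_ge0.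
 exact: mk_step.
have sm : smooth phi by have [] := cp.
have cIJ : #|I| = #|J| by rewrite cI cJ.
have [_ _ HT] := MT; move: HT => /(_ I J phi cIJ) HT.
(* [IntC_hess2] expands the smooth side and the definition of the currents expands [T], with the
   same signs and indices. *)
have EQ i : mk I J k.+1 phi i - T I J phi = \sum_(p in I) \sum_(q in J) psgn I p * (psgn
 J q * ((mk (I :\ p)%SET (J :\ q)%SET k (fun x => us i x * ddbar_re p q phi x) i - T (I
 :\ p)%SET (J :\ q)%SET (fun x => u0 x * ddbar_re p q phi x)) + 'i%C * (mk (I :\ p)%SET
 (J :\ q)%SET k (fun x => us i x * ddbar_im p q phi x) i - T (I :\ p)%SET (J :\ q)%SET
 (fun x => u0 x * ddbar_im p q phi x)))).
 have sM p q : csm (mcf (I :\ p) (J :\ q) (nseq k (cHess (us i)))).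
  by rewrite -map_nseq; apply: csm_mcfH; exact: smooth_nseq.
 have -> : mk I J k.+1 phi i = \sum_(p in I) \sum_(q in J) psgn I p * (psgn J q * IntC
  (fun x => (us i x)%:C%C * cHess phi p q x * mcf (I :\ p) (J :\ q) (nseq k (cHess (us
  i))) x)).
  have En : nseq k (cHess (us i)) = map cHess (nseq k (us i)) by rewrite map_nseq.
  by rewrite /mk -[nseq k.+1 _]/(cHess (us i) :: nseq k (cHess (us i))) En (IntC_hess2 _
   _ cp (sus i) (smooth_nseq (sus i))).
 rewrite HT; [|by rewrite cI|by split; [exact: Cc_ball (smooth_cont sm)
  sp|exact/smoothP]].
 rewrite -sumrB; ebig p; rewrite -sumrB; ebig q.
 have [c1 c2] := Ccs_ddbar p q cp.
 have -> : (-1) ^+ (pos_in I p + pos_in J q) = psgn I p * psgn J q :> C by rewrite /psgn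
  exprD.
 have ca (psi : E -> R) : Ccs psi -> ccs (fun x => (us i x * psi x)%:C%C * mcf (I :\ p)
  (J :\ q) (nseq k (cHess (us i))) x).
  by move=> cpsi; apply: ccsMr (sM p q); apply: ccs_real; apply: Ccs_mul (sus i) cpsi.
 have -> : (fun x => (us i x)%:C%C * cHess phi p q x * mcf (I :\ p) (J :\ q) (nseq k
  (cHess (us i))) x) = fun x => (us i x * ddbar_re p q phi x)%:C%C * mcf (I :\ p) (J :\
  q) (nseq k (cHess (us i))) x + 'i%C * ((us i x * ddbar_im p q phi x)%:C%C * mcf (I :\
  p) (J :\ q) (nseq k (cHess (us i))) x).
  ext x; rewrite ddbarE // !rmorphM.
  move: (mcf _ _ _ x) => m; rewrite mulrDr mulrDl; congr (_ + _).
  by rewrite !mulrA [_ * 'i%C]mulrC.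
 rewrite (IntC_add (ca _ c1) (ccsM (csm_cst _) (ca _ c2))) (IntC_scale _ (ca _ c2)).
 rewrite -/(mk _ _ _ _ _) -/(mk _ _ _ _ _).
 move: (mk _ _ _ _ _) (mk _ _ _ _ _) (T _ _ _) (T _ _ _) (psgn I p) (psgn J q); clear.
 move=> a b c d e f; rewrite [e * f * _](esym (mulrA _ _ _)) -mulrBr -mulrBr; congr (_ *
  (_ * _)).
 by rewrite mulrBr opprD addrACA.
rewrite (_ : (fun _ => _) = fun i => \sum_(p in I) \sum_(q in J) psgn I p * (psgn J q *
 ((mk (I :\ p)%SET (J :\ q)%SET k (fun x => us i x * ddbar_re p q phi x) i - T (I :\
 p)%SET (J :\ q)%SET (fun x => u0 x * ddbar_re p q phi x)) + 'i%C * (mk (I :\ p)%SET (J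
 :\ q)%SET k (fun x => us i x * ddbar_im p q phi x) i - T (I :\ p)%SET (J :\ q)%SET (fun
 x => u0 x * ddbar_im p q phi x))))); last exact/funext.
apply: cvz_sum => p pI; apply: cvz_sum => q qJ.
have cI' : #|(I :\ p)%SET| = k by move: cI; rewrite (cardsD1 p) pI => -[].
have cJ' : #|(J :\ q)%SET| = k by move: cJ; rewrite (cardsD1 q) qJ => -[].
have [c1 c2] := Ccs_ddbar p q cp; have [s1 s2] := supp_ddbar p q sp.
have cz : cvz (fun i => (mk (I :\ p)%SET (J :\ q)%SET k (fun x => us i x * ddbar_re p q
 phi x) i - T (I :\ p)%SET (J :\ q)%SET (fun x => u0 x * ddbar_re p q phi x)) + 'i%C *
 (mk (I :\ p)%SET (J :\ q)%SET k (fun x => us i x * ddbar_im p q phi x) i - T (I :\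
 p)%SET (J :\ q)%SET (fun x => u0 x * ddbar_im p q phi x))).
 apply: cvz_add; first exact: term.
 move=> e' e'0; have [J1 H1] := @term k _ _ _ cI' cJ' kn Hk c2 s2 e' e'0.
 by exists J1 => i /H1; rewrite nC_i.
move=> e e0; have [J0 HJ] := cz e e0.
by exists J0 => i /HJ; rewrite !nC_psgn.
Qed.

Let claim_all k : (k <= n)%N -> claim k.
Proof. by elim: k => [_|k IH kn]; [exact: claim0|apply: claimS => //; apply: IH; exact:
 ltnW]. Qed.

(** This is the claim in full degree: [h ^+ n < 4] makes the rate less than one, and the coefficient
    is [MAd] up to the factorial. *)
Lemma MAd_convergence (I_mu : (E -> R) -> R) phi :
 (forall phi, Cc Omega phi -> T [set: 'I_n]%SET [set: 'I_n]%SET phi = (n`!%:R * I_mu phi)%:C%C) ->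
 Ccs phi -> supp_ball phi z0 r1 -> forall e, 0 < e -> exists J0 : nat, forall j, (J0 <= j)%N ->
  `|Int (fun x => phi x * MAd (Hs (us j) x)) - I_mu phi| <= e.
Proof.
move=> HT cp sp e e0.
have cn : #|[set: 'I_n]%SET| = n by rewrite cardsT card_ord.
have [K K0 HK] := claim_all (leqnn n) cn cn; have [M M0 bM] := Ccs_C2b cp.
have yx : 0 <= h ^+ n / 4 < 1 by rewrite divr_ge0 ?exprn_ge0 // ltr_pdivrMr ?mul1r.
have cz : cvz (fun j => mk [set: 'I_n]%SET [set: 'I_n]%SET n phi j - T [set: 'I_n]%SET
 [set: 'I_n]%SET phi).
 apply: (cvz_geo (K := K * M) _ yx) => [|j]; first exact: mulr_ge0.
 exact: HK.
have [J0 HJ] := cz e e0.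
exists J0 => j /HJ; rewrite HT; last by apply: Cc_ball sp; apply: smooth_cont; case: cp.
have sP : Ccs (fun x => phi x * MAd (Hs (us j) x)).
 have -> : (fun x => phi x * MAd (Hs (us j) x)) = fun x => MAd (Hs (us j) x) * phi x.
  by ext x; rewrite mulrC.
 by apply: Ccs_mul cp; exact: smooth_MAd.
have -> : mk [set: 'I_n]%SET [set: 'I_n]%SET n phi j = (n`!%:R * Int (fun x => phi x *
 MAd (Hs (us j) x)))%:C%C.
 rewrite /mk -IntZ; last exact: Ccs_Cc0.
 have -> : (fun x => (phi x)%:C%C * mcf [set: 'I_n] [set: 'I_n] (nseq n (cHess (us j)))
  x) = fun x => (n`!%:R * (phi x * MAd (Hs (us j) x)))%:C%C.
  by ext x; rewrite mcf_MAd // -rmorphM mulrCA.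
 by apply: cplx_eq => //; rewrite -[RHS](@Int0 R (n + n)).
rewrite -rmorphB nC_real -mulrBr normrM ger0_norm //; apply: le_trans.
by rewrite ler_peMl // ler1n fact_gt0.
Qed.

End limit.

End bt_convergence.

(** * An integral comparison principle for smooth functions *)

Section comparison.
Context {R : realType} {n : nat}.
Local Notation E := 'rV[R]_(n + n).
Local Notation C := R[i].
Implicit Types (g phi q v w : E -> R) (xi : E).

#[local] Opaque Int D csm ccs Ccs IntC psgn cRe cIm mcf Mc dzs.

Lemma cone_rank1 (x : 'I_n -> C) : (0 < n)%N -> cone (rank1 x).
Proof.
move=> n0; pose k0 := Ordinal n0.
exists (fun k => (k == k0)%:R), (fun=> x); split=> [k|]; first by [].
ext i; ext j; rewrite (bigD1 k0) //= mul1r big1 ?addr0 // => k /negbTE ->.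
by rewrite mul0r.
Qed.

Lemma cHess_cone g x : smooth g -> (forall xi, 0 <= levi (Hs g x) xi) -> cone (fun i j => cHess g i j x).
Proof.
move=> sg pg; have -> : (fun i j => cHess g i j x) = cmat (Hs g x).
 by ext i; ext j; exact: cHessE.
exact: cone_cmat (symH_Hs x sg) pg.
Qed.

#[local] Transparent dzs cRe cIm.
Lemma dzs_conj g j x : dzs (-1) j (fun x => (g x)%:C%C) x = ((dzs 1 j (fun x => (g x)%:C%C) x)^*)%R.
Proof.
have Z a : D a (fun _ : E => 0 : R) x = 0 by rewrite D_cst.
rewrite conjCE; apply: cplx_eq => /=; rewrite !Z.
 by gen_D => *; ring.
by gen_D => *; ring.
Qed.

Lemma dzs_fexp p g i x : smooth g ->
 dzs 1 i (fun x => (fexp p (g x))%:C%C) x =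
 (fexp (fder p) (g x))%:C%C * dzs 1 i (fun x => (g x)%:C%C) x.
Proof.
move=> sg; have Z a : D a (fun _ : E => 0 : R) x = 0 by rewrite D_cst.
apply: cplx_eq; rewrite /= !cRe_real !Z !D_fexp //.
 by gen_D => *; ring.
by gen_D => *; ring.
Qed.

Lemma Re_ge0 (z : C) : 0 <= z -> 0 <= complex.Re z.
Proof. by case: z => a b; rewrite lecE => /andP[]. Qed.

#[local] Transparent IntC.
Lemma Re_IntC_ge0 (F : E -> C) : (forall x, 0 <= complex.Re (F x)) -> 0 <= complex.Re (IntC F).
Proof. by move=> H; apply: Int_ge0 => x; exact: H. Qed.
#[local] Opaque IntC dzs cRe cIm.

Lemma fexp_fder_ge0 x : 0 <= fexp (fder 1) x :> R.
Proof.
have [x0|x0] := leP x 0; first by rewrite fexp0.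
by rewrite fexpE // /fder derivC subr0 mulr1 hornerXn mulr_ge0 ?sqr_ge0.
Qed.

Lemma fexp1E x : 0 < x -> fexp 1 x = expR (- x^-1) :> R.
Proof. by move=> x0; rewrite fexpE // hornerC mul1r. Qed.

Lemma fexp1_ge0 x : 0 <= fexp 1 x :> R.
Proof. by have [x0|x0] := leP x 0; [rewrite fexp0|rewrite fexp1E // expR_ge0]. Qed.

Lemma fexp1_gt0 x : 0 < x -> 0 < fexp 1 x :> R.
Proof. by move=> x0; rewrite fexp1E // expR_gt0. Qed.

Lemma fexp1_le x y : x <= y -> fexp 1 x <= fexp 1 y :> R.
Proof.
move=> xy; have [x0|x0] := leP x 0; first by rewrite [leLHS]fexp0 // fexp1_ge0.
by rewrite !fexp1E ?(lt_le_trans x0 xy) // ler_expR lerN2 lef_pV2 // posrE ?(lt_le_trans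
 x0 xy).
Qed.

Lemma fexp1_lip (b : R) : exists2 L, 0 <= L & forall x y, x <= b -> y <= b ->
 `|fexp 1 y - fexp 1 x| <= L * `|y - x|.
Proof.
have [C0 C0p HC] := fexp_le (fder 1 : {poly R}); exists (C0 * `|b|); first by pos.
move=> x y xb yb; pose g (t : R) := fexp 1 (x + t * (y - x)).
have dg (t : R) : 0 <= t <= 1 -> is_derive t 1 g (fexp (fder 1) (x + t * (y - x)) * (y -
 x)).
 move=> _; have d2 : is_derive t (1 : R) (fun t : R => x + t * (y - x)) (y - x).
  apply: is_deriveP => e e0; exists 1 => // k k0 _.
  rewrite -[k *: 1]/(k * 1) mulr1.
  have -> : (x + (t + k) * (y - x) - (x + t * (y - x))) / k - (y - x) = 0 by field.
  by rewrite normr0 ltW.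
 have H := (@is_derive1_comp R (fexp 1) (fun t : R => x + t * (y - x)) t _ _
  (is_derive_fexp 1 _) d2).
 by first [exact: H|rewrite [X in is_derive _ _ _ X]mulrC; exact: H].
have [t /andP[t0 t1]] := mvt01 dg; rewrite /g mul1r mul0r addr0 [x + (_ - _)]addrC subrK
 => ->.
rewrite normrM ler_wpM2r //; set z := x + _.
have zb : z <= b by rewrite /z; nra.
have [z0|z0] := leP z 0; first by rewrite fexp0 // normr0 mulr_ge0.
apply: le_trans (HC z) _; rewrite ler_wpM2l // !ger0_norm ?(ltW z0) //.
by apply: ltW; apply: lt_le_trans zb.
Qed.

(** Let [d = v - w]. Telescoping yields terms in which the Hessian of [d] is multiplied by Hessians
    of [v] and [w] and by an increasing function of [d]. One integration by parts turns each of them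
    into minus the integral of a nonnegative factor times the mixed discriminant of a rank one
    matrix and of nonnegative Hessians, which is nonnegative by [Mc_cone_ge0]. *)
Lemma comparison v w (c : R) : (0 < n)%N -> smooth v -> smooth w ->
 (exists r, forall x, r < enorm x -> v x - w x - c <= 0) ->
 (forall x, 0 < v x - w x - c -> forall xi, 0 <= levi (Hs v x) xi /\ 0 <= levi (Hs w x) xi) ->
 Int (fun x => fexp 1 (v x - w x - c) * (MAd (Hs v x) - MAd (Hs w x))) <= 0.
Proof.
move=> n0 sv sw [r Hr] Hp.
pose d x := v x - w x; pose phi x := fexp 1 (d x - c).
have sd : smooth d by exact: smooth_sub.
have sdc : smooth (fun x => d x - c) by apply: smooth_sub => //; exact: smooth_cst.
have cphi : Ccs phi.
 apply: (@Ccs_ball R (n + n) phi 0 r); first exact: smooth_fexp.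
 by move=> x; rewrite subr0 => /Hr; exact: fexp0.
have cM u : smooth u -> Cc0 (fun x => phi x * MAd (Hs u x)).
 by move=> su; apply: Cc0Mr; [exact: Ccs_Cc0|exact: smooth_cont (smooth_MAd su)].
have EI u : smooth u -> IntC (fun x => (phi x)%:C%C * mcf [set: 'I_n] [set: 'I_n] (nseq
 n (cHess u)) x) = (n`!%:R * Int (fun x => phi x * MAd (Hs u x)))%:C%C.
 move=> su; rewrite -IntZ; last exact: cM.
 have -> : (fun x => (phi x)%:C%C * mcf [set: 'I_n] [set: 'I_n] (nseq n (cHess u)) x) =
  fun x => (n`!%:R * (phi x * MAd (Hs u x)))%:C%C.
  by ext x; rewrite mcf_MAd // -rmorphM mulrCA.
 by apply: cplx_eq => //; rewrite -[RHS](@Int0 R (n + n)).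
have -> : (fun x => fexp 1 (v x - w x - c) * (MAd (Hs v x) - MAd (Hs w x))) = fun x =>
 phi x * MAd (Hs v x) - phi x * MAd (Hs w x) by ext x; rewrite mulrBr.
rewrite (IntB (cM v sv) (cM w sw)).
have f0 : 0 < n`!%:R :> R by [].
rewrite -(pmulr_rle0 _ f0) mulrBr.
have -> : n`!%:R * Int (fun x => phi x * MAd (Hs v x)) - n`!%:R * Int (fun x => phi x *
 MAd (Hs w x)) = complex.Re (\sum_(L <- teleT v w n) IntC (fun x => (phi x)%:C%C * mcf
 [set: 'I_n] [set: 'I_n] (cHess d :: map cHess L) x)).
 have EQ := IntC_tele [set: 'I_n]%SET [set: 'I_n]%SET n cphi sv sw.
 have ReB (a b : C) : complex.Re (a - b) = complex.Re a - complex.Re b by case: a; case: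
  b.
 apply: etrans _ (congr1 (@complex.Re R) EQ); rewrite ReB.
 congr (_ - _); first exact: (esym (congr1 (@complex.Re R) (EI v sv))).
 exact: (esym (congr1 (@complex.Re R) (EI w sw))).
rewrite (raddf_sum (@complex.Re R : Rcomplex R -> R)) big_seq.
apply: sumr_le0 => L; move: (teleT v w n) (@teleTP _ v w n) => s Hs' Ls.
have {Hs' Ls} HL : forall a, List.In a L -> a = v \/ a = w.
 suff /Hs'[] : List.In L s by [].
 by elim: s Ls {Hs'} => // a s IH; rewrite inE => /predU1P[->|/IH]; [left|right].
have sL g : List.In g L -> smooth g by move=> /HL[] ->.
have sG := csm_real sd; have cP := ccs_real cphi.
have sM I J : csm (mcf I J (map cHess L)) by exact: csm_mcfH.
rewrite (IntC_hess1 _ _ cphi sd sL).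
have cc i j : ccs (fun x => dzs 1 i (fun x => (phi x)%:C%C) x * dzs (-1) j (fun x => (d
 x)%:C%C) x * mcf ([set: 'I_n] :\ i) ([set: 'I_n] :\ j) (map cHess L) x).
 apply: ccsMr (sM _ _); apply: ccsMr (csm_dzs (-1) j sG); exact: ccs_dzs.
have cc' i j : ccs (fun x => (psgn [set: 'I_n]%SET i * psgn [set: 'I_n]%SET j) * (dzs 1
 i (fun x => (phi x)%:C%C) x * dzs (-1) j (fun x => (d x)%:C%C) x * mcf ([set: 'I_n] :\
 i) ([set: 'I_n] :\ j) (map cHess L) x)).
 by apply: ccsM; [exact: csm_cst|exact: cc].
pose F x := \sum_(i in [set: 'I_n]%SET) \sum_(j in [set: 'I_n]%SET) (psgn [set:
 'I_n]%SET i * psgn [set: 'I_n]%SET j) * (dzs 1 i (fun x => (phi x)%:C%C) x * dzs (-1) j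
 (fun x => (d x)%:C%C) x * mcf ([set: 'I_n] :\ i) ([set: 'I_n] :\ j) (map cHess L) x).
have -> : \sum_(i in [set: 'I_n]%SET) \sum_(j in [set: 'I_n]%SET) psgn [set: 'I_n]%SET i
 * (psgn [set: 'I_n]%SET j * IntC (fun x => dzs 1 i (fun x => (phi x)%:C%C) x * dzs (-1)
 j (fun x => (d x)%:C%C) x * mcf ([set: 'I_n] :\ i) ([set: 'I_n] :\ j) (map cHess L) x))
 = IntC F.
 rewrite /F (IntC_sum _ (fun i => ccs_sum _ (fun j => cc' i j))); ebig i.
 rewrite (IntC_sum _ (fun j => cc' i j)); ebig j.
 by rewrite (IntC_scale _ (cc i j)) mulrA.
have ReN (z : C) : complex.Re (- z) = - complex.Re z by case: z.
suff H0 : 0 <= complex.Re (IntC F) by rewrite -oppr_le0 -ReN in H0; exact: H0.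
apply: Re_IntC_ge0 => x.
(* The derivative of [phi] is [fexp (fder 1)] times that of [d], so the two first-order factors
   combine into a nonnegative multiple of the rank one matrix [W]. *)
pose W : 'I_n -> 'I_n -> C := rank1 (fun i => dzs 1 i (fun x => (d x)%:C%C) x).
have dphi i : dzs 1 i (fun x => (phi x)%:C%C) x = (fexp (fder 1) (d x - c))%:C%C * dzs 1
 i (fun x => (d x)%:C%C) x.
 rewrite (dzs_fexp 1 i x sdc); congr (_ * _).
 have -> : (fun x => (d x - c)%:C%C) = fun x => (d x)%:C%C + (- c)%:C%C.
  by ext y; rewrite rmorphD.
 have csc := @csm_cst R n (- c)%:C%C.
 have -> : (fun x => (d x)%:C%C + (- c)%:C%C) = fun x => \sum_(b : bool) (if b then (d
  x)%:C%C else (- c)%:C%C).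
  by ext y; rewrite big_bool.
 rewrite (@dzs_sum R n 1 i bool xpredT (fun b x => if b then (d x)%:C%C else (-
  c)%:C%C)) ?big_bool /=.
  by rewrite dzs_cst addr0.
 by case.
have FE : F x = (fexp (fder 1) (d x - c))%:C%C * Mc [set: 'I_n] [set: 'I_n] (W :: [seq
 (fun i j => V i j x) | V : fmat <- map cHess L]).
 rewrite -[Mc _ _ (_ :: _)]/(\sum_(i in _) \sum_(j in _) psgn _ i * psgn _ j * (W i j *
  mcf ([set: 'I_n] :\ i) ([set: 'I_n] :\ j) (map cHess L) x)).
 rewrite mulr_sumr; ebig i; rewrite mulr_sumr; ebig j.
 rewrite dphi dzs_conj /W /rank1.
 move: (psgn _ i) (psgn _ j) (mcf _ _ _ x) (dzs _ _ _ _) ((dzs _ _ _ _)^*) ((fexp _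
  _)%:C%C); clear.
 by move=> a b m y z f; rewrite [RHS]mulrCA; congr (_ * _); rewrite !mulrA.
have ReZ (a : R) (z : C) : complex.Re (a%:C%C * z) = a * complex.Re z.
 by case: z => z1 z2 /=; rewrite mul0r subr0.
rewrite FE; apply: le_trans _ (_ : fexp (fder 1) (d x - c) * complex.Re _ <= _); last
 first.
 by apply: le_of_eq; exact: (esym (ReZ _ _)).
have [d0|d0] := leP (d x - c) 0; first by rewrite fexp0 // mul0r.
rewrite mulr_ge0 ?fexp_fder_ge0 //; apply: Re_ge0; apply: Mc_cone_ge0 => V [<-|].
 exact: cone_rank1.
move=> /List.in_map_iff[V' [<- /List.in_map_iff[g [<- gL]]]].
by apply: cHess_cone; [exact: sL|move=> xi; have [? ?] := Hp x d0 xi; case: (HL g gL) =>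
 ->].
Qed.

Lemma dot_Jc xi : dot (Jc xi) (Jc xi) = dot xi xi.
Proof.
rewrite /dot !big_split_ord /= addrC; congr (_ + _); ebig i.
 by rewrite /Jc !row_mxEr !mxE.
by rewrite /Jc !row_mxEl !mxE mulrNN.
Qed.

Lemma qf_pert (H H' : 'I_(n + n) -> 'I_(n + n) -> R) e xi : (forall a b, `|H a b - H' a b| <= e) ->
 `|qf H xi - qf H' xi| <= (n + n)%:R * ((n + n)%:R * (e * dot xi xi)).
Proof.
move=> He; rewrite /qf -sumrB.
have t0 a b : `|xi ord0 a * xi ord0 b * H a b - xi ord0 a * xi ord0 b * H' a b| <= e *
 dot xi xi.
 rewrite -mulrBr normrM mulrC; apply: ler_pM => //; rewrite normrM -enorm_sqr expr2.
 by apply: ler_pM => //; exact: coord_le_enorm.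
apply: le_trans (ler_norm_sum _ _ _) _.
apply: le_trans (_ : \sum_(a < n + n) (n + n)%:R * (e * dot xi xi) <= _); last first.
 by rewrite sum_const.
apply: ler_sum => a _; rewrite -sumrB; apply: le_trans (ler_norm_sum _ _ _) _.
apply: le_trans (_ : \sum_(b < n + n) (e * dot xi xi) <= _); last first.
 by rewrite sum_const.
by apply: ler_sum => b _.
Qed.

Lemma levi_pert (H H' : 'I_(n + n) -> 'I_(n + n) -> R) e xi : (forall a b, `|H a b - H' a b| <= e) ->
 `|levi H xi - levi H' xi| <= (n + n)%:R * ((n + n)%:R * (e * dot xi xi)).
Proof.
move=> He; rewrite levi.unlock; have := qf_pert xi He; have := qf_pert (Jc xi) He;
 rewrite dot_Jc.
rewrite !ler_norml; lra.
Qed.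

Lemma bigmin_gt0 (T : finType) (f : T -> R) : (forall i, 0 < f i) -> 0 < \big[Num.min/1]_i f i.
Proof. by move=> H; elim/big_ind: _ => // x y x0 y0; rewrite lt_min x0. Qed.

(** A Levi form bounded below by a positive multiple of the square norm stays nonnegative under
    small changes of the second derivatives. *)
Lemma levi_near q x1 (c : R) : smooth q -> 0 < c -> (forall xi, c * dot xi xi <= levi (Hs q x1) xi) ->
 exists2 s, 0 < s & forall x, enorm (x - x1) < s -> forall xi, 0 <= levi (Hs q x) xi.
Proof.
move=> sq c0 Hc; pose e := c / ((n + n)%:R * (n + n)%:R + 1).
have e0 : 0 < e by pos.
have [s s0 Hs1] : exists2 s, 0 < s & forall x, enorm (x - x1) < s -> forall a b, `|Hs q
 x a b - Hs q x1 a b| < e.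
 have near a b : exists2 s, 0 < s & forall x, enorm (x - x1) < s -> `|Hs q x a b - Hs q
  x1 a b| < e.
  have ch : {for x1, continuous (fun x => D a (D b q) x)}.
   by apply: smooth_cont; do 2!apply: smoothD.
  by have /cont_enormP/(_ _ e0)[s s0 H] := ch; exists s.
 have nearb a : exists2 s, 0 < s & forall x, enorm (x - x1) < s -> forall b, `|Hs q x a
  b - Hs q x1 a b| < e.
  have [sf Hsf] := choice2 (near a).
  exists (\big[Num.min/1]_b sf b) => [|x xs b].
   by apply: bigmin_gt0 => b; case: (Hsf b).
  by have [_ H] := Hsf b; apply: H; apply: lt_le_trans xs _; exact: bigmin_le_cond.
 have [sf Hsf] := choice2 nearb.
 exists (\big[Num.min/1]_a sf a) => [|x xs a b].
  by apply: bigmin_gt0 => b; case: (Hsf b).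
 by have [_ H] := Hsf a; apply: H; apply: lt_le_trans xs _; exact: bigmin_le_cond.
exists s => [//|x xs xi].
have HH a b : `|Hs q x a b - Hs q x1 a b| <= e by exact/ltW/Hs1.
have := @levi_pert (Hs q x) (Hs q x1) e xi HH; have := Hc xi.
have d0 := dot_ge0 xi; rewrite ler_norml => h1 /andP[h2 _].
have h3 : (n + n)%:R * ((n + n)%:R * (e * dot xi xi)) <= c * dot xi xi.
 have eE : e * ((n + n)%:R * (n + n)%:R + 1) = c by rewrite /e divfK // gt_eqF ltr_wpDl.
 have -> : (n + n)%:R * ((n + n)%:R * (e * dot xi xi)) = (n + n)%:R * (n + n)%:R * e *
  dot xi xi.
  by rewrite !mulrA.
 apply: ler_wpM2r => //; rewrite -eE mulrDr mulr1 mulrC lerDl; exact: ltW.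
rewrite -(subrK (levi (Hs q x1) xi) (levi (Hs q x) xi)).
by apply: le_trans (lerD h2 (le_trans h3 h1)); rewrite addNr.
Qed.

End comparison.

(** * Integration against a measure with a given density *)

Section measure_comparison.
Context {R : realType}.
Import HBNNSimple.

(** Integrals are suprema over the simple functions below [f], and the nonzero level sets of these
    lie where [f] is positive. *)
Lemma le_measure_integral d (T : measurableType d) (m1 m2 : {measure set T -> \bar R})
  (f : T -> \bar R) : (forall x, 0 <= f x)%E ->
 (forall A, measurable A -> (forall x, A x -> (0 < f x)%E) -> (m1 A <= m2 A)%E) ->
 (\int[m1]_x f x <= \int[m2]_x f x)%E.
Proof.
move=> f0 H.
rewrite (@ge0_integralTE _ _ _ m1) // (@ge0_integralTE _ _ _ m2) //.
apply: ge_ereal_sup => _ [h hf <-]; apply: le_trans (ereal_sup_ubound _); last by exists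
 h.
rewrite !sintegralE; apply: lee_fsum => [|x [t _ <-]]; first by [].
have [->|h0] := eqVneq (h t) 0; first by rewrite !mul0e.
apply: lee_wpmul2l; first by rewrite lee_fin fun_ge0.
apply: H => [|y hy]; first exact: measurable_sfunP.
apply: lt_le_trans (hf y); rewrite lte_fin [h y]hy lt_neqAle eq_sym h0; exact: fun_ge0.
Qed.

(** The integral of a nonnegative function is a supremum over the simple functions below it, which
    is monotone for arbitrary functions. This suits the density in [MA_weak_solution], which is
    controlled on [Omega] only. *)
Lemma ge0_le_integral_nomeas d (T : measurableType d) (m : {measure set T -> \bar R})
  (D : set T) (f g : T -> \bar R) : (forall x, D x -> (0 <= f x)%E) ->
 (forall x, D x -> (f x <= g x)%E) -> (\int[m]_(x in D) f x <= \int[m]_(x in D) g x)%E.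
Proof.
move=> f0 fg; have g0 x : D x -> (0 <= g x)%E by move=> Dx; apply: le_trans (fg x Dx);
 exact: f0.
rewrite !ge0_integralE //; apply: ge_ereal_sup => _ [h hf <-]; apply: ereal_sup_ubound;
 exists h => // x.
apply: le_trans (hf x) _; rewrite !patchE; case: ifPn => // xD; apply: fg.
by move: xD; rewrite inE.
Qed.

(** On measurable sets where [phi] is positive, [mu] lies between [b] and [a] times Lebesgue
    measure. *)
Lemma density_bounds (N : nat) (Omega : set 'rV[R]_N) (f phi : 'rV[R]_N -> R)
  (mu : {measure set 'rV[R]_N -> \bar R}) x1 s (a b : R) :
 (forall A, measurable A -> A `<=` Omega -> mu A = (\int[lebesgue_rV R N]_(x in A) (f x)%:E)%E) ->
 (forall x, enorm (x - x1) <= s -> Omega x /\ b <= f x <= a) -> 0 <= b -> 0 <= a ->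
 continuous phi -> supp_ball phi x1 s -> (forall x, 0 <= phi x) ->
 b * Int phi <= (\int[mu]_(x in Omega) phi x)%R <= a * Int phi.
Proof.
move=> Hmu Hf b0 a0 cp sp p0.
have c0 : Cc0 phi := Cc0_ball cp sp.
have mp : measurable_fun setT (EFin \o phi) by apply/measurable_EFinP; exact:
 continuous_measurable_rV.
have ball x : (0 < (phi x)%:E)%E -> enorm (x - x1) <= s.
 by rewrite lte_fin => px; rewrite leNgt; apply/negP => /sp E0; rewrite E0 ltxx in px.
have -> : (\int[mu]_(x in Omega) phi x)%R = fine (\int[mu]_x (phi x)%:E)%E.
 rewrite Rintegral_mkcond /Rintegral; congr (fine (integral _ _ _)); ext x => /=.
 rewrite patchE; case: ifPn => // /negP xO; congr EFin; apply/esym; apply/eqP.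
 rewrite -[_ == _]negbK; apply/negP => px; apply: xO; rewrite inE.
 have : (0 < (phi x)%:E)%E by rewrite lte_fin lt_neqAle eq_sym px p0.
 by move=> /ball /Hf[].
have fin : (\int[lebesgue_rV R N]_x (phi x)%:E \is a fin_num)%E by apply:
 integrable_fin_num => //; exact: Cc0_integrable.
have IE : (Int phi)%:E = (\int[lebesgue_rV R N]_x (phi x)%:E)%E by rewrite /Int
 /Rintegral fineK.
have hup : (\int[mu]_x (phi x)%:E <= (a * Int phi)%:E)%E.
 rewrite EFinM IE -[a]/(NngNum a0)%:num -(ge0_integral_mscale (lebesgue_rV R N)
  measurableT (NngNum a0) mp); last by move=> x _; rewrite lee_fin.
 apply: le_measure_integral => [x|A mA HA]; first by rewrite lee_fin.
 rewrite Hmu //; last by move=> x /HA/ball/Hf[].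
 apply: le_trans (_ : (\int[lebesgue_rV R N]_(x in A) (cst a%:E) x <= _)%E).
  apply: ge0_le_integral_nomeas => x /HA/ball/Hf[_ /andP[? ?]]; rewrite lee_fin //.
  exact: le_trans b0 _.
 by rewrite integral_cst.
have hlo : ((b * Int phi)%:E <= \int[mu]_x (phi x)%:E)%E.
 rewrite EFinM IE -[b]/(NngNum b0)%:num -(ge0_integral_mscale (lebesgue_rV R N)
  measurableT (NngNum b0) mp); last by move=> x _; rewrite lee_fin.
 apply: le_measure_integral => [x|A mA HA]; first by rewrite lee_fin.
 rewrite Hmu //; last by move=> x /HA/ball/Hf[].
 apply: le_trans (_ : (_ <= \int[lebesgue_rV R N]_(x in A) (cst b%:E) x)%E) _.
  by rewrite integral_cst.
 by apply: ge0_le_integral_nomeas => x /HA/ball/Hf[_ /andP[? ?]]; rewrite lee_fin.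
have fm : (\int[mu]_x (phi x)%:E \is a fin_num)%E.
 rewrite ge0_fin_numE; first by apply: le_lt_trans hup _; rewrite ltry.
 by apply: integral_ge0 => x _; rewrite lee_fin.
by rewrite -lee_fin -[X in (_ <= X)%R]/(fine _) -!lee_fin fineK // hlo.
Qed.

End measure_comparison.

(** * Smooth functions touching a solution from below or from above *)

Section touching.
Context {R : realType} {n : nat}.
Local Notation E := 'rV[R]_(n + n).

(* Smooth approximations of u whose Monge-Ampere measures converge weakly, on
 the ball of radius r1, to a measure with continuous density f. *)
Record ma_approx (u f : E -> R) (us : nat -> E -> R) (dl : nat -> R) (I_mu : (E -> R) ->
 R) (z0 : E) (r1 : R) : Prop := MaApprox { ma_cont : continuous u; ma_smooth : forall j,
 smooth (us j); ma_dist : forall j x, `|us j x - u x| <= dl j; ma_small : forall e, 0 <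
 e -> exists J0 : nat, forall j, (J0 <= j)%N -> dl j <= e; ma_psd : exists J0 : nat,
 forall j, (J0 <= j)%N -> forall x, enorm (x - z0) <= r1 -> forall xi, 0 <= levi (Hs (us
 j) x) xi; ma_conv : forall phi, Ccs phi -> supp_ball phi z0 r1 -> forall e, 0 < e ->
 exists J0 : nat, forall j, (J0 <= j)%N -> `|Int (fun x => phi x * MAd (Hs (us j) x)) -
 I_mu phi| <= e; ma_dens : forall phi x1 s k, Ccs phi -> supp_ball phi x1 s -> (forall
 x, 0 <= phi x) -> (forall x, enorm (x - x1) <= s -> enorm (x - z0) <= r1 /\ `|f x - f
 x1| <= k) -> `|I_mu phi - f x1 * Int phi| <= k * Int phi; ma_dcont : forall x, enorm (x
 - z0) <= r1 -> {for x, continuous f} }.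

Let sqn x1 : smooth (fun x : E => dot (x - x1) (x - x1)).
Proof. exact: (smooth_shift (- x1) (@smooth_dot R (n + n))). Qed.

Lemma touching_arith (sg k fx p1 p2 c m1 m2 w : R) : sg = 1 \/ sg = -1 ->
 0 <= p2 -> 0 <= m1 -> 0 <= m2 -> `|p1 - p2| <= w * c -> p2 = 0 \/ sg * fx + 2 * k <= sg * m1 ->
 (sg * fx + 2 * k) * p2 - sg * (p2 * m2) - w * (c * m1 + c * m2) <= p1 * (sg * (m1 - m2)).
Proof.
move=> sg1 p20 m10 m20 lp H.
have h1 : (sg * fx + 2 * k) * p2 <= sg * m1 * p2 by case: H => [->|H]; [rewrite
 !mulr0|rewrite ler_wpM2r].
have h2 : `|(p1 - p2) * (sg * (m1 - m2))| <= w * c * (m1 + m2).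
 rewrite normrM; apply: ler_pM => //.
 have -> : `|sg * (m1 - m2)| = `|m1 - m2| by case: sg1 => ->; rewrite ?mul1r // mulN1r
  normrN.
 by apply: le_trans (ler_normB _ _) _; rewrite !ger0_norm.
move: h2; rewrite ler_norml => /andP[+ _]; move: h1.
lra.
Qed.

(** Integrated form of the contradiction in [touching]. Here [p] is a fixed weight, [pj] the weight
    for which comparison holds, [chi] a cutoff dominating their difference, and [mq], [mu] are the
    determinants of the test function and of an approximation. Of the margin [2 * k], one [k] pays
    for the oscillation of the density and one survives. *)
Lemma touching_key (sg k f1 w e' I1 I2 : R) (pj p chi mq mu : E -> R) : sg = 1 \/ sg = -1 ->
 Cc0 pj -> Cc0 p -> Cc0 chi -> continuous mq -> continuous mu -> (forall x, 0 <= p x) ->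
 (forall x, [/\ pj x = 0, p x = 0 & chi x = 0] \/ [/\ 0 <= mq x, 0 <= mu x, `|pj x - p x| <= w * chi x
  & p x = 0 \/ sg * f1 + 2 * k <= sg * mq x]) ->
 Int (fun x => pj x * (sg * (mq x - mu x))) <= 0 -> 0 <= w ->
 `|I1 - f1 * Int p| <= k * Int p -> `|Int (fun x => p x * mu x) - I1| <= e' ->
 `|Int (fun x => chi x * mu x) - I2| <= e' ->
 k * Int p <= e' + w * (`|Int (fun x => chi x * mq x) + I2| + e').
Proof.
move=> sg1 Cpj Cp Cchi cmq cmu p0 H comp w0 h1 h3 h2.
have sgn (a : R) : `|sg * a| = `|a| by case: sg1 => ->; rewrite ?mul1r // mulN1r normrN.
have C1i : Cc0 (fun x => p x * mu x) by exact: Cc0Mr.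
have C2i : Cc0 (fun x => chi x * mq x) by exact: Cc0Mr.
have C3i : Cc0 (fun x => chi x * mu x) by exact: Cc0Mr.
have point x : (sg * f1 + 2 * k) * p x + - sg * (p x * mu x) + - w * (chi x * mq x + chi
 x * mu x) <= pj x * (sg * (mq x - mu x)).
 case: (H x) => [[-> -> ->]|[a0 b0 lp D2]].
  by rewrite !mul0r !mulr0 !addr0 mulr0.
 by rewrite !mulNr; exact: touching_arith.
have CS : Cc0 (fun x => chi x * mq x + chi x * mu x) by exact: Cc0D.
have CA : Cc0 (fun x => (sg * f1 + 2 * k) * p x) by exact: Cc0Z.
have CB : Cc0 (fun x => - sg * (p x * mu x)) by exact: Cc0Z.
have CAB : Cc0 (fun x => (sg * f1 + 2 * k) * p x + - sg * (p x * mu x)) by exact: Cc0D.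
have CW : Cc0 (fun x => - w * (chi x * mq x + chi x * mu x)) by exact: Cc0Z.
have CR : Cc0 (fun x => pj x * (sg * (mq x - mu x))).
 by apply: Cc0Mr => //; apply: contM; [exact: cont_cst|exact: contB].
have := le_trans (Int_le (Cc0D CAB CW) CR point) comp.
rewrite (IntD CAB CW) (IntD CA CB) (IntZ _ Cp) (IntZ _ C1i) (IntZ _ CS) (IntD C2i C3i).
have {}h1 : sg * I1 - sg * (f1 * Int p) <= k * Int p.
 by rewrite -mulrBr; apply: le_trans (ler_norm _) _; rewrite sgn.
have {}h3 : sg * Int (fun x => p x * mu x) - sg * I1 <= e'.
 by rewrite -mulrBr; apply: le_trans (ler_norm _) _; rewrite sgn.
have {}h2 : Int (fun x => chi x * mu x) - I2 <= e' by exact: le_trans (ler_norm _) h2.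
set X := Int (fun x => chi x * mq x) in h2 *.
have q5 : w * (X + Int (fun x => chi x * mu x)) <= w * (`|X + I2| + e').
 by apply: ler_wpM2l => //; have := ler_norm (X + I2); lra.
have E1 : (sg * f1 + 2 * k) * Int p = sg * (f1 * Int p) + 2 * (k * Int p) by ring.
rewrite E1 !mulNr; move: h1 h3 q5.
move: (k * Int p) (sg * (f1 * _)) (sg * I1) (sg * Int _) (w * (`|_| + e')) (w * (_ +
 _)).
by move=> a1 a2 a3 a4 a5 a6; lra.
Qed.

Lemma touching_arith3 (sg a a1 b k : R) : `|sg * (a - a1)| < k -> sg * a1 = b + 3 * k ->
 b + 2 * k <= sg * a.
Proof.
move=> + E1; rewrite mulrBr E1 ltr_norml => /andP[+ _]; lra.
Qed.

Lemma touching_arith2 (L K e e' w di dj : R) : 0 <= L -> 0 <= K -> 0 <= di -> 0 < e' -> e' <= 1 ->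
 dj <= e' -> w = L * (dj + di) -> e' * (1 + L * (K + 1) + L * di) <= e ->
 e' + w * (K + e') <= L * di * K + e.
Proof.
move=> L0 K0 di0 e'0 e'1 dje -> He.
have h1 : L * (dj + di) * (K + e') <= L * (e' + di) * (K + e').
 by apply: ler_wpM2r; [exact: addr_ge0 K0 (ltW e'0)|apply: ler_wpM2l => //; rewrite
  lerD2r].
have le1 : L * e' * e' <= L * e' * 1 by apply: ler_wpM2l => //; exact: mulr_ge0 L0 (ltW
 e'0).
nra.
Qed.

(* [sg = 1]: q touches u from below; [sg = -1]: q touches u from above. *)
Lemma touching u f us dl I_mu z0 r1 (sg : R) q x1 (eta : R) : (0 < n)%N ->
 ma_approx u f us dl I_mu z0 r1 -> sg = 1 \/ sg = -1 -> smooth q -> 0 < eta ->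
 enorm (x1 - z0) < r1 ->
 (forall x, sg * (q x - u x) <= sg * (q x1 - u x1) - eta * dot (x - x1) (x - x1)) ->
 (exists2 s, 0 < s & forall x, enorm (x - x1) < s -> forall xi, 0 <= levi (Hs q x) xi) ->
 sg * MAd (Hs q x1) <= sg * f x1.
Proof.
move=> n0 [cu sus usu dl0 psd conv dens cf] sg1 sq eta0 x1r Hq [sp sp0 Hpsd]; rewrite
 leNgt; apply/negP => contra.
have dl_ge0 j : 0 <= dl j by exact: le_trans (usu j 0).
have sg2 : sg ^+ 2 = 1 by case: sg1 => ->; rewrite ?sqrrN expr1n.
have sgn (a : R) : `|sg * a| = `|a| by case: sg1 => ->; rewrite ?mul1r // mulN1r normrN.
(* A third of the violation: one share is spent on the oscillation of the determinant of [q], one on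
   that of [f], and one is left over. *)
pose k := (sg * MAd (Hs q x1) - sg * f x1) / 3.
have k0 : 0 < k by pos.
have kE : sg * MAd (Hs q x1) = sg * f x1 + 3 * k by rewrite /k; field.
clearbody k.
have cM : {for x1, continuous (fun x => MAd (Hs q x))} by exact: smooth_cont (smooth_MAd
 sq) x1.
have /cont_enormP/(_ _ k0)[s1 s10 Hs1] := cM.
have /cont_enormP/(_ _ k0)[s2 s20 Hs2] := cf _ (ltW x1r).
pose s := Num.min (Num.min s1 s2) (Num.min sp (r1 - enorm (x1 - z0))) / 3.
have m0 : 0 < Num.min (Num.min s1 s2) (Num.min sp (r1 - enorm (x1 - z0))).
 by rewrite !lt_min s10 s20 sp0 subr_gt0.
have s0 : 0 < s by pos.
have s3 : [/\ 3 * s <= s1, 3 * s <= s2, 3 * s <= sp & 3 * s <= r1 - enorm (x1 - z0)].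
 rewrite /s [3 * _]mulrC divfK //; split; by rewrite !ge_min lexx ?orbT.
case: s3 => t1 t2 t3 t4; clearbody s.
have ballr x : enorm (x - x1) <= 2 * s -> enorm (x - z0) <= r1.
 move=> h; apply: le_trans (ler_enormB x x1 z0) _; move: h t4 s0; clra.
(* The level [c] lies so little below the maximum [M] that [g0], and also [g j] for large [j], is
   positive only within distance [s] of [x1]. *)
pose M := sg * (q x1 - u x1); pose c := M - eta * s ^+ 2 / 2.
pose g j x := sg * (q x - us j x) - c.
pose g0 x := sg * (q x - u x) - c.
have es0 : 0 < eta * s ^+ 2 by pos.
have gg0 j x : `|g j x - g0 x| <= dl j.
 have -> : g j x - g0 x = - (sg * (us j x - u x)) by rewrite /g /g0; ring.
 by rewrite normrN sgn.
have g0_le x : g0 x <= eta * s ^+ 2 / 2 - eta * dot (x - x1) (x - x1).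
 by have := Hq x; rewrite /g0 /c -/M; clra.
have [J1 HJ1] := dl0 _ (divr_gt0 es0 (ltr0n R 2)); have [J2 HJ2] := psd.
have gpos j x : (J1 <= j)%N -> 0 < g j x -> enorm (x - x1) <= s.
 move=> /HJ1 dj gx; rewrite -ler_sqr ?nnegrE ?enorm_ge0 ?(ltW s0) // enorm_sqr.
 rewrite -(ler_pM2l eta0); have := g0_le x; have := gg0 j x.
 rewrite ler_norml => /andP[_]; move: gx dj; clra.
have sgsm j : smooth (g j).
 apply: smooth_sub; last exact: smooth_cst.
 by apply: smoothZ; apply: smooth_sub.
pose phi j x := fexp 1 (g j x).
have sphi j : smooth (phi j) by exact: smooth_fexp.
have supphi j : (J1 <= j)%N -> supp_ball (phi j) x1 s.
 move=> Jj x sx; apply: fexp0; rewrite leNgt; apply/negP => /(gpos j x Jj).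
 by rewrite leNgt sx.
have cphi j : (J1 <= j)%N -> Ccs (phi j) by move=> Jj; exact: Ccs_ball (supphi j Jj).
have phi0 j x : 0 <= phi j x by exact: fexp1_ge0.
pose b3 := 3 * s ^+ 2.
have b30 : 0 < b3 by pos.
pose chi x := (fexp 1 b3)^-1 * fexp 1 (4 * s ^+ 2 - dot (x - x1) (x - x1)).
have schi : smooth chi.
 apply: smoothZ; apply: smooth_fexp; apply: smooth_sub => //; exact: smooth_cst.
have chi0 x : 0 <= chi x by rewrite mulr_ge0 ?invr_ge0 ?fexp1_ge0.
have chi1 x : enorm (x - x1) <= s -> 1 <= chi x.
 move=> h; rewrite /chi mulrC ler_pdivlMr ?fexp1_gt0 // mul1r; apply: fexp1_le.
 have : enorm (x - x1) ^+ 2 <= s ^+ 2 by rewrite ler_sqr ?nnegrE ?enorm_ge0 ?(ltW s0).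
 by rewrite enorm_sqr /b3; clra.
have supchi : supp_ball chi x1 (2 * s).
 move=> x h; rewrite /chi [X in _ * X]fexp0 ?mulr0 //.
 have : (2 * s) ^+ 2 <= enorm (x - x1) ^+ 2.
  by rewrite ler_sqr ?nnegrE ?enorm_ge0 ?(ltW h) // mulr_ge0 // ltW.
 by rewrite enorm_sqr exprMn; clra.
have cchi : Ccs chi := Ccs_ball schi supchi.
have [L L0 HL] := @fexp1_lip R (eta * s ^+ 2).
have g0b x : g0 x <= eta * s ^+ 2.
 by have := g0_le x; have := mulr_ge0 (ltW eta0) (dot_ge0 (x - x1)); move: es0; clra.
have gb j x : (J1 <= j)%N -> g j x <= eta * s ^+ 2.
 move=> /HJ1 dj; have := g0_le x; have := mulr_ge0 (ltW eta0) (dot_ge0 (x - x1)).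
 have := gg0 j x; rewrite ler_norml => /andP[_]; move: es0 dj; clra.
pose phi_ x := fexp 1 (g0 x).
have cont_g0 : continuous g0.
 apply: contB; last exact: cont_cst.
 apply: contM; first exact: cont_cst.
 by apply: contB => //; exact: smooth_cont.
have cphi_ : continuous phi_.
 move=> x; apply: (@continuous_comp _ _ _ g0 (fexp 1)); first exact: cont_g0.
 exact: cont_fexp.
have supphi_ : supp_ball phi_ x1 s.
 move=> x sx; apply: fexp0; apply: le_trans (g0_le x) _.
 have : s ^+ 2 <= enorm (x - x1) ^+ 2 by rewrite ler_sqr ?nnegrE ?enorm_ge0 // ltW.
 by rewrite enorm_sqr -(ler_pM2l eta0); move: es0; clra.
have Cphi_ : Cc0 phi_ := Cc0_ball cphi_ supphi_.
have IP : 0 < Int phi_.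
 apply: (@Int_gt0 R (n + n) phi_ x1) => //; first by move=> x; exact: fexp1_ge0.
 apply: fexp1_gt0; rewrite /g0 /c -/M; move: es0; clra.
have supp0 h h' x : supp_ball h x1 s -> supp_ball h' x1 s -> ~ (enorm (x - x1) <= s) ->
 h x = h' x.
 by move=> H1 H2 /negP; rewrite -ltNge => sx; rewrite (H1 x sx) (H2 x sx).
have lip1 j i x : (J1 <= j)%N -> (J1 <= i)%N -> `|phi j x - phi i x| <= L * (dl j + dl
 i) * chi x.
 move=> Jj Ji; have [sx|nx] := boolP (enorm (x - x1) <= s); last first.
  rewrite (supp0 _ _ x (supphi j Jj) (supphi i Ji)) ?subrr ?normr0; last exact/negP.
  exact: mulr_ge0 (mulr_ge0 L0 (addr_ge0 (dl_ge0 j) (dl_ge0 i))) (chi0 x).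
 apply: le_trans (HL _ _ (gb i x Ji) (gb j x Jj)) _; rewrite -mulrA ler_wpM2l //.
 apply: le_trans (_ : dl j + dl i <= _); last by rewrite ler_peMr ?chi1 // addr_ge0.
 have := gg0 j x; have := gg0 i x; rewrite !ler_norml; clra.
have lip2 j x : (J1 <= j)%N -> `|phi j x - phi_ x| <= L * dl j * chi x.
 move=> Jj; have [sx|nx] := boolP (enorm (x - x1) <= s); last first.
  rewrite (supp0 _ _ x (supphi j Jj) supphi_) ?subrr ?normr0; last exact/negP.
  exact: mulr_ge0 (mulr_ge0 L0 (dl_ge0 j)) (chi0 x).
 apply: le_trans (HL _ _ (g0b x) (gb j x Jj)) _; rewrite -mulrA ler_wpM2l //.
 by apply: le_trans (gg0 j x) _; rewrite ler_peMr ?chi1.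
(* comparison with the approximations *)
have comp j : (J1 <= j)%N -> (J2 <= j)%N -> Int (fun x => phi j x * (sg * (MAd (Hs q x)
 - MAd (Hs (us j) x)))) <= 0.
 move=> Jj J2j; have bnd : exists r, forall x, r < enorm x -> g j x <= 0.
  exists (s + enorm x1) => x h; rewrite leNgt; apply/negP => /(gpos j x Jj).
  have := ler_enormB x x1 0; rewrite !subr0; move: h; clra.
 have psdj x : 0 < g j x -> forall xi, 0 <= levi (Hs q x) xi /\ 0 <= levi (Hs (us j) x)
  xi.
  move=> /(gpos j x Jj) h xi; split; first by apply: Hpsd; move: h t3 s0; clra.
  by apply: HJ2 => //; apply: ballr; move: h s0; clra.
 case: sg1 => E1.
  have EG x : g j x = q x - us j x - c by rewrite /g E1 mul1r.
  have := @comparison R n q (us j) c n0 sq (sus j).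
  have -> : (fun x => phi j x * (sg * (MAd (Hs q x) - MAd (Hs (us j) x)))) = fun x =>
   fexp 1 (q x - us j x - c) * (MAd (Hs q x) - MAd (Hs (us j) x)).
   by ext x; rewrite /phi EG E1 mul1r.
  by apply=> [|x]; [move: bnd => [r Hr]; exists r => x /Hr; rewrite EG|rewrite -EG;
   exact: psdj].
 have EG x : g j x = us j x - q x - c by rewrite /g E1 mulN1r opprB.
 have := @comparison R n (us j) q c n0 (sus j) sq.
 have -> : (fun x => phi j x * (sg * (MAd (Hs q x) - MAd (Hs (us j) x)))) = fun x =>
  fexp 1 (us j x - q x - c) * (MAd (Hs (us j) x) - MAd (Hs q x)).
  by ext x; rewrite /phi EG; congr (_ * _); rewrite E1 mulN1r opprB.
 apply=> [|x]; first by move: bnd => [r Hr]; exists r => x /Hr; rewrite EG.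
 by rewrite -(EG x) => h xi; have [h1 h2] := psdj x h xi; split; [exact: h2|exact: h1].
clearbody phi phi_ chi g g0 c M b3.
pose K := Int (fun x => chi x * MAd (Hs q x)) + I_mu chi.
have cMq := smooth_cont (smooth_MAd sq).
have cMu j := smooth_cont (smooth_MAd (sus j)).
have CM (h v : E -> R) : Ccs h -> smooth v -> Cc0 (fun x => h x * MAd (Hs v x)).
 by move=> ch sv; apply: Cc0Mr; [exact: Ccs_Cc0|exact: smooth_cont (smooth_MAd sv)].
have Cchi := Ccs_Cc0 cchi.
have rz h y : supp_ball h x1 y -> y <= 2 * s -> supp_ball h z0 r1.
 move=> sh yl x xr; apply: sh; rewrite ltNge; apply/negP => hy.
 by move: xr; rewrite ltNge ballr //; apply: le_trans yl.
have Mq0 x : enorm (x - x1) <= 2 * s -> 0 <= MAd (Hs q x).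
 move=> h; apply: MAd_ge0; first exact: symH_Hs.
 by apply: Hpsd; move: h t3 s0; clra.
have Mu0 j x : (J2 <= j)%N -> enorm (x - x1) <= 2 * s -> 0 <= MAd (Hs (us j) x).
 by move=> J2j h; apply: MAd_ge0; [exact: symH_Hs|apply: HJ2 => //; exact: ballr].
(* Weak convergence tests against a fixed function, so the weight [phi i] is frozen while [us j]
   tends to [u]; the change from [phi j] to [phi i] is controlled by [lip1]. *)
have key i : (J1 <= i)%N -> k * Int (phi i) <= L * dl i * `|K|.
 move=> J1i; apply/ler_addgt0Pr => e e0.
 have W0 : 0 < 1 + L * (`|K| + 1) + L * dl i.
  by rewrite -addrA ltr_pwDl // addr_ge0 // mulr_ge0 // addr_ge0.
 pose e' := Num.min 1 (e / (1 + L * (`|K| + 1) + L * dl i)).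
 have e'0 : 0 < e' by rewrite lt_min ltr01 divr_gt0.
 have [J3 HJ3] := conv _ (cphi i J1i) (rz _ _ (supphi i J1i) (ler_peMl (ltW s0) (ler1n R
  2))) _ e'0.
 have [J4 HJ4] := conv _ cchi (rz _ _ supchi (lexx _)) _ e'0.
 have [J5 HJ5] := dl0 _ e'0.
 pose j := maxn (maxn J1 J2) (maxn (maxn J3 J4) J5).
 have [g1 g2 g3 g4 g5] : [/\ (J1 <= j)%N, (J2 <= j)%N, (J3 <= j)%N, (J4 <= j)%N & (J5 <=
  j)%N].
  by rewrite /j !leq_max !leqnn !orbT.
 pose w := L * (dl j + dl i).
 have w0 : 0 <= w by pos.
 have wE : w = L * (dl j + dl i) by [].
 have lipw x : `|phi j x - phi i x| <= w * chi x by exact: lip1.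
 have e'1 : e' <= 1 by rewrite ge_min lexx.
 have e'e : e' * (1 + L * (`|K| + 1) + L * dl i) <= e.
  by rewrite -ler_pdivlMr // ge_min lexx orbT.
 have KE : K = Int (fun x => chi x * MAd (Hs q x)) + I_mu chi by [].
 clearbody w j e' K.
 have r1' : `|I_mu (phi i) - f x1 * Int (phi i)| <= k * Int (phi i).
  apply: (dens _ _ _ _ (cphi i J1i) (supphi i J1i) (phi0 i)) => x h; split.
   by apply: ballr; move: h s0; clra.
  by apply/ltW/Hs2; move: h t2 s0; clra.
 apply: le_trans (_ : e' + w * (`|K| + e') <= _); last first.
  exact: touching_arith2 L0 (normr_ge0 K) (dl_ge0 i) e'0 e'1 (HJ5 _ g5) wE e'e.
 rewrite KE; apply: (@touching_key sg k (f x1) w e' (I_mu (phi i)) (I_mu chi) (phi j)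
  (phi i) chi (fun x => MAd (Hs q x)) (fun x => MAd (Hs (us j) x)) sg1 _ _ Cchi cMq (cMu
  j) (phi0 i) _ (comp j g1 g2) w0 r1' (HJ3 j g3) (HJ4 j g4)).
 - exact: Ccs_Cc0 (cphi j g1).
 - exact: Ccs_Cc0 (cphi i J1i).
 - move=> x; have [sx|nx] := boolP (enorm (x - x1) <= 2 * s); last first.
   move: nx; rewrite -ltNge => nx; have nx' : s < enorm (x - x1) by move: nx s0; clra.
   by left; split; [exact: supphi g1 _ nx'|exact: supphi J1i _ nx'|exact: supchi].
  right; split; [exact: Mq0|exact: Mu0|exact: lipw|].
  have [sx1|nx1] := boolP (enorm (x - x1) <= s); last first.
   by left; move: nx1; rewrite -ltNge => nx1; exact: supphi.
  right; have h1 : `|sg * (MAd (Hs q x) - MAd (Hs q x1))| < k.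
   by rewrite sgn; apply: Hs1; move: sx1 t1 s0; clra.
  exact: touching_arith3 h1 kE.
(* As [i] grows, the right-hand side of [key] tends to zero while the integral of [phi i] stays near
   that of [phi_], which is positive: a contradiction. *)
pose W := L * `|K| + k * L * Int chi + 1.
have W0 : 0 < W.
 have i0 : 0 <= Int chi by exact: Int_ge0.
 have := mulr_ge0 L0 (normr_ge0 K); have := mulr_ge0 (mulr_ge0 (ltW k0) L0) i0.
 by rewrite /W; clra.
have e1 : 0 < k * Int phi_ / (2 * W) by pos.
have [J3 HJ3] := dl0 _ e1; pose i := maxn J1 J3.
have Ji : (J1 <= i)%N by rewrite leq_maxl.
have di : dl i <= k * Int phi_ / (2 * W) by apply: HJ3; rewrite leq_maxr.
have k1 := key i Ji.
have CX : Cc0 (fun x => phi_ x - L * dl i * chi x) by apply: Cc0B => //; exact: Cc0Z.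
have k2 : Int phi_ - L * dl i * Int chi <= Int (phi i).
 rewrite -IntZ // -IntB //; last exact: Cc0Z.
 apply: Int_le => // [|x]; first exact: Ccs_Cc0 (cphi i Ji).
 by have := lip2 i x Ji; rewrite ler_norml => /andP[+ _]; clra.
have k3 : k * (Int phi_ - L * dl i * Int chi) <= k * Int (phi i) by rewrite ler_wpM2l //
 ltW.
have k4 : dl i * W <= k * Int phi_ / 2.
 have := ler_wpM2r (ltW W0) di.
 have -> : k * Int phi_ / (2 * W) * W = k * Int phi_ / 2 by field; rewrite gt_eqF.
 by [].
have k5 : 0 < k * Int phi_ by pos.
have k6 := dl_ge0 i.
move: k1 k3 k4 k5 k6; rewrite /W; move: (Int phi_) (Int (phi i)) (Int chi) (dl i) (`|K|)
 => a b d t v; clear; nra.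
Qed.

End touching.

(** * Elementary inequalities for the discrete heat flow *)

Section heat_arithmetic.
Context {R : realType}.

Lemma norm_tri (a b c x y : R) : `|a - b| <= x -> `|b - c| <= y -> `|a - c| <= x + y.
Proof. by move=> h1 h2; apply: le_trans (ler_distD b a c) _; exact: lerD. Qed.

Lemma heat_ar7 (e M : R) : e <= 1 -> 1 + (e + M) <= M + 2.
Proof. lra. Qed.

Lemma heat_ar1 (h2 J T e : R) : 0 < T -> T <= 1 -> 0 < e -> h2 * J = T -> J * (h2 * (e / T + e)) <= 2 * e.
Proof.
move=> T0 T1 e0 hJ; have -> : J * (h2 * (e / T + e)) = e / T * T + e * T by rewrite -hJ;
 ring.
rewrite divfK; have := ler_piMr (ltW e0) T1; lra.
Qed.

Lemma heat_ar2 (gam BL e a b : R) : gam <= b + BL -> b - a <= e -> gam - BL - e <= a.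
Proof. lra. Qed.

Lemma heat_ar3 (F0 w1 w0 h2 L e eT jr X : R) : - (h2 * e) <= w1 - (w0 + h2 * L) ->
 F0 <= eT - jr * h2 * (X - 2 * e) -> h2 * (X - e) <= h2 * L ->
 F0 - (w1 - w0) <= eT - (jr + 1) * h2 * (X - 2 * e).
Proof.
by lra.
Qed.

Lemma heat_ar4 (B d e eT w u : R) : `|u - w| <= eT -> 0 <= B * d -> u - (w + B * d) <= eT.
Proof. by rewrite ler_norml => /andP[_ a] b; lra. Qed.

Lemma heat_ar5 (t e u w : R) : `|u - w| <= 3 * e -> 7 * e <= t -> 0 < e -> u - (w + t) < - (3 * e).
Proof. by rewrite ler_norml => /andP[_ a] b c; lra. Qed.

(** Lets an auxiliary parameter tend to zero in an inequality whose error is linear in it. *)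
Lemma le_lim0 (a b C : R) : (forall e, 0 < e <= 1 -> a <= b + e * C) -> a <= b.
Proof.
move=> H; rewrite leNgt; apply/negP => ba; have C1 : 0 < 2 * (`|C| + 1) by [].
have [e0 e1 eC] : [/\ 0 < Num.min 1 ((a - b) / (2 * (`|C| + 1))), Num.min 1 ((a - b) /
 (2 * (`|C| + 1))) <= 1 & Num.min 1 ((a - b) / (2 * (`|C| + 1))) <= (a - b) / (2 * (`|C|
 + 1))].
 by rewrite lt_min ltr01 divr_gt0 ?subr_gt0 // !ge_min !lexx orbT.
move: (Num.min _ _) e0 e1 eC => e e0 e1; rewrite ler_pdivlMr // => eC.
have := H e; rewrite e0 e1 => /(_ isT) H1.
have : e * C <= e * (`|C| + 1) by rewrite ler_pM2l; have := ler_norm C; lra.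
by move: eC H1 ba; rewrite mulrCA; lra.
Qed.

Lemma step_size (T d : R) : 0 < T -> 0 < d -> exists h (J : nat), [/\ 0 <= h < d, h ^+ 2 * J%:R = T & h ^+ 2 <= d ^+ 2].
Proof.
move=> T0 d0; have [J J0 HJ] := @small_inv R T ((d / 2) ^+ 2) (exprn_gt0 2 (divr_gt0 d0
 (ltr0n _ 2))).
have TJ : 0 <= T / J%:R by pos.
have hd : Num.sqrt (T / J%:R) <= d / 2.
 have d20 : 0 <= d / 2 by pos.
 by rewrite -(ger0_norm d20) -sqrtr_sqr ler_wsqrtr.
exists (Num.sqrt (T / J%:R)), J; rewrite sqrtr_ge0 sqr_sqrtr // divfK ?pnatr_eq0 -?lt0n
 //; split => //.
 by apply: le_lt_trans hd _; lra.
by apply: le_trans HJ _; rewrite ler_sqr ?nnegrE; lra.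
Qed.

Lemma heat_ar6 (e T a b up wp wl ul gam c IL W M1 wA : R) : 0 < T -> T <= 1 -> 0 < e ->
 up - wA <= e * T - T * (gam - e * c) ->
 `|wA - (wp + T * wl)| <= T * (e * (M1 + 2)) * W -> `|up - wp| <= e * T ->
 `|ul - wl| <= e * T * IL -> 0 <= IL -> gam <= ul + e * (2 + c + (M1 + 2) * W + IL).
Proof.
move=> T0 T1 e0 h1; rewrite !ler_norml => /andP[h2 h2'] /andP[h3 _] /andP[h4 _] IL0.
have h5 : T * gam <= T * (wl + e * (2 + c + (M1 + 2) * W)).
 move: h1 h2' h3; have -> : T * (e * (M1 + 2)) * W = T * e * ((M1 + 2) * W) by ring.
 move: ((M1 + 2) * W) => Q a1 a2 a3.
 move: a1 a2 a3; rewrite mulrBr; lra.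
rewrite ler_pM2l // in h5.
have h6 : e * T * IL <= e * IL by rewrite ler_wpM2r // ler_piMr // ltW.
by rewrite !mulrDr; lra.
Qed.

End heat_arithmetic.

(** * A discrete heat flow, from inequalities at contact points to averaged inequalities *)

Section discrete_heat.
Context {R : realType} {N K : nat}.
Local Notation E := 'rV[R]_N.
Variable eta : 'I_K -> E.
Implicit Types (u w g q psi : E -> R) (x z v : E) (h e : R).

#[local] Opaque Int HF.

Let cK : R := (2 * K%:R)^-1.

Let cK0 : 0 <= cK. Proof. by pos. Qed.

Definition Lop q x : R := cK * \sum_k HF q (eta k) x.

(** One step of the symmetric random walk with directions [eta k]. By [Ah_taylor] it adds
    [h ^+ 2 * Lop] to first order, so [J] steps with [h ^+ 2 * J = T] approximate the heat flow of
    [Lop] up to time [T]. *)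
Definition Ah h g x : R := cK * \sum_k (g (x + h *: eta k) + g (x - h *: eta k)).

Lemma Ah_lin h g q c : Ah h (fun x => g x + c * q x) = fun x => Ah h g x + c * Ah h q x.
Proof.
ext x; rewrite /Ah [c * (cK * _)]mulrCA -mulrDr; congr (_ * _).
rewrite mulr_sumr -big_split.
by ebig k; rewrite mulrDr addrACA.
Qed.

Lemma iter_lin h j g q c : iter j (Ah h) (fun x => g x + c * q x) =
 fun x => iter j (Ah h) g x + c * iter j (Ah h) q x.
Proof. by elim: j => //= j ->; rewrite Ah_lin. Qed.

Lemma Ah_diff h g q (M : R) : (0 < K)%N -> (forall x, `|g x - q x| <= M) -> forall x, `|Ah h g x - Ah h q x| <= M.
Proof.
move=> K0 H x; rewrite /Ah -mulrBr -sumrB normrM (ger0_norm cK0) /cK mulrC ler_pdivrMr;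
 last first.
 by rewrite mulr_gt0 // ltr0n.
apply: le_trans (ler_norm_sum _ _ _) _.
apply: le_trans (_ : \sum_(k < K) 2 * M <= _); last first.
 by rewrite sum_const; apply: le_of_eq; ring.
apply: ler_sum => k _.
rewrite opprD addrACA; apply: le_trans (ler_normD _ _) _.
by rewrite mulr_natl mulr2n lerD.
Qed.

Lemma iter_diff h j g q (M : R) : (0 < K)%N -> (forall x, `|g x - q x| <= M) ->
 forall x, `|iter j (Ah h) g x - iter j (Ah h) q x| <= M.
Proof. by move=> K0 H; elim: j => // j IH; exact: Ah_diff. Qed.

Lemma smooth_Ah h g : smooth g -> smooth (Ah h g).
Proof.
move=> sg; apply: smoothZ; apply: smooth_sum => k.
by apply: smooth_add; exact: smooth_shift.
Qed.

Lemma cont_Ah h g : continuous g -> continuous (Ah h g).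
Proof.
move=> cg; apply: contM; first exact: cont_cst.
by apply: cont_sum => k; apply: contD; exact: cont_shift.
Qed.

Lemma Cc0_Ah h g : Cc0 g -> Cc0 (Ah h g).
Proof.
move=> cg; apply: Cc0Z; apply: Cc0_sum => k.
by apply: Cc0D; exact: Cc0_shift.
Qed.

Lemma D_Ah h g i : smooth g -> D i (Ah h g) = Ah h (D i g).
Proof.
move=> sg; have ss a := smooth_shift a sg; have pg := smooth_pd sg.
have s2 k : smooth (fun x => g (x + h *: eta k) + g (x - h *: eta k)) by exact:
 smooth_add.
have Ek k : D i (fun x => g (x + h *: eta k) + g (x - h *: eta k)) = fun x => D i g (x +
 h *: eta k) + D i g (x - h *: eta k).
 by rewrite (D_add i (smooth_pd (ss _)) (smooth_pd (ss _))) (D_shift _ _ pg) (D_shift _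
  _ pg).
rewrite /Ah (DZ _ i (smooth_pd (smooth_sum _ _ s2))) (D_sum _ _ i s2).
by ext x; congr (_ * _); ebig k; rewrite Ek.
Qed.

Lemma DL_Ah h g v : smooth g -> DL (Ah h g) v = Ah h (DL g v).
Proof.
move=> sg; ext x; rewrite /DL; under eq_bigr do rewrite D_Ah //.
rewrite /Ah; under eq_bigr do rewrite mulrCA mulr_sumr.
rewrite -mulr_sumr exchange_big; congr (_ * _); ebig k.
by rewrite -big_split; ebig i; rewrite mulrDr.
Qed.

#[local] Transparent HF.
Lemma HF_Ah h g v : smooth g -> HF (Ah h g) v = Ah h (HF g v).
Proof.
move=> sg; ext x; rewrite /HF DL_Ah //.
by rewrite DL_Ah //; exact: smooth_DL.
Qed.
#[local] Opaque HF.


Lemma Ccs_Lop q : Ccs q -> Ccs (Lop q).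
Proof. by move=> sq; apply: CcsZ; apply: Ccs_sum => k; exact: Ccs_HF. Qed.

Lemma Lop_Ah h g : smooth g -> Lop (Ah h g) = Ah h (Lop g).
Proof.
move=> sg; ext x; rewrite /Lop.
have Ek k : HF (Ah h g) (eta k) x = Ah h (HF g (eta k)) x by rewrite HF_Ah.
transitivity (cK * \sum_k Ah h (HF g (eta k)) x); first by congr (_ * _); ebig k; exact:
 Ek.
rewrite /Ah -mulr_sumr exchange_big mulrCA; congr (_ * _).
rewrite mulr_sumr; ebig k; rewrite big_split mulrDr //.
Qed.

Lemma smooth_iter h j g : smooth g -> smooth (iter j (Ah h) g).
Proof. by move=> sg; elim: j => // j; exact: smooth_Ah. Qed.

Lemma Lop_iter h j g : smooth g -> Lop (iter j (Ah h) g) = iter j (Ah h) (Lop g).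
Proof. by move=> sg; elim: j => // j IH; rewrite Lop_Ah ?IH //; exact: smooth_iter. Qed.

(** Every direction of the walk occurs with both signs, so translating the integration variable
    moves the step to the other factor. *)
Lemma Int_Ah h g psi : continuous g -> Cc0 psi ->
 Int (fun x => g x * Ah h psi x) = Int (fun x => Ah h g x * psi x).
Proof.
move=> cg cp; have cM (a : E) (f : E -> R) : continuous f -> Cc0 (fun x => f x * psi (x
 + a)).
 by move=> cf; apply: Cc0M => //; exact: Cc0_shift.
have sh a : Int (fun x => g x * psi (x + a)) = Int (fun x => g (x - a) * psi x).
 rewrite -(Int_shift (- a) (cM a g cg)); congr Int; ext x.
 by rewrite subrK.
have cg' a : continuous (fun x => g (x + a)) by exact: cont_shift.
have c0 (f : E -> R) : continuous f -> Cc0 (fun x => f x * psi x) by move=> cf; exact: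
 Cc0M.
have -> : (fun x => g x * Ah h psi x) = fun x => cK * \sum_k (g x * psi (x + h *: eta k)
 + g x * psi (x - h *: eta k)).
 by ext x; rewrite /Ah mulrCA; congr (_ * _); rewrite mulr_sumr; ebig k; rewrite mulrDr.
have -> : (fun x => Ah h g x * psi x) = fun x => cK * \sum_k (g (x + h *: eta k) * psi x
 + g (x - h *: eta k) * psi x).
 by ext x; rewrite /Ah -mulrA; congr (_ * _); rewrite mulr_suml; ebig k; rewrite mulrDl.
have c1 k : Cc0 (fun x => g x * psi (x + h *: eta k) + g x * psi (x - h *: eta k)).
 by apply: Cc0D; exact: cM.
have c2 k : Cc0 (fun x => g (x + h *: eta k) * psi x + g (x - h *: eta k) * psi x).
 by apply: Cc0D; exact: c0.
rewrite !IntZ; [|exact: Cc0_sum|exact: Cc0_sum]; congr (_ * _).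
rewrite !Int_sum //; ebig k.
rewrite (IntD (cM _ _ cg) (cM _ _ cg)) (IntD (c0 _ (cg' _)) (c0 _ (cg' _))) !sh opprK
 addrC //.
Qed.

Lemma Int_iter h j g psi : continuous g -> Cc0 psi ->
 Int (fun x => g x * iter j (Ah h) psi x) = Int (fun x => iter j (Ah h) g x * psi x).
Proof.
elim: j g psi => // j IH g psi cg cp.
rewrite -[iter j.+1 _ g]/(Ah h _) iterSr IH //; last exact: Cc0_Ah.
have ci : continuous (iter j (Ah h) g) by elim: j {IH} => // j; exact: cont_Ah.
by rewrite -Int_Ah.
Qed.

Lemma HF_scale_dir g v c x : smooth g -> HF g (c *: v) x = c ^+ 2 * HF g v x.
Proof.
move=> sg; rewrite !HFE // mulr_sumr; ebig i; rewrite mulr_sumr; ebig j.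
by rewrite !mxE; ring.
Qed.

Lemma finite_min (P : 'I_K -> R -> Prop) :
 (forall k, exists2 d : R, 0 < d & forall h, `|h| < d -> P k h) ->
 exists2 d : R, 0 < d & forall h, `|h| < d -> forall k, P k h.
Proof.
move=> H; have [f Hf] := choice2 H.
exists (\big[Num.min/1]_k f k) => [|h hd k].
 by elim/big_ind: _ => // [a b a0 b0|k _]; [rewrite lt_min a0|case: (Hf k)].
by have [_] := Hf k; apply; apply: lt_le_trans hd _; exact: bigmin_le_cond.
Qed.

Lemma Ah_taylor g e : (0 < K)%N -> Ccs g -> 0 < e -> exists2 d : R, 0 < d & forall h, `|h| < d -> forall x,
 `|Ah h g x - (g x + h ^+ 2 * Lop g x)| <= h ^+ 2 * e.
Proof.
move=> K0 cg e0; have sg := cg.1.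
have [d d0 Hd] : exists2 d : R, 0 < d & forall h, `|h| < d -> forall k x, `|g (x + h *:
 eta k) + g (x - h *: eta k) - 2 * g x - h ^+ 2 * HF g (eta k) x| <= h ^+ 2 * e.
 apply: finite_min => k.
 have [d d0 Hd] := Cc0_unif (Ccs_Cc0 (Ccs_HF (eta k) cg)) e0.
 exists (d / (enorm (eta k) + 1)) => [|h hd x]; first by pos.
 apply: second_diff => // t t1; rewrite !HF_scale_dir // -mulrBr normrM ger0_norm
  ?sqr_ge0 //.
 apply: ler_wpM2l; first exact: sqr_ge0.
 apply/ltW/Hd; rewrite addrAC subrr add0r scalerA enormZ normrM.
 rewrite ltr_pdivlMr ?ltr_wpDl ?enorm_ge0 // in hd; apply: le_lt_trans hd.
 rewrite -mulrA; apply: le_trans (ler_piMl _ t1) _; first by pos.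
 by rewrite ler_wpM2l // lerDl.
exists d => // h hd x; have Hk := Hd h hd.
have -> : Ah h g x - (g x + h ^+ 2 * Lop g x) = cK * \sum_k (g (x + h *: eta k) + g (x -
 h *: eta k) - 2 * g x - h ^+ 2 * HF g (eta k) x).
 have -> : \sum_k (g (x + h *: eta k) + g (x - h *: eta k) - 2 * g x - h ^+ 2 * HF g
  (eta k) x) = \sum_k (g (x + h *: eta k) + g (x - h *: eta k)) - K%:R * (2 * g x) - h
  ^+ 2 * \sum_k HF g (eta k) x.
  rewrite (sumrB _ _ (fun k => _ - _)) (sumrB _ _ (fun k => _ + _)) -mulr_sumr
   sumr_const card_ord.
  by rewrite -mulr_sumr -[g x *+ K]mulr_natl [2 * (K%:R * _)]mulrCA.
 rewrite /Ah /Lop; set S1 := (\sum_k (_ + _)); set S2 := (\sum_k HF _ _ _); move: S1 S2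
  => S1 S2.
 have c1 : cK * (K%:R * 2) = 1 by rewrite /cK mulrC [2 * _]mulrC divff // mulf_neq0 //
  pnatr_eq0 -lt0n.
 have -> : cK * (S1 - K%:R * (2 * g x) - h ^+ 2 * S2) = cK * S1 - (cK * (K%:R * 2)) * g
  x - h ^+ 2 * (cK * S2).
  by ring.
 by rewrite c1 mul1r opprD addrA.
rewrite normrM (ger0_norm cK0) /cK mulrC ler_pdivrMr; last by rewrite mulr_gt0 // ltr0n.
apply: le_trans (ler_norm_sum _ _ _) _.
apply: le_trans (_ : \sum_(k < K) h ^+ 2 * e <= _); first by apply: ler_sum.
rewrite sum_const mulrC.
have X0 : 0 <= h ^+ 2 * e by pos.
apply: ler_wpM2l; first exact: X0.
by rewrite ler_peMl ?ler1n.
Qed.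

Lemma smooth_sqr x0 : smooth (fun x : E => dot (x - x0) (x - x0)).
Proof. exact: (smooth_shift (- x0) (@smooth_dot R N)). Qed.

#[local] Transparent HF.
Lemma HF_sqr x0 v x : HF (fun x : E => dot (x - x0) (x - x0)) v x = 2 * dot v v.
Proof.
have E1 j : D j (fun x : E => dot (x - x0) (x - x0)) = fun x => 2 * (x - x0) ord0 j.
 by rewrite (D_shift (- x0) j (smooth_pd (@smooth_dot R N))) D_dot.
rewrite HFE; last exact: smooth_sqr.
have sc j : smooth (fun x : E => 2 * x ord0 j) by apply: smoothZ; exact: smooth_coord.
have E2 i j : D i (D j (fun x : E => dot (x - x0) (x - x0))) x = 2 * (i == j)%:R.
 by rewrite E1 (D_shift (- x0) i (smooth_pd (sc j))) (DZ _ i (pdiff_coord _)) D_coord.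
rewrite /dot mulr_sumr; ebig i; rewrite (bigD1 i) //= E2 eqxx big1 ?addr0.
 by rewrite mulr1; ring.
by move=> j ji; rewrite E2 eq_sym (negbTE ji) !mulr0.
Qed.

Lemma HF_addZ g q c v x : smooth g -> smooth q -> HF (fun x => g x + c * q x) v x = HF g v x + c * HF q v x.
Proof.
move=> sg sq; have sc := smoothZ c sq; rewrite !HFE //; last exact: smooth_add.
rewrite mulr_sumr -big_split; ebig i; rewrite mulr_sumr -big_split; ebig j => /=.
have -> : D i (D j (fun x => g x + c * q x)) x = D i (D j g) x + c * D i (D j q) x.
 rewrite (D_add j (smooth_pd sg) (smooth_pd sc)) (DZ c j (smooth_pd sq)).
 have s1 := smoothD j sg; have s2 := smoothD j sq.
 by rewrite (D_add i (smooth_pd s1) (smooth_pd (smoothZ c s2))) (DZ c i (smooth_pd s2)).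
move: (D i (D j g) x) (D i (D j q) x) (v ord0 i) (v ord0 j) => a b d e; ring.
Qed.
#[local] Opaque HF.

Definition Lsqr : R := K%:R^-1 * \sum_k dot (eta k) (eta k).

Lemma Lop_addZ g q c x : smooth g -> smooth q -> Lop (fun x => g x + c * q x) x = Lop g x + c * Lop q x.
Proof.
move=> sg sq; rewrite /Lop mulrCA -mulrDr; congr (_ * _); rewrite mulr_sumr -big_split.
by ebig k; rewrite HF_addZ.
Qed.

Lemma Lop_sqr x0 x : (0 < K)%N -> Lop (fun x => dot (x - x0) (x - x0)) x = Lsqr.
Proof.
move=> K0; rewrite /Lop (eq_bigr (fun k => 2 * dot (eta k) (eta k))); last by move=> k
 _; rewrite HF_sqr.
rewrite -mulr_sumr /cK /Lsqr; field; rewrite pnatr_eq0 -lt0n //.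
Qed.

Lemma iter_bound h j g (M : R) : (0 < K)%N -> (forall x, `|g x| <= M) -> forall x, `|iter j (Ah h) g x| <= M.
Proof.
move=> K0 H x; have A0 : Ah h (fun _ : E => 0 : R) = fun=> 0.
 by ext y; rewrite /Ah big1 ?mulr0 // => k _; rewrite addr0.
have I0 : iter j (Ah h) (fun _ : E => 0 : R) = fun=> 0 by elim: j => //= j ->.
have := @iter_diff h j g (fun=> 0) M K0 _ x; rewrite I0 subr0; apply=> y; by rewrite
 subr0.
Qed.

(** Maximum principle: [u] minus the evolved [w] decreases at least at the rate [gam], up to errors.
    At a maximum point of [u - w_j - B |x - x0| ^ 2] the function [w_j + B |x - x0| ^ 2] touches [u]
    from above, so [Lop w_j] is at least about [gam] there, and one step of the flow changes [w_j]
    by about [h ^+ 2 * Lop w_j]. *)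
Lemma heat_max u w z (s s' gam e T h : R) (J : nat) x0 : (0 < K)%N -> continuous u -> Ccs w -> 0 <= s' < s ->
 (forall q x1, smooth q -> enorm (x1 - z) < s -> (forall x, u x - q x <= u x1 - q x1) -> gam <= Lop q x1) ->
 0 < e -> 0 < T <= 1 -> h ^+ 2 * J%:R = T ->
 (forall x, `|u x - w x| <= e * T) -> (forall x, T * `|Lop w x| <= e) ->
 (forall x, `|Ah h w x - (w x + h ^+ 2 * Lop w x)| <= h ^+ 2 * e) ->
 (forall x, `|Ah h (Lop w) x - Lop w x| <= e) -> enorm (x0 - z) <= s' ->
 u x0 - iter J (Ah h) w x0 <= e * T - T * (gam - 7 * e / (s - s') ^+ 2 * Lsqr - 2 * e).
Proof.
move=> K0 cu cw /andP[s'0 s's] touch e0 /andP[T0 T1] hJ uw Lw Hh HL x0z.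
pose r := s - s'; have r0 : 0 < r by pos.
have sw := cw.1; pose wj j := iter j (Ah h) w.
have swj j : smooth (wj j) by exact: smooth_iter.
have h20 : 0 <= h ^+ 2 by pos.
have step j x : `|wj j.+1 x - (wj j x + h ^+ 2 * Lop (wj j) x)| <= h ^+ 2 * e.
 have := @iter_diff h j (Ah h w) (fun x => w x + h ^+ 2 * Lop w x) _ K0 Hh x.
 by rewrite iter_lin -iterSr -(Lop_iter _ _ sw).
have stepL j x : `|Lop (wj j.+1) x - Lop (wj j) x| <= e.
 rewrite !Lop_iter // iterSr; exact: iter_diff.
have bL j x : `|Lop (wj j) x| <= e / T.
 by rewrite Lop_iter //; apply: iter_bound => // y; rewrite ler_pdivlMr // mulrC.
have dw j x : `|wj j x - w x| <= j%:R * (h ^+ 2 * (e / T + e)).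
 elim: j => [|j IH]; first by rewrite mul0r /wj subrr normr0.
 have := step j x; have := bL j x; rewrite -natr1 mulrDl mul1r => b1 b2.
 have -> : wj j.+1 x - w x = (wj j x - w x) + ((wj j.+1 x - (wj j x + h ^+ 2 * Lop (wj
  j) x)) + h ^+ 2 * Lop (wj j) x) by ring.
 apply: le_trans (ler_normD _ _) _; apply: lerD => //; apply: le_trans (ler_normD _ _)
  _.
 rewrite mulrDr addrC; apply: lerD => //; rewrite normrM ger0_norm //; exact: ler_wpM2l.
have uwj j x : (j <= J)%N -> `|u x - wj j x| <= 3 * e.
 move=> jJ; have -> : u x - wj j x = (u x - w x) - (wj j x - w x) by ring.
 apply: le_trans (ler_normB _ _) _.
 have b1 : e * T <= e by rewrite ler_piMr // ltW.
 have b2 : j%:R * (h ^+ 2 * (e / T + e)) <= 2 * e.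
  apply: le_trans (_ : J%:R * (h ^+ 2 * (e / T + e)) <= _); last exact: heat_ar1.
  apply: ler_wpM2r; last by rewrite ler_nat.
  by pos.
 have := uw x; have := dw j x; lra.
(* All [w_j] stay within [3 * e] of [u], so a penalty of [7 * e] at distance [r] from [x0] keeps the
   maximum strictly inside that ball, where the touching hypothesis is available. *)
pose B := 7 * e / r ^+ 2; have Br : B * r ^+ 2 = 7 * e by rewrite /B divfK // gt_eqF //
 exprn_gt0.
have B0 : 0 < B by pos.
pose F j x := u x - (wj j x + B * dot (x - x0) (x - x0)).
have sq j : smooth (fun x => wj j x + B * dot (x - x0) (x - x0)).
 by apply: smooth_add => //; apply: smoothZ; exact: smooth_sqr.
have cF j : continuous (F j) by apply: contB => //; exact: smooth_cont.
have maxF j : (j <= J)%N -> exists2 y, enorm (y - z) < s & forall x, F j x <= F j y.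
 move=> jJ; pose A : set E := [set x | enorm (x - x0) <= r].
 have [y yA Hy] : exists2 y, A y & forall x, A x -> F j x <= F j y.
  have A0 : A !=set0 by exists x0; rewrite /A /= subrr enorm0 ltW.
  have [y] := @EVT_max_rV R _ (F j) A A0 (@compact_cball _ _ x0 r) (continuous_subspaceT
   (cF j)).
  by rewrite inE => yA Hy; exists y => // x xA; apply: Hy; rewrite inE.
 have F0 : - (3 * e) <= F j x0.
  have := uwj j x0 jJ; rewrite /F subrr /dot big1 => [|i _]; last by rewrite mxE mul0r.
  by rewrite mulr0 addr0 ler_norml => /andP[].
 have Fbig x : r <= enorm (x - x0) -> F j x < - (3 * e).
  move=> rx.
  have : B * r ^+ 2 <= B * dot (x - x0) (x - x0).
   by rewrite ler_pM2l // -enorm_sqr ler_sqr ?nnegrE ?enorm_ge0 // ltW.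
  by rewrite Br /F => ub2; apply: heat_ar5 => //; exact: uwj.
 have Ax0 : A x0 by rewrite /A /= subrr enorm0 ltW.
 exists y.
  have yr : enorm (y - x0) < r.
   rewrite ltNge; apply/negP => /Fbig; have := Hy x0 Ax0; move: F0; clra.
  apply: le_lt_trans (ler_enormB y x0 z) _; move: yr x0z; rewrite /r; lra.
 move=> x; have [xA|xA] := leP (enorm (x - x0)) r; first exact: Hy.
 have := Fbig x (ltW xA); have := Hy x0 Ax0; move: F0; clra.
have P j : (j <= J)%N -> forall x, F j x <= e * T - j%:R * h ^+ 2 * (gam - B * Lsqr - 2
 * e).
 elim: j => [_|j IH jJ] x.
  by rewrite !mul0r subr0; apply: heat_ar4 => //; rewrite mulr_ge0 ?dot_ge0 // ltW.
 have [y yz Hy] := maxF j.+1 jJ; apply: le_trans (Hy x) _.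
 have := touch _ y (sq j.+1) yz Hy; rewrite (Lop_addZ _ _ (swj _) (smooth_sqr x0))
  Lop_sqr // => gL.
 have := IH (ltnW jJ) y; have := step j y; have := stepL j y; rewrite !ler_norml =>
  /andP[_ b1] /andP[b2 _] b3.
 have b4 : h ^+ 2 * (gam - B * Lsqr - e) <= h ^+ 2 * Lop (wj j) y.
  by apply: ler_wpM2l => //; exact: heat_ar2 gL b1.
 have -> : F j.+1 y = F j y - (wj j.+1 y - wj j y) by rewrite /F; ring.
 by rewrite -natr1; exact: heat_ar3 b2 b3 b4.
have := P J (leqnn J) x0; rewrite [J%:R * _]mulrC hJ /F subrr /dot big1 => [|i _]; last
 by rewrite mxE mul0r.
by rewrite mulr0 addr0.
Qed.

Lemma iter_taylor h e psi (M1 : R) (J : nat) (T : R) : (0 < K)%N -> smooth psi -> 0 <= e -> h ^+ 2 * J%:R = T -> 0 <= M1 ->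
 (forall x, `|Ah h psi x - (psi x + h ^+ 2 * Lop psi x)| <= h ^+ 2 * e) ->
 (forall x, `|Ah h (Lop psi) x - Lop psi x| <= h ^+ 2 * M1) ->
 forall x, `|iter J (Ah h) psi x - (psi x + T * Lop psi x)| <= T * (e + T * M1).
Proof.
move=> K0 sp e0 hJ M0 H1 H2 x; have h20 : 0 <= h ^+ 2 by pos.
have bL j y : `|iter j (Ah h) (Lop psi) y - Lop psi y| <= j%:R * (h ^+ 2 * M1).
 elim: j y => [|j IH] y; first by rewrite mul0r subrr normr0.
 have := @iter_diff h j (Ah h (Lop psi)) (Lop psi) _ K0 H2 y; rewrite -iterSr => b.
 rewrite -natr1 mulrDl mul1r; have := IH y; move: b; move: (iter j.+1 _ _ _) (iter j _ _
  _) => b1 b2 h1 h2.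
 by rewrite [X in _ <= X]addrC; exact: norm_tri h1 h2.
suff P j : (j <= J)%N -> `|iter j (Ah h) psi x - (psi x + (j%:R * h ^+ 2) * Lop psi x)|
 <= j%:R * h ^+ 2 * (e + T * M1).
 by have := P J (leqnn J); rewrite [J%:R * _]mulrC hJ.
elim: j => [_|j IH jJ]; first by rewrite !mul0r addr0 subrr normr0.
have b1 := @iter_diff h j (Ah h psi) (fun x => psi x + h ^+ 2 * Lop psi x) _ K0 H1 x.
rewrite iter_lin -iterSr in b1.
have b2 : `|iter j (Ah h) (Lop psi) x - Lop psi x| <= T * M1.
 apply: le_trans (bL j x) _; rewrite mulrA ler_wpM2r // -hJ mulrC ler_wpM2l // ler_nat
  ltnW //.
have b3 := IH (ltnW jJ).
have -> : iter j.+1 (Ah h) psi x - (psi x + (j.+1%:R * h ^+ 2) * Lop psi x) = (iter j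
 (Ah h) psi x - (psi x + (j%:R * h ^+ 2) * Lop psi x)) + ((iter j.+1 (Ah h) psi x -
 (iter j (Ah h) psi x + h ^+ 2 * iter j (Ah h) (Lop psi) x)) + h ^+ 2 * (iter j (Ah h)
 (Lop psi) x - Lop psi x)).
 by rewrite -natr1; ring.
apply: le_trans (ler_normD _ _) _; rewrite -natr1 2!mulrDl mul1r; apply: lerD => //.
apply: le_trans (ler_normD _ _) _; rewrite [X in _ <= X]mulrDr; apply: lerD; first
 exact: b1.
by rewrite normrM ger0_norm // ler_wpM2l.
Qed.

(** By [heat_max] the flow up to time [T] raises [u] by at least [T * gam], up to o(T), on the
    support of [psi]. Integrated against [psi], the flow moves to [psi] by symmetry, where it is
    [psi + T * Lop psi] to first order; division by [T] leaves the claim. The last hypothesis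
    supplies smooth approximations within o(T) of [u] on which the flow can be run. *)
Lemma parabolic u psi z (s s' gam W : R) : (0 < K)%N -> continuous u -> 0 <= s' < s -> Ccs psi -> (forall x, 0 <= psi x) ->
 Int psi = 1 -> supp_ball psi z s' ->
 (forall q x1, smooth q -> enorm (x1 - z) < s -> (forall x, u x - q x <= u x1 - q x1) -> gam <= Lop q x1) ->
 (forall e : R, 0 < e -> exists T : R, exists w, [/\ 0 < T <= e, Ccs w, forall x, `|u x - w x| <= e * T,
  forall x, T * `|Lop w x| <= e & Int (fun x => `|w x|) <= W]) ->
 gam <= Int (fun x => u x * Lop psi x).
Proof.
move=> K0 cu s's cp p0 ip sup touch app.
have cL := Ccs_Lop cp; have cLL := Ccs_Lop cL.
have [M1 M10 HM1] := Cc0_bounded (Ccs_Cc0 cLL).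
have cpc := Ccs_Cc0 cp; have cLc := Ccs_Cc0 cL.
pose c := 7 / (s - s') ^+ 2 * Lsqr + 2.
apply: (@le_lim0 R _ _ (2 + c + (M1 + 2) * W + Int (fun x => `|Lop psi x|))) => e
 /andP[e0 e1].
have [T [w [/andP[T0 Te] cw uw Lw Ww]]] := app e e0.
have T1 : T <= 1 := le_trans Te e1.
have cwc := Ccs_Cc0 cw; have cw0 := cwc.1; have cLw := Ccs_Lop cw.
have [M2 M20 HM2] := Cc0_bounded (Ccs_Cc0 (Ccs_Lop cLw)).
have [d1 d10 H1] := Ah_taylor K0 cw e0; have [d2 d20 H2] := Ah_taylor K0 cp e0.
have [d3 d30 H3] := Ah_taylor K0 cL e0; have [d4 d40 H4] := Ah_taylor K0 cLw e0.
have eM : 0 < e + M2 by pos.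
have [d d0 [[dd1 dd2 dd3 dd4] [dd5 dd6]]] : exists2 d : R, 0 < d & [/\ d <= d1, d <= d2,
 d <= d3 & d <= d4] /\ d <= 1 /\ d <= e / (e + M2).
 exists (Num.min d1 (Num.min d2 (Num.min d3 (Num.min d4 (Num.min 1 (e / (e + M2))))))).
  by rewrite !lt_min d10 d20 d30 d40 ltr01 divr_gt0.
 by rewrite !ge_min !lexx !orbT.
have [h [J [/andP[h0 hd] hJ hd2]]] := step_size T0 d0.
have nh : `|h| = h by rewrite ger0_norm.
have h20 : 0 <= h ^+ 2 by pos.
have {}H1 := H1 h; rewrite nh in H1; have {}H1 := H1 (lt_le_trans hd dd1).
have {}H2 := H2 h; rewrite nh in H2; have {}H2 := H2 (lt_le_trans hd dd2).
have {}H3 := H3 h; rewrite nh in H3; have {}H3 := H3 (lt_le_trans hd dd3).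
have {}H4 := H4 h; rewrite nh in H4; have {}H4 := H4 (lt_le_trans hd dd4).
have gen f (B : R) : (forall x, `|Lop f x| <= B) -> (forall x, `|Ah h f x - (f x + h ^+
 2 * Lop f x)| <= h ^+ 2 * e) -> forall x, `|Ah h f x - f x| <= h ^+ 2 * (e + B).
 move=> b1 b2 x; have -> : Ah h f x - f x = (Ah h f x - (f x + h ^+ 2 * Lop f x)) + h ^+
  2 * Lop f x.
  by ring.
 by apply: le_trans (ler_normD _ _) _; rewrite mulrDr; apply: lerD; [exact: b2|rewrite
  normrM ger0_norm // ler_wpM2l].
have HL1 x : `|Ah h (Lop w) x - Lop w x| <= e.
 apply: le_trans (gen (Lop w) M2 HM2 H4 x) _; apply: le_trans (ler_wpM2r (ltW eM) hd2)
  _.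
 rewrite -ler_pdivlMr //; apply: le_trans dd6; rewrite expr2 ler_piMl // ltW //.
have HL2 := gen (Lop psi) M1 HM1 H3.
have T01 : 0 < T <= 1 by rewrite T0.
have hm x : enorm (x - z) <= s' -> u x - iter J (Ah h) w x <= e * T - T * (gam - e * c).
 move=> xz; have := heat_max K0 cu cw s's touch e0 T01 hJ uw Lw H1 HL1 xz.
 suff -> : gam - 7 * e / (s - s') ^+ 2 * Lsqr - 2 * e = gam - e * c by [].
 by rewrite /c; ring.
have ci : continuous (iter J (Ah h) w) by exact: smooth_cont (smooth_iter _ _ cw.1).
have it := iter_taylor K0 cp.1 (ltW e0) hJ (addr_ge0 (ltW e0) M10) H2 HL2.
have cA : Cc0 (iter J (Ah h) psi) by elim: (J) => // j IH; exact: Cc0_Ah.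
have ub := Cc0Mr cpc cu; have wb := Cc0Mr cpc cw0; have wib := Cc0Mr cpc ci.
have mulC (f g : E -> R) : (fun x => f x * g x) = fun x => g x * f x by ext x; rewrite
 mulrC.
apply: (@heat_ar6 R e T 0 0 (Int (fun x => psi x * u x)) (Int (fun x => psi x * w x))
 (Int (fun x => Lop psi x * w x)) _ _ _ _ _ _ (Int (fun x => psi x * iter J (Ah h) w x))
 T0 T1 e0).
- rewrite -(IntB ub wib) -[X in _ <= X]mulr1 -ip -IntZ //.
 apply: Int_le; [exact: Cc0B|exact: Cc0Z|move=> x].
 rewrite -mulrBr mulrC; have [xz|xz] := leP (enorm (x - z)) s'; last by rewrite (sup x
  xz) !mulr0.
 by apply: ler_wpM2r => //; exact: hm.
- rewrite [fun x => psi x * _]mulC -(Int_iter _ _ cw0 cpc) [fun x => w x * _]mulC.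
 have cLw0 : Cc0 (fun x => Lop psi x * w x) by exact: Cc0Mr.
 have cAw : Cc0 (fun x => iter J (Ah h) psi x * w x) by exact: Cc0Mr.
 have cTL : Cc0 (fun x => T * (Lop psi x * w x)) by exact: Cc0Z.
 rewrite -(IntZ T cLw0) -(IntD wb cTL) -(IntB cAw (Cc0D wb cTL)).
 apply: le_trans (Int_norm (Cc0B cAw (Cc0D wb cTL))) _.
 have aw := Cc0_norm cwc.
 apply: le_trans (_ : T * (e * (M1 + 2)) * Int (fun x => `|w x|) <= _); last first.
  by apply: ler_wpM2l => //; rewrite mulr_ge0 ?mulr_ge0 ?addr_ge0 // ltW.
 rewrite -IntZ //; apply: Int_le; [exact: Cc0_norm (Cc0B cAw (Cc0D wb cTL))|exact:
  Cc0Z|move=> x].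
 have -> : iter J (Ah h) psi x * w x - (psi x * w x + T * (Lop psi x * w x)) = (iter J
  (Ah h) psi x - (psi x + T * Lop psi x)) * w x.
  by ring.
 rewrite normrM; apply: ler_wpM2r => //; apply: le_trans (it x) _.
 apply: ler_wpM2l; first exact: ltW.
 apply: le_trans (_ : e + e * (e + M1) <= _); first by rewrite lerD2l ler_wpM2r //
  addr_ge0 // ltW.
 rewrite -[X in X + _ <= _]mulr1 -mulrDr ler_wpM2l //; first exact: ltW.
 exact: heat_ar7.
- rewrite -(IntB ub wb); apply: le_trans (Int_norm (Cc0B ub wb)) _.
 rewrite -[X in _ <= X]mulr1 -ip -IntZ //; apply: Int_le; [exact: Cc0_norm (Cc0B ub
  wb)|exact: Cc0Z|move=> x].
 by rewrite -mulrBr normrM mulrC (ger0_norm (p0 x)) ler_wpM2r.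
- have c1 : Cc0 (fun x => u x * Lop psi x) by exact: Cc0M.
 have c2 : Cc0 (fun x => Lop psi x * w x) by exact: Cc0Mr.
 rewrite -(IntB c1 c2); apply: le_trans (Int_norm (Cc0B c1 c2)) _.
 rewrite -IntZ; last exact: Cc0_norm.
 apply: Int_le; [exact: Cc0_norm (Cc0B c1 c2)|apply: Cc0Z; exact: Cc0_norm|move=> x].
 by rewrite [Lop psi x * _]mulrC -mulrBl normrM ler_wpM2r.
- by apply: Int_ge0 => x.
Qed.

End discrete_heat.

(** * Functions with a first-order Taylor estimate, and their averages *)

Section taylor_class.
Context {R : realType} {N : nat}.
Local Notation E := 'rV[R]_N.
Implicit Types (u psi : E -> R) (x y p : E) (A B C b s r : R).

#[local] Opaque Int.

(** Compactly supported version of the class with Hoelder gradient, with a single constant [A]; [p]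
    plays the role of the gradient at [x], and [b] will be [1 + beta]. *)
Definition tay (A b : R) u := [/\ Cc0 u, forall x, `|u x| <= A &
 forall x, exists2 p, enorm p <= A & forall y, `|u (x + y) - u x - dot p y| <= A * enorm y `^ b].

Definition mom0 psi := forall i, Int (fun y => y ord0 i * psi y) = 0.

Lemma tay_ge0 A b u : tay A b u -> 0 <= A.
Proof. by case=> _ H _; exact: le_trans (H 0). Qed.

Lemma tay_cont A b u : tay A b u -> continuous u.
Proof. by case=> -[]. Qed.

Lemma scl_addn m k s psi : scl (m + k) s psi = fun y => s^-1 ^+ k * scl m s psi y.
Proof. by ext y; rewrite /scl exprD mulrCA mulrA. Qed.

Lemma Cc0_coord_mul psi i : Cc0 psi -> Cc0 (fun y => y ord0 i * psi y).
Proof. by apply: Cc0M; exact: cont_coord. Qed.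

Lemma cont_dotl p : continuous (fun y : E => dot p y).
Proof. by apply: cont_sum => i; apply: contM; [exact: cont_cst|exact: cont_coord]. Qed.

Lemma Int_dot_mom psi p : Cc0 psi -> mom0 psi -> Int (fun y => dot p y * psi y) = 0.
Proof.
move=> cp m0; have -> : (fun y => dot p y * psi y) = fun y => \sum_i p ord0 i * (y ord0
 i * psi y).
 by ext y; rewrite /dot mulr_suml; ebig i; rewrite mulrA.
rewrite Int_sum => [|i]; last by apply: Cc0Z; exact: Cc0_coord_mul.
by rewrite big1 // => i _; rewrite IntZ ?m0 ?mulr0 //; exact: Cc0_coord_mul.
Qed.

Lemma mom0_scl m psi s : 0 < s -> Ccs psi -> mom0 psi -> mom0 (scl m s psi).
Proof.
move=> s0 cp m0 i; have c1 : Ccs (fun y => y ord0 i * psi y) by apply: Ccs_mul => //;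
 exact: smooth_coord.
have := Int_scl c1 s0; rewrite m0 => I0.
have cN := Ccs_scl N s0 c1.
have -> : (fun y => y ord0 i * scl m s psi y) = fun y => (s ^+ N * s * s^-1 ^+ m) * scl
 N s (fun y => y ord0 i * psi y) y.
 ext y; rewrite /scl !mxE exprVn; move: (psi _) (y ord0 i) => a b.
 rewrite exprVn; have s1 := lt0r_neq0 s0; have := expf_neq0 N s1; have := expf_neq0 m
  s1; move: s1.
 by move: (s ^+ N) (s ^+ m) => c d h1 h2 h3; field; rewrite h1 h2 h3.
by rewrite IntZ ?I0 ?mulr0 //; exact: Ccs_Cc0.
Qed.

Lemma vol_scale (r s : R) : 0 <= r -> 0 <= s -> vol (N := N) (r * s) = s ^+ N * vol (N := N) r.
Proof.
move=> r0 s0; rewrite /vol !max_l ?mulr_ge0 //.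
by rewrite -exprMn; congr (_ ^+ _); rewrite mulrC mulrnAr.
Qed.

Lemma Ccs_radius psi : Ccs psi -> exists2 r, 0 <= r & supp_ball psi 0 r.
Proof.
move=> [_ [r Hr]]; exists (Num.max r 0); first by rewrite le_max lexx orbT.
by move=> x; rewrite gt_max => /andP[+ _]; exact: Hr.
Qed.

Lemma kern_est psi b : Ccs psi -> 0 <= b -> exists2 C, 0 <= C & forall (B : R) (g : E -> R) s, 0 < s -> 0 <= B ->
 continuous g -> (forall y, `|g y| <= B * enorm y `^ b) -> `|Int (fun y => g y * scl N s psi y)| <= B * C * s `^ b.
Proof.
move=> cp b0; have [r r0 Hr] := Ccs_radius cp; have [P P0 HP] := Cc0_bounded (Ccs_Cc0
 cp).
exists (r `^ b * P * vol (N := N) r); first by rewrite !mulr_ge0 ?powR_ge0 ?vol_ge0.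
move=> B g s s0 B0 cg Hg; have ss := supp_scl N s0 Hr.
have c1 := smooth_cont (Ccs_scl N s0 cp).1.
apply: le_trans (@Int_bound _ _ _ 0 (r * s) (B * (r * s) `^ b * (s^-1 ^+ N * P)) _ _ _)
 _.
- exact: contM.
- by move=> x xr; rewrite ss ?mulr0.
- move=> y; rewrite normrM; have [yr|yr] := leP (enorm (y - 0)) (r * s); last first.
  by rewrite ss // normr0 mulr0 !mulr_ge0 ?powR_ge0 ?exprn_ge0 ?invr_ge0 // ltW.
 apply: ler_pM => //.
  apply: le_trans (Hg y) _; rewrite ler_wpM2l //; rewrite subr0 in yr.
  by apply: ge0_ler_powR => //; rewrite nnegrE ?enorm_ge0 // mulr_ge0 // ltW.
 have k0 : 0 <= s^-1 ^+ N by pos.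
 by rewrite /scl normrM (ger0_norm k0) ler_wpM2l.
rewrite vol_scale ?(ltW s0) // powRM ?(ltW s0) // exprVn.
apply: le_of_eq.
have sN : s ^+ N != 0 by rewrite expf_neq0 // gt_eqF.
by move: (s ^+ N) (r `^ b) (s `^ b) (vol r) sN; clear => a c d e a0; field.
Qed.

(** The constant term of the Taylor expansion contributes the integral of [psi], the linear term
    vanishes by the moment condition, and the remainder is of size s^b. The factor with exponent [k]
    accounts for kernels that are derivatives. *)
Lemma kern0 psi (b : R) : Ccs psi -> mom0 psi -> 0 <= b -> exists2 C, 0 <= C & forall A u, tay A b u -> forall k s x, 0 < s ->
 `|cv u (scl (N + k) s psi) x - s^-1 ^+ k * (Int psi * u x)| <= A * C * (s^-1 ^+ k * s `^ b).
Proof.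
move=> cp m0 b0; have [C C0 HC] := kern_est cp b0; exists C => // A u tu k s x s0.
have [cu uA Hp] := tu; have [p pA Hy] := Hp x; have A0 := tay_ge0 tu.
have cs := Ccs_Cc0 (Ccs_scl N s0 cp).
have k0 : 0 <= s^-1 ^+ k by pos.
rewrite scl_addn cv_scale ?cvE //; [|exact: cu.1|exact: cu.1].
rewrite -mulrBr normrM (ger0_norm k0) mulrCA ler_wpM2l //.
have cux : continuous (fun y => u (x + y)) by move=> y; under eq_fun do rewrite addrC;
 exact: cont_shift cu.1 y.
have cg : continuous (fun y => u (x + y) - u x - dot p y).
 by apply: contB; [apply: contB => //; exact: cont_cst|exact: cont_dotl].
have := HC A _ s s0 A0 cg Hy; congr (_ <= _); congr (`|_|).
have c1 : Cc0 (fun y => u (x + y) * scl N s psi y) by exact: Cc0M.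
have c2 : Cc0 (fun y => dot p y * scl N s psi y) by apply: Cc0M => //; exact: cont_dotl.
have c3 : Cc0 (fun y => u x * scl N s psi y) by exact: Cc0Z.
have -> : (fun y => (u (x + y) - u x - dot p y) * scl N s psi y) = fun y => (u (x + y) *
 scl N s psi y - u x * scl N s psi y) - dot p y * scl N s psi y.
 by ext y; rewrite !mulrBl.
rewrite (IntB (Cc0B c1 c3) c2) (IntB c1 c3) (IntZ _ cs) (Int_scl cp s0).
by rewrite (Int_dot_mom _ cs (mom0_scl N s0 cp m0)) subr0 [u x * _]mulrC.
Qed.

(** Without a moment condition the linear term remains; it is of size [s], which compensates the
    extra factor [s^-1]. *)
Lemma kern1 psi (b : R) : Ccs psi -> Int psi = 0 -> 1 <= b -> exists2 C, 0 <= C & forall A u, tay A b u -> forall s x, 0 < s -> s <= 1 ->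
 `|cv u (scl N.+1 s psi) x| <= A * C.
Proof.
move=> cp i0 b1; have b0 : 0 <= b by exact: le_trans b1.
have [C C0 HC] := kern_est cp b0; have [C' C'0 HC'] := kern_est cp ler01.
exists (C + C'); first exact: addr_ge0.
move=> A u tu s x s0 s1; have [cu uA Hp] := tu; have [p pA Hy] := Hp x; have A0 :=
 tay_ge0 tu.
have cs := Ccs_Cc0 (Ccs_scl N s0 cp).
rewrite -addn1 scl_addn cv_scale ?cvE //; [|exact: cu.1|exact: cu.1].
have s'0 : 0 <= s^-1 by pos.
rewrite expr1 normrM (ger0_norm s'0) [s^-1 * _]mulrC ler_pdivrMr //.
have cux : continuous (fun y => u (x + y)) by move=> y; under eq_fun do rewrite addrC;
 exact: cont_shift cu.1 y.
have cg : continuous (fun y => u (x + y) - u x - dot p y).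
 by apply: contB; [apply: contB => //; exact: cont_cst|exact: cont_dotl].
have h1 := HC A _ s s0 A0 cg Hy.
have h2 : `|Int (fun y => dot p y * scl N s psi y)| <= A * C' * s `^ 1.
 apply: HC' => //; first exact: cont_dotl.
 by move=> y; rewrite powRr1 ?enorm_ge0 //; apply: le_trans (dot_le _ _) _; rewrite
  ler_wpM2r ?enorm_ge0.
have c1 : Cc0 (fun y => u (x + y) * scl N s psi y) by exact: Cc0M.
have c2 : Cc0 (fun y => dot p y * scl N s psi y) by apply: Cc0M => //; exact: cont_dotl.
have c3 : Cc0 (fun y => u x * scl N s psi y) by exact: Cc0Z.
have e1 : (fun y => (u (x + y) - u x - dot p y) * scl N s psi y) = fun y => (u (x + y) *
 scl N s psi y - u x * scl N s psi y) - dot p y * scl N s psi y.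
 by ext y; rewrite !mulrBl.
rewrite e1 (IntB (Cc0B c1 c3) c2) (IntB c1 c3) (IntZ _ cs) (Int_scl cp s0) i0 mulr0
 subr0 in h1.
have sb : s `^ b <= s by rewrite -[X in _ <= X](powRr1 (ltW s0)) ger_powR // s0.
rewrite powRr1 ?(ltW s0) // in h2.
have {}h1 : `|Int (fun y => u (x + y) * scl N s psi y) - Int (fun y => dot p y * scl N s
 psi y)| <= A * C * s.
 by apply: le_trans h1 _; rewrite ler_wpM2l // mulr_ge0.
have := ler_normD (Int (fun y => u (x + y) * scl N s psi y) - Int (fun y => dot p y *
 scl N s psi y)) (Int (fun y => dot p y * scl N s psi y)).
rewrite subrK => /le_trans; apply; rewrite mulrDr mulrDl; exact: lerD.
Qed.

Lemma mom0_radial (q : {poly R}) : mom0 (radial (N := N) (fder q)).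
Proof.
move=> i; have -> : (fun y : E => y ord0 i * radial (fder q) y) = fun y => (- 2^-1) * D
 i (radial q) y.
 by ext y; rewrite D_radial; field.
have c := Ccs_radial (N := N) q.
rewrite IntZ; last exact: Ccs_Cc0 (CcsD i c).
by rewrite Int_D ?mulr0 //; [exact: Ccs_Cc0|exact: smooth_C1 c.1].
Qed.

Lemma Int_D0 psi i : Ccs psi -> Int (D i psi) = 0.
Proof. by move=> c; apply: Int_D; [exact: Ccs_Cc0|exact: smooth_C1 c.1]. Qed.

Lemma mom0_D2 psi i j : Ccs psi -> mom0 (D i (D j psi)).
Proof.
move=> c k; have cj := CcsD j c.
have e1 := Int_ibp i (smooth_C1 (@smooth_coord R N k)) (smooth_C1 cj.1) (Ccs_Cc0 cj).
rewrite e1 (_ : (fun x => _) = fun x => (i == k)%:R * D j psi x); last by ext x; rewrite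
 D_coord.
rewrite IntZ ?Int_D0 ?mulr0 ?oppr0 //; exact: Ccs_Cc0.
Qed.

Lemma mom0Z a psi : Ccs psi -> mom0 psi -> mom0 (fun y => a * psi y).
Proof.
move=> c m i; rewrite (_ : (fun y => _) = fun y => a * (y ord0 i * psi y)); last by ext
 y; rewrite mulrCA.
by rewrite IntZ ?m ?mulr0 //; apply: Cc0_coord_mul; exact: Ccs_Cc0.
Qed.

Lemma mom0D f psi : Ccs f -> Ccs psi -> mom0 f -> mom0 psi -> mom0 (fun y => f y + psi y).
Proof.
move=> c1 c2 m1 m2 i; rewrite (_ : (fun y => _) = fun y => y ord0 i * f y + y ord0 i *
 psi y); last by ext y; rewrite mulrDr.
by rewrite IntD ?m2 ?addr0 //; apply: Cc0_coord_mul; exact: Ccs_Cc0.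
Qed.

(* A normalised mollifier; its scalings smooth u at scale s. *)
Definition molm : R := Int (radial (N := N) (fpoly 1)).
Definition moll (y : E) : R := molm^-1 * radial (fpoly 1) y.

Lemma radial_ge0 j (y : E) : (j <= 3)%N -> 0 <= radial (fpoly j) y.
Proof. by move=> j3; apply: fexp_fpoly_ge0 => //; rewrite lerBlDr lerDl dot_ge0. Qed.

Lemma Int_radial_gt0 j : (j <= 2)%N -> 0 < Int (radial (R := R) (N := N) (fpoly j)).
Proof.
move=> j2; apply: (@Int_gt0 _ _ _ 0); first exact: Ccs_Cc0 (Ccs_radial _).
 by move=> y; apply: radial_ge0; exact: leq_trans j2 _.
rewrite /radial (_ : dot 0 0 = 0) ?subr0; last by rewrite -enorm_sqr enorm0 expr0n.
exact: fexp_fpoly_gt0.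
Qed.

Lemma molm_gt0 : 0 < molm. Proof. exact: Int_radial_gt0. Qed.

Lemma Ccs_moll : Ccs moll. Proof. by apply: CcsZ; exact: Ccs_radial. Qed.

Lemma moll_ge0 y : 0 <= moll y.
Proof. by rewrite mulr_ge0 ?invr_ge0 ?(ltW molm_gt0) // radial_ge0. Qed.

Lemma Int_moll : Int moll = 1.
Proof. by rewrite IntZ ?mulVf ?gt_eqF ?molm_gt0 //; exact: Ccs_Cc0 (Ccs_radial _). Qed.

Lemma mom0_moll : mom0 moll.
Proof. by apply: mom0Z; [exact: Ccs_radial|exact: mom0_radial]. Qed.

Lemma supp_moll : supp_ball moll 0 2^-1.
Proof. by move=> x hx; rewrite /moll (supp_radial _ hx) mulr0. Qed.

Definition um u s : E -> R := cv u (scl N s moll).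

(** The mollifier and its second derivatives have zero first moments, so [kern0] applies to them;
    its first derivatives only have zero integral and are treated by [kern1]. *)
Lemma um_est b : 1 <= b -> exists2 C, 0 <= C & forall A u, tay A b u -> forall s x, 0 < s -> s <= 1 ->
 [/\ `|um u s x - u x| <= A * C * s `^ b, `|um u s x| <= A * C, forall i, `|D i (um u s) x| <= A * C
 & forall i j, `|D i (D j (um u s)) x| <= A * C * (s^-1 ^+ 2 * s `^ b)].
Proof.
move=> b1; have b0 : 0 <= b by exact: le_trans b1.
have [C1 C10 H1] := kern0 Ccs_moll mom0_moll b0.
have cN : Ccs (fun y => - moll y) by apply: Ccs_opp; exact: Ccs_moll.
have [C2 H2] := choice (fun i => let: ex_intro2 c c0 H := kern1 (CcsD i cN) (Int_D0 i
 cN) b1 in ex_intro _ c (conj c0 H)).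
have [C3 H3] := choice (fun ij : 'I_N * 'I_N => let: ex_intro2 c c0 H := kern0 (CcsD
 ij.1 (CcsD ij.2 Ccs_moll)) (mom0_D2 ij.1 ij.2 Ccs_moll) b0 in ex_intro _ c (conj c0
 H)).
pose C := 1 + C1 + \sum_i C2 i + \sum_ij C3 ij.
have S2 : 0 <= \sum_i C2 i by apply: sumr_ge0 => i _; case: (H2 i).
have S3 : 0 <= \sum_i C3 i by apply: sumr_ge0 => i _; case: (H3 i).
have le1 (T : finType) (F : T -> R) k : (forall i, 0 <= F i) -> F k <= \sum_i F i.
 by move=> F0; rewrite (bigD1 k) //= lerDl; apply: sumr_ge0.
have l2 i : C2 i <= C.
 have := le1 _ C2 i (fun i => let: conj h _ := H2 i in h); rewrite /C; lra.
have l3 i : C3 i <= C.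
 have := le1 _ C3 i (fun i => let: conj h _ := H3 i in h); rewrite /C; lra.
have C0 : 0 <= C by pos.
have lC1 : C1 + 1 <= C by rewrite /C; lra.
exists C => // A u tu s x s0 s1; have A0 := tay_ge0 tu; have [cu uA _] := tu.
have sb0 : 0 <= s `^ b by pos.
have sb1 : s `^ b <= 1 by rewrite -[X in _ <= X](powRr0 s) ger_powR ?s0.
have e1 : `|um u s x - u x| <= A * C1 * s `^ b.
 by have := H1 A u tu 0%N s x s0; rewrite addn0 expr0 !mul1r Int_moll mul1r.
have cm := Ccs_scl N s0 Ccs_moll.
split.
- by apply: le_trans e1 _; rewrite ler_wpM2r // ler_wpM2l //; lra.
- have := lerD e1 (uA x) => h; have h' := le_trans (ler_normD (um u s x - u x) (u x)) h;
 rewrite subrK in h'.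
 apply: le_trans h' _; apply: le_trans (_ : A * C1 * 1 + A <= _); first by rewrite
  lerD2r ler_wpM2l // mulr_ge0.
 by rewrite mulr1 -[X in _ + X]mulr1 -mulrDr ler_wpM2l.
- move=> i; rewrite D_cv //; last exact: cu.1.
 have -> : (fun y => - D i (scl N s moll) y) = scl N.+1 s (D i (fun y => - moll y)).
  ext y; rewrite D_scl; last exact: Ccs_moll.1.
  by rewrite D_opp ?/scl ?mulrN //; apply: smooth_pd; exact: Ccs_moll.1.
 have [_ HH] := H2 i; apply: le_trans (HH A u tu s x s0 s1) _; by rewrite ler_wpM2l.
- move=> i j; rewrite D2_cv //; last exact: cu.1.
 rewrite D2_scl; last exact: Ccs_moll.1.
 have [_ HH] := H3 (i, j); have := HH A u tu 2%N s x s0; rewrite addn2 Int_D0 ?mul0r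
  ?mulr0 ?subr0 /=; last exact: CcsD Ccs_moll.
 move=> /le_trans; apply; rewrite ler_wpM2r ?ler_wpM2l //; by pos.
Qed.

End taylor_class.

(** * Plurisubharmonicity and functions touching from above *)

Section plurisubharmonic.
Context {R : realType} {n : nat}.
Local Notation E := 'rV[R]_(n + n).
Implicit Types (u q : E -> R) (x w v : E) (e h t : R).

#[local] Opaque Int.

Lemma HF_qf q v x : smooth q -> HF q v x = qf (Hs q x) v.
Proof. by move=> sq; rewrite HFE. Qed.

Lemma levi_HF q v x : smooth q -> levi (Hs q x) v = (HF q v x + HF q (Jc v) x) / 4.
Proof. by move=> sq; rewrite levi.unlock !HF_qf. Qed.

Lemma crotE t w : crot t w = cos t *: w + sin t *: Jc w.
Proof.
by rewrite -[X in cos t *: X](hsubmxK w) /crot /Jc !scale_row_mx add_row_mx scalerN [X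
 in row_mx _ X]addrC.
Qed.

Lemma crot_Jc t w : crot t (Jc w) = Jc (crot t w).
Proof.
rewrite /crot /Jc !row_mxKl !row_mxKr scalerN opprD; congr row_mx.
- by rewrite addrC.
by rewrite scalerN addrC.
Qed.

Lemma JcZ (a : R) w : Jc (a *: w) = a *: Jc w.
Proof. by rewrite /Jc scale_row_mx; congr row_mx; apply/rowP => i; rewrite !mxE ?mulrN. Qed.

Lemma crotZ t (a : R) w : crot t (a *: w) = a *: crot t w.
Proof. by rewrite !crotE JcZ scalerDr !scalerA ![_ * a]mulrC. Qed.

Lemma crotN t w : crot t (- w) = - crot t w.
Proof. by rewrite -scaleN1r crotZ scaleN1r. Qed.

Lemma zc_crot t w i : zc (crot t w) i = Complex (cos t) (sin t) * zc w i.
Proof.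
rewrite /zc /crot !row_mxEl !row_mxEr !mxE; apply: cplx_eq => /=; rewrite ?ReM ?ImM /=;
 ring.
Qed.

Lemma levi_crot q x t w : smooth q -> levi (Hs q x) (crot t w) = levi (Hs q x) w.
Proof.
move=> sq; apply: (@complexI R); rewrite -!leviE; try exact: symH_Hs.
ebig i; ebig j; congr (_ * _); rewrite !zc_crot.
have zz : Complex (cos t) (sin t) * (Complex (cos t) (sin t))^*%C = 1.
 by apply/eqP; rewrite eq_complex /= mulrN opprK -!expr2 cos2Dsin2 eqxx /=; apply/eqP;
  ring.
by rewrite conjCM mulrACA zz mul1r.
Qed.

Lemma dot_crot t w : dot (crot t w) (crot t w) = dot w w.
Proof.
rewrite crotE !dotDl !dotDr !dotZl !dotZr dot_Jc.
have J0 : dot w (Jc w) = 0.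
 rewrite /dot big_split_ord /= -big_split big1 //= => i _.
 by rewrite /Jc row_mxEl row_mxEr !mxE; ring.
rewrite [dot (Jc w) w]dotC J0 !mulr0 addr0 add0r !mulrA -mulrDl -!expr2 cos2Dsin2 mul1r
 //.
Qed.

Lemma enorm_crot t w : enorm (crot t w) = enorm w.
Proof. by rewrite !enormE dot_crot. Qed.

Lemma enorm_Jc w : enorm (Jc w) = enorm w.
Proof. by rewrite !enormE dot_Jc. Qed.

Lemma cont_path u x w v (a b : R -> R) : continuous u -> continuous a -> continuous b ->
 continuous (fun t : R => u (x + (a t *: w + b t *: v))).
Proof.
move=> cu ca cb t; apply: (@continuous_comp _ _ _ (fun t : R => x + (a t *: w + b t *:
 v)) u); last exact: cu.
apply: cvgD; first exact: cvg_cst.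
by apply: cvgD; apply: cvgZr_tmp; [exact: ca|exact: cb].
Qed.

Lemma second_diff_unif q x e : smooth q -> 0 < e -> exists2 d : R, 0 < d & forall v, enorm v < d ->
 `|q (x + v) + q (x - v) - 2 * q x - HF q v x| <= e * dot v v.
Proof.
move=> sq e0; pose N2 : R := (n + n)%:R * (n + n)%:R + 1.
have N20 : 0 < N2 by pos.
have [f Hf] := choice (fun ab : 'I_(n + n) * 'I_(n + n) => let: ex_intro2 d d0 H :=
 (cont_enormP _ x).1 (@smooth_cont _ _ _ (smoothD ab.1 (smoothD ab.2 sq)) x) (e / N2)
 (divr_gt0 e0 N20) in ex_intro _ d (conj d0 H)).
have m0 := @bigmin_gt0 R _ f (fun i => let: conj h _ := Hf i in h).
exists (\big[Num.min/1]_i f i) => // v hv; apply: second_diff => // t t1.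
have hy : enorm (x + t *: v - x) < \big[Num.min/1]_i f i.
 by rewrite addrBl enormZ; apply: le_lt_trans hv; rewrite ler_piMl ?enorm_ge0.
have Hab a b : `|Hs q (x + t *: v) a b - Hs q x a b| <= e / N2.
 have [_ H] := Hf (a, b); apply/ltW/H; apply: lt_le_trans hy _; exact: bigmin_le_cond.
rewrite !HF_qf //; apply: le_trans (qf_pert v Hab) _.
rewrite !mulrA; apply: ler_wpM2r; first exact: dot_ge0.
rewrite -mulrA mulrCA ler_piMr ?(ltW e0) // ler_pdivrMr // mul1r /N2 lerDl //.
Qed.

Lemma submean_arith (g1 g2 g3 g4 q1 q2 q3 q4 u1 q0 h L F e D : R) :
 g1 <= u1 - q0 + q1 -> g2 <= u1 - q0 + q2 -> g3 <= u1 - q0 + q3 -> g4 <= u1 - q0 + q4 ->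
 q1 + q2 - 2 * q0 - h ^+ 2 * F <= e * (h * (h * D)) ->
 q3 + q4 - 2 * q0 - h ^+ 2 * (4 * L - F) <= e * (h * (h * D)) ->
 g1 + g2 + (g3 + g4) <= 4 * u1 + h ^+ 2 * (4 * L + 2 * e * D).
Proof.
have -> : h ^+ 2 * (4 * L - F) = 4 * (h ^+ 2 * L) - h ^+ 2 * F by ring.
have -> : h ^+ 2 * (4 * L + 2 * e * D) = 4 * (h ^+ 2 * L) + 2 * (e * (h * (h * D))) by
 ring.
by lra.
Qed.

Lemma submean_arith2 (L e D : R) : 0 <= 4 * L + 2 * e * D -> 0 <= D -> 0 < e -> 0 <= L + e * D.
Proof. by move=> h D0 e0; have : 0 <= e * D by [rewrite mulr_ge0 // ltW]; move: h;
 rewrite -mulrA; lra. Qed.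

(** The sub-mean value inequality is used on circles parametrized from [h w], [- h w], [h J w] and
    [- h J w]. At every angle the four increments of the touching function add up to [4 h ^ 2] times
    the Levi form at [w], to leading order, because the Levi form is invariant under [crot]. The
    integrand is therefore bounded by a constant, whose average must be at least the value at the
    centre. *)
Lemma submean Omega (u0 u : E -> R) z0 (r0 : R) q x1 w : psh Omega (EFin \o u0) -> continuous u ->
 (forall x, enorm (x - z0) < r0 -> Omega x /\ u x = u0 x) -> smooth q -> enorm (x1 - z0) < r0 ->
 (forall x, u x - q x <= u x1 - q x1) -> 0 <= levi (Hs q x1) w.
Proof.
move=> [_ _ _ sm] cu uu sq x1z mx.
apply/(@le_lim0 R _ _ (dot w w)) => e /andP[e0 _].
have [d d0 Hd] := second_diff_unif x1 sq e0.
pose m := Num.min d (r0 - enorm (x1 - z0)).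
have m0 : 0 < m by rewrite lt_min d0 subr_gt0.
pose h := m / 2 / (enorm w + 1).
have w1 : 0 < enorm w + 1 by pos.
have h0 : 0 < h by pos.
have hw : h * enorm w < m.
 apply: le_lt_trans (_ : h * (enorm w + 1) < m); first by rewrite ler_pM2l // lerDl.
 rewrite /h divfK ?gt_eqF //; lra.
have [hwd hwr] : h * enorm w < d /\ enorm (x1 - z0) + h * enorm w < r0.
 by move: hw; rewrite lt_min ltrBrDl => /andP[].
have inb v : enorm v <= h * enorm w -> Omega (x1 + v) /\ u (x1 + v) = u0 (x1 + v).
 move=> hv; apply: uu; rewrite addrAC; apply: le_lt_trans (ler_enormD _ _) _.
 by apply: le_lt_trans hwr; rewrite lerD2l.
pose g v t := u (x1 + crot t v).
have I2 : measurable (`[0%R, (2 * pi)%R] : set (measurableTypeR R)) by [].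
have cg v : continuous (g v).
 by rewrite /g; under eq_fun do rewrite crotE; apply: cont_path => //; [exact:
  continuous_cos|exact: continuous_sin].
have ig v : (@lebesgue_measure R).-integrable `[0%R, (2 * pi)%R] (EFin \o g v).
 by apply: continuous_compact_integrable; [exact: segment_compact|exact:
  continuous_subspaceT (cg v)].
have smv v : enorm v <= h * enorm w -> ((2 * pi * u x1)%:E <= \int[lebesgue_measure]_(t
 in `[0%R, (2 * pi)%R]) (g v t)%:E)%E.
 move=> hv; have := sm x1 v.
 have i0 : enorm (0 : E) <= h * enorm w by rewrite enorm0 mulr_ge0 ?enorm_ge0 // ltW.
 have -> : (EFin \o u0) x1 = (u x1)%:E.
  by have [_] := inb 0 i0; rewrite addr0 /= => ->.
 rewrite -EFinM => H; apply: le_trans (H _) _.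
  move=> r t /andP[r00 r11]; have [] // := inb (r *: crot t v).
  by rewrite enormZ enorm_crot ger0_norm //; apply: le_trans hv; rewrite ler_piMl
   ?enorm_ge0.
 apply: le_of_eq; apply: eq_integral => t _ /=.
 have ht : enorm (crot t v) <= h * enorm w by rewrite enorm_crot.
 by have [_] := inb _ ht; rewrite /g => ->.
pose v1 := h *: w; pose v2 := h *: Jc w.
have n1 : enorm v1 <= h * enorm w by rewrite enormZ gtr0_norm.
have n2 : enorm v2 <= h * enorm w by rewrite enormZ gtr0_norm // enorm_Jc.
have s1 := smv v1 n1; have s2 := smv v2 n2.
have s3 := smv (- v1); have s4 := smv (- v2); rewrite !enormN in s3 s4; have {}s3 := s3
 n1; have {}s4 := s4 n2.
have S := leeD (leeD s1 s3) (leeD s2 s4).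
have ig' v v' : (@lebesgue_measure R).-integrable `[0%R, (2 * pi)%R] (fun t => (g v
 t)%:E + (g v' t)%:E)%E.
 by apply: (integrableD I2 (ig v) (ig v')).
rewrite -(integralD I2 (ig v1) (ig (- v1))) -(integralD I2 (ig v2) (ig (- v2)))
 -(integralD I2 (ig' _ _) (ig' _ _)) in S.
pose c := 4 * u x1 + h ^+ 2 * (4 * levi (Hs q x1) w + 2 * e * dot w w).
have ub t : g v1 t + g (- v1) t + (g v2 t + g (- v2) t) <= c.
 have b v : g v t <= u x1 - q x1 + q (x1 + crot t v) by rewrite /g; have := mx (x1 +
  crot t v); clra.
 have b1 := b v1; have b2 := b (- v1); have b3 := b v2; have b4 := b (- v2).
 rewrite !crotN in b2 b4.
 have := Hd (crot t v1); rewrite enorm_crot => /(_ (le_lt_trans n1 hwd)).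
 have := Hd (crot t v2); rewrite enorm_crot => /(_ (le_lt_trans n2 hwd)).
 rewrite !dot_crot /v2 /v1 !dotZl !dotZr dot_Jc !crotZ !HF_scale_dir // crot_Jc -!crotZ.
 have := levi_HF (crot t w) x1 sq; rewrite levi_crot // => LE.
 have {}LE : HF q (Jc (crot t w)) x1 = 4 * levi (Hs q x1) w - HF q (crot t w) x1 by
  rewrite LE; field.
 rewrite LE /c !ler_norml => /andP[_ k2] /andP[_ k1].
 have crv2 : h *: Jc (crot t w) = crot t v2 by rewrite /v2 crotZ crot_Jc.
 have crv1 : h *: crot t w = crot t v1 by rewrite /v1 crotZ.
 rewrite ?crv1 ?crv2 in k1 k2; exact: submean_arith b1 b2 b3 b4 k1 k2.
have : (2 * pi * (4 * u x1) <= 2 * pi * c).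
 rewrite -lee_fin; have -> : (2 * pi * (4 * u x1))%:E = ((2 * pi * u x1)%:E + (2 * pi *
  u x1)%:E + ((2 * pi * u x1)%:E + (2 * pi * u x1)%:E))%E.
  by rewrite -!EFinD; congr EFin; ring.
 apply: le_trans S _.
 apply: le_trans (_ : (\int[lebesgue_measure]_(t in `[0%R, (2 * pi)%R]) cst c%:E t <=
  _)%E).
  apply: le_integral => //.
  - by apply: (integrableD I2 (ig' _ _) (ig' _ _)).
  - by have := @continuous_compact_integrable R (fun=> c) `[0%R, (2 * pi)%R]
   (@segment_compact _ _ _) (continuous_subspaceT (@cst_continuous _ _ c)).
  - by move=> t _; rewrite -!EFinD lee_fin; exact: ub.
 have EI : (lebesgue_measure (`[0%R, (2 * pi)%R] : set (measurableTypeR R)) = (2 *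
  pi)%:E)%E.
  by have := @lebesgue_measure_itv R `[0%R, (2 * pi)%R]; rewrite /= lte_fin mulr_gt0
   ?pi_gt0 // -EFinB subr0.
 have -> : (\int[@lebesgue_measure R]_(t in `[0%R, (2 * pi)%R]) cst c%:E t = (2 * pi *
  c)%:E)%E.
  apply: etrans (integral_cst (@lebesgue_measure R) I2 c%:E) _.
  by rewrite [2 * pi * c]mulrC EFinM; congr (_ * _)%E; exact: EI.
 exact: lexx.
rewrite ler_pM2l ?mulr_gt0 ?pi_gt0 // /c lerDl pmulr_rge0 ?exprn_gt0 //.
move=> H; exact: submean_arith2 H (dot_ge0 w) e0.
Qed.

End plurisubharmonic.

(** * Quadratic perturbations and functions touching from below *)

Section local_solutions.
Context {R : realType} {n : nat}.
Local Notation E := 'rV[R]_(n + n).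
Local Notation C := R[i].
Implicit Types (u q f : E -> R) (x z v : E) (c s eta : R) (H : 'I_(n + n) -> 'I_(n + n) -> R) (xi : 'I_n -> E).

#[local] Opaque Int HF.
#[local] Arguments zc : simpl never.

Lemma dot_subrr x : dot (x - x) (x - x) = 0.
Proof. by rewrite subrr -enorm_sqr enorm0 expr0n. Qed.

Lemma C_sum (F : 'I_n -> R) : (\sum_a F a)%:C%C = \sum_a (F a)%:C%C.
Proof. exact: rmorph_sum. Qed.

Lemma Hs_addsq g c x1 x i j : smooth g ->
 Hs (fun x => g x + c * dot (x - x1) (x - x1)) x i j = Hs g x i j + c * 2 * (i == j)%:R.
Proof.
move=> sg; have ss := smooth_sqr x1; have sc := smoothZ c ss; rewrite /Hs.
rewrite (D_add j (smooth_pd sg) (smooth_pd sc)) (DZ c j (smooth_pd ss)).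
have s1 := smoothD j sg; have s2 := smoothD j ss.
rewrite (D_add i (smooth_pd s1) (smooth_pd (smoothZ c s2))) (DZ c i (smooth_pd s2));
 congr (_ + _).
rewrite (D_shift (- x1) j (smooth_pd (@smooth_dot R (n + n)))) D_dot.
have sd : smooth (fun x : E => 2 * x ord0 j) by apply: smoothZ; exact: smooth_coord.
by rewrite (D_shift (- x1) i (smooth_pd sd)) (DZ _ i (pdiff_coord _)) D_coord mulrA.
Qed.

Definition addI H c : 'I_(n + n) -> 'I_(n + n) -> R := fun i j => H i j + c * (i == j)%:R.

Lemma qf_addI H c v : qf (addI H c) v = qf H v + c * dot v v.
Proof.
rewrite /qf /dot mulr_sumr -big_split; ebig i => /=.
transitivity (\sum_j v ord0 i * v ord0 j * H i j + \sum_j v ord0 i * v ord0 j * (c * (i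
 == j)%:R)).
 by rewrite -big_split; ebig j; rewrite mulrDr.
congr (_ + _); rewrite (bigD1 i) //= eqxx big1 ?addr0 ?mulr1; first by rewrite mulrC.
by move=> j ji; rewrite eq_sym (negbTE ji) !mulr0.
Qed.

Lemma levi_addI H c v : levi (addI H c) v = levi H v + c / 2 * dot v v.
Proof. by rewrite levi.unlock !qf_addI dot_Jc; field. Qed.

Lemma cmat_addI H c i j : cmat (addI H c) i j = cmat H i j + (c / 2)%:C%C * (i == j)%:R.
Proof.
rewrite /cmat /addI; apply: cplx_eq; rewrite ?ReD ?ImD.
 rewrite /= (inj_eq (@lshift_inj _ _)) (inj_eq (@rshift_inj _ _)); by case: (i == j);
  rewrite /=; field.
rewrite /= !(eq_lrshift, eq_rlshift); by case: (i == j); rewrite /=; field.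
Qed.

Definition eigen H xi (lam : 'I_n -> R) := uframe xi /\
 cmat H = (fun i j => \sum_a (lam a)%:C%C * ((zc (xi a) i)^*%C * zc (xi a) j)).

Lemma eigen_addI H xi lam c : eigen H xi lam -> eigen (addI H c) xi (fun l => lam l + c / 2).
Proof.
move=> [ux cH]; split => //; ext i; ext j; rewrite cmat_addI cH.
rewrite eq_sym -(uframe_dual ux j i) mulr_sumr -big_split; ebig a => /=.
by rewrite rmorphD /= mulrDl [zc _ j * _]mulrC.
Qed.

Lemma uframe_dot xi l : uframe xi -> dot (xi l) (xi l) = 1.
Proof.
move=> /(_ l l); rewrite eqxx => /(congr1 (@complex.Re R)); rewrite Re_sum /= => <-.
by rewrite /dot big_split_ord /= -big_split /=; ebig i; rewrite /zc /= mulrN opprK.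
Qed.

Lemma herm_sum (X V : 'I_n -> C) : (\sum_i (X i)^*%C * V i) * (\sum_i (X i)^*%C * V i)^*%C =
 \sum_i \sum_j (((X i)^*%C * X j) * (V i * (V j)^*%C)).
Proof.
rewrite (rmorph_sum (@conjc R)) big_distrlr; ebig i; ebig j.
transitivity (((X i)^*%C * V i) * ((X j)^*%C * V j)^*%C); first by [].
rewrite conjCM conjcK; ring.
Qed.

Lemma eigen_lower H xi lam c v : symH H -> eigen H xi lam -> (forall l, c <= lam l) -> c * dot v v <= levi H v.
Proof.
move=> sH [ux cH] cl; pose z a : C := \sum_i (zc (xi a) i)^*%C * zc v i.
pose p a := complex.Re (z a) ^+ 2 + complex.Im (z a) ^+ 2.
have pz a : (p a)%:C%C = \sum_i \sum_j ((zc (xi a) i)^*%C * zc (xi a) j) * (zc v i * (zc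
 v j)^*%C).
 rewrite -herm_sum -/(z a); apply: cplx_eq; rewrite ?ReM ?ImM /p; case: (z a) => s t /=;
  ring.
have lv : levi H v = \sum_a lam a * p a.
 apply: (@complexI R); rewrite -leviE // cH C_sum.
 have Ea a : (lam a * p a)%:C%C = \sum_i \sum_j (lam a)%:C%C * ((zc (xi a) i)^*%C * zc
  (xi a) j) * (zc v i * (zc v j)^*%C).
  transitivity ((lam a)%:C%C * (p a)%:C%C); first exact: rmorphM.
  rewrite pz mulr_sumr; ebig i; rewrite mulr_sumr; ebig j; exact: mulrA.
 transitivity (\sum_a \sum_i \sum_j (lam a)%:C%C * ((zc (xi a) i)^*%C * zc (xi a) j) *
  (zc v i * (zc v j)^*%C)); last first.
  by ebig a; exact/esym/Ea.
 rewrite [RHS]exchange_big; ebig i.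
 rewrite [RHS]exchange_big; ebig j; exact: mulr_suml.
have dv : dot v v = \sum_a p a.
 apply: (@complexI R); rewrite C_sum.
 transitivity (\sum_a \sum_i \sum_j ((zc (xi a) i)^*%C * zc (xi a) j) * (zc v i * (zc v
  j)^*%C)); last first.
  by ebig a; exact/esym/pz.
 transitivity (\sum_i (zc v i * (zc v i)^*%C)).
  rewrite /dot big_split_ord /= -big_split C_sum; ebig i => /=.
  by apply: cplx_eq; rewrite ?ReM ?ImM /zc /=; ring.
 rewrite [RHS]exchange_big; ebig i; rewrite [RHS]exchange_big.
 have Ej j : \sum_a ((zc (xi a) i)^*%C * zc (xi a) j) * (zc v i * (zc v j)^*%C) = (j ==
  i)%:R * (zc v i * (zc v j)^*%C).
  rewrite -(uframe_dual ux) mulr_suml; ebig a; congr (_ * _); exact: mulrC.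
 rewrite (bigD1 i) //= Ej eqxx mul1r big1 ?addr0 // => j ji; rewrite Ej (negbTE ji)
  mul0r //.
rewrite lv dv mulr_sumr; apply: ler_sum => a _; apply: ler_wpM2r => //.
by pos.
Qed.

Lemma Hs_sqE g c x1 x : smooth g -> Hs (fun x => g x + c * dot (x - x1) (x - x1)) x = addI (Hs g x) (c * 2).
Proof. by move=> sg; ext i; ext j; rewrite Hs_addsq. Qed.

(** Subtracting [eta |x - x1| ^ 2] makes the contact strict, as [touching] requires, and lowers each
    eigenvalue of the complex Hessian by [eta]; the bound [2 * eta] leaves a positive Levi form. *)
Lemma Vdet u f us dl I_mu z0 r1 q x1 xi mu eta : (0 < n)%N -> ma_approx u f us dl I_mu z0 r1 -> smooth q ->
 enorm (x1 - z0) < r1 -> (forall x, q x - u x <= q x1 - u x1) -> eigen (Hs q x1) xi mu ->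
 0 < eta -> (forall l, 2 * eta <= mu l) -> \prod_l (mu l - eta) <= f x1.
Proof.
move=> n0 ma sq x1z mx eg eta0 mu2.
pose q' x := q x + (- eta) * dot (x - x1) (x - x1).
have sq' : smooth q' by apply: smooth_add => //; apply: smoothZ; exact: smooth_sqr.
have HE : Hs q' x1 = addI (Hs q x1) (- eta * 2) by exact: Hs_sqE.
have eg' : eigen (Hs q' x1) xi (fun l => mu l - eta).
 by rewrite HE; have := eigen_addI (- eta * 2) eg; rewrite mulfK // pnatr_eq0.
have [<- _] := MAd_eigen (H := Hs q' x1) eg'.1 eg'.2.
have := @touching R n u f us dl I_mu z0 r1 1 q' x1 eta n0 ma (or_introl erefl) sq' eta0
 x1z; rewrite !mul1r.
apply.
 move=> x; rewrite /q' !mul1r dot_subrr mulr0 addr0.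
 have := mx x; rewrite mulNr; lra.
apply: (levi_near sq' eta0) => v; apply: (eigen_lower _ (symH_Hs x1 sq') eg') => l.
by have := mu2 l; lra.
Qed.

End local_solutions.

(** * Averaged differential inequalities for functions of the Taylor class *)

Section parabolic_kernels.
Context {R : realType} {N : nat}.
Local Notation E := 'rV[R]_N.
Implicit Types (u q psi w : E -> R) (x y z v : E) (A B b e s : R).

#[local] Opaque Int.

Lemma powR_small b e : 0 < b -> 0 < e -> exists s : R, [/\ 0 < s, s <= e, s <= 1 & s `^ b <= e].
Proof.
move=> b0 e0; pose m := Num.min 1 e; have m0 : 0 < m by rewrite lt_min ltr01.
have m1 : m <= 1 by rewrite ge_min lexx.
have me : m <= e by rewrite ge_min lexx orbT.
exists (Num.min m (m `^ b^-1)); split.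
- by rewrite lt_min m0 powR_gt0.
- by rewrite ge_min me.
- by rewrite ge_min m1.
- apply: le_trans me; rewrite -[X in _ <= X](powRr1 (ltW m0)) -(@mulVf _ b) ?gt_eqF //
 powRrM.
 apply: powR_mono; try pos; last by rewrite ge_min lexx orbT.
 by rewrite le_min powR_ge0 ltW.
Qed.

#[local] Transparent HF.
Lemma HF_shift psi a v x : smooth psi -> HF (fun y => psi (y + a)) v x = HF psi v (x + a).
Proof.
move=> sp; have Ej i j : D i (D j (fun y => psi (y + a))) x = D i (D j psi) (x + a).
 by rewrite (D_shift a j (smooth_pd sp)) (D_shift a i (smooth_pd (smoothD j sp))).
rewrite (HFE v x (smooth_shift a sp)) (HFE v (x + a) sp).
by ebig i; ebig j; rewrite Ej.
Qed.

Lemma HF_bound q v x B : smooth q -> (forall i j, `|D i (D j q) x| <= B) ->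
 `|HF q v x| <= (\sum_i `|v ord0 i|) ^+ 2 * B.
Proof.
move=> sq HB; rewrite HFE // expr2 mulr_suml; rewrite mulr_suml.
apply: le_trans (ler_norm_sum _ _ _) _; apply: ler_sum => i _.
rewrite mulr_sumr mulr_suml; apply: le_trans (ler_norm_sum _ _ _) _; apply: ler_sum => j
 _.
by rewrite !normrM ler_wpM2l // mulr_ge0.
Qed.
#[local] Opaque HF.

Lemma Lop_shift K (eta : 'I_K -> E) psi a x : smooth psi -> Lop eta (fun y => psi (y + a)) x = Lop eta psi (x + a).
Proof.
move=> sp; rewrite /Lop; have Ek k : HF (fun y => psi (y + a)) (eta k) x = HF psi (eta
 k) (x + a) by exact: HF_shift.
by apply: (congr1 (fun t : R => (2 * K%:R)^-1 * t)); ebig k; exact: Ek.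
Qed.

Lemma Lop_cv K (eta : 'I_K -> E) u psi x : continuous u -> Ccs psi -> Lop eta (cv u psi) x = cv u (Lop eta psi) x.
Proof.
move=> cu cp; rewrite /Lop cv_scale //; last by apply: Cc0_sum => k; exact: Ccs_Cc0
 (Ccs_HF _ cp).
rewrite cv_sum //; last by move=> k; exact: Ccs_Cc0 (Ccs_HF _ cp).
by congr (_ * _); ebig k; rewrite HF_cv.
Qed.

(** Mollification at scale [s], run for the time [T = s]: the distance to [u] is of order s^b and
    [s * Lop] is of order s^(b-1). Since [b > 1], the first is o(s) and the second tends to zero, as
    [parabolic] asks. *)
Lemma tay_app K (eta : 'I_K -> E) u A b : 1 < b -> tay A b u ->
 exists W : R, forall e : R, 0 < e -> exists T : R, exists w, [/\ 0 < T <= e, Ccs w, forall x, `|u x - w x| <= e * T,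
  forall x, T * `|Lop eta w x| <= e & Int (fun x => `|w x|) <= W].
Proof.
move=> b1 tu; have A0 := tay_ge0 tu; have [C C0 HC] := @um_est R N b (ltW b1).
have [[cu [r0 Hr0]] _ _] := tu.
pose r := Num.max r0 0 + 1; pose M := A * C.
have M0 : 0 <= M by pos.
exists (M * vol (N := N) r) => e e0.
pose L := (2 * K%:R)^-1 * \sum_k (\sum_i `|eta k ord0 i|) ^+ 2.
have L0 : 0 <= L by pos.
pose Q := M + L * M + 1; have Q0 : 0 < Q by pos.
have Q1 : 1 <= Q by rewrite lerDr addr_ge0 // mulr_ge0.
have [s [s0 se s1 sb]] := @powR_small (b - 1) (e / Q) (etrans (subr_gt0 1 b) b1)
 (divr_gt0 e0 Q0).
have b0 : 0 < b by exact: lt_trans b1.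
have sbE : s `^ b = s * s `^ (b - 1) by rewrite mulr_powRB1 // ltW.
have sQ : Q * s `^ (b - 1) <= e by rewrite mulrC -ler_pdivlMr.
have t0 : 0 <= s `^ (b - 1) by pos.
have sM : M * s `^ (b - 1) <= e.
 by apply: le_trans sQ; apply: ler_wpM2r => //; rewrite /Q -addrA lerDl addr_ge0 //
  mulr_ge0.
have sLM : L * M * s `^ (b - 1) <= e.
 by apply: le_trans sQ; apply: ler_wpM2r => //; rewrite /Q -addrA addrCA lerDl addr_ge0.
have sw : smooth (um u s) by apply: smooth_cv => //; exact: Ccs_scl Ccs_moll.
have rr0 : r0 <= r - 1 by rewrite /r addrK le_max lexx.
have suppw : supp_ball (um u s) 0 r.
 move=> x xr; rewrite /um /cv (_ : (fun y => _) = fun=> 0) ?Int0 //; ext y.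
 have [yr|yr] := leP (enorm (y - 0)) (r - 1); last by rewrite (Hr0 y (le_lt_trans rr0
  yr)) mul0r.
 rewrite (supp_scl N s0 supp_moll) ?mulr0 // subr0.
 have := ler_enormD (y - x) (- y); rewrite addrAC subrr add0r !enormN.
 by move: xr yr s1; rewrite !subr0; clra.
exists s, (um u s); split.
- by rewrite s0; apply: le_trans se _; rewrite ler_pdivrMr // ler_peMr // ltW.
- by split=> //; exists r.
- move=> x; rewrite distrC; have [h _ _ _] := HC A u tu s x s0 s1; apply: le_trans h _.
 by rewrite sbE mulrCA [e * s]mulrC ler_wpM2l // ltW.
- move=> x; have [_ _ _ h] := HC A u tu s x s0 s1.
 have hL : `|Lop eta (um u s) x| <= L * (M * (s^-1 ^+ 2 * s `^ b)).
  rewrite /Lop normrM ger0_norm // /L -mulrA ler_wpM2l //.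
  apply: le_trans (ler_norm_sum _ _ _) _; rewrite mulr_suml; apply: ler_sum => k _.
  exact: HF_bound.
 apply: le_trans (ler_wpM2l (ltW s0) hL) _; apply: le_trans sLM.
 rewrite sbE; apply: le_of_eq.
 have ar (t l m : R) : s * (l * (m * (s^-1 ^+ 2 * (s * t)))) = l * m * t by field;
  rewrite gt_eqF.
 exact: ar.
- have cw := smooth_cont sw.
 apply: le_trans (ler_norm _) _; apply: (@Int_bound _ _ _ 0 r M).
 + by move=> x; apply: continuous_comp (cw x) _; exact: norm_continuous.
 + by move=> x hx; rewrite (suppw x hx) normr0.
 + by move=> x; rewrite normr_id; have [_ h _ _] := HC A u tu s x s0 s1.
Qed.

Lemma parabolic_cv K (eta : 'I_K -> E) u A b psi z (s s' gam : R) : (0 < K)%N -> 1 < b -> tay A b u -> 0 <= s' < s ->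
 Ccs psi -> (forall x, 0 <= psi x) -> Int psi = 1 -> supp_ball psi 0 s' ->
 (forall q x1, smooth q -> enorm (x1 - z) < s -> (forall x, u x - q x <= u x1 - q x1) -> gam <= Lop eta q x1) ->
 gam <= Lop eta (cv u psi) z.
Proof.
move=> K0 b1 tu s's cp p0 ip sp touch; have [W HW] := tay_app eta b1 tu.
have cu := tay_cont tu; rewrite Lop_cv // /cv.
have -> : (fun y => u y * Lop eta psi (y - z)) = fun y => u y * Lop eta (fun y => psi (y
 - z)) y.
 by ext y; rewrite (Lop_shift eta (- z) y cp.1).
have sps : supp_ball (fun y => psi (y - z)) z s' by move=> x hx; rewrite sp // subr0.
apply: (parabolic K0 cu s's _ _ _ sps touch HW) => //.
- by apply: (Ccs_ball (c := z) (r := s')) => //; exact: smooth_shift cp.1.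
- by rewrite Int_shift //; exact: Ccs_Cc0.
Qed.

End parabolic_kernels.

(** * Averages of a solution inherit the arithmetic-geometric inequality *)

Section mixed_inequality.
Context {R : realType} {n : nat}.
Local Notation E := 'rV[R]_(n + n).
Implicit Types (u q psi f : E -> R) (x z w v : E) (A b c s e : R) (H : 'I_(n + n) -> 'I_(n + n) -> R) (xi : 'I_n -> E).

#[local] Opaque Int HF.

(* A convolution average H of complex Hessians of solutions with density at
 least g satisfies the arithmetic-geometric inequality of det H >= g. *)
Definition Smaj H g := forall xi (d : 'I_n -> R), uframe xi -> (forall l, 0 < d l) ->
 0 <= \sum_l d l * levi H (xi l) /\ n%:R ^+ n * ((\prod_l d l) * g) <= (\sum_l d l * levi H (xi l)) ^+ n.

(** Directions for which [Lop] becomes the sum of the [d l * levi (Hs q x) (xi l)]; the factor [n]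
    under the root undoes the normalization by the number of directions ([Lop_frame]). *)
Definition frame_dirs xi (d : 'I_n -> R) (k : 'I_(n + n)) : E :=
 match fintype.split k with
 | inl l => Num.sqrt (n%:R * d l) *: xi l
 | inr l => Num.sqrt (n%:R * d l) *: Jc (xi l)
 end.

Lemma Lop_frame xi (d : 'I_n -> R) q x : (0 < n)%N -> smooth q -> (forall l, 0 < d l) ->
 Lop (frame_dirs xi d) q x = \sum_l d l * levi (Hs q x) (xi l).
Proof.
move=> n0 sq d0; rewrite /Lop big_split_ord /=.
have El l : HF q (frame_dirs xi d (lshift n l)) x = n%:R * d l * HF q (xi l) x.
 rewrite /frame_dirs (unsplitK (inl l) : fintype.split (lshift n l) = inl l)
  HF_scale_dir // sqr_sqrtr //.
 by rewrite mulr_ge0 // ltW.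
have Er l : HF q (frame_dirs xi d (rshift n l)) x = n%:R * d l * HF q (Jc (xi l)) x.
 rewrite /frame_dirs (unsplitK (inr l) : fintype.split (rshift n l) = inr l)
  HF_scale_dir // sqr_sqrtr //.
 by rewrite mulr_ge0 // ltW.
rewrite (eq_bigr _ (fun l _ => El l)) (eq_bigr _ (fun l _ => Er l)) -big_split mulr_sumr
 /=.
ebig l; rewrite levi_HF //.
have -> : (n + n)%:R = 2 * n%:R :> R by rewrite natrD; ring.
have n1 : n%:R != 0 :> R by rewrite pnatr_eq0 -lt0n.
by field.
Qed.

Lemma sum_levi_add (d L L' : 'I_n -> R) e : (forall l, L' l = L l + e) ->
 \sum_l d l * L' l = \sum_l d l * L l + e * \sum_l d l.
Proof. by move=> LE; rewrite mulr_sumr -big_split; ebig l; rewrite LE mulrDr [e *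
 _]mulrC. Qed.

(** A function touching [u] from above has nonnegative Levi form and, up to a vanishing
    perturbation, determinant at least [f]; so [levi_AGM] bounds every weighted sum of its Levi
    forms from below by a constant. That inequality is linear, hence passes to averages of [u] by
    [parabolic_cv]. *)
Lemma Smaj_cv u f us dl I_mu z0 r1 A b psi z s s' g0 : (0 < n)%N -> ma_approx u f us dl I_mu z0 r1 ->
 (forall q x1 w, smooth q -> enorm (x1 - z0) < r1 -> (forall x, u x - q x <= u x1 - q x1) -> 0 <= levi (Hs q x1) w) ->
 1 < b -> tay A b u -> 0 <= s' < s -> enorm (z - z0) + s <= r1 ->
 Ccs psi -> (forall x, 0 <= psi x) -> Int psi = 1 -> supp_ball psi 0 s' ->
 0 <= g0 -> (forall x, enorm (x - z) < s -> g0 <= f x) -> Smaj (Hs (cv u psi) z) g0.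
Proof.
move=> n0 ma sm b1 tu s's zs cp p0 ip sp g00 fg xi d ux d0.
have scv : smooth (cv u psi) by apply: smooth_cv cp; exact: tay_cont tu.
have P gam : 0 <= gam -> gam ^+ n <= n%:R ^+ n * ((\prod_l d l) * g0) -> gam <= \sum_l d
 l * levi (Hs (cv u psi) z) (xi l).
 move=> gam0 gamn; rewrite -Lop_frame //.
 have K0 : (0 < n + n)%N by rewrite addn_gt0 n0.
 apply: (parabolic_cv K0 b1 tu s's cp p0 ip sp) => q x1 sq x1s mx; rewrite Lop_frame //.
 have x1r : enorm (x1 - z0) < r1.
  by apply: le_lt_trans (ler_enormB _ z _) _; apply: lt_le_trans zs; rewrite addrC
   ltrD2l.
 have ps w := sm q x1 w sq x1r mx.
 apply: (@le_lim0 R _ _ (\sum_l d l)) => e /andP[e0 _].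
 (* The added quadratic makes the contact strict and the Levi form positive definite, as [touching]
    and [levi_near] require; it disappears with [e]. *)
 pose q' x := q x + e * dot (x - x1) (x - x1).
 have sq' : smooth q' by apply: smooth_add => //; apply: smoothZ; exact: smooth_sqr.
 have HE : Hs q' x1 = addI (Hs q x1) (e * 2) by exact: Hs_sqE.
 have lv w : levi (Hs q' x1) w = levi (Hs q x1) w + e * dot w w by rewrite HE levi_addI
  mulfK.
 have lv0 w : 0 <= levi (Hs q' x1) w by rewrite lv addr_ge0 // mulr_ge0 ?dot_ge0 // ltW.
 have := @touching R n u f us dl I_mu z0 r1 (-1) q' x1 e n0 ma (or_intror erefl) sq' e0
  x1r.
 rewrite !mulN1r lerN2 => T.
 have {}T : f x1 <= MAd (Hs q' x1).
  apply: T => [x|].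
   rewrite /q' !mulN1r dot_subrr mulr0 addr0; have := mx x; lra.
  apply: (levi_near sq' e0) => v; rewrite lv lerDr //.
 have ag := levi_AGM n0 (symH_Hs x1 sq') lv0 ux d0.
 have D0 : 0 <= \prod_l d l by apply: prodr_ge0 => l _; exact: ltW.
 have gn : gam ^+ n <= (\sum_l d l * levi (Hs q' x1) (xi l)) ^+ n.
  apply: le_trans gamn _; apply: le_trans ag; rewrite ler_wpM2l ?exprn_ge0 // ler_wpM2l
   //.
  by apply: le_trans T; exact: fg.
 have SE : \sum_l d l * levi (Hs q' x1) (xi l) = \sum_l d l * levi (Hs q x1) (xi l) + e
  * \sum_l d l.
  by apply: sum_levi_add => l; rewrite lv (uframe_dot l ux) mulr1.
 have S0 : 0 <= \sum_l d l * levi (Hs q' x1) (xi l) by apply: sumr_ge0 => l _; rewrite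
  mulr_ge0 // ltW.
 rewrite ler_pXn2r ?nnegrE // in gn; apply: le_trans gn _.
 by apply: le_of_eq; exact: SE.
split; first by apply: P => //; rewrite expr0n (gtn_eqF n0) mulr_ge0 ?exprn_ge0 //
 mulr_ge0 // prodr_ge0 // => l _; exact: ltW.
set c := n%:R ^+ n * _.
have c0 : 0 <= c by rewrite mulr_ge0 ?exprn_ge0 // mulr_ge0 // prodr_ge0 // => l _;
 exact: ltW.
have cn : (c `^ n%:R^-1) ^+ n = c.
 by rewrite -powR_mulrn ?powR_ge0 // -powRrM mulVf ?powRr1 // pnatr_eq0 -lt0n.
have := P (c `^ n%:R^-1) (powR_ge0 _ _); rewrite cn => /(_ (lexx _)) h.
rewrite -{1}cn; apply: lerXn2r => //; rewrite nnegrE ?powR_ge0 //; exact: le_trans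
 (powR_ge0 _ _) h.
Qed.

End mixed_inequality.

(** * Mollifications of a solution as approximations in the sense of [ma_approx] *)

Section approximations.
Context {R : realType} {n : nat}.
Local Notation E := 'rV[R]_(n + n).
Implicit Types (u q f : E -> R) (x y w : E) (A b s e eta : R).

#[local] Opaque Int HF.

Lemma powR_half b (j : nat) : (2^-1 ^+ j : R) `^ b = (2 `^ (- b)) ^+ j.
Proof.
have h : (2^-1 : R) `^ b = 2 `^ (- b) by rewrite -[2^-1]powR_inv1 // -powRrM mulN1r.
elim: j => [|j IH]; first by rewrite !expr0 powR1.
by rewrite !exprS powRM ?exprn_ge0 ?invr_ge0 // IH h.
Qed.

(** Nonnegativity of one Levi form is a linear inequality with the two directions [xi] and [Jc xi],
    so it passes from contact points to mollifications by [parabolic_cv] with constant zero. *)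
Lemma levi_um_ge0 u A b z0 r1 r2 s x xi : (0 < n)%N -> 1 < b -> tay A b u ->
 (forall q x1 w, smooth q -> enorm (x1 - z0) < r2 -> (forall x, u x - q x <= u x1 - q x1) -> 0 <= levi (Hs q x1) w) ->
 0 < s -> s <= r2 - r1 -> enorm (x - z0) <= r1 -> 0 <= levi (Hs (um u s) x) xi.
Proof.
move=> n0 b1 tu sm s0 sr xr; pose eta (k : 'I_2) := if k == 0 then xi else Jc xi.
have LE q y : smooth q -> Lop eta q y = levi (Hs q y) xi.
 move=> sq; rewrite /Lop big_ord_recl big_ord1 /eta /= levi_HF // mulrC.
 by congr (_ / _); ring.
have su : smooth (um u s) by apply: smooth_cv; [exact: tay_cont tu|exact: Ccs_scl
 Ccs_moll].
rewrite -LE //.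
have s's : 0 <= 2^-1 * s < s by rewrite mulr_ge0 ?ltW //=; lra.
apply: (parabolic_cv _ b1 tu s's) => //.
- exact: Ccs_scl Ccs_moll.
- by move=> y; rewrite mulr_ge0 ?moll_ge0 // exprn_ge0 // invr_ge0 ltW.
- by rewrite Int_scl ?Int_moll //; exact: Ccs_moll.
- exact: supp_scl supp_moll.
move=> q x1 sq x1s mx; rewrite LE //; apply: sm => //.
apply: le_lt_trans (ler_enormB _ x _) _; lra.
Qed.

Lemma geo_small (B x : R) : 0 <= B -> 0 <= x < 1 -> forall e, 0 < e -> exists J0 : nat, forall j, (J0 <= j)%N -> B * x ^+ j <= e.
Proof.
move=> B0 x01 e e0.
have [|J0 HJ] := @cvz_geo R (fun j => (B * x ^+ j)%:C%C) B x B0 x01 _ e e0.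
 by move=> j; rewrite nC_real ger0_norm // mulr_ge0 // exprn_ge0 //; case/andP: x01.
exists J0 => j /HJ; rewrite nC_real; exact: le_trans (ler_norm _).
Qed.

(** At scale 2^-j the mollification is at distance of order 2^(-bj) from [u] and has second
    derivatives of order 2^((2-b)j). With [h] equal to 2^(2-b) these are the rates [(h / 4) ^+ j]
    and [h ^+ j] of [MAd_convergence], and [h ^+ n < 4] amounts to [n * (2 - b) < 2]. *)
Lemma approx_of_solution Omega (u0 : E -> R) f u z0 r1 r2 A b : (0 < n)%N -> 1 < b -> b <= 2 -> n%:R * (2 - b) < 2 ->
 tay A b u -> (forall x, enorm (x - z0) <= r2 -> Omega x /\ u x = u0 x) -> r1 < r2 ->
 (forall q x1 w, smooth q -> enorm (x1 - z0) < r2 -> (forall x, u x - q x <= u x1 - q x1) -> 0 <= levi (Hs q x1) w) ->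
 MA_weak_solution Omega u0 f -> (forall x, enorm (x - z0) <= r2 -> 0 <= f x /\ {for x, continuous f}) ->
 exists us dl I_mu, ma_approx u f us dl I_mu z0 r1.
Proof.
move=> n0 b1 b2 nb tu uu r12 sm [mu [_ [T MT Tmu]] muf] fc.
have A0 := tay_ge0 tu; have [C C0 HC] := @um_est R (n + n) b (ltW b1).
pose h : R := 2 `^ (2 - b); pose B := A * C; have B0 : 0 <= B by pos.
have h1 : 1 <= h by rewrite -(powRr0 2) ler_powR ?ler1n // subr_ge0.
have h0 : 0 <= h by pos.
have E4 : (4 : R) = 2 `^ 2%:R by rewrite powR_mulrn //; ring.
have hn : h ^+ n < 4.
 rewrite -powR_mulrn // -powRrM E4 mulrC; rewrite /powR pnatr_eq0 /= ltr_expR ltr_pM2r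
  //.
 by rewrite ln_gt0 // ltr1n.
have h4 : h / 4 = 2 `^ (- b).
 by rewrite E4 -powRB ?pnatr_eq0 ?implybT //; congr (_ `^ _); ring.
have h41 : 0 <= h / 4 < 1.
 rewrite h4 powR_ge0 /= /powR pnatr_eq0 /= -[X in _ < X]expR0 ltr_expR mulNr oppr_lt0
  mulr_gt0 ?(lt_trans ltr01 b1) //.
 by rewrite ln_gt0 // ltr1n.
pose s j : R := 2^-1 ^+ j.
have s0 j : 0 < s j by pos.
have s1 j : s j <= 1 by rewrite exprn_ile1 // ?invr_ge0 // invf_le1 ?ler1n.
have sb j : s j `^ b = (h / 4) ^+ j by rewrite powR_half h4.
pose us j := um u (s j).
have sus j : smooth (us j) by apply: smooth_cv; [exact: tay_cont tu|exact: Ccs_scl (s0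
 j) Ccs_moll].
have usu j x : `|us j x - u x| <= B * (h / 4) ^+ j.
 by have [hh _ _ _] := HC A u tu (s j) x (s0 j) (s1 j); rewrite -sb.
have hj j : 1 <= h ^+ j by rewrite exprn_ege1.
have usb j : C2b (us j) (B * h ^+ j).
 have Bh : B <= B * h ^+ j by rewrite ler_peMr.
 split=> [x|a x|a a' x]; have [_ h2 h3 h5] := HC A u tu (s j) x (s0 j) (s1 j).
 - exact: le_trans h2 Bh.
 - exact: le_trans (h3 a) Bh.
 - apply: le_trans (h5 a a') _; rewrite ler_wpM2l // sb /s expr_div_n.
  rewrite -exprVn invrK -exprM mulnC exprM (_ : 2 ^+ 2 = 4 :> R); last by ring.
  by rewrite mulrCA divff ?mulr1 // expf_neq0 // pnatr_eq0.
exists us, (fun j => B * (h / 4) ^+ j), (fun phi => (\int[mu]_(x in Omega) phi x)%R).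
split.
- exact: tay_cont tu.
- exact: sus.
- exact: usu.
- exact: geo_small.
- have [J0 HJ] := @geo_small 1 2^-1 ler01 ltac:(by rewrite invr_ge0 ler0n invf_lt1
 ?ltr1n) (r2 - r1) (etrans (subr_gt0 _ _) r12).
 exists J0 => j jJ x xr xi; apply: (levi_um_ge0 xi n0 b1 tu sm (s0 j) _ xr).
 by have := HJ j jJ; rewrite mul1r.
- move=> phi cp sp e e0.
 have uu0 x : enorm (x - z0) <= r1 -> u x = u0 x by move=> xr; have [] := uu x (le_trans
  xr (ltW r12)).
 have uO x : enorm (x - z0) <= r1 -> Omega x by move=> xr; have [] := uu x (le_trans xr
  (ltW r12)).
 exact: (MAd_convergence n0 MT uu0 uO (tay_cont tu) sus h1 hn usu usb Tmu cp sp e0).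
- move=> phi x1 t k cp sp p0 fk.
 have [xt|xt] := leP 0 t; last first.
  have -> : phi = fun=> 0 by ext y; apply: sp; exact: lt_le_trans xt (enorm_ge0 _).
  rewrite Int0 !mulr0 subr0 (_ : (\int[mu]_(x in Omega) 0)%R = 0) ?normr0 //.
  by rewrite /Rintegral integral0.
 have [x1r _] := fk x1 ltac:(by rewrite subrr enorm0).
 have k0 : 0 <= k by have [_] := fk x1 ltac:(by rewrite subrr enorm0); apply: le_trans.
 have [f10 _] := fc x1 (le_trans x1r (ltW r12)).
 (* The lower bound is truncated at zero, since [density_bounds] needs a nonnegative one. *)
 have ab x : enorm (x - x1) <= t -> Omega x /\ Num.max 0 (f x1 - k) <= f x <= f x1 + k.
  move=> xx; have [xr] := fk x xx; rewrite ler_norml => /andP[k1 k2].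
  have [xO _] := uu x (le_trans xr (ltW r12)); have [fx0 _] := fc x (le_trans xr (ltW
   r12)).
  split=> //; rewrite ge_max fx0 /=; move: k1 k2; clra.
 have m0 : 0 <= Num.max 0 (f x1 - k) by rewrite le_max lexx.
 have fk0 : 0 <= f x1 + k by pos.
 have /andP[l1 l2] := density_bounds muf ab m0 fk0 (smooth_cont cp.1) sp p0.
 have I0 := Int_ge0 p0.
 have l3 : (f x1 - k) * Int phi <= Num.max 0 (f x1 - k) * Int phi by rewrite ler_wpM2r
  // le_max lexx orbT.
 rewrite ler_norml; move: l1 l2 l3; rewrite mulrBl mulrDl; clra.
- by move=> x xr; have [] := fc x (le_trans xr (ltW r12)).
Qed.

End approximations.

(** * Elementary inequalities for the trace estimate *)

Section trace_arithmetic.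
Context {R : realType}.

Lemma trace_ar1 (a b s : R) : a != 0 -> b != 0 -> b^-1 + s / a = b^-1 * (1 + s / a * b).
Proof. by move=> a0 b0; field; rewrite a0 b0. Qed.

Lemma trace_ar2 (a s y2 z X T : R) : 0 <= a * y2 -> (1 - z) * (a + s - 2 * y2) <= X + T -> X - a <= a * y2 ->
 z * (a + s - 2 * y2) <= 2 * a * y2 -> - ((3 * a + 2) * y2) - 2 * a * y2 + s <= T.
Proof.
move=> h0; rewrite mulrBl mul1r => h1 h2 h3; rewrite -mulrA in h3.
by lra.
Qed.

Lemma trace_ar3 (a s y2 m S : R) : 0 < m -> - ((3 * a + 2) * y2) - 2 * a * y2 + s <= s / m * S ->
 - ((5 * a + 2) * y2 * m) <= s * (S - m).
Proof.
move=> m0; rewrite -(ler_pM2r m0).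
have -> : s / m * S * m = s * S by field; rewrite gt_eqF.
have -> : (- ((3 * a + 2) * y2) - 2 * a * y2 + s) * m = - ((5 * a + 2) * y2 * m) + s * m
 by ring.
by rewrite mulrBr lerBrDr.
Qed.

Lemma trace_ar4 (y D Q : R) : 0 < y -> - (y * Q) <= y * D -> - (y * Q) <= - y * D -> `|D| <= Q.
Proof.
move=> y0; rewrite mulNr -mulrN -mulrN !ler_pM2l // => h1 h2; rewrite ler_norml;
 apply/andP; split => //; lra.
Qed.

(** Quadratic lower bound for the logarithm of [1 + y], in exponential form so that it can be
    multiplied over the eigenvalues. *)
Lemma expR_lower (y : R) : - 2^-1 <= y -> expR (y - 2 * y ^+ 2) <= 1 + y.
Proof.
move=> hy; have h := expR_ge1Dx (2 * y ^+ 2 - y).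
have e0 := expR_gt0 (y - 2 * y ^+ 2).
have e1 : (1 + (2 * y ^+ 2 - y)) * expR (y - 2 * y ^+ 2) <= 1.
 apply: le_trans (ler_wpM2r (ltW e0) h) _.
 by rewrite -expRD (_ : _ + _ = 0) //; ring.
have q : 1 <= (1 + (2 * y ^+ 2 - y)) * (1 + y).
 have -> : (1 + (2 * y ^+ 2 - y)) * (1 + y) = 1 + y ^+ 2 * (1 + 2 * y) by ring.
 by rewrite lerDl mulr_ge0 ?sqr_ge0; lra.
have p0 : 0 < 1 + (2 * y ^+ 2 - y) by have := sqr_ge0 (y - 4^-1); nra.
by have := le_trans e1 q; rewrite ler_pM2l.
Qed.

End trace_arithmetic.

(** * Near equality in the arithmetic-geometric inequality for averages *)

Section linear_analysis.
Context {R : realType} {n : nat} {I : finType}.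
Implicit Types (t : I -> 'I_n -> R) (w : I -> R) (lam d : 'I_n -> R) (y zeta g : R).

(** Encodes that [tr] is nonnegative with product at least [g], see [rmaj_ge0] and [rmaj_prod],
    through inequalities that become linear in [tr] after taking n-th roots and so survive
    averaging. *)
Definition rmaj (tr : 'I_n -> R) g := forall d, (forall l, 0 < d l) ->
 0 <= \sum_l d l * tr l /\ n%:R ^+ n * ((\prod_l d l) * g) <= (\sum_l d l * tr l) ^+ n.

Lemma rmaj_sum t w g : (0 < n)%N -> 0 <= g -> (forall i, 0 <= w i) -> \sum_i w i = 1 -> (forall i, rmaj (t i) g) ->
 rmaj (fun l => \sum_i w i * t i l) g.
Proof.
move=> n0 g0 w0 w1 H d d0.
have SE : \sum_l d l * (\sum_i w i * t i l) = \sum_i w i * \sum_l d l * t i l.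
 under eq_bigr do rewrite mulr_sumr; rewrite exchange_big; ebig i.
 by rewrite mulr_sumr; ebig l; rewrite mulrCA.
rewrite SE; split; first by apply: sumr_ge0 => i _; rewrite mulr_ge0; case: (H i d d0).
set c := n%:R ^+ n * _.
have c0 : 0 <= c by rewrite mulr_ge0 // mulr_ge0 // prodr_ge0 // => l _; exact: ltW.
have cn : (c `^ n%:R^-1) ^+ n = c.
 by rewrite -powR_mulrn ?powR_ge0 // -powRrM mulVf ?powRr1 // pnatr_eq0 -lt0n.
rewrite -{1}cn; apply: lerXn2r; rewrite ?nnegrE ?powR_ge0 //.
 by apply: sumr_ge0 => i _; rewrite mulr_ge0; case: (H i d d0).
have -> : c `^ n%:R^-1 = \sum_i w i * c `^ n%:R^-1 by rewrite -mulr_suml w1 mul1r.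
apply: ler_sum => i _; apply: ler_wpM2l => //.
have [h1 h2] := H i d d0.
by rewrite -(ler_pXn2r n0) ?nnegrE ?powR_ge0 // cn.
Qed.

Lemma rmaj_ge0 (tr : 'I_n -> R) g l : rmaj tr g -> 0 <= tr l.
Proof.
move=> H; apply: (@le_lim0 R _ _ (\sum_(k | k != l) `|tr k|)) => e /andP[e0 _].
have [] := H (fun k => if k == l then 1 else e); first by move=> k; case: ifP.
rewrite (bigD1 l) // eqxx mul1r => /le_trans + _; apply; rewrite lerD2l mulr_sumr.
by apply: ler_sum => k kl; rewrite (negbTE kl) ler_wpM2l ?(ltW e0) // ler_norm.
Qed.

(** Testing with the weights [(tr l + e)^-1] makes the weighted sum at most [n], which bounds [g] by
    the product of the [tr l + e]; then [e] tends to zero. *)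
Lemma rmaj_prod (tr : 'I_n -> R) g : (0 < n)%N -> 0 <= g -> rmaj tr g -> g <= \prod_l tr l.
Proof.
move=> n0 g0 H; have t0 l := rmaj_ge0 l H.
have P e : 0 < e -> g <= \prod_l (tr l + e).
 move=> e0; have te l : 0 < tr l + e by pos.
 have [s0 sn] := H (fun l => (tr l + e)^-1) (fun l => etrans (invr_gt0 _) (te l)).
 have s1 : \sum_l (tr l + e)^-1 * tr l <= n%:R.
  rewrite -[n in X in _ <= X]card_ord -sumr_const; apply: ler_sum => l _.
  by rewrite mulrC ler_pdivrMr // mul1r lerDl ltW.
 have s2 := le_trans sn (lerXn2r n _ _ s1); rewrite !nnegrE in s2.
 have {}s2 := s2 s0 (ler0n _ _).
 rewrite -[X in _ <= X]mulr1 ler_pM2l in s2; last by rewrite exprn_gt0 // ltr0n.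
 have P0 : 0 < \prod_l (tr l + e) by apply: prodr_gt0.
 by move: s2; rewrite prodfV mulrC ler_pdivrMr // mul1r.
have [M HM] : exists M : R, forall e, 0 < e <= 1 -> \prod_l (tr l + e) <= \prod_l tr l +
 e * M.
 have gen (r : seq 'I_n) : exists M : R, 0 <= M /\ forall e, 0 < e <= 1 -> \prod_(l <-
  r) (tr l + e) <= \prod_(l <- r) tr l + e * M.
  elim: r => [|l r [M [M0 IH]]]; first by exists 0; split=> // e _; rewrite !big_nil
   mulr0 addr0.
  pose Q := \prod_(l <- r) tr l; have Q0 : 0 <= Q by apply: prodr_ge0.
  exists (tr l * M + Q + M); split; first by pos.
  move=> e /andP[e0 e1]; have := IH e; rewrite e0 e1 !big_cons => /(_ isT) h.
  have te : 0 <= tr l + e by pos.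
  apply: le_trans (ler_wpM2l te h) _; rewrite -/Q.
  have : e * e * M <= e * M by rewrite ler_wpM2r // ler_piMl // ltW.
  have -> : (tr l + e) * (Q + e * M) = tr l * Q + e * (tr l * M + Q) + e * e * M by
   ring.
  by rewrite [e * (_ + M)]mulrDr addrA lerD2l.
 by have [M [_ HM]] := gen (index_enum 'I_n); exists M.
by apply: (@le_lim0 R _ _ M) => e /[dup] /andP[e0 _] h; apply: le_trans (P e e0) (HM e
 h).
Qed.

(* Testing with d = 1/lam + t for both signs of t linearises the inequality and
 forces the trace of each average to be close to the mean trace. *)
Lemma trace_close t w lam g zeta y j : (0 < n)%N -> 0 < g -> (forall i, rmaj (t i) g) -> (forall i, 0 <= w i) ->
 \sum_i w i = 1 -> (forall l, lam l = \sum_i w i * t i l) -> 0 <= zeta <= 1 ->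
 (1 - zeta) ^+ n * \prod_l lam l <= g -> 0 < w j -> zeta <= w j * y ^+ 2 -> 0 < y <= 2^-1 ->
 `|\sum_l t j l - \sum_l lam l| <= (5 * n%:R + 2) * y * \sum_l lam l.
Proof.
move=> n0 g0 H w0 w1 lamE /andP[z0 z1] zg wj zy /andP[y0 y2].
have t0 i l := rmaj_ge0 l (H i).
have Hl : rmaj lam g.
 by have := rmaj_sum n0 (ltW g0) w0 w1 H; congr (rmaj _ g); ext l; rewrite lamE.
have l0 l : 0 <= lam l := rmaj_ge0 l Hl.
have P0 : 0 < \prod_l lam l by exact: lt_le_trans g0 (rmaj_prod n0 (ltW g0) Hl).
have lp l : 0 < lam l.
 rewrite lt_neqAle l0 andbT; apply/eqP => e; move: P0.
 by rewrite (bigD1 l) //= -e mul0r ltxx.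
set m := \sum_l lam l; have m0 : 0 < m.
 by rewrite /m (bigD1 (Ordinal n0)) //= ltr_wpDr // sumr_ge0.
have lm l : lam l <= m by rewrite /m (bigD1 l) //= lerDl sumr_ge0.
have n1 : 1 <= n%:R :> R by rewrite ler1n.
pose X i := \sum_l (lam l)^-1 * t i l.
(* the key lower bound *)
have key i (s : R) : `|s| <= 2^-1 -> n%:R * (1 - zeta) * (1 + s / n%:R - 2 * s ^+ 2 /
 n%:R) <= X i + s / m * \sum_l t i l.
 move=> s2; have sl l : - 2^-1 <= s / m * lam l.
  have : `|s / m * lam l| <= 2^-1.
   rewrite normrM normf_div (gtr0_norm m0) (ger0_norm (l0 l)) mulrAC ler_pdivrMr //.
   by apply: ler_pM.
  by rewrite ler_norml => /andP[].
 have dp l : 0 < (lam l)^-1 + s / m.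
  rewrite -(pmulr_lgt0 _ (lp l)) mulrDl mulVf ?gt_eqF //; have := sl l; lra.
 have [sp sn] := H i (fun l => (lam l)^-1 + s / m) dp.
 have SE : \sum_l ((lam l)^-1 + s / m) * t i l = X i + s / m * \sum_l t i l.
  by rewrite mulr_sumr -big_split; ebig l; rewrite mulrDl.
 rewrite SE in sp sn.
 have PE : \prod_l ((lam l)^-1 + s / m) = (\prod_l lam l)^-1 * \prod_l (1 + s / m * lam
  l).
  rewrite -prodfV -big_split; ebig l => /=; exact: trace_ar1 (lt0r_neq0 m0) (lt0r_neq0
   (lp l)).
 have L2 : \sum_l lam l ^+ 2 <= m ^+ 2.
  rewrite expr2 {1}/m mulr_suml; apply: ler_sum => l _; rewrite expr2 ler_wpM2l //.
 have PB : expR (s - 2 * s ^+ 2) <= \prod_l (1 + s / m * lam l).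
  apply: le_trans (_ : expR (\sum_l (s / m * lam l - 2 * (s / m * lam l) ^+ 2)) <= _).
   rewrite ler_expR sumrB -mulr_sumr -/m divfK ?gt_eqF // lerD2l lerN2 -mulr_sumr
    ler_wpM2l //.
   under eq_bigr do rewrite exprMn.
   rewrite -mulr_sumr expr_div_n -mulrA ler_piMr ?sqr_ge0 // mulrC ler_pdivrMr
    ?exprn_gt0 // mul1r //.
  rewrite expR_sum; apply: ler_prod => l _; rewrite expR_ge0 /=; exact: expR_lower.
 set q := 1 + s / n%:R - 2 * s ^+ 2 / n%:R.
 have q0 : 0 <= q.
  rewrite /q; have : (- s + 2 * s ^+ 2) / n%:R <= 1.
   rewrite ler_pdivrMr ?(lt_le_trans ltr01 n1) // mul1r; apply: le_trans n1.
   move: s2; rewrite ler_norml => /andP[h1 h2]; nra.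
  rewrite mulrDl mulNr; lra.
 have qn : q ^+ n <= expR (s - 2 * s ^+ 2).
  have -> : s - 2 * s ^+ 2 = n%:R * (s / n%:R - 2 * s ^+ 2 / n%:R).
   by have := lt0r_neq0 (lt_le_trans ltr01 n1); move: (n%:R : R) => a a0; field.
  rewrite expRM_natl; apply: lerXn2r; rewrite ?nnegrE ?expR_ge0 //.
  by rewrite /q -addrA; exact: expR_ge1Dx.
 have z0' : 0 <= 1 - zeta by pos.
 have : (n%:R * (1 - zeta) * q) ^+ n <= (X i + s / m * \sum_l t i l) ^+ n.
  apply: le_trans sn; rewrite !exprMn -mulrA ler_wpM2l ?exprn_ge0 // PE.
  apply: le_trans (_ : (1 - zeta) ^+ n * \prod_l (1 + s / m * lam l) <= _).
   by rewrite ler_wpM2l ?exprn_ge0 //; exact: le_trans qn PB.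
  rewrite mulrAC; apply: ler_wpM2r.
   by apply: prodr_ge0 => l _; have := sl l; lra.
  by rewrite mulrC ler_pdivlMr.
 by rewrite ler_pXn2r // nnegrE // !mulr_ge0.
have X0 i : n%:R * (1 - zeta) <= X i.
 have := key i 0; rewrite normr0 invr_ge0 ler0n => /(_ isT).
 by rewrite !mul0r expr0n /= mulr0 mul0r subr0 addr0 mulr1 addr0.
have SX : \sum_i w i * X i = n%:R.
 rewrite /X; under eq_bigr do rewrite mulr_sumr; rewrite exchange_big /=.
 rewrite -[n in RHS]card_ord -sumr_const; ebig l.
 under eq_bigr do rewrite mulrCA; rewrite -mulr_sumr -lamE mulVf // gt_eqF //.
(* Every [X i] is at least [n (1 - zeta)] and their weighted mean is exactly [n], so a single one
   cannot exceed [n] by much. *)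
have Xj : w j * (X j - n%:R) <= n%:R * zeta.
 have : \sum_(i | i != j) w i * (n%:R * (1 - zeta)) <= \sum_(i | i != j) w i * X i.
  by apply: ler_sum => i _; exact: ler_wpM2l.
 rewrite -mulr_suml; move: SX w1; rewrite (bigD1 j) //= => SX; rewrite (bigD1 j) //= =>
  w1.
 have -> : \sum_(i | i != j) w i = 1 - w j by rewrite -w1; ring.
 have -> : \sum_(i | i != j) w i * X i = n%:R - w j * X j by rewrite -SX; ring.
 rewrite mulrBr; have : 0 <= n%:R * (w j * zeta) by pos.
 by nra.
have {}Xj : X j - n%:R <= n%:R * y ^+ 2.
 rewrite -(ler_pM2l wj); apply: le_trans Xj _; rewrite mulrCA ler_wpM2l //.
have zy2 : zeta <= y ^+ 2.
 apply: le_trans zy _; rewrite ler_piMl ?sqr_ge0 // -w1 (bigD1 j) //= lerDl sumr_ge0 //.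
(* The two signs of [s] bound the trace of the average number [j] from below and from above. *)
have fin s : s = y \/ s = - y -> s * (\sum_l t j l - m) >= - ((5 * n%:R + 2) * y ^+ 2 *
 m).
 move=> sy; have s2 : `|s| <= 2^-1 by case: sy => ->; rewrite ?normrN gtr0_norm.
 have sq : s ^+ 2 = y ^+ 2 by case: sy => ->; rewrite ?sqrrN.
 have K := key j s s2; rewrite sq in K.
 have nn0 := lt0r_neq0 (lt_le_trans ltr01 n1).
 have E1 : n%:R * (1 - zeta) * (1 + s / n%:R - 2 * y ^+ 2 / n%:R) = (1 - zeta) * (n%:R +
  s - 2 * y ^+ 2).
  by field.
 rewrite E1 in K.
 have K2 : - ((3 * n%:R + 2) * y ^+ 2) - (2 * n%:R) * y ^+ 2 + s <= s / m * \sum_l t j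
  l.
  have h : zeta * (n%:R + s - 2 * y ^+ 2) <= 2 * n%:R * y ^+ 2.
   have b : n%:R + s - 2 * y ^+ 2 <= 2 * n%:R.
    move: s2; rewrite ler_norml => /andP[_ s2]; have := sqr_ge0 y; lra.
   apply: le_trans (ler_wpM2l z0 b) _; rewrite mulrC ler_wpM2l // mulr_ge0.
  apply: trace_ar2 K Xj h; by pos.
 exact: trace_ar3 K2.
have f1 := fin y (or_introl erefl); have f2 := fin (- y) (or_intror erefl).
have E2 : (5 * n%:R + 2) * y ^+ 2 * m = y * ((5 * n%:R + 2) * y * m) by ring.
rewrite E2 in f1 f2; exact: trace_ar4 y0 f1 f2.
Qed.

End linear_analysis.

(** * The kernels of the averages and their mixtures over scales *)

Section kernels.
Context {R : realType} {N : nat}.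
Local Notation E := 'rV[R]_N.
Implicit Types (u psi kap : E -> R) (x y e : E) (A b s r : R).

#[local] Opaque Int HF.

Definition kj j : E -> R := radial (fpoly j).
(** Averaging against this kernel gives, at unit scale, the average against [kj j] plus half the
    second derivative in the direction [e] of the average against [kj j.-1]. *)
Definition pk j e : E -> R := fun y => kj j y + 2^-1 * HF (kj j.-1) e y.

Lemma Ccs_kj j : Ccs (kj j). Proof. exact: Ccs_radial. Qed.

Lemma kj_ge0 j y : (j <= 3)%N -> 0 <= kj j y. Proof. exact: radial_ge0. Qed.

Lemma supp_kj j : supp_ball (kj j) 0 2^-1. Proof. exact: supp_radial. Qed.

Lemma supp_HF psi e c r : smooth psi -> supp_ball psi c r -> supp_ball (HF psi e) c r.
Proof.
move=> sp H x xr; rewrite HFE // big1 // => i _; rewrite big1 // => j _.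
by rewrite (D_supp_ball i (D_supp_ball j H) xr) mulr0.
Qed.

Lemma Int_HF psi e : Ccs psi -> Int (HF psi e) = 0.
Proof.
move=> cp; have cD i j := CcsD i (CcsD j cp).
have -> : HF psi e = fun y => \sum_i \sum_j e ord0 i * e ord0 j * D i (D j psi) y.
 by ext y; rewrite HFE //; exact: cp.1.
have c1 i j : Cc0 (fun y => e ord0 i * e ord0 j * D i (D j psi) y) by apply: Cc0Z;
 exact: Ccs_Cc0.
rewrite Int_sum => [|i]; last exact: Cc0_sum.
rewrite big1 // => i _; rewrite Int_sum // big1 // => j _.
by rewrite IntZ ?Int_D0 ?mulr0 //; [exact: CcsD|exact: Ccs_Cc0].
Qed.

Lemma mom0_sum (I : finType) (F : I -> E -> R) : (forall i, Ccs (F i)) -> (forall i, mom0 (F i)) -> mom0 (fun y => \sum_i F i y).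
Proof.
move=> cF mF k; have -> : (fun y => y ord0 k * \sum_i F i y) = fun y => \sum_i y ord0 k
 * F i y.
 by ext y; rewrite mulr_sumr.
rewrite Int_sum => [|i]; last by apply: Cc0_coord_mul; exact: Ccs_Cc0.
by rewrite big1 // => i _; exact: mF.
Qed.

Lemma mom0_HF psi e : Ccs psi -> mom0 (HF psi e).
Proof.
move=> cp; have cD i j := CcsD i (CcsD j cp).
have -> : HF psi e = fun y => \sum_i \sum_j e ord0 i * e ord0 j * D i (D j psi) y.
 by ext y; rewrite HFE //; exact: cp.1.
have c1 i j : Ccs (fun y => e ord0 i * e ord0 j * D i (D j psi) y) by exact: CcsZ.
apply: mom0_sum => i; first exact: Ccs_sum.
by apply: mom0_sum => // j; apply: mom0Z => //; exact: mom0_D2.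
Qed.

Lemma Ccs_pk j e : Ccs (pk j e).
Proof. by apply: Ccs_add; [exact: Ccs_kj|apply: CcsZ; apply: Ccs_HF; exact: Ccs_kj]. Qed.

Lemma pkE j e y : pk j.+1 e y = (1 - dot e e) * kj j.+1 y + 2 * dot y e ^+ 2 * kj j.+2 y.
Proof.
rewrite /pk /kj HF_radial -![fder (fpoly _)]/(fpoly _.+1); by field.
Qed.

(** By [pkE] the coefficients of the two radial functions are [1 - |e| ^ 2] and twice the square of
    [dot y e]; the radial functions are nonnegative by the signs of the derivatives of exp(-1/x) up
    to order three. *)
Lemma pk_ge0 j e y : (j <= 1)%N -> enorm e <= 1 -> 0 <= pk j.+1 e y.
Proof.
move=> j1 e1; rewrite pkE; apply: addr_ge0; apply: mulr_ge0.
- by rewrite subr_ge0 -enorm_sqr expr_le1 ?enorm_ge0.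
- by apply: kj_ge0; exact: (@leq_trans 2).
- by pos.
- exact: kj_ge0.
Qed.

Lemma supp_pk j e : supp_ball (pk j e) 0 2^-1.
Proof. by move=> y hy; rewrite /pk (supp_kj _ hy) (supp_HF _ (Ccs_kj _).1 (@supp_kj _)
 hy) mulr0 addr0. Qed.

Lemma Int_pk j e : Int (pk j e) = Int (kj j).
Proof.
have c1 := Ccs_Cc0 (Ccs_kj j); have c2 := Ccs_Cc0 (Ccs_HF e (Ccs_kj j.-1)).
by rewrite /pk IntD ?IntZ ?Int_HF ?mulr0 ?addr0 //; [exact: Ccs_kj|exact: Cc0Z].
Qed.

Lemma mom0_kj j : mom0 (kj j.+1). Proof. exact: mom0_radial. Qed.

Lemma mom0_pk j e : mom0 (pk j.+1 e).
Proof.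
apply: mom0D; [exact: Ccs_kj|by apply: CcsZ; apply: Ccs_HF; exact: Ccs_kj|exact:
 mom0_kj|].
by apply: mom0Z; [apply: Ccs_HF|apply: mom0_HF]; exact: Ccs_kj.
Qed.

Lemma Int_kj_gt0 j : (j <= 2)%N -> 0 < Int (kj j). Proof. exact: Int_radial_gt0. Qed.

Lemma Ccs_Lap psi : Ccs psi -> Ccs (Lap psi).
Proof. by move=> cp; apply: Ccs_sum => i; exact: CcsD (CcsD i cp). Qed.

Lemma Lap_cv u psi x : continuous u -> Ccs psi -> Lap (cv u psi) x = cv u (Lap psi) x.
Proof.
move=> cu cp; rewrite /Lap cv_sum //; last by move=> i; exact: Ccs_Cc0 (CcsD i (CcsD i
 cp)).
by ebig i; rewrite D2_cv.
Qed.

Lemma Int_Lap psi : Ccs psi -> Int (Lap psi) = 0.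
Proof.
move=> cp; rewrite Int_sum => [|i]; last exact: Ccs_Cc0 (CcsD i (CcsD i cp)).
by rewrite big1 // => i _; rewrite Int_D0 //; exact: CcsD.
Qed.

Lemma mom0_Lap psi : Ccs psi -> mom0 (Lap psi).
Proof. by move=> cp; apply: mom0_sum => i; [exact: CcsD (CcsD i cp)|exact: mom0_D2]. Qed.

Lemma Lap_lin f psi (a : R) y : smooth f -> smooth psi -> Lap (fun y => f y + a * psi y) y = Lap f y + a * Lap psi y.
Proof.
move=> sf sp; rewrite /Lap mulr_sumr -big_split; ebig i.
have sc := smoothZ a sp.
rewrite (D_add i (smooth_pd sf) (smooth_pd sc)) (DZ a i (smooth_pd sp)).
have s1 := smoothD i sf; have s2 := smoothD i sp.
by rewrite (D_add i (smooth_pd s1) (smooth_pd (smoothZ a s2))) (DZ a i (smooth_pd s2)).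
Qed.

Lemma Lap_scale psi (a : R) y : smooth psi -> Lap (fun y => a * psi y) y = a * Lap psi y.
Proof.
move=> sp; rewrite /Lap mulr_sumr; ebig i.
by rewrite (DZ a i (smooth_pd sp)) (DZ a i (smooth_pd (smoothD i sp))).
Qed.

Lemma Lap_sum (I : finType) (F : I -> E -> R) y : (forall j, smooth (F j)) ->
 Lap (fun y => \sum_j F j y) y = \sum_j Lap (F j) y.
Proof.
move=> sF; rewrite /Lap exchange_big; ebig i.
by rewrite (D_sum _ _ i sF) (D_sum _ _ i (fun j => smoothD i (sF j))).
Qed.

(** Convex combination, with weights proportional to [c], of dilations of the normalized [psi]; it
    discretizes an integral over scales. *)
Definition mix M (c sig : 'I_M -> R) psi : E -> R :=
 fun y => \sum_j (c j / ((\sum_j c j) * Int psi)) * scl N (sig j) psi y.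

Record kernel kap r : Prop := Kernel { ker_Ccs : Ccs kap; ker_ge0 : forall y, 0 <= kap
 y; ker_Int : Int kap = 1; ker_supp : supp_ball kap 0 r }.

Lemma mix_kernel M (c sig : 'I_M -> R) psi r : Ccs psi -> (forall y, 0 <= psi y) -> 0 < Int psi -> supp_ball psi 0 2^-1 ->
 (forall j, 0 <= c j) -> (forall j, 0 < sig j <= r) -> 0 < \sum_j c j -> kernel (mix c sig psi) r.
Proof.
move=> cp p0 I0 sp c0 sg S0; have cs j : Ccs (scl N (sig j) psi) by apply: Ccs_scl =>
 //; case/andP: (sg j).
have d0 : 0 < (\sum_j c j) * Int psi by pos.
split.
- by apply: Ccs_sum => j; apply: CcsZ.
- move=> y; apply: sumr_ge0 => j _; rewrite mulr_ge0 ?divr_ge0 ?(ltW d0) // mulr_ge0 //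
 exprn_ge0 // invr_ge0.
 by apply: ltW; case/andP: (sg j).
- rewrite Int_sum => [|j]; last by apply: Cc0Z; exact: Ccs_Cc0.
 rewrite (eq_bigr (fun j => c j / (\sum_j c j))) => [|j _].
  by rewrite -mulr_suml divff // gt_eqF.
 rewrite IntZ ?Int_scl //; [|by case/andP: (sg j)|exact: Ccs_Cc0].
 by rewrite invfM mulrA -[RHS]mulr1 -(mulVf (lt0r_neq0 I0)) !mulrA.
- move=> y yr; rewrite /mix big1 // => j _; have /andP[s0 sr] := sg j.
 rewrite (supp_scl N s0 sp) ?mulr0 //; apply: le_lt_trans yr; apply: le_trans sr.
 by rewrite ler_piMl ?(ltW s0) // invf_le1 // ler1n.
Qed.

(** [P] bounds the scales, and [Q] bounds the weighted mean of the scales raised to the power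
    [b - 2]. Both estimates are averages of [kern0], for [psi] and for its Laplacian. *)
Lemma mix_est psi b : Ccs psi -> 0 < Int psi -> mom0 psi -> 0 <= b -> exists2 C, 0 <= C & forall M (c sig : 'I_M -> R) P Q,
 (forall j, 0 <= c j) -> (forall j, 0 < sig j <= P) -> 0 < \sum_j c j ->
 \sum_j c j * ((sig j)^-1 ^+ 2 * sig j `^ b) <= (\sum_j c j) * Q ->
 forall A u, tay A b u -> forall x, [/\ `|cv u (mix c sig psi) x - u x| <= A * C * P `^ b,
 `|Lap (cv u (mix c sig psi)) x| <= A * C * Q &
 \sum_j c j * cv u (scl N.+2 (sig j) (Lap psi)) x = (\sum_j c j) * Int psi * Lap (cv u (mix c sig psi)) x].
Proof.
move=> cp I0 m0 b0; have [C1 C10 H1] := kern0 cp m0 b0.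
have [C2 C20 H2] := kern0 (Ccs_Lap cp) (mom0_Lap cp) b0.
exists ((C1 + C2) / Int psi); first by pos.
move=> M c sig P Q c0 sg S0 SQ A u tu x; have cu := tay_cont tu; have A0 := tay_ge0 tu.
have s0 j : 0 < sig j by case/andP: (sg j).
have cs j : Ccs (scl N (sig j) psi) by exact: Ccs_scl.
have cz j : Cc0 (fun y => c j / ((\sum_j c j) * Int psi) * scl N (sig j) psi y) by
 apply: Cc0Z; exact: Ccs_Cc0.
have d0 : 0 < (\sum_j c j) * Int psi by pos.
have W1 : \sum_j c j / ((\sum_j c j) * Int psi) = (Int psi)^-1 by rewrite -mulr_suml
 invfM mulrA divff ?mul1r // gt_eqF.
have cW j : 0 <= c j / ((\sum_j c j) * Int psi) by pos.
have CI : 0 <= (Int psi)^-1 by pos.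
have CL : Lap (cv u (mix c sig psi)) x = \sum_j c j / ((\sum_j c j) * Int psi) * cv u
 (scl N.+2 (sig j) (Lap psi)) x.
 rewrite Lap_cv //; last by apply: Ccs_sum => j; exact: CcsZ.
 have cL j : Cc0 (scl N.+2 (sig j) (Lap psi)) by exact: Ccs_Cc0 (Ccs_scl _ (s0 j)
  (Ccs_Lap cp)).
 have -> : Lap (mix c sig psi) = fun y => \sum_j c j / ((\sum_j c j) * Int psi) * scl
  N.+2 (sig j) (Lap psi) y.
  ext y; rewrite Lap_sum => [|j]; last by apply: smoothZ; exact: (cs j).1.
  by ebig j; rewrite (Lap_scale _ _ (cs j).1) Lap_scl //; exact: cp.1.
 rewrite cv_sum // => [|j]; last exact: Cc0Z.
 by ebig j; rewrite cv_scale.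
split.
- have -> : cv u (mix c sig psi) x - u x = \sum_j c j / ((\sum_j c j) * Int psi) * (cv u
 (scl N (sig j) psi) x - Int psi * u x).
  under [RHS]eq_bigr do rewrite mulrBr; rewrite sumrB -mulr_suml W1 mulKf ?gt_eqF //;
   congr (_ - _).
  rewrite /mix cv_sum //; ebig j; rewrite cv_scale //; exact: Ccs_Cc0.
 apply: le_trans (ler_norm_sum _ _ _) _.
 apply: le_trans (_ : \sum_j c j / ((\sum_j c j) * Int psi) * (A * C1 * P `^ b) <= _).
  apply: ler_sum => j _; rewrite normrM ger0_norm // ler_wpM2l //.
  have := H1 A u tu 0%N (sig j) x (s0 j); rewrite addn0 expr0 !mul1r => /le_trans;
   apply.
  rewrite ler_wpM2l ?mulr_ge0 //; have /andP[a1 a2] := sg j; apply: powR_mono => //;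
   exact: ltW.
 rewrite -mulr_suml W1; have -> : (Int psi)^-1 * (A * C1 * P `^ b) = A * (C1 / Int psi)
  * P `^ b.
  by ring.
 rewrite ler_wpM2r ?powR_ge0 //.
 by rewrite ler_wpM2l // ler_wpM2r // lerDl.
- rewrite CL; apply: le_trans (ler_norm_sum _ _ _) _.
 apply: le_trans (_ : \sum_j c j / ((\sum_j c j) * Int psi) * (A * C2 * ((sig j)^-1 ^+ 2
  * sig j `^ b)) <= _).
  apply: ler_sum => j _; rewrite normrM ger0_norm // ler_wpM2l //.
  have := H2 A u tu 2%N (sig j) x (s0 j); rewrite Int_Lap // mul0r mulr0 subr0 addn2;
   exact.
 have -> : \sum_j c j / ((\sum_j c j) * Int psi) * (A * C2 * ((sig j)^-1 ^+ 2 * sig j `^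
  b)) = A * C2 / ((\sum_j c j) * Int psi) * \sum_j c j * ((sig j)^-1 ^+ 2 * sig j `^ b).
  rewrite mulr_sumr; ebig j; ring.
 have Q0 : 0 <= Q.
  rewrite -(pmulr_rge0 _ S0); apply: le_trans SQ; apply: sumr_ge0 => j _; rewrite
   !mulr_ge0 ?powR_ge0 ?invr_ge0 // ltW //.
 apply: le_trans (ler_wpM2l _ SQ) _; first by pos.
 have -> : A * C2 / ((\sum_j c j) * Int psi) * ((\sum_j c j) * Q) = A * (C2 / Int psi) *
  Q.
  by have := lt0r_neq0 S0; have := lt0r_neq0 I0; move: (\sum_j c j) (Int psi) => a a' h
   h'; field; rewrite h h'.
 by rewrite ler_wpM2r // ler_wpM2l // ler_wpM2r // lerDr.
- rewrite CL mulr_sumr; ebig j; rewrite mulrA; congr (_ * _).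
 by rewrite mulrC divfK // gt_eqF.
Qed.

Lemma riemann_cv m psi u (a b B : R) : 0 < a -> a <= b -> Ccs psi -> continuous u -> (forall x, `|u x| <= B) ->
 exists2 C : R, 0 <= C & forall M : nat, (0 < M)%N -> forall x,
 `|cv u (scl m b psi) x - cv u (scl m a psi) x
  - \sum_(j < M) (b - a) / M%:R * cv u (scl m.+1 (a + j%:R * ((b - a) / M%:R)) (Euler m psi)) x| <= C / M%:R.
Proof.
move=> a0 ab cp cu uB; have [C C0 HC] := scl_riemann m a0 ab cp.
have [rr rr0 Hr] := Ccs_radius cp; have [r1 r10 Hr1] := Ccs_radius (Ccs_Euler m cp).
have B0 : 0 <= B := le_trans (normr_ge0 _) (uB 0).
have b0 : 0 < b by exact: lt_le_trans ab.
pose r := Num.max rr r1 * b.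
exists (B * C * vol (N := N) r); first by rewrite !mulr_ge0 ?vol_ge0.
move=> M M0 x; pose h := (b - a) / M%:R; have Mr : 0 < M%:R :> R by rewrite ltr0n.
have sj (j : 'I_M) : 0 < a + j%:R * h <= b.
 apply/andP; split; first by pos.
 rewrite -lerBrDl /h mulrA ler_pdivrMr // mulrC ler_wpM2l ?subr_ge0 // ler_nat ltnW //.
have cE (j : 'I_M) : Ccs (scl m.+1 (a + j%:R * h) (Euler m psi)) by apply: Ccs_scl;
 [case/andP: (sj j)|exact: Ccs_Euler].
have cb := Ccs_scl m b0 cp; have ca := Ccs_scl m a0 cp.
have cEz (j : 'I_M) : Ccs (fun y => h * scl m.+1 (a + j%:R * h) (Euler m psi) y) by
 exact: CcsZ.
pose W y := scl m b psi y - scl m a psi y - \sum_(j < M) h * scl m.+1 (a + j%:R * h)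
 (Euler m psi) y.
have cW : Cc0 W by apply: Cc0B; [apply: Cc0B; exact: Ccs_Cc0|apply: Cc0_sum => j; exact:
 Ccs_Cc0].
have -> : cv u (scl m b psi) x - cv u (scl m a psi) x - \sum_(j < M) h * cv u (scl m.+1
 (a + j%:R * h) (Euler m psi)) x = cv u W x.
 rewrite /W cv_sub ?cv_sub ?cv_sum //; try exact: Ccs_Cc0; try by move=> j; exact:
  Ccs_Cc0.
 - by congr (_ - _); ebig j; rewrite cv_scale //; exact: Ccs_Cc0.
 - by apply: Cc0B; exact: Ccs_Cc0.
 - by apply: Cc0_sum => j; exact: Ccs_Cc0.
have supW : supp_ball W 0 r.
 have le2 t t' s : 0 < s <= b -> t <= Num.max rr r1 -> t' = t * s -> 0 <= t -> t' <= r.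
  move=> /andP[s0 sb] tm -> t0; apply: ler_pM => //; exact: ltW.
 move=> y hy; have z1 s : 0 < s <= b -> scl m s psi y = 0.
  move=> sb; have /andP[s0 _] := sb; apply: (supp_scl m s0 Hr); apply: le_lt_trans hy.
  by apply: (le2 rr _ s) => //; rewrite le_max lexx.
 have z2 s : 0 < s <= b -> scl m.+1 s (Euler m psi) y = 0.
  move=> sb; have /andP[s0 _] := sb; apply: (supp_scl m.+1 s0 Hr1); apply: le_lt_trans
   hy.
  by apply: (le2 r1 _ s) => //; rewrite le_max lexx orbT.
 rewrite /W !z1 ?a0 ?b0 ?lexx // subrr sub0r big1 ?oppr0 // => j _.
 by rewrite z2 ?mulr0.
rewrite /cv; have -> : B * C * vol (N := N) r / M%:R = B * (C / M%:R) * vol (N := N) r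
 by ring.
apply: (@Int_bound _ _ _ x r).
- by apply: contM => //; exact: cont_shift cW.1.
- by move=> y yr; rewrite supW ?mulr0 // subr0.
- move=> y; rewrite normrM; apply: ler_pM => //; exact: HC.
Qed.

End kernels.

(** * Differences between consecutive scales as differences of Laplacians *)

Section decomposition.
Context {R : realType} {N : nat}.
Local Notation E := 'rV[R]_N.
Implicit Types (u psi kap : E -> R) (x y z e : E) (A b s r : R).

#[local] Opaque Int HF.

(** A second-order difference quotient of [u] at scale [s]; the subtracted constant is the mass of
    [pk 2 e]. For a [tay] function it is a priori of order s^(b-2). *)
Definition Tq u e s x : R := s^-1 ^+ 2 * (cv u (scl N s (pk 2 e)) x - Int (kj (N := N) 2) * u x).

Lemma Lap_D psi a : smooth psi -> Lap (D a psi) = D a (Lap psi).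
Proof.
move=> sp; ext y; rewrite /Lap (D_sum _ _ a (fun i => smoothD i (smoothD i sp))).
by ebig i; rewrite (D_comm i a sp) (D_comm i a (smoothD i sp)).
Qed.

Lemma Lap_HF psi e y : smooth psi -> Lap (HF psi e) y = \sum_i \sum_j e ord0 i * e ord0 j * D i (D j (Lap psi)) y.
Proof.
move=> sp; have s2 i j := smoothD i (smoothD j sp).
have -> : HF psi e = fun y => \sum_i \sum_j e ord0 i * e ord0 j * D i (D j psi) y by ext
 z; rewrite HFE.
rewrite Lap_sum => [|i]; last by apply: smooth_sum => j; exact: smoothZ.
ebig i; rewrite Lap_sum => [|j]; last exact: smoothZ.
by ebig j; rewrite Lap_scale // (Lap_D i (smoothD j sp)) (Lap_D j sp).
Qed.

Lemma Euler_sum m (I : finType) (F : I -> E -> R) y : (forall j, smooth (F j)) ->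
 Euler m (fun y => \sum_j F j y) y = \sum_j Euler m (F j) y.
Proof.
move=> sF; rewrite /Euler sumrB -mulr_sumr; congr (_ - _).
rewrite exchange_big; ebig i; rewrite (D_sum _ _ i sF) mulr_sumr //.
Qed.

Lemma Euler_scale m psi (a : R) y : smooth psi -> Euler m (fun y => a * psi y) y = a * Euler m psi y.
Proof.
move=> sp; rewrite /Euler mulrBr mulr_sumr; congr (_ - _); first by rewrite mulrCA.
by ebig i; rewrite (DZ a i (smooth_pd sp)) mulrCA.
Qed.

(** By [Euler_D] the operator passes through the two derivatives, and [Euler N (kj 1)] is half the
    Laplacian of [kj 0]. The result is half the Laplacian of [HF (kj 0) e], which is exactly what
    distinguishes [pk 1 e] from [kj 1]. *)
Lemma Euler_HF_kj1 e y : Euler N.+2 (HF (kj 1) e) y = Lap (pk 1 e) y - Lap (kj 1) y.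
Proof.
have sk j : smooth (kj (R := R) (N := N) j) by exact: smooth_radial.
have s2 i j := smoothD i (smoothD j (sk 1%N)).
have -> : HF (kj 1) e = fun y => \sum_i \sum_j e ord0 i * e ord0 j * D i (D j (kj 1)) y
 by ext z; rewrite HFE.
rewrite Euler_sum => [|i]; last by apply: smooth_sum => j; exact: smoothZ.
have sH : smooth (HF (kj 0) e) by do 2!apply: smooth_DL.
rewrite /pk (Lap_lin _ _ (sk 1%N) sH) Lap_HF // [X in X - _]addrC addrK mulr_sumr.
ebig i; rewrite Euler_sum => [|j]; last exact: smoothZ.
rewrite mulr_sumr; ebig j; rewrite Euler_scale // mulrCA; congr (_ * _).
rewrite (Euler_D N.+1 i (smoothD j (sk 1%N))) (Euler_D N j (sk 1%N)).
have -> : Euler N (kj 1) = fun y => 2^-1 * Lap (kj 0) y by ext z; rewrite mulrC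
 -Euler_radial.
have sL : smooth (Lap (kj (R := R) (N := N) 0)) by apply: smooth_sum => k; do 2!apply:
 smoothD.
by rewrite (DZ _ j (smooth_pd sL)) (DZ _ i (smooth_pd (smoothD j sL))).
Qed.

Lemma scl_Euler_kj2 s y : 0 < s -> scl N.+1 s (Euler N (kj 2)) y = s / 2 * scl N.+2 s (Lap (kj 1)) y.
Proof.
move=> s0; rewrite /scl -[kj 2]/(radial (fder (fpoly 1))) Euler_radial exprSr -/(kj 1).
rewrite 2!exprS; field; by rewrite gt_eqF.
Qed.

Lemma scl_Euler_HF s e y : 0 < s -> scl N.+3 s (Euler N.+2 (HF (kj 1) e)) y =
 s^-1 * (scl N.+2 s (Lap (pk 1 e)) y - scl N.+2 s (Lap (kj 1)) y).
Proof. by move=> s0; rewrite /scl Euler_HF_kj1 (exprS _ N.+2); move: (s^-1 ^+ N.+2) (Lap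
 (pk 1 e) _) (Lap (kj 1) _) => a p q; ring. Qed.

(** A Riemann sum of [s / 2] over the scales from [t] to [r]. *)
Lemma sum_coef_lower (r t h : R) (M : nat) : (1 < M)%N -> 0 < t -> 2 * t <= r -> h = (r - t) / M%:R ->
 r ^+ 2 / 32 <= \sum_(j < M) h * (t + j%:R * h) / 2 <= r ^+ 2 / 2.
Proof.
move=> M1 t0 tr hE; have M0 : 0 < M%:R :> R by rewrite ltr0n (ltn_trans _ M1).
have h0 : 0 < h by rewrite hE divr_gt0 // subr_gt0; lra.
have hM : h * M%:R = r - t by rewrite hE divfK // gt_eqF.
apply/andP; split.
 have -> : \sum_(j < M) h * (t + j%:R * h) / 2 = \sum_(j < M) h * t / 2 + h ^+ 2 / 2 *
  \sum_(j < M) j%:R.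
  by rewrite mulr_sumr -big_split; ebig j => /=; ring.
 have G : \sum_(j < M) (j%:R : R) = M%:R * (M%:R - 1) / 2.
  clear; elim: M => [|M IH]; first by rewrite big_ord0 mul0r mul0r.
  by rewrite big_ord_recr /= IH -natr1; field.
 rewrite G; have S0 : 0 <= \sum_(j < M) h * t / 2 by pos.
 have M2 : 2 <= M%:R :> R by rewrite (ler_nat R 2).
 have q : (r - t) ^+ 2 / 8 <= h ^+ 2 / 2 * (M%:R * (M%:R - 1) / 2).
  rewrite -hM; have -> : h ^+ 2 / 2 * (M%:R * (M%:R - 1) / 2) = (h * M%:R) ^+ 2 / 8 + h
   ^+ 2 * M%:R * (M%:R - 2) / 8 by field.
  by rewrite lerDl !mulr_ge0 ?subr_ge0 // ltW.
 have q2 : r ^+ 2 / 32 <= (r - t) ^+ 2 / 8.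
  have : r ^+ 2 / 4 <= (r - t) ^+ 2.
   have -> : r ^+ 2 / 4 = (r / 2) ^+ 2 by field.
   by rewrite ler_sqr ?nnegrE; lra.
  by lra.
 by lra.
apply: le_trans (_ : \sum_(j < M) h * r / 2 <= _).
 apply: ler_sum => j _; rewrite ler_wpM2r // ler_wpM2l ?(ltW h0) //.
 have : j%:R * h <= M%:R * h by rewrite ler_wpM2r ?(ltW h0) // ler_nat ltnW.
 by rewrite [M%:R * h]mulrC hM; lra.
rewrite sum_const.
have -> : M%:R * (h * r / 2) = (h * M%:R) * r / 2 by ring.
by rewrite hM; have : 0 <= t * r by [rewrite mulr_ge0; lra]; nra.
Qed.

(** A Riemann sum of [s^-1] over the scales from [r] to [2 r]. *)
Lemma sum_coef3 (r h : R) (M : nat) : (0 < M)%N -> 0 < r -> h = (2 * r - r) / M%:R ->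
 2^-1 <= \sum_(j < M) h / (r + j%:R * h) <= 1.
Proof.
move=> M1 r0 hE; have M0 : 0 < M%:R :> R by rewrite ltr0n.
have h0 : 0 < h by rewrite hE divr_gt0; lra.
have hM : h * M%:R = r by rewrite hE divfK ?gt_eqF //; ring.
have sj (j : 'I_M) : r <= r + j%:R * h <= 2 * r.
 have : j%:R * h <= M%:R * h by rewrite ler_wpM2r ?(ltW h0) // ler_nat ltnW.
 rewrite [M%:R * h]mulrC hM; have : 0 <= j%:R * h by pos.
 by move: (j%:R * h) => a b c; apply/andP; split; lra.
apply/andP; split.
 apply: le_trans (_ : \sum_(j < M) h / (2 * r) <= _); last first.
  apply: ler_sum => j _; have /andP[a1 a2] := sj j.
  by rewrite ler_wpM2l ?(ltW h0) // lef_pV2 ?posrE; lra.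
 rewrite sum_const mulrA [M%:R * h]mulrC hM.
 by apply: le_of_eq; field; rewrite gt_eqF.
apply: le_trans (_ : \sum_(j < M) h / r <= _).
 apply: ler_sum => j _; have /andP[a1 a2] := sj j.
 by rewrite ler_wpM2l ?(ltW h0) // lef_pV2 ?posrE; lra.
by rewrite sum_const mulrA [M%:R * h]mulrC hM divff // gt_eqF.
Qed.

Lemma T_arith (r ca1 cb1 ca2 cb2 I2u h1 h2 P1 P2 P3 e1 e2 e3 t1 t2 : R) : 0 < r ->
 `|ca1 - cb1 - P1| <= e1 -> `|ca2 - cb2 - 4 * P2| <= e2 -> `|h2 - h1 - P3| <= e3 ->
 `|cb1 - I2u| <= t1 -> `|cb2 - I2u| <= t2 ->
 `|(r^-1 ^+ 2 * (ca1 - I2u) + 2^-1 * h1) - ((2 * r)^-1 ^+ 2 * (ca2 - I2u) + 2^-1 * h2) - (r^-1 ^+ 2 * (P1 - P2) - 2^-1 * P3)|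
 <= r^-1 ^+ 2 * (t1 + t2 + e1 + e2) + e3.
Proof.
move=> r0; have -> : (2 * r)^-1 ^+ 2 = r^-1 ^+ 2 / 4 by field; rewrite gt_eqF.
have q0 : 0 <= r^-1 ^+ 2 by pos.
move: (r^-1 ^+ 2) q0 => q q0 H1 H2 H3 H4 H5.
have -> : (q * (ca1 - I2u) + 2^-1 * h1) - (q / 4 * (ca2 - I2u) + 2^-1 * h2) - (q * (P1 -
 P2) - 2^-1 * P3) = q * ((ca1 - cb1 - P1) + (cb1 - I2u) - (ca2 - cb2 - 4 * P2) / 4 -
 (cb2 - I2u) / 4) - (h2 - h1 - P3) / 2 by field.
apply: le_trans (ler_normB _ _) _; apply: lerD.
 rewrite normrM (ger0_norm q0) ler_wpM2l //.
 by move: H1 H2 H4 H5; rewrite !ler_norml; do 4!(case/andP => ? ?); apply/andP; split;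
  lra.
by apply: le_trans H3; rewrite normrM ler_piMr // ger0_norm // invf_le1 // ler1n.
Qed.

Lemma pow_split (sg P b X : R) : 1 <= b -> 0 < sg -> sg <= P -> X = P `^ b -> sg^-1 ^+ 2 * sg `^ b <= sg^-1 * (X / P).
Proof.
move=> b1 s0 sP ->; have b0 : 0 < b by exact: lt_le_trans b1.
have P0 : 0 < P by exact: lt_le_trans sP.
rewrite -(mulr_powRB1 (ltW s0) b0) -(mulr_powRB1 (ltW P0) b0).
have -> : P * P `^ (b - 1) / P = P `^ (b - 1) by rewrite mulrC mulKf // gt_eqF.
have -> : sg^-1 ^+ 2 * (sg * sg `^ (b - 1)) = sg^-1 * sg `^ (b - 1) by field; rewrite
 gt_eqF.
by rewrite ler_wpM2l ?invr_ge0 ?(ltW s0) // ge0_ler_powR ?nnegrE ?subr_ge0 ?(ltW s0)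
 ?(ltW P0).
Qed.

Lemma Qgen M (c sg : 'I_M -> R) (P b g : R) : 1 <= b -> (forall j, 0 < sg j <= P) -> (forall j, 0 <= c j) ->
 (forall j, c j / sg j <= g) -> \sum_j c j * ((sg j)^-1 ^+ 2 * sg j `^ b) <= M%:R * g * (P `^ b / P).
Proof.
move=> b1 sP c0 cg; apply: le_trans (_ : \sum_(j < M) g * (P `^ b / P) <= _).
 apply: ler_sum => j _; have /andP[s0 sp] := sP j.
 apply: le_trans (ler_wpM2l (c0 j) (pow_split b1 s0 sp erefl)) _.
 have P0 : 0 <= P := le_trans (ltW s0) sp.
 by rewrite [X in X <= _]mulrA; apply: ler_wpM2r; [rewrite divr_ge0 ?powR_ge0|exact:
  cg].
by rewrite sum_const mulrA.
Qed.

Lemma T_arith2 (q a b1 d1 d2 d3 M1 M : R) : 0 <= q -> a <= b1 -> d1 / M1 <= d1 / M -> d2 / M1 <= d2 / M -> d3 / M1 <= d3 / M ->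
 q * (a + b1 + d1 / M1 + d2 / M1) + d3 / M1 <= q * (2 * b1) + (q * (d1 + d2) + d3) / M.
Proof.
move=> q0 h1 h2 h3 h4.
have -> : (q * (d1 + d2) + d3) / M = q * (d1 / M + d2 / M) + d3 / M by ring.
have H : q * (a + b1 + d1 / M1 + d2 / M1) <= q * (2 * b1 + (d1 / M + d2 / M)).
 by apply: ler_wpM2l => //; lra.
by apply: le_trans (lerD H h4) _; rewrite mulrDr addrA.
Qed.

Lemma T_arith3 (q S S3 I l1 l2 l3 l4 : R) : q * (S * I) * (l1 - l2) + 2^-1 * (S3 * I) * (l3 - l4) =
 q * (S * I * l1 - S * I * l2) - 2^-1 * (S3 * I * (l4 - l3)).
Proof. ring. Qed.

(** [Tq] splits into the rescaled excess of the average against [kj 2] and half a second derivative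
    of the average against [kj 1]. The excess at scale [r] is that at scale [t] plus an integral
    over the scales in between of Laplacians of averages against [kj 1]; at scale [2 r] one starts
    from [2 t], and after rescaling both integrals have the same weight. The second part changes
    from [r] to [2 r] by an integral of differences of Laplacians, for [pk 1 e] and [kj 1].
    Normalizing the four discretized integrals gives the kernels [kap]; [t] governs the remainder
    and [eps] the error of the Riemann sums. *)
Lemma T_decomp b e : 1 < b -> enorm e <= 1 -> exists2 C, 0 <= C & forall A u, tay A b u -> forall r t, 0 < r -> 0 < t -> 2 * t <= r ->
 forall eps : R, 0 < eps -> exists kap : 'I_4 -> E -> R, exists m1 m2 : R,
 [/\ forall i, kernel (kap i) (2 * r), 0 <= m1 <= C /\ 0 <= m2 <= C,
  forall i x, `|cv u (kap i) x - u x| <= A * C * (2 * r) `^ b,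
  forall i x, `|Lap (cv u (kap i)) x| <= A * C * (r^-1 ^+ 2 * (2 * r) `^ b) &
  forall x, `|Tq u e r x - Tq u e (2 * r) x - (m1 * (Lap (cv u (kap 0)) x - Lap (cv u (kap 1)) x)
   + m2 * (Lap (cv u (kap 2%:R)) x - Lap (cv u (kap 3%:R)) x))| <= A * C * (r^-1 ^+ 2 * (2 * t) `^ b) + eps].
Proof.
move=> b1 e1; have b0 : 0 <= b by apply: ltW; exact: lt_trans b1.
have ck j := @Ccs_kj R N j; have ik j := @Int_kj_gt0 R N j.
have [C1 C10 M1] := mix_est (ck 1%N) (ik 1%N isT) (@mom0_kj R N 0) b0.
have ip1 : Int (pk 1 e) = Int (kj (R := R) (N := N) 1) by exact: Int_pk.
have ip10 : 0 < Int (pk 1 e) by rewrite ip1; exact: ik.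
have [C2 C20 M2] := mix_est (Ccs_pk 1 e) ip10 (@mom0_pk R N 0 e) b0.
have [C3 C30 M3] := kern0 (ck 2%N) (@mom0_kj R N 1) b0.
pose I1 := Int (kj (R := R) (N := N) 1); have I10 : 0 < I1 by exact: ik.
pose C := 8 * (C1 + C2) + 2 * C3 + I1.
have C0 : 0 <= C by pos.
exists C => // A u tu r t r0 t0 tr eps eps0.
have A0 := tay_ge0 tu; have cu := tay_cont tu; have [_ uA _] := tu.
have r20 : 0 < 2 * r by pos.
have t20 : 0 < 2 * t by pos.
have tr1 : t <= r by lra.
have tr2 : 2 * t <= 2 * r by rewrite ler_pM2l.
have rr2 : r <= 2 * r by move: r0; clra.
have [D1 D10 R1] := riemann_cv N t0 tr1 (ck 2%N) cu uA.
have [D2 D20 R2] := riemann_cv N t20 tr2 (ck 2%N) cu uA.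
have cH := Ccs_HF e (ck 1%N).
have [D3 D30 R3] := riemann_cv N.+2 r0 rr2 cH cu uA.
have [M0 M00 HM0] := small_inv (r^-1 ^+ 2 * (D1 + D2) + D3) eps0.
(* Doubling guarantees at least two points, as [sum_coef_lower] needs. *)
pose M := M0.*2; have Mgt1 : (1 < M)%N by rewrite -(@ltn_double 0) in M00; rewrite /M;
 case: (M0) M00.
have Mgt0 : (0 < M)%N by exact: ltn_trans Mgt1.
have MM (d : R) : 0 <= d -> d / M%:R <= d / M0%:R.
 move=> d0; rewrite ler_wpM2l // lef_pV2 ?posrE ?ltr0n // ler_nat /M -addnn leq_addr //.
pose h := (r - t) / M%:R; pose h' := (2 * r - 2 * t) / M%:R; pose h3 := (2 * r - r) /
 M%:R.
have Mr : 0 < M%:R :> R by rewrite ltr0n.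
have hh' : h' = 2 * h by rewrite /h' /h; ring.
have h0 : 0 <= h by pos.
have h30 : 0 < h3 by rewrite divr_gt0 // subr_gt0; move: r0; clra.
pose s1 (j : 'I_M) := t + j%:R * h; pose s2 (j : 'I_M) := 2 * t + j%:R * h'; pose s3 (j
 : 'I_M) := r + j%:R * h3.
have s12 j : s2 j = 2 * s1 j by rewrite /s2 /s1 hh'; ring.
have s1r j : 0 < s1 j <= r.
 apply/andP; split; first by pos.
 rewrite /s1 -lerBrDl /h mulrA ler_pdivrMr // mulrC ler_wpM2l ?subr_ge0 // ler_nat ltnW
  //.
have s3r j : r <= s3 j <= 2 * r.
 rewrite /s3 lerDl mulr_ge0 ?(ltW h30) //= -lerBrDl /h3 mulrA ler_pdivrMr // mulrC
  ler_wpM2l ?subr_ge0 // ler_nat ltnW //.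
have s1p j : 0 < s1 j <= 2 * r by have /andP[-> a] := s1r j; exact: le_trans a rr2.
have s2p j : 0 < s2 j <= 2 * r by rewrite s12 ler_pM2l // pmulr_rgt0.
have s3p j : 0 < s3 j <= 2 * r by have /andP[a ->] := s3r j; rewrite (lt_le_trans r0 a).
pose c1 j := h * s1 j / 2; pose c2 j := h' * s2 j / 2; pose c3 j := h3 / s3 j.
have c12 j : c2 j = 4 * c1 j by rewrite /c2 /c1 hh' s12; ring.
have c10 j : 0 <= c1 j by have /andP[a _] := s1p j; rewrite /c1 divr_ge0 // mulr_ge0 //
 ltW.
have c20 j : 0 <= c2 j by rewrite c12 mulr_ge0.
have c30 j : 0 <= c3 j by have /andP[a _] := s3p j; rewrite divr_ge0 // ltW.
have S1 : r ^+ 2 / 32 <= \sum_j c1 j <= r ^+ 2 / 2 by exact: (sum_coef_lower Mgt1 t0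
 tr).
have S3 : 2^-1 <= \sum_j c3 j <= 1 by exact: (sum_coef3 Mgt0 r0).
have S12 : \sum_j c2 j = 4 * \sum_j c1 j by rewrite mulr_sumr; apply: eq_bigr.
have r2 : 0 < r ^+ 2 by pos.
have S1p : 0 < \sum_j c1 j by have /andP[a _] := S1; apply: lt_le_trans a; rewrite
 divr_gt0.
have S2p : 0 < \sum_j c2 j by rewrite S12 mulr_gt0.
have S3p : 0 < \sum_j c3 j by have /andP[a _] := S3; apply: lt_le_trans a; rewrite
 invr_gt0.
pose X := (2 * r) `^ b; have X0 : 0 <= X by pos.
(* A common bound for the weighted means of s^(b-2) in the three families. Small scales do no harm,
   since the weights [c1] and [c2] are proportional to the scale. *)
pose Q := 8 * (r^-1 ^+ 2 * X).
have hM : M%:R * h = r - t by rewrite mulrC divfK // gt_eqF.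
have hM' : M%:R * h' = 2 * (r - t) by rewrite hh' mulrCA hM.
have hM3 : M%:R * h3 = r by rewrite mulrC divfK ?gt_eqF //; ring.
have XE : r ^+ 2 / 32 * Q = X / 4 by rewrite /Q; field; rewrite gt_eqF.
have Q0 : 0 <= Q by pos.
have S1Q : X / 4 <= (\sum_j c1 j) * Q by rewrite -XE ler_wpM2r //; case/andP: S1.
have Y0 : 0 <= X / (2 * r) by pos.
have XY : X = X / (2 * r) * (2 * r) by rewrite divfK // gt_eqF.
have Q1 : \sum_j c1 j * ((s1 j)^-1 ^+ 2 * s1 j `^ b) <= (\sum_j c1 j) * Q.
 apply: le_trans S1Q; apply: le_trans (Qgen (g := h / 2) (ltW b1) s1p c10 _) _ => [j|].
  by have /andP[a _] := s1p j; rewrite /c1 mulrAC mulfK // gt_eqF.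
 have -> : M%:R * (h / 2) = (r - t) / 2 by rewrite mulrA hM.
 by rewrite -/X [X in _ <= X / _]XY; have := mulr_ge0 (ltW t0) Y0; clear; nra.
have Q2 : \sum_j c2 j * ((s2 j)^-1 ^+ 2 * s2 j `^ b) <= (\sum_j c2 j) * Q.
 rewrite S12 -mulrA; apply: le_trans (ler_wpM2l _ S1Q) => //.
 apply: le_trans (Qgen (g := h' / 2) (ltW b1) s2p c20 _) _ => [j|].
  by have /andP[a _] := s2p j; rewrite /c2 mulrAC mulfK // gt_eqF.
 have -> : M%:R * (h' / 2) = 2 * (r - t) / 2 by rewrite mulrA hM'.
 rewrite -/X [X in _ <= _ * (X / _)]XY; move: (X / _) Y0 => Y Y0.
 by have := mulr_ge0 (ltW t0) Y0; have := mulr_ge0 (ltW r0) Y0; clear; nra.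
have Q3 : \sum_j c3 j * ((s3 j)^-1 ^+ 2 * s3 j `^ b) <= (\sum_j c3 j) * Q.
 apply: le_trans (_ : 2^-1 * Q <= _); last by rewrite ler_wpM2r //; case/andP: S3.
 apply: le_trans (Qgen (g := h3 / r ^+ 2) (ltW b1) s3p c30 _) _ => [j|].
  have /andP[a a'] := s3r j; have a0 := lt_le_trans r0 a.
  rewrite /c3 -mulrA ler_wpM2l ?(ltW h30) // -invfM lef_pV2 ?posrE ?mulr_gt0 // expr2;
   apply: ler_pM => //; exact: ltW.
 have -> : M%:R * (h3 / r ^+ 2) = r / r ^+ 2 by rewrite mulrA hM3.
 rewrite -/X /Q; have -> : r / r ^+ 2 * (X / (2 * r)) = 2^-1 * (r^-1 ^+ 2 * X) by field;
  rewrite gt_eqF.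
 rewrite ler_wpM2l //; have : 0 <= r^-1 ^+ 2 * X by pos.
 by clear; lra.
have E1 := M1 M c1 s1 _ _ c10 s1p S1p Q1 A u tu.
have E2 := M1 M c2 s2 _ _ c20 s2p S2p Q2 A u tu.
have E3 := M1 M c3 s3 _ _ c30 s3p S3p Q3 A u tu.
have E4 := M2 M c3 s3 _ _ c30 s3p S3p Q3 A u tu.
pose k1 := mix c1 s1 (kj (R := R) (N := N) 1); pose k2 := mix c2 s2 (kj (R := R) (N :=
 N) 1).
pose k3 := mix c3 s3 (kj (R := R) (N := N) 1); pose k4 := mix c3 s3 (pk 1 e).
pose kap (i : 'I_4) := nth k1 [:: k1; k2; k3; k4] i.
have all4 (P : (E -> R) -> Prop) : P k1 -> P k2 -> P k3 -> P k4 -> forall i, P (kap i).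
 by move=> p1 p2 p3 p4 [[|[|[|[|i]]]] Hi].
exists kap, (r^-1 ^+ 2 * ((\sum_j c1 j) * I1)), (2^-1 * ((\sum_j c3 j) * I1)).
have kg j y : (j <= 3)%N -> 0 <= kj (R := R) (N := N) j y by exact: kj_ge0.
have sk := @supp_kj R N 1.
split.
- apply: (all4 (fun k => kernel k (2 * r))).
 + by apply: (mix_kernel (ck 1%N) _ I10 sk c10 s1p S1p) => y; exact: kg.
 + by apply: (mix_kernel (ck 1%N) _ I10 sk c20 s2p S2p) => y; exact: kg.
 + by apply: (mix_kernel (ck 1%N) _ I10 sk c30 s3p S3p) => y; exact: kg.
 + by apply: (mix_kernel (Ccs_pk 1 e) _ ip10 (@supp_pk R N 1 e) c30 s3p S3p) => y;
  exact: (@pk_ge0 R N 0 e y).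
- have IC : I1 <= C by rewrite /C lerDr addr_ge0 // mulr_ge0 // addr_ge0.
 have /andP[_ a1] := S1; have /andP[_ a3] := S3.
 have p1 : 0 <= (\sum_j c1 j) * I1 by pos.
 have p3 : 0 <= (\sum_j c3 j) * I1 by rewrite mulr_ge0 // ltW.
 have q0 : 0 <= r^-1 ^+ 2 by pos.
 rewrite (mulr_ge0 q0 p1) mulr_ge0 //=; split; apply: le_trans IC.
  by rewrite mulrA ler_piMl ?(ltW I10) // exprVn mulrC ler_pdivrMr // mul1r; apply:
   le_trans a1 _; move: r2; clra.
 by rewrite mulrA ler_piMl ?(ltW I10) //; move: a3; clra.
- have l1 : C1 <= C by rewrite /C; move: C10 C20 C30 I10; clra.
 have l2 : C2 <= C by rewrite /C; move: C10 C20 C30 I10; clra.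
 have up (c p q : R) : c <= C -> `|p - q| <= A * c * X -> `|p - q| <= A * C * X.
  by move=> cC /le_trans; apply; rewrite ler_wpM2r // ler_wpM2l.
 apply: (all4 (fun k => forall x, `|cv u k x - u x| <= A * C * X)) => x; [have [hx _ _]
  := E1 x|have [hx _ _] := E2 x|have [hx _ _] := E3 x|have [hx _ _] := E4 x]; [exact: up
  _ _ _ l1 hx|exact: up _ _ _ l1 hx|exact: up _ _ _ l1 hx|exact: up _ _ _ l2 hx].
- have l1 : 8 * C1 <= C by rewrite /C; move: C10 C20 C30 I10; clra.
 have l2 : 8 * C2 <= C by rewrite /C; move: C10 C20 C30 I10; clra.
 have Y1 : 0 <= r^-1 ^+ 2 * X by pos.
 have up (c p : R) : 8 * c <= C -> `|p| <= A * c * Q -> `|p| <= A * C * (r^-1 ^+ 2 * X).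
  move=> cC /le_trans; apply; rewrite /Q; have -> : A * c * (8 * (r^-1 ^+ 2 * X)) = A *
   (8 * c) * (r^-1 ^+ 2 * X) by ring.
  by rewrite ler_wpM2r // ler_wpM2l.
 apply: (all4 (fun k => forall x, `|Lap (cv u k) x| <= A * C * (r^-1 ^+ 2 * X))) => x;
  [have [_ hx _] := E1 x|have [_ hx _] := E2 x|have [_ hx _] := E3 x|have [_ hx _] := E4
  x]; [exact: up _ _ l1 hx|exact: up _ _ l1 hx|exact: up _ _ l1 hx|exact: up _ _ l2 hx].
move=> x.
have [_ _ F1] := E1 x; have [_ _ F2] := E2 x; have [_ _ F3] := E3 x; have [_ _ F4] := E4
 x.
have cvs m s (f : E -> R) : 0 < s -> Ccs f -> Cc0 (scl m s f) by move=> s0 cf; exact: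
 Ccs_Cc0 (Ccs_scl m s0 cf).
have cL j := Ccs_Lap (ck j); have cLp := Ccs_Lap (Ccs_pk 1 e).
have G1 : \sum_(j < M) (r - t) / M%:R * cv u (scl N.+1 (t + j%:R * ((r - t) / M%:R))
 (Euler N (kj 2))) x = (\sum_j c1 j) * I1 * Lap (cv u k1) x.
 rewrite -F1; ebig j; have /andP[sj _] := s1p j; rewrite -/h -/(s1 j).
 have -> : scl N.+1 (s1 j) (Euler N (kj 2)) = fun y => s1 j / 2 * scl N.+2 (s1 j) (Lap
  (kj 1)) y.
  by ext y; rewrite scl_Euler_kj2.
 by rewrite (cv_scale _ _ cu (cvs _ _ _ sj (cL 1%N))) mulrA /c1; congr (_ * _); ring.
have G2 : \sum_(j < M) (2 * r - 2 * t) / M%:R * cv u (scl N.+1 (2 * t + j%:R * ((2 * r -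
 2 * t) / M%:R)) (Euler N (kj 2))) x = 4 * ((\sum_j c1 j) * I1 * Lap (cv u k2) x).
 rewrite 2!mulrA -S12 -/I1 -F2; ebig j; have /andP[sj _] := s2p j; rewrite -/h' -/(s2
  j).
 have -> : scl N.+1 (s2 j) (Euler N (kj 2)) = fun y => s2 j / 2 * scl N.+2 (s2 j) (Lap
  (kj 1)) y.
  by ext y; rewrite scl_Euler_kj2.
 by rewrite (cv_scale _ _ cu (cvs _ _ _ sj (cL 1%N))) mulrA /c2; congr (_ * _); ring.
have G3 : \sum_(j < M) (2 * r - r) / M%:R * cv u (scl N.+3 (r + j%:R * ((2 * r - r) /
 M%:R)) (Euler N.+2 (HF (kj 1) e))) x = (\sum_j c3 j) * I1 * (Lap (cv u k4) x - Lap (cv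
 u k3) x).
 have F4' : \sum_j c3 j * cv u (scl N.+2 (s3 j) (Lap (pk 1 e))) x = (\sum_j c3 j) * I1 *
  Lap (cv u k4) x.
  by apply: etrans F4 _; congr (_ * _ * _).
 apply: etrans (etrans (congr2 (fun a b => a - b) F4' F3) (esym (mulrBr _ _ _))).
 rewrite -sumrB; ebig j; have /andP[sj _] := s3p j; rewrite -/h3 -/(s3 j).
 have -> : scl N.+3 (s3 j) (Euler N.+2 (HF (kj 1) e)) = fun y => (s3 j)^-1 * (scl N.+2
  (s3 j) (Lap (pk 1 e)) y - scl N.+2 (s3 j) (Lap (kj 1)) y).
  by ext y; rewrite scl_Euler_HF.
 have d1 := cvs N.+2 _ _ sj cLp; have d2 := cvs N.+2 _ _ sj (cL 1%N); have d3 := Cc0B d1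
  d2.
 by rewrite (cv_scale (s3 j)^-1 x cu d3) (cv_sub x cu d1 d2) mulrA -mulrBr.
have H1 : `|cv u (scl N r (kj 2)) x - cv u (scl N t (kj 2)) x - (\sum_j c1 j) * I1 * Lap
 (cv u k1) x| <= D1 / M%:R.
 by rewrite -G1; exact: R1.
have H2 : `|cv u (scl N (2 * r) (kj 2)) x - cv u (scl N (2 * t) (kj 2)) x - 4 * ((\sum_j
 c1 j) * I1 * Lap (cv u k2) x)| <= D2 / M%:R.
 by rewrite -G2; exact: R2.
have H3 : `|cv u (scl N.+2 (2 * r) (HF (kj 1) e)) x - cv u (scl N.+2 r (HF (kj 1) e)) x
 - (\sum_j c3 j) * I1 * (Lap (cv u k4) x - Lap (cv u k3) x)| <= D3 / M%:R.
 by rewrite -G3; exact: R3.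
have K1 : `|cv u (scl N t (kj 2)) x - Int (kj (R := R) (N := N) 2) * u x| <= A * C3 * t
 `^ b.
 by have := M3 A u tu 0%N t x t0; rewrite addn0 expr0 !mul1r.
have K2 : `|cv u (scl N (2 * t) (kj 2)) x - Int (kj (R := R) (N := N) 2) * u x| <= A *
 C3 * (2 * t) `^ b.
 by have := M3 A u tu 0%N (2 * t) x t20; rewrite addn0 expr0 !mul1r.
have := T_arith r0 H1 H2 H3 K1 K2.
have TE s : 0 < s -> Tq u e s x = s^-1 ^+ 2 * (cv u (scl N s (kj 2)) x - Int (kj (R :=
 R) (N := N) 2) * u x) + 2^-1 * cv u (scl N.+2 s (HF (kj 1) e)) x.
 move=> s0; rewrite /Tq; have -> : scl N s (pk 2 e) = fun y => scl N s (kj 2) y + (2^-1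
  * s ^+ 2) * scl N.+2 s (HF (kj 1) e) y.
  ext y; rewrite /scl /pk /= [s^-1 ^+ N.+2]exprS [s^-1 ^+ N.+1]exprS mulrDr; congr (_ +
   _).
  by field; rewrite gt_eqF.
 have d1 := cvs N _ _ s0 (ck 2%N); have d2 := cvs N.+2 _ _ s0 cH.
 rewrite (cv_add x cu d1 (Cc0Z _ d2)) (cv_scale _ x cu d2).
 by field; rewrite gt_eqF.
rewrite (TE r r0) (TE (2 * r) r20) => H; apply: le_trans (_ : _ <= _) (le_trans H _).
 apply: le_of_eq; congr (`|_ - _|).
 rewrite -[kap 0]/k1 -[kap 1]/k2 -[kap 2%:R]/k3 -[kap 3%:R]/k4.
 exact: T_arith3.
have tb : t `^ b <= (2 * t) `^ b by apply: powR_mono; try pos; move: t0; clra.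
have q0 : 0 <= r^-1 ^+ 2 by pos.
apply: le_trans (_ : r^-1 ^+ 2 * (2 * (A * C3 * (2 * t) `^ b)) + (r^-1 ^+ 2 * (D1 + D2)
 + D3) / M0%:R <= _).
 have a1 := MM D1 D10; have a2 := MM D2 D20; have a3 := MM D3 D30.
 have k1' : A * C3 * t `^ b <= A * C3 * (2 * t) `^ b by rewrite ler_wpM2l // mulr_ge0.
 exact: T_arith2 q0 k1' a1 a2 a3.
apply: lerD => //; have P0 : 0 <= (2 * t) `^ b by pos.
have -> : r^-1 ^+ 2 * (2 * (A * C3 * (2 * t) `^ b)) = A * (2 * C3) * (r^-1 ^+ 2 * (2 *
 t) `^ b) by ring.
apply: ler_wpM2r; first exact: mulr_ge0.
by apply: ler_wpM2l => //; rewrite /C; move: C10 C20 I10; clra.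
Qed.

End decomposition.

(** * Local solutions, and closeness of traces at a maximum point *)

Section local_solution_class.
Context {R : realType} {n : nat}.
Local Notation E := 'rV[R]_(n + n).
Implicit Types (u q psi f : E -> R) (x y z w v : E) (A b s eta : R) (H : 'I_(n + n) -> 'I_(n + n) -> R) (xi : 'I_n -> E).

#[local] Opaque Int HF.

(** What the iteration uses of a solution on a ball: the Taylor class, the determinant bound for
    functions touching from below, the arithmetic-geometric inequality for averages, and bounds on
    [f]. No current or measure remains, and the constants obtained below are uniform over all [u]
    and [f] in this class. *)
Record lsol u f z0 r0 A b lam F al : Prop := LSol { ls_tay : tay A b u; ls_V : forall q
 x1 xi mu eta, smooth q -> enorm (x1 - z0) < r0 -> (forall x, q x - u x <= q x1 - u x1)
 -> eigen (Hs q x1) xi mu -> 0 < eta -> (forall l, 2 * eta <= mu l) -> \prod_l (mu l -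
 eta) <= f x1; ls_S : forall psi z s s' g0, 0 <= s' < s -> enorm (z - z0) + s <= r0 ->
 kernel psi s' -> 0 <= g0 -> (forall x, enorm (x - z) < s -> g0 <= f x) -> Smaj (Hs (cv
 u psi) z) g0; ls_lam : forall x, enorm (x - z0) < r0 -> lam <= f x <= F; ls_hol :
 forall x y, enorm (x - z0) < r0 -> enorm (y - z0) < r0 -> `|f x - f y| <= F * enorm (x
 - y) `^ al }.

(** At distance [rho] the penalty exceeds the largest possible oscillation [2 * M] of [g], so the
    maximum over the closed ball is a global one. *)
Lemma max_quad (g : E -> R) z (B M rho : R) : continuous g -> (forall x, `|g x| <= M) -> 0 < rho -> 2 * M < B * rho ^+ 2 ->
 exists2 z1, enorm (z1 - z) <= rho & forall x, g x - B * dot (x - z) (x - z) <= g z1 - B * dot (z1 - z) (z1 - z).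
Proof.
move=> cg gM rho0 BM; pose G x := g x - B * dot (x - z) (x - z).
have M0 : 0 <= M := le_trans (normr_ge0 _) (gM 0).
have B0 : 0 < B by rewrite -(pmulr_lgt0 _ (exprn_gt0 2 rho0)); apply: le_lt_trans BM;
 rewrite mulr_ge0.
have cG : continuous G by apply: contB => //; apply: contM; [exact: cont_cst|exact:
 smooth_cont (smooth_sqr z)].
pose K : set E := [set x | enorm (x - z) <= rho].
have zK : K z by rewrite /K /= subrr enorm0 ltW.
have K0 : K !=set0 by exists z.
have [y] := @EVT_max_rV R _ G K K0 (@compact_cball _ _ z rho) (continuous_subspaceT cG).
rewrite inE => yK Hy; exists y => // x; have [xK|xK] := leP (enorm (x - z)) rho; first
 by apply: Hy; rewrite inE.
apply: le_trans (Hy z _); last by rewrite inE.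
rewrite /G dot_subrr mulr0 subr0.
have h1 : B * rho ^+ 2 <= B * dot (x - z) (x - z).
 by rewrite ler_pM2l // -enorm_sqr ler_sqr ?nnegrE ?enorm_ge0 ?(ltW xK) // ltW.
have := gM x; have := gM z; rewrite !ler_norml => /andP[a1 a2] /andP[a3 a4].
lra.
Qed.

Lemma Hs_sum (I : finType) (g : I -> E -> R) (w : I -> R) x : (forall i, smooth (g i)) ->
 Hs (fun x => \sum_i w i * g i x) x = fun k l => \sum_i w i * Hs (g i) x k l.
Proof.
move=> sg; ext a; ext b; rewrite /Hs.
have sw i : smooth (fun x => w i * g i x) by exact: smoothZ.
rewrite (D_sum _ _ b sw).
have -> : (fun x => \sum_i D b (fun x => w i * g i x) x) = fun x => \sum_i w i * D b (g
 i) x.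
 by ext y; ebig i; rewrite (DZ _ b (smooth_pd (sg i))).
rewrite (D_sum _ _ a (fun i => smoothZ (w i) (smoothD b (sg i)))).
by ebig i; rewrite (DZ _ a (smooth_pd (smoothD b (sg i)))).
Qed.

Lemma qf_sum (I : finType) (H : I -> 'I_(n + n) -> 'I_(n + n) -> R) (w : I -> R) v :
 qf (fun k l => \sum_i w i * H i k l) v = \sum_i w i * qf (H i) v.
Proof.
rewrite /qf; have -> : \sum_i w i * (\sum_a \sum_b v ord0 a * v ord0 b * H i a b) =
 \sum_i \sum_a \sum_b w i * (v ord0 a * v ord0 b * H i a b).
 by ebig i; rewrite mulr_sumr; ebig a; rewrite mulr_sumr.
rewrite [RHS]exchange_big; ebig a => /=; rewrite [RHS]exchange_big; ebig b => /=.
by rewrite mulr_sumr; ebig i; rewrite mulrCA.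
Qed.

Lemma levi_sum (I : finType) (H : I -> 'I_(n + n) -> 'I_(n + n) -> R) (w : I -> R) v :
 levi (fun k l => \sum_i w i * H i k l) v = \sum_i w i * levi (H i) v.
Proof.
rewrite levi.unlock !qf_sum -big_split mulr_suml; ebig i => /=.
by rewrite -mulrDr mulrA.
Qed.

Lemma Lap_levi (g : E -> R) xi x : smooth g -> uframe xi -> \sum_l levi (Hs g x) (xi l) = Lap g x / 4.
Proof. by move=> sg ux; rewrite (levi_trace (symH_Hs x sg) ux). Qed.

Lemma prod_lower (lam : 'I_n -> R) (g Mr : R) l : (0 < n)%N -> (forall k, 0 <= lam k) -> \sum_k lam k <= Mr ->
 g <= \prod_k lam k -> g <= lam l * Mr ^+ n.-1.
Proof.
move=> n0 l0 lM /le_trans; apply; rewrite (bigD1 l) //= ler_wpM2l //.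
have kM k : lam k <= Mr by apply: le_trans lM; rewrite (bigD1 k) //= lerDl sumr_ge0.
apply: le_trans (_ : \prod_(k | k != l) Mr <= _); first by apply: ler_prod => k _;
 rewrite l0 kM.
by rewrite prodr_const cardC1 card_ord.
Qed.

(** At [z1] the mean of the averages, lowered by the penalty, touches [u] from below; so the product
    of its eigenvalues, each reduced by [2 * B], is at most [f z1]. Each single average satisfies
    the arithmetic-geometric inequality with [g0], which is close to [f z1]. Concavity is thus
    almost an equality and [trace_close] applies; [th] measures the loss due to the penalty and [om]
    the one due to the oscillation of [f]. *)
Lemma trace_at_max u f z0 r0 A b lam F al (I : finType) (kap : I -> E -> R) (w : I -> R) s' s z1 zs (B Mr g0 th om : R) :
 (0 < n)%N -> lsol u f z0 r0 A b lam F al -> (forall i, kernel (kap i) s') -> (forall i, 0 < w i) -> \sum_i w i = 1 ->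
 0 <= s' < s -> enorm (z1 - z0) + s <= r0 -> 0 < B ->
 (forall x, \sum_i w i * cv u (kap i) x - u x - B * dot (x - zs) (x - zs) <=
      \sum_i w i * cv u (kap i) z1 - u z1 - B * dot (z1 - zs) (z1 - zs)) ->
 (forall i, Lap (cv u (kap i)) z1 / 4 <= Mr) -> 0 < g0 -> (forall x, enorm (x - z1) < s -> g0 <= f x) ->
 0 < Mr -> 2 * B * Mr ^+ n.-1 <= th * g0 -> 0 <= th <= 2^-1 -> 0 <= om <= 2^-1 -> f z1 * (1 - om) <= g0 ->
 exists m : R, [/\ 0 <= m <= Mr, n = 1 -> m <= 2 * f z1 & forall j (y : R), th + om <= w j * y ^+ 2 -> 0 < y <= 2^-1 ->
  `|Lap (cv u (kap j)) z1 / 4 - m| <= (5 * n%:R + 2) * y * m].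
Proof.
move=> n0 ls kk w0 w1 s's z1s B0 mx LM g00 gf Mr0 thB /andP[th0 th1] /andP[ om0 om1] fg.
have s0 : 0 < s by case/andP: s's => a; exact: le_lt_trans.
have z1r : enorm (z1 - z0) < r0 by apply: lt_le_trans z1s; rewrite ltrDl.
have cu := tay_cont (ls_tay ls).
have sk i : smooth (cv u (kap i)) by exact: smooth_cv (ker_Ccs (kk i)).
pose q0 x := \sum_i w i * cv u (kap i) x.
have sq0 : smooth q0 by apply: smooth_sum => i; exact: smoothZ.
have [xi [lm [ux cH lv]]] := spectral_frame (symH_Hs z1 sq0).
pose t i l := levi (Hs (cv u (kap i)) z1) (xi l).
have lmE l : lm l = \sum_i w i * t i l by rewrite -lv /q0 Hs_sum // levi_sum.
have maj i : rmaj (t i) g0.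
 by move=> d d0; exact: (ls_S ls s's z1s (kk i) (ltW g00) gf ux d0).
have tr i : \sum_l t i l = Lap (cv u (kap i)) z1 / 4 by exact: Lap_levi.
pose m := \sum_l lm l.
have t0 i l := rmaj_ge0 l (maj i).
have l0 l : 0 <= lm l by rewrite lmE sumr_ge0 // => i _; rewrite mulr_ge0 // ltW.
have mE : m = \sum_i w i * \sum_l t i l.
 by rewrite /m; under eq_bigr do rewrite lmE; rewrite exchange_big; ebig i; rewrite
  mulr_sumr.
have mM : m <= Mr.
 rewrite mE -[X in _ <= X]mul1r -w1 mulr_suml; apply: ler_sum => i _; rewrite ler_wpM2l
  ?(ltW (w0 i)) // tr //.
have m0 : 0 <= m by pos.
have maj0 : rmaj lm g0.
 have := rmaj_sum n0 (ltW g00) (fun i => ltW (w0 i)) w1 maj; congr (rmaj _ g0); ext l;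
  by [].
have P0 := rmaj_prod n0 (ltW g00) maj0.
(* The product of the eigenvalues is at least [g0] and each is at most [Mr], so each is at least
   [g0 / Mr ^+ n.-1]: the penalty is small relative to every one of them. *)
have lB l : 2 * B <= th * lm l.
 have h := prod_lower l n0 l0 mM P0.
 have M0 : 0 < Mr ^+ n.-1 by pos.
 rewrite -(ler_pM2r M0); apply: le_trans thB _; rewrite -mulrA ler_wpM2l //.
have l4 l : 4 * B <= lm l.
 have : th * lm l <= 2^-1 * lm l by rewrite ler_wpM2r.
 by have := lB l; lra.
pose q x := q0 x + (- B) * dot (x - zs) (x - zs).
have sq : smooth q by apply: smooth_add => //; apply: smoothZ; exact: smooth_sqr.
have eq1 : eigen (Hs q z1) xi (fun l => lm l - B).
 rewrite /q Hs_sqE //; have := @eigen_addI R n (Hs q0 z1) xi lm (- B * 2) (conj ux cH).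
 by rewrite mulfK // pnatr_eq0.
have mu2 l : 2 * B <= lm l - B by have := l4 l; lra.
have mxq x : q x - u x <= q z1 - u z1.
 have := mx x; rewrite -/(q0 x) -/(q0 z1) /q !mulNr; lra.
have V := ls_V ls sq z1r mxq eq1 B0 mu2.
have V2 : (1 - th) ^+ n * \prod_l lm l <= f z1.
 have -> : (1 - th) ^+ n * \prod_l lm l = \prod_l ((1 - th) * lm l) by rewrite big_split
  /= prodr_const card_ord.
 apply: le_trans V; apply: ler_prod => l _.
 rewrite mulr_ge0 ?subr_ge0 //=; last by lra.
 by have := lB l; lra.
exists m; split; first by rewrite m0.
(* In dimension one the trace is the only eigenvalue, and touching from below bounds it by [f z1]
   directly. *)
- move=> n1; have lm2 l : lm l / 2 <= lm l - B - B by have := l4 l; lra.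
 have : \prod_l (lm l / 2) <= f z1.
  apply: le_trans V; apply: ler_prod => l _; rewrite divr_ge0 //= lm2 //.
 have En (G : 'I_n -> R) : \prod_l G l = \sum_l G l.
  by move: G; rewrite n1 => G; rewrite !big_ord_recl !big_ord0 mulr1 addr0.
 rewrite En -mulr_suml -/m; lra.
- move=> j y zy y2; rewrite -tr.
 apply: (@trace_close R n I t w lm g0 (th + om) y j n0 g00 maj (fun i => ltW (w0 i)) w1
  lmE _ _ (w0 j) zy y2).
  by apply/andP; split; lra.
 apply: le_trans fg.
 have q1 : (1 - (th + om)) ^+ n <= (1 - om) * (1 - th) ^+ n.
  apply: le_trans (_ : ((1 - om) * (1 - th)) ^+ n <= _).
   apply: lerXn2r; rewrite ?nnegrE ?mulr_ge0 ?subr_ge0 //; try by lra.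
   by have := mulr_ge0 th0 om0; nra.
  rewrite exprMn; apply: ler_wpM2r; first by rewrite exprn_ge0 // subr_ge0; lra.
  by rewrite -[X in _ <= X]expr1; apply: ler_wiXn2l => //; rewrite ?subr_ge0; lra.
 have P00 : 0 <= \prod_l lm l by apply: prodr_ge0.
 apply: le_trans (ler_wpM2r P00 q1) _; rewrite -mulrA [f z1 * _]mulrC ler_wpM2l //; lra.
Qed.

End local_solution_class.

(** * One step of the iteration: from scale [2 r] to scale [r] *)

Section main_step.
Context {R : realType} {n : nat}.
Local Notation E := 'rV[R]_(n + n).
Implicit Types (u q f : E -> R) (x z w : E) (A b c r : R).

#[local] Opaque Int HF.

Lemma pwD (r x y : R) : 0 < r -> r `^ (x + y) = r `^ x * r `^ y.
Proof. by move=> r0; rewrite powRD // (gt_eqF r0) implybT. Qed.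

Lemma pwM2 r : 0 < r -> r^-1 ^+ 2 = r `^ (- 2%:R).
Proof. by move=> r0; rewrite powR_invn ?(ltW r0) // exprVn. Qed.

Lemma pw_exp (r x : R) (k : nat) : 0 < r -> (r `^ x) ^+ k = r `^ (x * k%:R).
Proof. by move=> r0; rewrite -powR_mulrn ?powR_ge0 // powRrM. Qed.

Lemma pw_le (r x y : R) : 0 < r -> r <= 1 -> x <= y -> r `^ y <= r `^ x.
Proof. by move=> r0 r1; apply: ger_powR; rewrite r0. Qed.

Lemma pow2r (c r b : R) : 0 <= b <= 2 -> 1 <= c -> 0 < r -> (c * r) `^ b <= c ^+ 2 * r `^ b.
Proof.
move=> /andP[b0 b2] c1 r0; have c0 : 0 <= c by exact: le_trans c1.
rewrite powRM ?(ltW r0) // ler_wpM2r ?powR_ge0 // -powR_mulrn // ler_powR //.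
Qed.

Lemma max_cmp_arith (p M a0 a1 s0 s1 : R) : 0 <= p -> (1 + 4 * p)^-1 * (a0 + p * s0) <= (1 + 4 * p)^-1 * (a1 + p * s1) ->
 `|s0| <= 4 * M -> `|s1| <= 4 * M -> a0 <= a1 + 8 * (p * M).
Proof.
move=> p0; have q0 : 0 < (1 + 4 * p)^-1 by pos.
rewrite ler_pM2l // => h /ler_normlP[h1 _] /ler_normlP[_ h2].
have h3 := ler_wpM2l p0 h1; have h4 := ler_wpM2l p0 h2; move: h h3 h4.
by rewrite mulrN; lra.
Qed.

Lemma lap_arith (L1 L2 L3 L4 m K m1 m2 C : R) : `|L1 / 4 - m| <= K -> `|L2 / 4 - m| <= K -> `|L3 / 4 - m| <= K -> `|L4 / 4 - m| <= K ->
 0 <= m1 <= C -> 0 <= m2 <= C -> m1 * (L1 - L2) + m2 * (L3 - L4) <= 16 * (C * K).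
Proof.
rewrite !ler_norml => /andP[a1 a2] /andP[b1 b2] /andP[c1 c2] /andP[d1 d2] /andP[m10 m1C]
 /andP[m20 m2C].
have K0 : 0 <= K by lra.
have h1 : m1 * (L1 - L2) <= m1 * (8 * K) by apply: ler_wpM2l => //; lra.
have h2 : m2 * (L3 - L4) <= m2 * (8 * K) by apply: ler_wpM2l => //; lra.
have h3 : m1 * (8 * K) <= C * (8 * K) by apply: ler_wpM2r => //; rewrite mulr_ge0.
have h4 : m2 * (8 * K) <= C * (8 * K) by apply: ler_wpM2r => //; rewrite mulr_ge0.
lra.
Qed.

Lemma step2_arith (t1 t2 N dl a l m c d : R) : t1 - t2 - dl <= a + d -> dl <= l -> l <= m -> a <= c -> t2 <= N ->
 t1 <= N + (m + c + d).
Proof. lra. Qed.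

Lemma step3_arith (t1 N a m c d : R) : t1 <= N + (m * d + c * d + d) -> t1 + a * d <= N + (a + m + c + 1) * d.
Proof. by rewrite !mulrDl mul1r; lra. Qed.

Lemma hol_arith (p q a d : R) : - q <= a - d -> q <= p -> d - p <= a.
Proof. lra. Qed.

(** [trace_at_max] is applied to the normalized kernel of [Tq u e r] together with the four kernels
    of [T_decomp], the latter with small relative weight [p = r ^ (2 - b + kp)], and a penalty
    acting at distance [r ^ kp]. The exponents balance as follows. Moving from [zs] to the maximum
    point costs [p r ^ (b - 2) = r ^ kp]. The traces agree up to [y m], where [y ^ 2] is of order
    [r ^ al / p] and the mean trace [m] is at most of order [r ^ (- dp)]; this is the condition on
    [3 * kp]. The loss [th] due to the penalty must be of order [r ^ al], which is the condition on
    [2 * kp]. Finally, the remainder of [T_decomp] with [t = r ^ 2] is of order [r ^ (2 b - 2)]. *)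
Lemma main_step (b al lam F A kp dp : R) (e : E) : (0 < n)%N -> 1 < b < 2 -> 0 < al <= 1 -> 0 < kp -> 0 < lam -> 0 <= F -> 0 <= A ->
 0 <= dp -> (n = 1 \/ 2 - b <= dp) -> 3 * kp <= al - (2 - b) - 2 * dp -> 2 * kp <= 2 - al - n%:R * (2 - b) -> kp <= 2 * b - 2 ->
 enorm e <= 1 ->
 exists Cm rb : R, [/\ 0 <= Cm, 0 < rb <= 2^-1 & forall u f z0 r0, lsol u f z0 r0 A b lam F al ->
  forall zs r (N0 : R), 0 < r <= rb -> enorm (zs - z0) + r `^ kp + 4 * r <= r0 ->
  (forall z, enorm (z - zs) <= r `^ kp -> Tq u e (2 * r) z <= N0) -> Tq u e r zs <= N0 + Cm * r `^ kp].
Proof.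
move=> n0 /andP[b1 b2] /andP[al0 al1] kp0 lam0 F0 A0 dp0 ndp H1 H2 H3 e1.
have b0 : 0 <= b by apply: ltW; exact: lt_trans b1.
have b02 : 0 <= b <= 2 by rewrite b0 ltW.
have [Ca Ca0 TD] := @T_decomp R (n + n) b e b1 e1.
have [Cb Cb0 KB] := kern0 (Ccs_pk 2 e) (@mom0_pk R (n + n) 1 e) b0.
have [Cc Cc0 KC] := kern0 (Ccs_Lap (Ccs_pk 2 e)) (mom0_Lap (Ccs_pk 2 e)) b0.
pose I2 := Int (kj (R := R) (N := n + n) 2); have I20 : 0 < I2 by exact: Int_kj_gt0.
have I2i : 0 <= I2^-1 by pos.
pose C1 := Ca + (Cb + Cc) / I2; have C10 : 0 <= C1 by pos.
pose D := A * C1 + 1; have D0 : 0 < D by pos.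
have D1 : 1 <= D by rewrite lerDr mulr_ge0.
pose Cth := 4 / lam * (3 * D * 4 * (4 * D) ^+ n.-1); pose Co := 16 * F / lam; pose Cz :=
 Cth + Co.
have Cth0 : 0 <= Cth by pos.
have Co0 : 0 <= Co by pos.
have Cz0 : 0 <= Cz by pos.
(* Exponent of the relative trace error [y]: twice [ey] is what remains of [al] after division by
   the weight [p]. *)
pose ey := (al - (2 - b) - kp) / 2; have ey0 : 0 < ey by rewrite divr_gt0 //; move: H1
 dp0 kp0; clra.
pose Sq := Num.sqrt (5 * Cz + 1); have Sq0 : 0 < Sq by rewrite sqrtr_gt0 ltr_wpDl //
 mulr_ge0.
have Sq2 : Sq ^+ 2 = 5 * Cz + 1 by rewrite sqr_sqrtr // addr_ge0 // mulr_ge0.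
have [ra [ra0 _ ra1 raE]] := @powR_small R al (2^-1 / (Cz + 1)) al0 ltac:(by rewrite
 divr_gt0 // ltr_wpDl).
have [rc [rc0 _ rc1 rcE]] := @powR_small R ey (2^-1 / Sq) ey0 ltac:(by rewrite
 divr_gt0).
pose rb := Num.min 2^-1 (Num.min ra rc).
exists (32 * (I2 * (A * C1)) + 16 * (C1 * ((5 * n%:R + 2) * (Sq * (4 * D + 2 * F)))) + A
 * C1 * 4 + 1), rb; split.
- have DF0 : 0 <= 4 * D + 2 * F by pos.
 have h1 : 0 <= 32 * (I2 * (A * C1)) by pos.
 have h2 : 0 <= 16 * (C1 * ((5 * n%:R + 2) * (Sq * (4 * D + 2 * F)))).
  by apply: mulr_ge0 => //; apply: mulr_ge0 => //; apply: mulr_ge0; [rewrite addr_ge0 //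
   mulr_ge0|apply: mulr_ge0; [exact: ltW|]].
 have h3 : 0 <= A * C1 * 4 by pos.
 exact: addr_ge0 (addr_ge0 (addr_ge0 h1 h2) h3) ler01.
- by rewrite !lt_min ra0 rc0 invr_gt0 ltr0n /= ge_min lexx.
move=> u f z0 r0 ls zs r N0 /andP[rp rrb] zsr HN.
have [r2 [rra rrc]] : r <= 2^-1 /\ r <= ra /\ r <= rc by move: rrb; rewrite !le_min =>
 /andP[-> /andP[]].
have r1 : r <= 1 by apply: le_trans r2 _; rewrite invf_le1 // ler1n.
have tu := ls_tay ls; have cu := tay_cont tu.
have al_small : r `^ al <= 2^-1 / (Cz + 1).
 by apply: le_trans raE; apply: powR_mono; try pos.
have y_small : r `^ ey <= 2^-1 / Sq.
 by apply: le_trans rcE; apply: powR_mono; try pos.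
(* Relative weight of the four kernels of [T_decomp]: small enough not to disturb [Tq u e r] at the
   maximum, large enough for [trace_close], which divides by it. *)
pose p := r `^ (2 - b + kp); have p0 : 0 < p by pos.
have p1 : p <= 1 by rewrite -(powRr0 r) pw_le //; move: b2 kp0; clra.
pose rho := r `^ kp; have rho0 : 0 < rho by pos.
pose X := (2 * r) `^ b; have X0 : 0 < X by pos.
have X4 : X <= 4 * r `^ b.
 by have := @pow2r 2 r b b02 ltac:(by rewrite ler1n) rp; rewrite -natrX.
pose Y := r^-1 ^+ 2 * X; have Y0 : 0 < Y by pos.
have Y4 : Y <= 4 * r `^ (b - 2).
 rewrite /Y pwM2 // addrC pwD // mulrCA ler_wpM2l ?powR_ge0 //.
have t0 : 0 < r ^+ 2 by pos.
have tr : 2 * r ^+ 2 <= r by rewrite expr2 mulrA ler_piMl ?(ltW rp) // mulrC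
 -ler_pdivlMr // mul1r.
have [kap [m1 [m2 [kk [m1C m2C] kest klap kdec]]]] := TD A u tu r (r ^+ 2) rp t0 tr (r
 `^ kp) rho0.
(* The normalized kernel of [Tq u e r]: the excess of its average over [u] is a positive multiple of
   [Tq u e r]. With the four [kap] it forms the family [kp5]. *)
pose kap0 := fun y : E => I2^-1 * scl (n + n) r (pk 2 e) y.
pose kp5 (i : 'I_5) := if fintype.unlift ord0 i is Some j then kap j else kap0.
have k50 : kp5 ord0 = kap0 by rewrite /kp5 unlift_none.
have k5S j : kp5 (lift ord0 j) = kap j by rewrite /kp5 liftK.
have cs0 := Ccs_scl (n + n) rp (Ccs_pk 2 e).
have ker0 : kernel kap0 (2 * r).
 split.
 - exact: CcsZ.
 - move=> y; rewrite mulr_ge0 ?invr_ge0 ?(ltW I20) // mulr_ge0 ?(@pk_ge0 R (n + n) 1) //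
  exprn_ge0 // invr_ge0 ltW //.
 - rewrite IntZ ?Int_scl ?Int_pk ?mulVf ?gt_eqF //; [exact: Ccs_pk|exact: Ccs_Cc0].
 - move=> y hy; rewrite /kap0 (supp_scl (n + n) rp (@supp_pk R (n + n) 2 e)) ?mulr0 //;
  apply: le_lt_trans hy.
  by rewrite ler_pM2r //; clra.
have kk5 i : kernel (kp5 i) (2 * r) by rewrite /kp5; case: (fintype.unlift ord0 i).
have cvk0 x : cv u kap0 x = I2^-1 * cv u (scl (n + n) r (pk 2 e)) x by rewrite /kap0
 cv_scale //; exact: Ccs_Cc0.
have est0 x : `|cv u kap0 x - u x| <= A * C1 * X.
 have -> : cv u kap0 x - u x = I2^-1 * (cv u (scl (n + n) r (pk 2 e)) x - Int (pk 2 e) *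
  u x).
  by rewrite cvk0 Int_pk mulrBr mulKf // gt_eqF.
 rewrite normrM ger0_norm ?invr_ge0 ?(ltW I20) //.
 have := KB A u tu 0%N r x rp; rewrite addn0 expr0 !mul1r => /(ler_wpM2l I2i) /le_trans;
  apply.
 have -> : I2^-1 * (A * Cb * r `^ b) = A * (Cb / I2) * r `^ b by ring.
 apply: ler_pM => //; rewrite ?mulr_ge0 ?divr_ge0 ?powR_ge0 ?(ltW I20) //.
  by rewrite ler_wpM2l // /C1 mulrDl addrA addrAC lerDr addr_ge0 // divr_ge0 // ltW.
 by apply: powR_mono; try pos; move: rp; clra.
have CaC : Ca <= C1 by rewrite /C1 lerDl divr_ge0 ?addr_ge0 // ltW.
have est5 i x : `|cv u (kp5 i) x - u x| <= A * C1 * X.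
 rewrite /kp5; case: (fintype.unlift ord0 i) => [j|]; last exact: est0.
 by apply: le_trans (kest j x) _; rewrite ler_wpM2r ?(ltW X0) // ler_wpM2l.
have lap5 i x : Lap (cv u (kp5 i)) x / 4 <= D * Y.
 have ACD : A * C1 <= D by rewrite lerDl.
 suff h : `|Lap (cv u (kp5 i)) x| <= D * Y.
  rewrite ler_pdivrMr //; apply: le_trans (ler_norm _) _; apply: le_trans h _; rewrite
   ler_peMr ?ler1n //.
  exact: ltW (mulr_gt0 D0 Y0).
 apply: le_trans (_ : A * C1 * Y <= _); last by rewrite ler_wpM2r // ltW.
 rewrite /kp5; case: (fintype.unlift ord0 i) => [j|].
  by apply: le_trans (klap j x) _; rewrite ler_wpM2r ?(ltW Y0) // ler_wpM2l.
 have -> : Lap (cv u kap0) x = I2^-1 * cv u (scl (n + n).+2 r (Lap (pk 2 e))) x.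
  rewrite Lap_cv //; last exact: CcsZ.
  have -> : Lap kap0 = fun y => I2^-1 * scl (n + n).+2 r (Lap (pk 2 e)) y.
   by ext y; rewrite /kap0 (Lap_scale _ _ cs0.1) Lap_scl //; exact: (Ccs_pk 2 e).1.
  by rewrite cv_scale //; apply: Ccs_Cc0; apply: Ccs_scl => //; apply: Ccs_Lap; exact:
   Ccs_pk.
 rewrite normrM ger0_norm ?invr_ge0 ?(ltW I20) //.
 have := KC A u tu 2%N r x rp; rewrite Int_Lap ?mul0r ?mulr0 ?subr0 ?addn2; last exact:
  Ccs_pk.
 move=> /(ler_wpM2l I2i) /le_trans; apply.
 have -> : I2^-1 * (A * Cc * (r^-1 ^+ 2 * r `^ b)) = A * (Cc / I2) * (r^-1 ^+ 2 * r `^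
  b) by ring.
 have r0i : 0 <= r^-1 ^+ 2 by pos.
 apply: ler_pM; [pos|exact: mulr_ge0 r0i (powR_ge0 _ _)| |].
  by rewrite ler_wpM2l // /C1 mulrDl addrA lerDr addr_ge0 // divr_ge0 // ltW.
 by rewrite ler_wpM2l //; apply: powR_mono; try pos; move: rp; clra.
have p4 : 0 < 1 + 4 * p by pos.
pose w (i : 'I_5) := if fintype.unlift ord0 i is Some j then p / (1 + 4 * p) else (1 + 4
 * p)^-1.
have w50 : w ord0 = (1 + 4 * p)^-1 by rewrite /w unlift_none.
have w5S (j : 'I_4) : w (lift ord0 j) = p / (1 + 4 * p) by rewrite /w liftK.
have w0 i : 0 < w i by rewrite /w; case: (fintype.unlift ord0 i) => [j|]; rewrite
 ?divr_gt0 ?invr_gt0.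
have sum5 (G : 'I_5 -> R) : \sum_i w i * G i = (1 + 4 * p)^-1 * (G ord0 + p * \sum_(j <
 4) G (lift ord0 j)).
 rewrite big_ord_recl w50 mulrDr; congr (_ + _); rewrite !mulr_sumr; ebig j; rewrite
  w5S.
 by ring.
have w1 : \sum_i w i = 1.
 have := sum5 (fun=> 1); under eq_bigr do rewrite mulr1; move=> ->.
 by rewrite sumr_const card_ord; field; rewrite gt_eqF.
pose g x := \sum_i w i * cv u (kp5 i) x - u x.
have gE x : g x = \sum_i w i * (cv u (kp5 i) x - u x).
 by under [RHS]eq_bigr do rewrite mulrBr; rewrite sumrB -mulr_suml w1 mul1r.
have gM x : `|g x| <= A * C1 * X.
 rewrite gE -[X in _ <= X]mul1r -w1 mulr_suml; apply: le_trans (ler_norm_sum _ _ _) _;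
  apply: ler_sum => i _.
 by rewrite normrM (gtr0_norm (w0 i)) ler_wpM2l // ltW.
have cg : continuous g.
 by apply: contB => //; apply: cont_sum => i; apply: contM; [exact: cont_cst|exact:
  smooth_cont (smooth_cv cu (ker_Ccs (kk5 i)))].
(* The penalty equals [3 * D * X] at distance [rho], more than twice the bound [A * C1 * X] on
   [g]. *)
pose B := 3 * D * X / rho ^+ 2.
have rho2 : 0 < rho ^+ 2 by pos.
have B0 : 0 < B by pos.
have Brho : B * rho ^+ 2 = 3 * D * X by rewrite divfK // gt_eqF.
have BM : 2 * (A * C1 * X) < B * rho ^+ 2.
 rewrite Brho; have -> : 3 * D * X = 3 * (A * C1 * X) + 3 * X by rewrite /D; ring.
 have : 0 <= A * C1 * X by pos.
 by move=> h; rewrite ltr_pwDr ?mulr_gt0 // ler_wpM2r // ler_nat.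
have [z1 z1r mx] := max_quad zs cg gM rho0 BM.
have z1r0 : enorm (z1 - z0) + 4 * r <= r0.
 apply: le_trans zsr; rewrite lerD2r; apply: le_trans (ler_enormB _ zs _) _; rewrite
  addrC lerD2l //.
have z1in : enorm (z1 - z0) < r0 by apply: lt_le_trans z1r0; rewrite ltrDl mulr_gt0.
have s's : 0 <= 2 * r < 4 * r by rewrite mulr_ge0 ?(ltW rp) //= ltr_pM2r //; clra.
have /andP[f1 f2] := ls_lam ls z1in.
pose om := F * (4 * r) `^ al / lam; pose g0 := f z1 - F * (4 * r) `^ al.
have oE : om <= Co * r `^ al.
 rewrite /om /Co; have h : (4 * r) `^ al <= 16 * r `^ al.
  have := @pow2r 4 r al ltac:(by rewrite (ltW al0) /=; move: al1; clra) ltac:(by rewrite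
   ler1n) rp.
  by rewrite -natrX.
 have -> : 16 * F / lam * r `^ al = F * (16 * r `^ al) / lam by ring.
 by rewrite ler_pM2r ?invr_gt0 // ler_wpM2l.
have om0 : 0 <= om by rewrite divr_ge0 ?mulr_ge0 ?powR_ge0 // ltW.
have Mn : 0 < (D * Y) ^+ n.-1 by pos.
(* Makes [2 * B * (D * Y) ^+ n.-1] equal to [th * (lam / 2)], where [lam / 2] is a lower bound of
   [g0]. *)
pose th := 4 / lam * (B * (D * Y) ^+ n.-1).
have th0 : 0 <= th by pos.
have thE : th <= Cth * r `^ al.
 rewrite /th /Cth -[X in _ <= X]mulrA ler_wpM2l ?divr_ge0 ?(ltW lam0) //.
 have h1 : B <= 3 * D * 4 * r `^ (b - 2 * kp).
  have e2 : r `^ b = r `^ (b - 2 * kp) * r `^ (kp * 2%:R) by rewrite -pwD //; congr (_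
   `^ _); ring.
  rewrite /B ler_pdivrMr // /rho pw_exp // -[X in _ <= X]mulrA -e2 -[3 * D * 4 * _]mulrA
   ler_pM2l // mulr_gt0 //.
 have h2 : (D * Y) ^+ n.-1 <= (4 * D) ^+ n.-1 * r `^ ((b - 2) * n.-1%:R).
  rewrite -pw_exp // -exprMn; apply: lerXn2r; rewrite ?nnegrE; [exact: ltW (mulr_gt0 D0
   Y0)|pos|].
  by rewrite -[4 * D * _]mulrA [X in _ <= X]mulrCA ler_pM2l.
 apply: le_trans (ler_pM (ltW B0) (ltW Mn) h1 h2) _.
 have -> : 3 * D * 4 * r `^ (b - 2 * kp) * ((4 * D) ^+ n.-1 * r `^ ((b - 2) * n.-1%:R))
  = 3 * D * 4 * (4 * D) ^+ n.-1 * (r `^ (b - 2 * kp) * r `^ ((b - 2) * n.-1%:R)) by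
  ring.
 rewrite -pwD //; apply: ler_wpM2l; first by pos.
 apply: pw_le => //; have nE : n%:R = n.-1%:R + 1 :> R by rewrite natr1 prednK.
 by move: H2; rewrite nE; clear; nra.
have thoz : th + om <= Cz * r `^ al by rewrite mulrDl lerD.
have ral0 : 0 <= r `^ al by pos.
have thoh : th + om <= 2^-1.
 apply: le_trans thoz _; apply: le_trans (_ : (Cz + 1) * r `^ al <= _); first by rewrite
  ler_wpM2r // lerDl.
 by rewrite mulrC -ler_pdivlMr // ltr_wpDl.
have om1 : om <= 2^-1 by apply: le_trans thoh; rewrite lerDr.
have th1 : th <= 2^-1 by apply: le_trans thoh; rewrite lerDl.
have oF : om * lam = F * (4 * r) `^ al by rewrite divfK // gt_eqF.
have fo : f z1 * (1 - om) <= g0.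
 rewrite mulrBr mulr1 lerD2l lerN2 -oF mulrC; exact: ler_wpM2r.
have g0lam : lam / 2 <= g0.
 apply: le_trans fo; apply: ler_pM => //; [exact: ltW|by move: om1; clra].
have g00 : 0 < g0 by apply: lt_le_trans g0lam; rewrite divr_gt0.
have gf x : enorm (x - z1) < 4 * r -> g0 <= f x.
 move=> xz; have xin : enorm (x - z0) < r0.
  by apply: le_lt_trans (ler_enormB _ z1 _) _; apply: lt_le_trans z1r0; rewrite addrC
   ltrD2l.
 have := ls_hol ls xin z1in; rewrite ler_norml => /andP[h _].
 apply: hol_arith h _.
  by apply: ler_wpM2l => //; apply: powR_mono; try pos.
have thB : 2 * B * (D * Y) ^+ n.-1 <= th * g0.
 apply: le_trans (ler_wpM2l th0 g0lam).
 apply: le_of_eq; rewrite /th.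
 by field; rewrite gt_eqF.
have th01 : 0 <= th <= 2^-1 by rewrite th0.
have om01 : 0 <= om <= 2^-1 by rewrite om0.
have [m [/andP[m0 mM] mn1 mtr]] := trace_at_max n0 ls kk5 w0 w1 s's z1r0 B0 mx (fun i =>
 lap5 i z1) g00 gf (mulr_gt0 D0 Y0) thB th01 om01 fo.
pose y := Sq * r `^ ey; have y0 : 0 < y by pos.
have y12 : 0 < y <= 2^-1 by rewrite y0 /= /y mulrC -ler_pdivlMr.
have wy (j : 'I_4) : th + om <= w (lift ord0 j) * y ^+ 2.
 apply: le_trans thoz _; rewrite w5S exprMn Sq2 pw_exp //.
 apply: le_trans (_ : p / 5 * ((5 * Cz + 1) * r `^ (ey * 2%:R)) <= _); last first.
  apply: ler_wpM2r; first by pos.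
  by rewrite ler_pM2l // lef_pV2 ?posrE //; move: p1; clra.
 have -> : p / 5 * ((5 * Cz + 1) * r `^ (ey * 2%:R)) = (Cz + 5^-1) * (p * r `^ (ey *
  2%:R)) by field.
 rewrite /p -pwD // (_ : 2 - b + kp + ey * 2%:R = al); last by rewrite /ey; field.
 by rewrite ler_wpM2r // lerDl invr_ge0.
have tr5 (j : 'I_4) : `|Lap (cv u (kap j)) z1 / 4 - m| <= (5 * n%:R + 2) * y * m.
 by have := mtr _ _ (wy j) y12; rewrite k5S.
(* For [n = 1] the mean trace is at most [2 * F]; in the other case it is bounded by [D * Y], of
   order [r ^ (b - 2)], which [dp] absorbs. *)
have ym : y * m <= Sq * (4 * D + 2 * F) * r `^ kp.
 have mdp : m <= (4 * D + 2 * F) * r `^ (- dp).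
  have dp1 : 1 <= r `^ (- dp) by rewrite -(powRr0 r) pw_le // oppr_le0.
  case: ndp => [n1|ndp].
   have m2F : m <= 2 * F by apply: le_trans (mn1 n1) _; rewrite ler_pM2l.
   apply: le_trans m2F _; apply: le_trans (_ : 4 * D + 2 * F <= _); first by rewrite
    lerDr mulr_ge0 // ltW.
   by rewrite ler_peMr // addr_ge0 ?mulr_ge0 // ltW.
  apply: le_trans mM _; apply: le_trans (_ : D * (4 * r `^ (- dp)) <= _).
   rewrite ler_pM2l //; apply: le_trans Y4 _; rewrite ler_pM2l //; apply: pw_le => //;
    move: ndp; clra.
  by rewrite mulrA [D * 4]mulrC ler_wpM2r ?powR_ge0 // lerDl mulr_ge0.
 apply: le_trans (ler_wpM2l (ltW y0) mdp) _.
 have -> : y * ((4 * D + 2 * F) * r `^ (- dp)) = Sq * (4 * D + 2 * F) * (r `^ ey * r `^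
  (- dp)) by rewrite /y; ring.
 rewrite -pwD //; apply: ler_wpM2l; first by pos.
 by apply: pw_le => //; rewrite /ey; move: H1; clra.
clearbody y.
have TqE z : Tq u e r z = r^-1 ^+ 2 * I2 * (cv u kap0 z - u z).
 by rewrite /Tq cvk0 -/I2 -mulrA; congr (_ * _); rewrite mulrBr mulVKf // gt_eqF.
have q0 : 0 <= r^-1 ^+ 2 by pos.
(* Since [g zs <= g z1] and [kap0] dominates in [g], the value of [Tq u e r] at [zs] exceeds that at
   [z1] only by the contribution of the four kernels of relative weight [p]. *)
have step1 : Tq u e r zs <= Tq u e r z1 + 32 * (I2 * (A * C1)) * r `^ kp.
 have gg : g zs <= g z1.
  have := mx zs; rewrite dot_subrr mulr0 subr0 => /le_trans; apply; by rewrite gerBl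
   mulr_ge0 ?dot_ge0 ?(ltW B0).
 rewrite !gE !sum5 in gg; rewrite !k50 in gg.
 have s4 z : `|\sum_(j < 4) (cv u (kp5 (lift ord0 j)) z - u z)| <= 4 * (A * C1 * X).
  apply: le_trans (ler_norm_sum _ _ _) _; apply: le_trans (_ : \sum_(j < 4) A * C1 * X
   <= _); first exact: ler_sum.
  by rewrite sum_const.
 have h := max_cmp_arith (ltW p0) gg (s4 zs) (s4 z1).
 rewrite !TqE; have qI : 0 <= r^-1 ^+ 2 * I2 by pos.
 apply: le_trans (ler_wpM2l qI h) _; rewrite mulrDr lerD2l.
 have -> : r^-1 ^+ 2 * I2 * (8 * (p * (A * C1 * X))) = 8 * (I2 * (A * C1)) * (p * Y) by
  rewrite /Y; ring.
 have -> : 32 * (I2 * (A * C1)) * r `^ kp = 8 * (I2 * (A * C1)) * (4 * r `^ kp) by ring.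
 apply: ler_wpM2l; first by pos.
 apply: le_trans (ler_wpM2l (ltW p0) Y4) _; rewrite mulrCA ler_pM2l // /p -pwD //.
 by rewrite (_ : 2 - b + kp + (b - 2) = kp) //; ring.
(* [T_decomp] at [z1]: the four Laplacians are all close to [4 * m], so their differences are small,
   and [Tq] at scale [2 r] is bounded by [N0]. *)
have step2 : Tq u e r z1 <= N0 + (16 * (C1 * ((5 * n%:R + 2) * (Sq * (4 * D + 2 * F))))
 * r `^ kp + A * C1 * 4 * r `^ kp + r `^ kp).
 have H := kdec z1; rewrite ler_norml in H; have {H} /andP[_ H] := H.
 have l16 := lap_arith (tr5 0) (tr5 1) (tr5 2%:R) (tr5 3%:R) m1C m2C.
 have HN1 := HN z1 z1r.
 have l17 : 16 * (Ca * ((5 * n%:R + 2) * y * m)) <= 16 * (C1 * ((5 * n%:R + 2) * (Sq *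
  (4 * D + 2 * F)))) * r `^ kp.
  rewrite -!mulrA ler_pM2l //; apply: ler_pM => //.
   by apply: mulr_ge0; [rewrite addr_ge0 // mulr_ge0|exact: mulr_ge0 (ltW y0) m0].
  by apply: ler_wpM2l; [rewrite addr_ge0 // mulr_ge0|move: ym; rewrite -!mulrA].
 have l18 : A * Ca * (r^-1 ^+ 2 * (2 * r ^+ 2) `^ b) <= A * C1 * 4 * r `^ kp.
  rewrite -[X in _ <= X]mulrA; apply: ler_pM; [exact: mulr_ge0|exact: mulr_ge0 q0
   (powR_ge0 _ _)|exact: ler_wpM2l|].
  have h := @pow2r 2 (r ^+ 2) b b02 ltac:(by rewrite ler1n) t0; rewrite -natrX in h.
  apply: le_trans (ler_wpM2l q0 h) _; rewrite mulrCA ler_pM2l // pwM2 // -powR_mulrn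
   ?(ltW rp) // -powRrM -pwD //.
  by apply: pw_le => //; move: H3; clra.
 exact: step2_arith H l16 l17 l18 HN1.
exact: le_trans step1 (step3_arith _ step2).
Qed.

End main_step.

(** * From bounds on [Tq] to bounds on the Hessian *)

Section hessian_bounds.
Context {R : realType} {N : nat}.
Local Notation E := 'rV[R]_N.
Implicit Types (u g : E -> R) (x y z : E) (A b s r : R).

#[local] Opaque Int.

Lemma DL_comb g (c d : R) i j : DL g (c *: de i + d *: de j) = fun x => c * D i g x + d * D j g x.
Proof.
ext x; have <- := congr1 (fun f => f x) (DL_delta g i c); have <- := congr1 (fun f => f
 x) (DL_delta g j d).
by rewrite /DL -big_split; ebig k; rewrite mxE mulrDl.
Qed.

Lemma HF_comb g (c d : R) i j x : smooth g -> HF g (c *: de i + d *: de j) x =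
 c ^+ 2 * D i (D i g) x + 2 * (c * d) * D i (D j g) x + d ^+ 2 * D j (D j g) x.
Proof.
move=> sg; have pD k (e : R) := smooth_pd (smoothZ e (smoothD k sg)).
rewrite /HF DL_comb DL_comb !D_add // !DZ; try exact: smooth_pd (smoothD _ sg).
rewrite (D_comm j i sg); move: (D i _ x) (D i _ x) (D j _ x) => *; ring.
Qed.

(** Half sums and half differences of basis vectors, of length at most one as [pk_ge0] requires; for
    equal indices the half sum is the basis vector. *)
Definition hdir (p : 'I_N * 'I_N * bool) : E := 2^-1 *: de p.1.1 + ((-1) ^+ p.2 / 2) *: de p.1.2.

Lemma enorm_hdir p : enorm (hdir p) <= 1.
Proof.
apply: le_trans (ler_enormD _ _) _; rewrite !enormZ !enorm_delta normrM normr_sign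
 mul1r.
by rewrite ger0_norm; lra.
Qed.

Lemma hess_arith (a c d B K : R) : (2^-1) ^+ 2 * a + 2 * (2^-1 * (1 / 2)) * d + (1 / 2) ^+ 2 * c <= B ->
 (2^-1) ^+ 2 * a + 2 * (2^-1 * (- 1 / 2)) * d + (- 1 / 2) ^+ 2 * c <= B -> - K <= a -> - K <= c -> `|d| <= 2 * B + K.
Proof. by move=> h1 h2 h3 h4; rewrite ler_norml; apply/andP; split; lra. Qed.

(** The nonnegative Laplacian turns the upper bounds on pure second derivatives into lower ones, and
    polarization gives the mixed derivatives. *)
Lemma hess_bound g (B : R) x i j : smooth g -> 0 <= B -> (forall p, HF g (hdir p) x <= B) -> 0 <= Lap g x ->
 `|D i (D j g) x| <= (2 + N%:R) * B.
Proof.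
move=> sg B0 hB L0.
have dB k : D k (D k g) x <= B.
 by have := hB (k, k, false); rewrite /hdir HF_comb // expr0; lra.
have dL k : - (N%:R * B) <= D k (D k g) x.
 rewrite lerNl -subr_ge0 opprK; apply: le_trans L0 _; rewrite /Lap (bigD1 k) //= addrC
  lerD2r.
 apply: le_trans (ler_sum _ (fun l _ => dB l)) _; rewrite sumr_const -[B *+ _]mulr_natl
  ler_wpM2r // ler_nat.
 by rewrite -[X in (_ <= X)%N](card_ord N) max_card.
rewrite mulrDl; have := hB (i, j, false); have := hB (i, j, true); rewrite /hdir
 !HF_comb // expr0 expr1 => h1 h2.
exact: hess_arith h2 h1 (dL i) (dL j).
Qed.

Lemma cball_line z0 x y (P t : R) : 0 <= t <= 1 -> enorm (x - z0) <= P -> enorm (y - z0) <= P -> enorm (x + t *: (y - x) - z0) <= P.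
Proof.
move=> /andP[t0 t1] hx hy; have -> : x + t *: (y - x) - z0 = (1 - t) *: (x - z0) + t *:
 (y - z0).
 by apply/rowP => k; rewrite !mxE; ring.
apply: le_trans (ler_enormD _ _) _; rewrite !enormZ !ger0_norm ?subr_ge0 //.
have := ler_wpM2l t0 hy; have := @ler_wpM2l _ (1 - t) ltac:(by rewrite subr_ge0) _ _ hx;
 rewrite mulrBl mul1r; lra.
Qed.

(** This is the increment between [y] and [x] of the function [z |-> g (z + h e_i) - g z], whose
    gradient consists of [h] times second derivatives at points of the ball. *)
Lemma grad_diff_bound g z0 (P C h : R) i x y : smooth g -> 0 <= C -> (forall z, enorm (z - z0) <= P -> forall k, `|D k (D i g) z| <= C) ->
 enorm (x - z0) + `|h| <= P -> enorm (y - z0) + `|h| <= P ->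
 `|g (x + h *: de i) - g x - (g (y + h *: de i) - g y)| <= N%:R * C * (`|h| * enorm (x - y)).
Proof.
move=> sg C0 H hx hy; set d := h *: de i.
have ed : enorm d = `|h| by rewrite enormZ enorm_delta mulr1.
pose phi z := g (z + d) - g z; have sphi : smooth phi by apply: smooth_sub => //; exact:
 smooth_shift.
have [t t01] := mvt_line y (x - y) (smooth_C1 sphi); rewrite [y + _]addrC subrK => E1.
rewrite -/(phi x) -/(phi y) E1 /DL; set zt := y + t *: (x - y).
have ztP : enorm (zt - z0) <= P - `|h| by apply: cball_line => //; lra.
apply: le_trans (ler_norm_sum _ _ _) _; apply: le_trans (_ : \sum_(k < N) enorm (x - y)
 * (`|h| * C) <= _); last first.
 by rewrite sum_const; apply: le_of_eq; ring.
apply: ler_sum => k _; rewrite normrM; apply: ler_pM => //; first exact: coord_le_enorm.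
rewrite /phi D_sub //; last exact: smooth_shift.
rewrite D_shift; last exact: smooth_pd.
have [t' /andP[t0 t1] ->] := mvt_line zt d (smooth_C1 (smoothD k sg)).
rewrite DL_delta normrM ler_wpM2l // D_comm //; apply: H.
have -> : zt + t' *: d - z0 = (zt - z0) + t' *: d by rewrite addrAC.
apply: le_trans (ler_enormD _ _) _; rewrite enormZ ed ger0_norm //.
by have := ler_piMl (normr_ge0 h) t1; lra.
Qed.

Lemma four_arith (g1 g2 g3 g4 v1 v2 v3 v4 K a e : R) : `|g3 - g1 - (g4 - g2)| <= K -> `|g1 - v1| <= a * e -> `|g2 - v2| <= a * e ->
 `|g3 - v3| <= a * e -> `|g4 - v4| <= a * e -> `|v3 - v1 - (v4 - v2)| <= K + e * (4 * a).
Proof.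
by rewrite !ler_norml; lra. Qed.

(** The average against [kj 2] has as derivative in the scale a positive multiple of the Laplacian
    of the average against [kj 1]. So it increases from its limit at scale zero, which is
    [Int (kj 2) * u z]. *)
Lemma avg_ge u A b r z : tay A b u -> 0 < b -> 0 < r -> (forall s, 0 < s <= r -> 0 <= Lap (cv u (scl N s (kj 1))) z) ->
 Int (kj (N := N) 2) * u z <= cv u (scl N r (kj 2)) z.
Proof.
move=> tu b0 r0 H; have cu := tay_cont tu; have [_ uA _] := tu.
have [C0 C00 K0] := kern0 (Ccs_kj 2) (@mom0_kj R N 1) (ltW b0).
apply: (@le_lim0 _ _ _ (A * C0 + 1)) => e /andP[e0 e1].
have er0 : 0 < Num.min e r by rewrite lt_min e0.
have [s [s0 se s1 sb]] := powR_small b0 er0.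
have sr : s <= r by apply: le_trans se _; rewrite ge_min lexx orbT.
have [C1 C10 K1] := riemann_cv N s0 sr (Ccs_kj 2) cu uA.
have [M M0 CM] := small_inv C1 e0.
have := K0 A u tu 0%N s z s0; rewrite addn0 expr0 !mul1r => k0.
have k1 := K1 M M0 z.
have S0 : 0 <= \sum_(j < M) (r - s) / M%:R * cv u (scl N.+1 (s + j%:R * ((r - s) /
 M%:R)) (Euler N (kj 2))) z.
 apply: sumr_ge0 => j _; have M1 : 0 < M%:R :> R by rewrite ltr0n.
 set sg := s + _; have h0 : 0 <= (r - s) / M%:R by pos.
 have sg0 : 0 < sg by pos.
 have sgr : sg <= r.
  rewrite /sg -lerBrDl mulrA ler_pdivrMr // mulrC; apply: ler_wpM2l; first by pos.
  by rewrite ler_nat ltnW.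
 have -> : scl N.+1 sg (Euler N (kj 2)) = fun y => sg / 2 * scl N.+2 sg (Lap (kj 1)) y.
  by ext y; exact: scl_Euler_kj2.
 rewrite cv_scale //; last by apply: Ccs_Cc0; apply: Ccs_scl => //; apply: Ccs_Lap;
  exact: Ccs_kj.
 have := H sg; rewrite sg0 sgr => /(_ isT).
 rewrite Lap_cv //; last by apply: Ccs_scl => //; exact: Ccs_kj.
 rewrite Lap_scl; last exact: (Ccs_kj 1).1.
 by move=> h; apply: mulr_ge0 => //; apply: mulr_ge0 => //; rewrite divr_ge0 // ltW.
have sbe : A * C0 * s `^ b <= A * C0 * e.
 by rewrite ler_wpM2l ?mulr_ge0 ?(tay_ge0 tu) //; apply: le_trans sb _; rewrite ge_min
  lexx.
move: k0 k1 S0 sbe CM; rewrite !ler_norml mulrDr mulr1 [e * _]mulrC => /andP[a1 _]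
 /andP[a2 _].
move: (\sum_j _) (Int _ * _) (cv _ _ _) (cv _ _ _) (A * C0 * _) (A * C0 * _) (C1 / _) a1
 a2 => *; lra.
Qed.

(** This identity converts upper bounds on [Tq] into upper bounds on second derivatives of
    mollifications, the first term being nonnegative by [avg_ge]. *)
Lemma TqE u e s x : continuous u -> 0 < s ->
 Tq u e s x = s^-1 ^+ 2 * (cv u (scl N s (kj 2)) x - Int (kj (N := N) 2) * u x) + 2^-1 * HF (cv u (scl N s (kj 1))) e x.
Proof.
move=> cu s0; rewrite /Tq; have c1 := Ccs_scl N s0 (@Ccs_kj R N 1); have c2 := Ccs_scl N
 s0 (@Ccs_kj R N 2).
have c3 := Ccs_scl N s0 (Ccs_HF e (Ccs_kj 1)).
have -> : scl N s (pk 2 e) = fun y => scl N s (kj 2) y + 2^-1 * scl N s (HF (kj 1) e) y.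
 by ext y; rewrite /scl /pk mulrDr mulrCA.
rewrite (cv_add x cu (Ccs_Cc0 c2) (Cc0Z _ (Ccs_Cc0 c3))) (cv_scale _ x cu (Ccs_Cc0 c3))
 HF_cv // HF_scl; last exact: (Ccs_kj 1).1.
have -> : scl N.+2 s (HF (kj 1) e) = fun y => s^-1 ^+ 2 * scl N s (HF (kj 1) e) y.
 by rewrite -addn2 scl_addn.
by rewrite (cv_scale _ x cu (Ccs_Cc0 c3)); ring.
Qed.

End hessian_bounds.

(** * Iteration over dyadic scales and the interior second difference estimate *)

Section interior_estimate.
Context {R : realType} {n : nat}.
Local Notation E := 'rV[R]_(n + n).
Implicit Types (u f : E -> R) (x y z : E) (A b s r : R).

#[local] Opaque Int HF.

(** The arithmetic-geometric inequality with all weights one and lower bound zero says that the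
    trace of the complex Hessian of an average is nonnegative. *)
Lemma Lap_ge0 u f z0 r0 A b lam F al s z : 0 <= lam -> lsol u f z0 r0 A b lam F al -> 0 < s -> enorm (z - z0) + s <= r0 ->
 0 <= Lap (cv u (scl (n + n) s (kj 1))) z.
Proof.
move=> lam0 ls s0 zs; have cu := tay_cont (ls_tay ls).
have I0 := @Int_kj_gt0 R (n + n) 1 isT; set I1 := Int (kj 1) in I0.
have ck := Ccs_scl (n + n) s0 (Ccs_kj 1).
have kk : kernel (fun y : E => I1^-1 * scl (n + n) s (kj 1) y) (2^-1 * s).
 split.
 - exact: CcsZ.
 - by move=> y; rewrite mulr_ge0 ?invr_ge0 ?(ltW I0) // mulr_ge0 ?kj_ge0 // exprn_ge0 //
  invr_ge0 ltW.
 - by rewrite IntZ ?Int_scl ?mulVf ?gt_eqF //; [exact: Ccs_kj|exact: Ccs_Cc0].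
 - by move=> y hy; rewrite (supp_scl (n + n) s0 (@supp_kj R (n + n) 1)) ?mulr0.
have ss : 0 <= 2^-1 * s < s by lra.
have f0 x : enorm (x - z) < s -> 0 <= f x.
 move=> xz; have xr : enorm (x - z0) < r0.
  by apply: le_lt_trans (ler_enormB _ z _) _; apply: lt_le_trans zs; rewrite addrC
   ltrD2l.
 by have /andP[h _] := ls_lam ls xr; exact: le_trans h.
have S := ls_S ls ss zs kk (lexx 0) f0.
have sc : smooth (cv u (scl (n + n) s (kj 1))) by exact: smooth_cv.
have [xi [lm [ux _ _]]] := spectral_frame (symH_Hs z sc).
have [h _] := S xi (fun=> 1) ux (fun=> ltr01).
have E1 : cv u (fun y : E => I1^-1 * scl (n + n) s (kj 1) y) = fun x => I1^-1 * cv u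
 (scl (n + n) s (kj 1)) x.
 by ext x; rewrite cv_scale //; exact: Ccs_Cc0.
have sc2 := smoothZ I1^-1 sc.
move: h; under eq_bigr do rewrite mul1r.
rewrite E1 Lap_levi // Lap_scale // => h.
by rewrite -(pmulr_rge0 _ (_ : 0 < I1^-1 / 4)) ?divr_gt0 ?invr_gt0 // mulrAC.
Qed.

(** [main_step] runs through the scales [rb / 2 ^ j]. The losses and the radii given up are both of
    order [(rb / 2 ^ j) ^ kp], geometric with ratio [th], so for small [rb] the ball of half the
    radius survives all steps. The start at scale [rb] comes from the Taylor estimate. *)
Lemma iter_T (b al lam F A kp dp r0 : R) (e : E) : (0 < n)%N -> 1 < b < 2 -> 0 < al <= 1 -> 0 < kp -> 0 < lam -> 0 <= F -> 0 <= A ->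
 0 <= dp -> (n = 1 \/ 2 - b <= dp) -> 3 * kp <= al - (2 - b) - 2 * dp -> 2 * kp <= 2 - al - n%:R * (2 - b) -> kp <= 2 * b - 2 ->
 enorm e <= 1 -> 0 < r0 ->
 exists2 rm : R, 0 < rm & forall rb, 0 < rb <= rm -> exists Bd : R, forall u f z0, lsol u f z0 r0 A b lam F al ->
  forall j z, enorm (z - z0) <= r0 / 2 -> Tq u e (rb * 2^-1 ^+ j) z <= Bd.
Proof.
move=> n0 b12 al01 kp0 lam0 F0 A0 dp0 ndp H1 H2 H3 e1 r00.
have [Cm [rb0 [Cm0 /andP[rb00 rb02] MS]]] := main_step n0 b12 al01 kp0 lam0 F0 A0 dp0
 ndp H1 H2 H3 e1.
have b0 : 0 <= b by case/andP: b12 => b1 _; apply: ltW; exact: lt_trans b1.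
have [Cb Cb0 KB] := kern0 (Ccs_pk 2 e) (@mom0_pk R (n + n) 1 e) b0.
pose th : R := 2^-1 `^ kp; have th0 : 0 < th by pos.
have th1 : th < 1.
 have -> : 1 = (1 : R) `^ kp by rewrite powR1.
 apply: gt0_ltr_powR; rewrite ?nnegrE //.
 by rewrite invf_lt1 // ltr1n.
have th1' : 0 < 1 - th by pos.
pose m := Num.min rb0 (Num.min (r0 / 16) (r0 / 4 * (1 - th))).
have m0 : 0 < m by rewrite !lt_min rb00 divr_gt0 // mulr_gt0 // divr_gt0.
have [rm [rm0 rmm _ rmk]] := powR_small kp0 m0.
exists rm => // rb /andP[rbp rbm].
have rbm' := le_trans rbm rmm.
have [hm1 hm2] : rb <= rb0 /\ rb <= r0 / 16 by move: rbm'; rewrite !le_min => /andP[->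
 /andP[]].
have hm3 : rb `^ kp <= r0 / 4 * (1 - th).
 apply: le_trans (_ : rm `^ kp <= _); first by apply: powR_mono; try pos.
 by apply: le_trans rmk _; rewrite !ge_min lexx !orbT.
pose c := rb `^ kp / (1 - th); have c0 : 0 <= c by pos.
have cE : rb `^ kp = c * (1 - th) by rewrite divfK // gt_eqF.
have c4 : c <= r0 / 4 by rewrite ler_pdivrMr.
pose Bd := A * Cb * (rb^-1 ^+ 2 * rb `^ b) + Cm * c.
exists Bd => u f z0 ls.
(* Radius and bound both carry the geometric tail [c * th ^+ j], which pays for all the remaining
   steps. *)
have key j z : enorm (z - z0) <= r0 / 2 + c * th ^+ j -> Tq u e (rb * 2^-1 ^+ j) z <= Bd
 - Cm * (c * th ^+ j).
 elim: j z => [|j IH] z.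
  rewrite expr0 !mulr1 => _; rewrite /Bd addrK.
  have := KB A u (ls_tay ls) 0%N rb z rbp; rewrite addn0 expr0 !mul1r Int_pk =>
   /ler_normlP[_ h].
  by rewrite /Tq mulrCA ler_wpM2l ?sqr_ge0.
 set r := rb * 2^-1 ^+ j.+1; have r_gt0 : 0 < r by pos.
 have tj0 : 0 <= th ^+ j by pos.
 have tj1 : th ^+ j <= 1 by rewrite exprn_ile1 // ltW.
 have rkp : r `^ kp = c * (1 - th) * th ^+ j.+1.
  rewrite /r powRM ?(ltW rbp) // -cE; congr (_ * _).
  have -> : 2^-1 ^+ j.+1 = 2^-1 `^ j.+1%:R :> R by rewrite powR_mulrn // invr_ge0.
  by rewrite powRAC powR_mulrn // ltW.
 have rkpj : r `^ kp <= c * th ^+ j - c * th ^+ j.+1.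
  rewrite rkp exprS; have -> : c * th ^+ j - c * (th * th ^+ j) = c * (1 - th) * th ^+ j
   by ring.
  by apply: ler_wpM2l; [rewrite mulr_ge0 // ltW|rewrite ler_piMl // ltW].
 have rrb : r <= rb by rewrite /r ler_piMr ?(ltW rbp) // exprn_ile1 // invf_le1 //
  ler1n.
 have r2 : 2 * r = rb * 2^-1 ^+ j by rewrite /r exprS; field.
 have cj : c * th ^+ j <= c by rewrite ler_piMr.
 move=> hz; have zr : enorm (z - z0) + r `^ kp + 4 * r <= r0.
  move: hz rkpj rrb hm2 c4 cj; clear=> *; lra.
 have rr : 0 < r <= rb0 by rewrite r_gt0 (le_trans rrb).
 have := MS u f z0 r0 ls z r (Bd - Cm * (c * th ^+ j)) rr zr.
 rewrite r2 => MS1.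
 apply: le_trans (MS1 _) _.
  move=> z' hz'; apply: IH; apply: le_trans (ler_enormB _ z _) _.
  by move: hz hz' rkpj; move: (enorm _) (enorm _) (r `^ kp) (c * _) (c * _) => *; lra.
 have := ler_wpM2l Cm0 rkpj; rewrite mulrBr; move: (Cm * _) (Cm * _) (Cm * _) => *; lra.
move=> j z hz; apply: le_trans (key j z _) _; first by rewrite ler_wpDr // mulr_ge0
 ?exprn_ge0 // ltW.
by rewrite gerBl; apply: mulr_ge0 => //; apply: mulr_ge0 => //; rewrite exprn_ge0 //
 ltW.
Qed.

(** [iter_T], [TqE] and [avg_ge] bound from above the second derivatives, in all directions [hdir],
    of the mollifications of [u] at arbitrarily small scales; [hess_bound] completes this to the
    Hessian. The resulting bound on differences passes to [u] as the scale tends to zero. *)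
Lemma second_difference_bound (b al lam F A kp dp r0 : R) : (0 < n)%N -> 1 < b < 2 -> 0 < al <= 1 -> 0 < kp -> 0 < lam -> 0 <= F -> 0 <= A ->
 0 <= dp -> (n = 1 \/ 2 - b <= dp) -> 3 * kp <= al - (2 - b) - 2 * dp -> 2 * kp <= 2 - al - n%:R * (2 - b) -> kp <= 2 * b - 2 ->
 0 < r0 ->
 exists2 C : R, 0 <= C & forall u f z0, lsol u f z0 r0 A b lam F al -> forall i x y (h : R),
  enorm (x - z0) <= r0 / 4 -> enorm (y - z0) <= r0 / 4 -> `|h| <= r0 / 4 ->
  `|u (x + h *: de i) - u x - (u (y + h *: de i) - u y)| <= C * (`|h| * enorm (x - y)).
Proof.
move=> n0 b12 al01 kp0 lam0 F0 A0 dp0 ndp H1 H2 H3 r00.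
have b0 : 0 < b by case/andP: b12 => b1 _; exact: lt_trans b1.
have near p := iter_T n0 b12 al01 kp0 lam0 F0 A0 dp0 ndp H1 H2 H3 (@enorm_hdir R (n + n)
 p) r00.
have [rm Hrm] := choice2 near.
(* The inverse of a sum of inverses lies below [r0 / 2] and below each of the finitely many
   [rm p]. *)
pose rb := (\sum_p (rm p)^-1 + (r0 / 2)^-1)^-1.
have rmV0 p : 0 <= (rm p)^-1 by rewrite invr_ge0 ltW; case: (Hrm p).
have r02 : 0 < (r0 / 2)^-1 by pos.
have rb0 : 0 < rb by pos.
have rb2 : rb <= r0 / 2.
 by rewrite -[X in _ <= X]invrK lef_pV2 ?posrE ?lerDr ?sumr_ge0 // ltr_wpDl // sumr_ge0.
have rbrm p : 0 < rb <= rm p.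
 rewrite rb0 /= -[X in _ <= X]invrK; have [q0 _] := Hrm p.
 rewrite lef_pV2 ?posrE ?invr_gt0 //; last by pos.
 by rewrite (bigD1 p) // -addrA lerDl addr_ge0 ?sumr_ge0 // ltW.
have [Bd HB] := choice (fun p => let: conj _ H := Hrm p in H rb (rbrm p)).
pose B := 2 * \sum_p `|Bd p|; have B0 : 0 <= B by pos.
have Bp p : 2 * Bd p <= B.
 rewrite ler_pM2l //; apply: le_trans (ler_norm _) _; rewrite (bigD1 p) // lerDl
  sumr_ge0 //.
have [Ck Ck0 KK] := kern0 (Ccs_kj 1) (@mom0_kj R (n + n) 0) (ltW b0).
have I0 := @Int_kj_gt0 R (n + n) 1 isT; set I1 := Int (kj 1) in I0 KK.
pose C := (n + n)%:R * ((2 + (n + n)%:R) * B).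
exists (C / I1); first pos.
move=> u f z0 ls i x y h hx hy hh; have tu := ls_tay ls; have cu := tay_cont tu.
set dl := h *: de i; rewrite mulrAC ler_pdivlMr // mulrC.
apply: (@le_lim0 _ _ _ (4 * (A * Ck))) => e /andP[e0 e1].
have [s [s0 se _ sb]] := powR_small b0 e0.
have [j sj] : exists j, rb * 2^-1 ^+ j <= s.
 have [M M0 CM] := small_inv rb s0; exists M; apply: le_trans CM; rewrite ler_pM2l //
  exprVn lef_pV2 ?posrE ?ltr0n //.
 by rewrite -natrX ler_nat ltnW // ltn_expl.
set r := rb * _ in sj; have r_gt0 : 0 < r by pos.
have rrb : r <= rb by rewrite /r ler_piMr ?(ltW rb0) // exprn_ile1 // invf_le1 // ler1n.
pose g := cv u (scl (n + n) r (kj 1)); have sg : smooth g by apply: smooth_cv => //;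
 apply: Ccs_scl => //; exact: Ccs_kj.
have gE z : `|g z - I1 * u z| <= A * Ck * e.
 have := KK A u tu 0%N r z r_gt0; rewrite addn0 expr0 !mul1r => /le_trans; apply.
 apply: ler_wpM2l; first exact: mulr_ge0.
 by apply: le_trans sb; apply: powR_mono; try pos.
have hess z : enorm (z - z0) <= r0 / 2 -> forall k, `|D k (D i g) z| <= (2 + (n + n)%:R)
 * B.
 move=> hz k; have Lz s' : 0 < s' <= r -> 0 <= Lap (cv u (scl (n + n) s' (kj 1))) z.
  move=> /andP[s'0 s'r]; apply: Lap_ge0 (ltW lam0) ls s'0 _.
  by move: hz s'r rrb rb2; clra.
 apply: hess_bound => //; last by apply: Lz; rewrite r_gt0 lexx.
 move=> p; have := HB p u f z0 ls j z hz; rewrite -/r TqE // -/g => T.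
 have ag := avg_ge tu b0 r_gt0 Lz.
 have : 0 <= r^-1 ^+ 2 * (cv u (scl (n + n) r (kj 2)) z - Int (kj (N := n + n) 2) * u z)
  by pos.
 by move: T (Bp p); clra.
have hxP : enorm (x - z0) + `|h| <= r0 / 2 by move: hx hh; clra.
have hyP : enorm (y - z0) + `|h| <= r0 / 2 by move: hy hh; clra.
have Q0 : 0 <= (2 + (n + n)%:R) * B by pos.
have := grad_diff_bound sg Q0 hess hxP hyP; rewrite -/dl -/C => G.
rewrite -[X in X * _](gtr0_norm I0) -normrM.
have t1 := gE x; have t2 := gE y; have t3 := gE (x + dl); have t4 := gE (y + dl).
rewrite !mulrBr; exact: four_arith G t1 t2 t3 t4.
Qed.

End interior_estimate.

(** * Cutoff, choice of the exponents and the local Lipschitz bound of the gradient *)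

Section localization.
Context {R : realType} {n : nat}.
Local Notation E := 'rV[R]_(n + n).
Local Notation m := ((n + n)%:R : R).
Implicit Types (u f chi : E -> R) (x y z v : E) (A C U b d : R).

#[local] Opaque Int.

Definition clamp (t : R) : R := (`|t| - `|t - 1| + 1) / 2.

Lemma clamp_le0 t : t <= 0 -> clamp t = 0.
Proof. by move=> t0; rewrite /clamp !ler0_norm //; [field|lra]. Qed.

Lemma clamp_ge1 t : 1 <= t -> clamp t = 1.
Proof. by move=> t1; rewrite /clamp !ger0_norm ?subr_ge0 //; [field|exact: le_trans t1]. Qed.

(** A clamped function of the norm, equal to one up to [5 d / 8] and to zero from [11 d / 16] on, is
    mollified with a kernel supported in the ball of radius [d / 16]. *)
Lemma cutoff d : 0 < d -> exists chi C, [/\ 0 <= C, smooth chi, C2b chi C, forall x, enorm x <= d / 2 -> chi x = 1 &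
 forall x, 3 * d / 4 <= enorm x -> chi x = 0].
Proof.
move=> d0; pose g x := clamp ((11 * d / 16 - enorm x) * (16 / d)).
have cg : continuous g.
 have ct : continuous (fun x : E => (11 * d / 16 - enorm x) * (16 / d)).
  by apply: contM; [apply: contB; [exact: cont_cst|exact: continuous_enorm]|exact:
   cont_cst].
 have cn (w : E -> R) : continuous w -> continuous (fun x => `|w x|).
  by move=> cw x; apply: (continuous_comp (cw x)); exact: norm_continuous.
 rewrite /g /clamp; apply: contM; last exact: cont_cst.
 by apply: contD; [apply: contB; [exact: cn|apply: cn; apply: contB => //; exact:
  cont_cst]|exact: cont_cst].
have d16 : 0 < 16 / d by pos.
have g0 x : 11 * d / 16 <= enorm x -> g x = 0.
 by move=> h; apply: clamp_le0; rewrite pmulr_lle0 // subr_le0.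
have g1 x : enorm x <= 5 * d / 8 -> g x = 1.
 move=> h; apply: clamp_ge1; rewrite mulrA ler_pdivlMr // mul1r; lra.
have s0 : 0 < d / 8 by pos.
have cm := Ccs_scl (n + n) s0 (@Ccs_moll R (n + n)).
have sm y : d / 16 < enorm y -> scl (n + n) (d / 8) moll y = 0.
 move=> h; apply: (supp_scl (n + n) s0 (@supp_moll R (n + n))); rewrite subr0; apply:
  le_lt_trans h.
 by apply: le_of_eq; field.
pose chi := cv g (scl (n + n) (d / 8) moll).
have sc : smooth chi by exact: smooth_cv.
have chiE x : chi x = Int (fun y => g (x + y) * scl (n + n) (d / 8) moll y) by apply:
 cvE => //; exact: Ccs_Cc0.
have chi0 x : 3 * d / 4 <= enorm x -> chi x = 0.
 move=> h; rewrite chiE -[RHS](@Int0 R (n + n)); congr Int; ext y.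
 have [hy|hy] := leP (enorm y) (d / 16); last by rewrite sm // mulr0.
 rewrite g0 ?mul0r //; have := ler_enormB x (- y) 0; rewrite !subr0 opprK enormN.
 by lra.
have cc : Ccs chi.
 split=> //; exists (3 * d / 4) => x; rewrite subr0 => h; apply: chi0; exact: ltW.
have [C C0 HC] := Ccs_C2b cc.
exists chi, C; split=> // x h; rewrite chiE -[RHS](@Int_moll R (n + n)) -(Int_scl
 (@Ccs_moll R (n + n)) s0).
congr Int; ext y; have [hy|hy] := leP (enorm y) (d / 16); last by rewrite sm // mulr0.
rewrite g1 ?mul1r //; apply: le_trans (ler_enormD _ _) _; lra.
Qed.

Lemma DL_le chi v x (C : R) : (forall i, `|D i chi x| <= C) -> `|DL chi v x| <= m * C * enorm v.
Proof.
move=> H; apply: le_trans (ler_norm_sum _ _ _) _; apply: le_trans (_ : \sum_(i < n + n)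
 enorm v * C <= _).
 by apply: ler_sum => i _; rewrite normrM ler_pM // coord_le_enorm.
by rewrite sum_const [enorm v * C]mulrC mulrA.
Qed.

Lemma DLZ chi (t : R) v x : DL chi (t *: v) x = t * DL chi v x.
Proof. by rewrite /DL mulr_sumr; ebig i; rewrite mxE mulrA. Qed.

Lemma C2b_taylor chi (C : R) x y : smooth chi -> C2b chi C ->
 `|chi (x + y) - chi x| <= m * C * enorm y /\ `|chi (x + y) - chi x - DL chi y x| <= m * (m * C * enorm y) * enorm y.
Proof.
move=> sc [_ H1 H2]; have [t /andP[t0 t1] Et] := mvt_line x y (smooth_C1 sc); rewrite
 Et.
split; first by apply: DL_le => i; exact: H1.
have [t' _ ->] := mvt_line x (t *: y) (smooth_C1 (smooth_DL y sc)).
rewrite DLZ normrM ger0_norm //; apply: le_trans (ler_piMl (normr_ge0 _) t1) _.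
apply: DL_le => i; have -> : D i (DL chi y) = DL (D i chi) y.
 ext w; rewrite /DL D_sum => [|j]; last by apply: smoothZ; exact: smoothD.
 by ebig j; rewrite DZ ?(D_comm i j sc) //; apply: smooth_pd; exact: smoothD.
by apply: DL_le => j; exact: H2.
Qed.

Lemma prod_taylor (X X' V V' k l a1 a2 a3 a4 C U : R) : `|V' - V - l| <= a1 -> `|X' - X - k| <= a2 -> `|X' - X| <= a3 ->
 `|V' - V| <= a4 -> `|X| <= C -> `|V| <= U -> `|X' * V' - X * V - (X * l + V * k)| <= C * a1 + U * a2 + a3 * a4.
Proof.
move=> h1 h2 h3 h4 h5 h6.
have -> : X' * V' - X * V - (X * l + V * k) = X * (V' - V - l) + V * (X' - X - k) + (X'
 - X) * (V' - V) by ring.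
apply: le_trans (ler_normD _ _) _; apply: lerD; last by rewrite normrM ler_pM.
by apply: le_trans (ler_normD _ _) _; apply: lerD; rewrite normrM ler_pM.
Qed.

Definition C1b u z0 d b U := (forall x, enorm (x - z0) <= d -> [/\ {for x, continuous u},
  forall i, derivable u x (de i), `|u x| <= U & forall i, `|D i u x| <= U]) /\
 forall x y i, enorm (x - z0) <= d -> enorm (y - z0) <= d -> `|D i u x - D i u y| <= U * enorm (x - y) `^ (b - 1).

Lemma C1b_taylor u z0 d b U x y : C1b u z0 d b U -> 0 <= U -> 1 < b -> enorm (x - z0) + enorm y <= d ->
 `|u (x + y) - u x| <= m * U * enorm y /\ `|u (x + y) - u x - DL u y x| <= m * U * enorm y `^ b.
Proof.
move=> [H1 H2] U0 b1 xy; have inb w : enorm (w - x) <= enorm y -> enorm (w - z0) <= d.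
 by move=> h; apply: le_trans xy; apply: le_trans (ler_enormB w x z0) _; rewrite addrC
  lerD2l.
have xb : enorm (x - z0) <= d by apply: inb; rewrite subrr enorm0 enorm_ge0.
have dw i w : enorm (w - x) <= enorm y -> derivable u w (de i) by move=> h; case: (H1 w
 (inb w h)).
have [zt Hz ->] := mvt_coords (lexx (enorm y)) dw; split.
 apply: le_trans (ler_norm_sum _ _ _) _; apply: le_trans (_ : \sum_(i < n + n) enorm y *
  U <= _).
  apply: ler_sum => i _; rewrite normrM ler_pM ?coord_le_enorm //.
  by case: (H1 _ (inb _ (Hz i))).
 by rewrite sum_const [enorm y * U]mulrC mulrA.
rewrite /DL -sumrB; apply: le_trans (ler_norm_sum _ _ _) _.
apply: le_trans (_ : \sum_(i < n + n) U * enorm y `^ b <= _); last by rewrite sum_const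
 mulrA.
have b0 : 0 < b by exact: lt_trans b1.
apply: ler_sum => i _; rewrite -mulrBr normrM -(mulr_powRB1 (enorm_ge0 y) b0) mulrCA.
apply: ler_pM => //; first exact: coord_le_enorm.
apply: le_trans (H2 _ _ _ (inb _ (Hz i)) xb) _; rewrite ler_wpM2l //.
by apply: ge0_ler_powR; [rewrite subr_ge0 ltW|rewrite nnegrE enorm_ge0|rewrite nnegrE
 enorm_ge0|exact: Hz].
Qed.

Lemma far_arith (c P t q V : R) : 0 <= c -> 0 <= P -> 0 < q -> 1 <= t / q -> V <= t / q -> 0 <= V ->
 c + P * V <= (c + P) / q * t.
Proof.
move=> c0 P0 q0 h1 h2 V0; rewrite -mulrA [q^-1 * t]mulrC mulrDl; apply: lerD; last
 exact: ler_wpM2l.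
by rewrite -[X in X <= _]mulr1 ler_wpM2l.
Qed.

Lemma four_sum_ge (a p q t : R) : 0 <= a -> 0 <= p -> 0 <= q -> 0 <= t ->
 [/\ 0 <= a + p + q + t, a <= a + p + q + t, p <= a + p + q + t, q <= a + p + q + t & t <= a + p + q + t].
Proof. by move=> *; split; lra. Qed.

(** For short increments based well inside the ball, the product rule for first-order expansions
    applies. Increments longer than [d / 8] are trivial, the power of [|y|] being bounded below;
    near the boundary and outside, the function vanishes around [x], and [p = 0] serves. *)
Lemma tay_cutoff d b U : 0 < d <= 1 -> 1 < b < 2 -> 0 <= U -> exists2 A, 0 <= A & forall u0 z0, C1b u0 z0 d b U ->
 exists2 u, tay A b u & forall x, enorm (x - z0) <= d / 2 -> u x = u0 x.
Proof.
move=> /andP[d0 d1] /andP[b1 b2] U0; have [chi [C [C0 sc Cb chi1 chi0]]] := cutoff d0.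
have CU0 : 0 <= C * U by pos.
have m0 : 0 <= m by [].
pose P := m * (2 * (C * U)); have P0 : 0 <= P by pos.
pose q := (d / 8) `^ b; have q0 : 0 < q by pos.
pose A0 := C * (m * U) + (U * (m * (m * C)) + m * C * (m * U)).
have A00 : 0 <= A0 by pos.
pose A1 := (2 * (C * U) + P) / q; have A10 : 0 <= A1 by pos.
have [T0 TC TP TA0 TA1] := four_sum_ge CU0 P0 A00 A10.
exists (C * U + P + A0 + A1) => //.
move=> u0 z0 Hu; have [H1 H2] := Hu.
pose u x := chi (x - z0) * u0 x; have uE x : u x = chi (x - z0) * u0 x by [].
have d34 : 3 * d / 4 < d by lra.
have uz x : 3 * d / 4 <= enorm (x - z0) -> u x = 0 by move=> h; rewrite uE chi0 //
 mul0r.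
have uB x : `|u x| <= C * U.
 have [h|h] := leP (3 * d / 4) (enorm (x - z0)); first by rewrite uz // normr0.
 rewrite uE normrM; apply: ler_pM => //; first by case: Cb.
 by case: (H1 x (ltW (lt_trans h d34))).
have cu : continuous u.
 move=> x; have [h|h] := ltP (enorm (x - z0)) d.
  have [cx _ _ _] := H1 x (ltW h); apply: continuousM => //.
  by have := @cont_shift R (n + n) chi (- z0) (smooth_cont sc) x.
 apply/cont_enormP => e e0; exists (d / 8) => [|y hy]; first by pos.
 rewrite (uz x) ?(uz y) ?subrr ?normr0 //; last exact: le_trans (ltW d34) h.
 by have := ler_enormB x y z0; rewrite enormB in hy; lra.
have su : supp_ball u z0 (3 * d / 4) by move=> x h; apply: uz; exact: ltW.
exists u; last by move=> x h; rewrite uE chi1 // mul1r.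
split; first exact: Cc0_ball cu su.
- by move=> x; exact: le_trans (uB x) TC.
move=> x; have [hx|hx] := leP (enorm (x - z0)) (7 * d / 8).
 have xd : enorm (x - z0) <= d by lra.
 have [_ _ u0U DU] := H1 x xd; have [c0 c1 c2] := Cb.
 pose p : E := \row_i (chi (x - z0) * D i u0 x + u0 x * D i chi (x - z0)).
 have pP : enorm p <= P.
  apply: le_trans (enorm_le_sum _) _; apply: le_trans (_ : \sum_(i < n + n) 2 * (C * U)
   <= _).
   apply: ler_sum => i _; rewrite mxE; apply: le_trans (ler_normD _ _) _.
   have -> : 2 * (C * U) = C * U + U * C by ring.
   by apply: lerD; rewrite normrM; apply: ler_pM.
  by rewrite sum_const.
 have pE y : dot p y = chi (x - z0) * DL u0 y x + u0 x * DL chi y (x - z0).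
  rewrite /dot /DL !mulr_sumr -big_split; ebig i; rewrite mxE /=.
  by ring.
 exists p; first exact: le_trans pP TP.
 move=> y; have t0 : 0 <= enorm y `^ b by pos.
 have [hy|hy] := leP (enorm y) (d / 8).
  have xy : enorm (x - z0) + enorm y <= d by lra.
  have [l1 l2] := C1b_taylor Hu U0 b1 xy; have [k1 k2] := C2b_taylor (x - z0) y sc Cb.
  have y1 : enorm y <= 1 by move: hy d1; lra.
  have y2 : enorm y * enorm y <= enorm y `^ b.
   rewrite -expr2 -powR_mulrn ?enorm_ge0 //; have [->|yn] := eqVneq (enorm y) 0.
    by rewrite !powR0 // gt_eqF // ?(lt_trans _ b1).
   by apply: ger_powR; [rewrite lt_def yn enorm_ge0|exact: ltW].
  have e1 : x + y - z0 = x - z0 + y by rewrite addrAC.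
  rewrite !uE e1 pE; apply: le_trans (prod_taylor l2 k2 k1 l1 (c0 _) u0U) _.
  apply: le_trans (_ : A0 * enorm y `^ b <= _); last exact: ler_wpM2r.
  have -> : C * (m * U * enorm y `^ b) + U * (m * (m * C * enorm y) * enorm y) + m * C *
   enorm y * (m * U * enorm y) = C * (m * U) * enorm y `^ b + (U * (m * (m * C)) + m * C
   * (m * U)) * (enorm y * enorm y) by ring.
  rewrite /A0 [X in _ <= X]mulrDl lerD2l ler_wpM2l //; rewrite addr_ge0 // !mulr_ge0 //.
 have yq : 1 <= enorm y `^ b / q.
  rewrite ler_pdivlMr // mul1r; apply: powR_mono; try pos.
  by lra.
 have q1 : q <= 1.
  have e1 : 1 = (1 : R) `^ b by rewrite powR1.
  by rewrite e1; apply: powR_mono; try pos; lra.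
 have yV : enorm y <= enorm y `^ b / q.
  have [y1|y1] := leP (enorm y) 1; first exact: le_trans yq.
  apply: le_trans (le1r_powR (ltW y1) (ltW b1)) _; rewrite ler_peMr // invf_ge1 //.
 apply: le_trans (_ : 2 * (C * U) + P * enorm y <= _).
  have h3 : `|dot p y| <= P * enorm y by apply: le_trans (dot_le _ _) _; rewrite
   ler_wpM2r ?enorm_ge0.
  apply: le_trans (ler_normB _ _) _; apply: lerD => //; apply: le_trans (ler_normB _ _)
   _.
  by have := uB x; have := uB (x + y); lra.
 apply: le_trans (far_arith _ P0 q0 yq yV (enorm_ge0 y)) _; first by pos.
 by rewrite -/A1 ler_wpM2r.
exists 0; first by rewrite enorm0.
move=> y; have t0 : 0 <= enorm y `^ b by pos.
have -> : dot 0 y = 0 by rewrite -(scale0r (0 : E)) dotZl mul0r.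
rewrite (uz x) ?subr0; last by lra.
have [hy|hy] := leP (enorm y) (d / 8).
 rewrite uz ?normr0; first exact: mulr_ge0 T0 t0.
 by have := ler_enormB x (x + y) z0; rewrite opprD addNKr enormN; lra.
have yq : 1 <= enorm y `^ b / q.
 rewrite ler_pdivlMr // mul1r; apply: powR_mono; try pos.
 by lra.
apply: le_trans (uB _) _; apply: le_trans (_ : A1 * enorm y `^ b <= _); last exact:
 ler_wpM2r.
have := far_arith (mulr_ge0 (ler0n R 2) CU0) P0 q0 yq (le_trans ler01 yq) (lexx 0);
 rewrite mulr0 addr0 -/A1.
by apply: le_trans; rewrite ler_peMl // ler1n.
Qed.

(** Contact is required on the whole space but with the cut-off function [u]; the equation is used
    only near the contact point, where [u] equals the solution [u0]. *)
Lemma lsol_of_solution Omega u0 u f z0 d A b lam U al : (0 < n)%N -> 1 < b < 2 -> n%:R * (2 - b) < 2 -> 0 < d -> 0 <= lam ->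
 psh Omega (EFin \o u0) -> MA_weak_solution Omega u0 f -> tay A b u -> (forall x, enorm (x - z0) <= d / 2 -> Omega x /\ u x = u0 x) ->
 (forall x, enorm (x - z0) <= d / 2 -> lam <= f x <= U /\ {for x, continuous f}) ->
 (forall x y, enorm (x - z0) <= d / 2 -> enorm (y - z0) <= d / 2 -> `|f x - f y| <= U * enorm (x - y) `^ al) ->
 lsol u f z0 (d / 4) A b lam U al.
Proof.
move=> n0 /andP[b1 b2] nb d0 lam0 pu ma tu uO fO hf.
have d42 : d / 4 < d / 2 by lra.
have inb x : enorm (x - z0) < d / 4 -> enorm (x - z0) <= d / 2 by move=> h; exact: ltW
 (lt_trans h d42).
have uO' x : enorm (x - z0) < d / 2 -> Omega x /\ u x = u0 x by move=> h; apply: uO;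
 exact: ltW.
have sb q x1 w : smooth q -> enorm (x1 - z0) < d / 2 -> (forall x, u x - q x <= u x1 - q
 x1) -> 0 <= levi (Hs q x1) w.
 exact: (submean w pu (tay_cont tu) uO').
have fO' x : enorm (x - z0) <= d / 2 -> 0 <= f x /\ {for x, continuous f}.
 by move=> h; have [/andP[h1 _] h2] := fO x h; split=> //; exact: le_trans h1.
have [us [dl [I_mu H]]] := approx_of_solution n0 b1 (ltW b2) nb tu uO d42 sb ma fO'.
split=> //.
- by move=> q x1 xi mu eta sq x1r mx eg e0 hm; exact: Vdet n0 H sq x1r mx eg e0 hm.
- move=> psi z s s' g0 ss zs [kc kp kI ks] g00 gf; apply: (Smaj_cv n0 H _ b1 tu ss zs kc
 kp kI ks g00 gf).
 by move=> q x1 w sq x1r mx; apply: sb => //; exact: lt_trans d42.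
- by move=> x h; have [] := fO x (inb x h).
- by move=> x y hx hy; apply: hf; exact: inb.
Qed.

Lemma three_arith (a c g h K e : R) : `|a - g| <= e -> `|c - h| <= e -> `|g - h| <= K -> `|a - c| <= K + e * 2.
Proof. by rewrite !ler_norml; lra. Qed.

Lemma derive_le u x y i (K rho : R) : 0 < rho -> derivable u x (de i) -> derivable u y (de i) ->
 (forall h : R, `|h| <= rho -> `|u (x + h *: de i) - u x - (u (y + h *: de i) - u y)| <= `|h| * K) ->
 `|D i u x - D i u y| <= K.
Proof.
move=> rho0 dx dy H.
have dq w : derivable u w (de i) -> forall e : R, 0 < e -> exists2 r : R, 0 < r & forall
 h, h != 0 -> `|h| < r -> `|D i u w - h^-1 * (u (w + h *: de i) - u w)| <= e.
 move=> dw e e0; move: (dw : cvg _) => /cvgrPdist_le/(_ e e0)[r r0 rH]; exists r => // h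
  h0 hr.
 by have := rH h; rewrite /= sub0r normrN => /(_ hr h0); rewrite /shift /= [_ *: _ +
  w]addrC.
apply: (@le_lim0 _ _ _ 2) => e /andP[e0 _].
have [r1 r10 P1] := dq x dx e e0; have [r2 r20 P2] := dq y dy e e0.
pose h := Num.min rho (Num.min r1 r2) / 2.
have mn0 : 0 < Num.min rho (Num.min r1 r2) by rewrite !lt_min rho0 r10.
have h0 : 0 < h by pos.
have hm : h < Num.min rho (Num.min r1 r2) by rewrite /h; lra.
move: (hm); rewrite !lt_min => /and3P[h1 h2 h3].
have hn : `|h| = h by rewrite gtr0_norm.
have := P1 h (lt0r_neq0 h0); rewrite hn => /(_ h2) q1.
have := P2 h (lt0r_neq0 h0); rewrite hn => /(_ h3) q2.
have := H h; rewrite hn => /(_ (ltW h1)) q3.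
set a := u (x + _) - u x in q1 q3; set c := u (y + _) - u y in q2 q3.
have q4 : `|h^-1 * a - h^-1 * c| <= K.
 by rewrite -mulrBr normrM gtr0_norm ?invr_gt0 // mulrC ler_pdivrMr // mulrC.
exact: three_arith q1 q2 q4.
Qed.

Lemma kappa_arith (al be : R) : (0 < n)%N -> 0 < al < 1 -> beta0 n al < be < 1 -> exists kp dp : R,
 [/\ 0 < kp, 0 <= dp /\ (n = 1 \/ 1 - be <= dp), 3 * kp <= al - (1 - be) - 2 * dp, 2 * kp <= 2 - al - n%:R * (1 - be) /\
  n%:R * (1 - be) < 2 & kp <= 2 * be /\ 0 < be].
Proof.
move=> n0 /andP[al0 al1] /andP[hb be1].
have N1 : 1 <= n%:R :> R by rewrite ler1n.
have Q0 : 0 < n%:R * (2 + al) - 1 by have := ler_wpM2l (ltW al0) N1; lra.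
have dE : (1 - be) * (n%:R * (2 + al) - 1) < al by rewrite -ltr_pdivlMr //; move: hb;
 rewrite /beta0; lra.
have de0 : 0 < 1 - be by pos.
have nd1 : n%:R * (1 - be) < 1.
 have h : 0 <= (1 - be) * (n%:R - 1) by pos.
 have h2 : 0 <= al * (n%:R * (1 - be)) by pos.
 by nra.
have dal : (1 - be) < al / 1 by have := ler_wpM2l (ltW de0) N1; nra.
have bh : 1 - be < 2^-1.
 have h := ler_wpM2l (ltW de0) N1; have h2 := ler_wpM2l (ltW al0) h; nra.
pose dp : R := if n == 1%N then 0 else 1 - be.
have dp0 : 0 <= dp by rewrite /dp; case: ifP => // _; exact: ltW.
have gap : 0 < al - (1 - be) - 2 * dp.
 rewrite /dp; case: eqP => n1; first by lra.
 have n2 : 2 <= n%:R :> R by rewrite ler_nat; case: (n) n0 n1 => [|[]].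
 have h := ler_wpM2l (ltW de0) n2; have h2 : 0 <= al * (n%:R * (1 - be)) by pos.
 by nra.
exists (Num.min ((al - (1 - be) - 2 * dp) / 3) (Num.min ((2 - al - n%:R * (1 - be)) / 2)
 2^-1)), dp.
have m1 (a c d : R) : 0 < a -> 0 < c -> 0 < d -> let k := Num.min (a / 3) (Num.min (c /
 2) d) in [/\ 0 < k, 3 * k <= a, 2 * k <= c & k <= d].
 move=> a0 c0 d0; have q : Num.min (a / 3) (Num.min (c / 2) d) <= Num.min (a / 3)
  (Num.min (c / 2) d) by [].
 move: q; rewrite {2}/Num.min => _; split.
 - by rewrite !lt_min !divr_gt0.
 - by rewrite -ler_pdivlMl // [3^-1 * a]mulrC ge_min lexx.
 - by rewrite -ler_pdivlMl // [2^-1 * c]mulrC !ge_min lexx !orbT.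
 - by rewrite !ge_min lexx !orbT.
have c0 : 0 < 2 - al - n%:R * (1 - be) by lra.
have [k1 k2 k3 k4] := m1 _ _ 2^-1 gap c0 ltac:(by rewrite invr_gt0).
split=> //.
- by split=> //; rewrite /dp; case: eqP => [->|_]; [left|right].
- by split=> //; lra.
- by split; [apply: le_trans k4 _; move: bh|move: bh]; lra.
Qed.

(** The second difference bound for the cut-off function, divided by the increment, becomes a
    Lipschitz bound for the derivatives of [u] by [derive_le]. *)
Lemma local_estimate (al be lam U d : R) : (0 < n)%N -> 0 < al < 1 -> beta0 n al < be < 1 -> 0 < lam -> 0 <= U -> 0 < d <= 1 ->
 exists2 C, 0 <= C & forall Omega u f z0, psh Omega (EFin \o u) -> MA_weak_solution Omega u f ->
  (forall x, enorm (x - z0) <= d -> Omega x) -> C1b u z0 d (1 + be) U ->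
  (forall x, enorm (x - z0) <= d -> lam <= f x <= U /\ {for x, continuous f}) ->
  (forall x y, enorm (x - z0) <= d -> enorm (y - z0) <= d -> `|f x - f y| <= U * enorm (x - y) `^ al) ->
  forall i x y, enorm (x - z0) <= d / 16 -> enorm (y - z0) <= d / 16 -> `|D i u x - D i u y| <= C * enorm (x - y).
Proof.
move=> n0 al01 hb lam0 U0 d01; have /andP[d0 d1] := d01; have /andP[al0 al1] := al01;
 have /andP[_ be1] := hb.
have [kp [dp [kp0 [dp0 ndp] H1 [H2 nb] [H3 be0]]]] := kappa_arith n0 al01 hb.
have dE : 2 - (1 + be) = 1 - be by ring.
have b12 : 1 < 1 + be < 2 by move: be0 be1; clear => *; apply/andP; split; lra.
have [A A0 HA] := tay_cutoff d01 b12 U0.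
have r00 : 0 < d / 4 by pos.
have al01' : 0 < al <= 1 by rewrite al0 ltW.
have H3' : kp <= 2 * (1 + be) - 2 by lra.
rewrite -!dE in H1 H2 nb ndp.
have [C C0 HC] := @second_difference_bound R n (1 + be) al lam U A kp dp (d / 4) n0 b12
 al01' kp0 lam0 U0 A0 dp0 ndp H1 H2 H3' r00.
exists C => // Omega u f z0 pu ma BO Hu Hf Hh i x y hx hy.
have [v tv vE] := HA u z0 Hu.
have d2 : d / 2 <= d by move: d0; clra.
have ls : lsol v f z0 (d / 4) A (1 + be) lam U al.
 apply: (lsol_of_solution n0 b12 nb d0 (ltW lam0) pu ma tv).
 - by move=> w hw; split; [apply: BO; exact: le_trans d2|exact: vE].
 - by move=> w hw; apply: Hf; exact: le_trans d2.
 - by move=> w w' hw hw'; apply: Hh; exact: le_trans d2.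
have dd w : enorm (w - z0) <= d / 16 -> derivable u w (de i).
 move=> hw; have wd : enorm (w - z0) <= d by move: hw d0; clra.
 by have [_ dw _ _] := Hu.1 w wd; exact: dw.
have d16 : 0 < d / 16 by pos.
apply: (derive_le d16 (dd x hx) (dd y hy)) => h hh.
have vu w : enorm (w - z0) <= d / 16 -> v w = u w /\ v (w + h *: de i) = u (w + h *: de
 i).
 move=> hw; split; apply: vE; first by move: hw d0; clra.
 rewrite addrAC; apply: le_trans (ler_enormD _ _) _; rewrite enormZ enorm_delta mulr1.
 by move: hw hh d0; clra.
have [<- <-] := vu x hx; have [<- <-] := vu y hy.
have h4 t : t <= d / 16 -> t <= d / 4 / 4 by move=> ht; apply: le_trans ht _; rewrite
 -mulrA -invfM -natrM.
by have := HC v f z0 ls i x y h (h4 _ hx) (h4 _ hy) (h4 _ hh); rewrite mulrCA.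
Qed.

End localization.

(** * Hoelder norms, compactness and the distance to the boundary *)

Section holder_norms.
Context {R : realType} {N : nat}.
Local Notation E := 'rV[R]_N.
Implicit Types (u : E -> R) (x y z : E) (K Omega : set E) (g M B : R).

Lemma le_tensor_norm k (a : seq 'I_N -> R) (s : k.-tuple 'I_N) : `|a s| <= tensor_norm k a.
Proof.
by rewrite -sqrtr_sqr ler_sqrt ?sumr_ge0 // => [|t _]; rewrite ?sqr_ge0 // (bigD1 s) //
 lerDl sumr_ge0 // => t _; exact: sqr_ge0.
Qed.

Lemma tensor_norm_le k (a : seq 'I_N -> R) B : 0 <= B -> (forall s : k.-tuple 'I_N, `|a s| <= B) ->
 tensor_norm k a <= #|{: k.-tuple 'I_N}|%:R * B.
Proof.
move=> B0 H; have c0 : 0 <= #|{: k.-tuple 'I_N}|%:R * B by pos.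
rewrite /tensor_norm -(ger0_norm c0) -sqrtr_sqr ler_sqrt ?sqr_ge0 //.
apply: le_trans (_ : \sum_(s : k.-tuple 'I_N) B ^+ 2 <= _).
 by apply: ler_sum => s _; rewrite -[_ ^+ 2]real_normK ?num_real // ler_sqr.
rewrite sumr_const -[B ^+ 2 *+ _]mulr_natl exprMn ler_wpM2r ?sqr_ge0 //.
by rewrite -natrX ler_nat -mulnn; case: #|_| => // c; rewrite leq_pmulr.
Qed.

Lemma sup_ge0_ub (A : set (\bar R)) t : A t -> (t <= sup_ge0 A)%E.
Proof. by move=> At; apply: le_ereal_sup_tmp; exists t => //; right. Qed.

Lemma sup_ge0_ge0 (A : set (\bar R)) : (0 <= sup_ge0 A)%E.
Proof. by apply: le_ereal_sup_tmp; exists 0%E => //; left. Qed.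

Lemma sup_ge0_le (A : set (\bar R)) t : (0 <= t)%E -> (forall s, A s -> (s <= t)%E) -> (sup_ge0 A <= t)%E.
Proof. by move=> t0 H; apply/ereal_supP => s [->//|]; exact: H. Qed.

Lemma holder_normP k g K u B : (holder_norm k g K u <= B%:E)%E ->
 (forall i x, (i <= k)%N -> K x -> nabla_norm i u x <= B) /\
 (forall x y, K x -> K y -> nabla_dist k u x y <= B * enorm (x - y) `^ g).
Proof.
rewrite /holder_norm => H; have S0 (F : 'I_k.+1 -> \bar R) : (forall i, (0 <= F i)%E) ->
 (0 <= \sum_(i < k.+1) F i)%E by move=> F0; apply: sume_ge0.
have P0 (i : 'I_k.+1) : (0 <= sup_ge0 [set (nabla_norm i u x)%:E | x in K])%E by exact:
 sup_ge0_ge0.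
have Q0 := @sup_ge0_ge0 [set (nabla_dist k u p.1 p.2 / enorm (p.1 - p.2) `^ g)%:E | p in
 [set p : E * E | [/\ K p.1, K p.2 & p.1 != p.2]]].
split=> [i x ik Kx|x y Kx Ky].
 rewrite -lee_fin; apply: le_trans H; apply: le_trans (leeDl _ Q0).
 rewrite (bigD1 (Ordinal (ik : (i < k.+1)%N))) //; apply: le_trans (leeDl _ _); last
  exact: sume_ge0.
 by apply: sup_ge0_ub; exists x.
have [->|xy] := eqVneq x y.
 rewrite subrr /nabla_dist /tensor_norm big1 ?sqrtr0 => [|s _]; last by rewrite subrr
  expr0n.
 rewrite mulr_ge0 ?powR_ge0 // -lee_fin; apply: le_trans H; apply: adde_ge0 => //;
  exact: S0.
have e0 : 0 < enorm (x - y).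
 by rewrite lt_def enorm_ge0 andbT; apply: contra_neq xy => /enorm_eq0/eqP; rewrite
  subr_eq0 => /eqP.
rewrite -ler_pdivrMr ?powR_gt0 // -lee_fin; apply: le_trans H; apply: le_trans (leeDr _
 (S0 _ P0)).
by apply: sup_ge0_ub; exists (x, y).
Qed.

Lemma holder_norm1_le K u B M : 0 <= B -> 0 <= M -> (forall i x, (i <= 1)%N -> K x -> nabla_norm i u x <= B) ->
 (forall x y, K x -> K y -> nabla_dist 1 u x y <= M * enorm (x - y) `^ 1) -> (holder_norm 1 1 K u <= (B + B + M)%:E)%E.
Proof.
move=> B0 M0 H1 H2; rewrite /holder_norm !EFinD; apply: leeD.
 rewrite big_ord_recr big_ord1; apply: leeD; apply: sup_ge0_le; rewrite // => s [x Kx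
  <-]; rewrite lee_fin; exact: H1.
apply: sup_ge0_le; rewrite // => s [[x y] [/= Kx Ky xy] <-]; rewrite lee_fin.
have e0 : 0 < enorm (x - y).
 by rewrite lt_def enorm_ge0 andbT; apply: contra_neq xy => /enorm_eq0/eqP; rewrite
  subr_eq0 => /eqP.
by rewrite ler_pdivrMr ?powR_gt0 //; exact: H2.
Qed.

(** [unif_cont_compact] for the indicator function of [Omega], which is continuous at the points of
    [K] because [Omega] is open. *)
Lemma compact_interior K Omega : compact K -> open Omega -> K `<=` Omega ->
 exists2 r : R, 0 < r & forall x y, K x -> enorm (y - x) < r -> Omega y.
Proof.
move=> cK oO KO; pose ind y : R := if pselect (Omega y) then 1 else 0.
have ind1 y : Omega y -> ind y = 1 by rewrite /ind; case: pselect.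
have ci x : K x -> {for x, continuous ind}.
 move=> Kx; apply/cont_enormP => e e0; have /nbhs_enormP[d d0 dH] : nbhs x Omega by
  apply: open_nbhs_nbhs; split=> //; exact: KO.
 by exists d => // y /dH Oy; rewrite !ind1 ?subrr ?normr0 //; exact: KO.
have [d d0 dH] := unif_cont_compact cK ci ltr01; exists d => // x y Kx yx.
have := dH x y Kx yx; rewrite (ind1 x (KO x Kx)) /ind; case: (pselect (Omega y)) =>
 [//|nO].
by rewrite sub0r normrN normr1 ltxx.
Qed.

(* The segment from z to y is connected, so that it meets the boundary of
 Omega if it leaves Omega. *)
Lemma ball_sub_dist K Omega (d : R) z y : open Omega -> K z -> Omega z -> (d%:E < dist_boundary K Omega)%E ->
 enorm (y - z) <= d -> Omega y.
Proof.
move=> oO Kz Oz dd yz; pose ga (t : R) : E := z + t *: (y - z).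
have cg : continuous ga.
 by move=> t; apply: cvgD; [exact: cvg_cst|apply: cvgZr_tmp; exact: cvg_id].
have nb t : `[0, 1]%classic t -> ~ (closure Omega (ga t) /\ closure (~` Omega) (ga t)).
 rewrite /= in_itv => /andP[t0 t1] bt; have : (dist_boundary K Omega <= (enorm (z - ga
  t))%:E)%E.
  by apply: ge_ereal_inf; exists (enorm (z - ga t))%:E => //; exists (z, ga t).
 have e1 : enorm (z - ga t) <= d.
  rewrite /ga opprD addrA subrr sub0r enormN enormZ ger0_norm //; apply: le_trans yz.
  by rewrite ler_piMl ?enorm_ge0.
 by move=> /(lt_le_trans dd); rewrite lte_fin ltNge e1.
(* No point of the segment is a boundary point, so along it [Omega] and its closure agree: their
   trace is both open and closed. *)
have EB : `[0, 1]%classic `&` ga @^-1` Omega = `[0 : R, 1]%classic `&` ga @^-1` (closure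
 Omega).
 apply/seteqP; split=> t [t01 Ot]; split=> //; first exact: subset_closure.
 by apply: contrapT => nO; apply: (nb t t01); split=> //; apply: subset_closure.
have : `[0, 1]%classic `&` ga @^-1` Omega = `[0 : R, 1]%classic.
 apply: segment_connected.
 - by exists 0; split; rewrite /= ?in_itv /= ?lexx ?ler01 // /ga scale0r addr0.
 - by exists (ga @^-1` Omega) => //; move/continuousP : cg; apply.
 - by exists (ga @^-1` (closure Omega)) => //; move/continuous_closedP : cg; apply;
  exact: closed_closure.
move=> /seteqP[_ /(_ 1)]; rewrite /= in_itv /= ler01 lexx => /(_ isT)[_].
by rewrite /ga scale1r addrC subrK.
Qed.

(** A boundary point too close to [K] would have points outside [Omega] near it that are still too
    close to [K], against [compact_interior]. *)
Lemma dist_boundary_gt0 K Omega : compact (closure K) -> open Omega -> closure K `<=` Omega -> (0 < dist_boundary K Omega)%E.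
Proof.
move=> cK oO KO; have [r r0 rH] := compact_interior cK oO KO.
apply: (@lt_le_trans _ _ r%:E); first by [].
apply/ereal_infP => _ [[x y] [/= Kx [_ cy]] <-]; rewrite lee_fin leNgt; apply/negP =>
 xy.
have nb : nbhs y [set w | enorm (w - x) < r].
 apply/nbhs_enormP; exists (r - enorm (x - y)); first by pos.
 by move=> w hw /=; have := ler_enormB w y x; rewrite (enormB y x); lra.
have [w [nO wx]] := cy _ nb; apply: nO; apply: rH wx; exact: subset_closure.
Qed.

Lemma dpart0 u x : nabla_norm 0 u x = `|u x|.
Proof.
rewrite /nabla_norm /tensor_norm (eq_bigr (fun=> u x ^+ 2)) => [|s _]; last by rewrite
 (tuple0 s).
by rewrite sumr_const card_tuple expn0 mulr1n sqrtr_sqr.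
Qed.

Lemma nabla_dist0 u x y : nabla_dist 0 u x y = `|u x - u y|.
Proof.
rewrite /nabla_dist /tensor_norm (eq_bigr (fun=> (u x - u y) ^+ 2)) => [|s _]; last by
 rewrite (tuple0 s).
by rewrite sumr_const card_tuple expn0 mulr1n sqrtr_sqr.
Qed.

Lemma nabla_norm1 u x i : `|D i u x| <= nabla_norm 1 u x.
Proof. exact: (le_tensor_norm (fun s => dpart s u x) [tuple i]). Qed.

Lemma nabla_dist1 u x y i : `|D i u x - D i u y| <= nabla_dist 1 u x y.
Proof. exact: (le_tensor_norm (fun s => dpart s u x - dpart s u y) [tuple i]). Qed.

Lemma nabla_dist1_le u x y B : 0 <= B -> (forall i, `|D i u x - D i u y| <= B) ->
 nabla_dist 1 u x y <= #|{: 1.-tuple 'I_N}|%:R * B.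
Proof. by move=> B0 H; apply: tensor_norm_le => // s; case/tupleP: s => i s; rewrite
 (tuple0 s); exact: H. Qed.

(* Compactness turns local Lipschitz bounds into a uniform one. *)
Lemma locally_lipschitz_compact K u : compact K -> (forall x i, K x -> {for x, continuous (D i u)}) ->
 (forall x0, K x0 -> exists C, exists2 rho : R, 0 < rho & forall x y i, enorm (x - x0) <= rho -> enorm (y - x0) <= rho ->
  `|D i u x - D i u y| <= C * enorm (x - y)) ->
 exists M, forall x y, K x -> K y -> nabla_dist 1 u x y <= M * enorm (x - y) `^ 1.
Proof.
move=> cK cD H.
have /compact_near_coveringP/(_ R (0^'+) (fun t x => forall y, enorm (y - x) < t ->
 forall i, `|D i u x - D i u y| <= t^-1 * enorm (x - y)) _) : compact K := cK.
case.
 move=> x Kx; have [C [rho rho0 HC]] := H x Kx.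
 have t0 : 0 < Num.min (rho / 2) (`|C| + 1)^-1 by rewrite lt_min divr_gt0 // invr_gt0
  ltr_wpDl.
 exists ([set y | enorm (y - x) < rho / 2], [set t | 0 < t < Num.min (rho / 2) (`|C| +
  1)^-1]) => /=.
  split; first by apply/nbhs_enormP; exists (rho / 2) => //; rewrite divr_gt0.
  by apply: filterS2 (nbhs_right_gt 0) (nbhs_right_lt t0) => t /= -> ->.
 move=> [y t] /= [yx /andP[tp]]; rewrite lt_min => /andP[td tC] z zy i.
 have h1 : enorm (z - x) <= rho by have := ler_enormB z y x; lra.
 have h2 : enorm (y - x) <= rho by lra.
 apply: le_trans (HC y z i h2 h1) _; apply: ler_wpM2r; first exact: enorm_ge0.
 apply: le_trans (ler_norm C) _; apply: le_trans (_ : `|C| + 1 <= _); first by rewrite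
  lerDl.
 by rewrite -[X in X <= _]invrK lef_pV2 ?posrE // ltW.
move=> t t0 Ht.
have tt : 0 < t / 2 by pos.
have Hu x y : K x -> enorm (y - x) < t / 2 -> forall i, `|D i u x - D i u y| <= (t /
 2)^-1 * enorm (x - y).
 move=> Kx yx; apply: (Ht (t / 2)) => //=.
 by rewrite sub0r normrN gtr0_norm // ltr_pdivrMr // ltr_pMr // ltr1n.
(* Pairs at distance at least [t / 2] are handled by the boundedness of the derivatives on [K]. *)
have near i := compact_bound cK (fun x Kx => cD x i Kx).
have [B HB] := choice2 near.
have B0 i : 0 <= B i by case: (HB i).
pose S := \sum_i B i; have S0 : 0 <= S by pos.
exists (#|{: 1.-tuple 'I_N}|%:R * (1 + 2 * S) * (t / 2)^-1) => x y Kx Ky.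
rewrite powRr1 ?enorm_ge0 // -!mulrA; apply: nabla_dist1_le => [|i].
 by pos.
have T0 : 0 <= (t / 2)^-1 * enorm (x - y) by pos.
have [h|h] := ltP (enorm (y - x)) (t / 2).
 by apply: le_trans (Hu x y Kx h i) _; rewrite mulrDl mul1r lerDl mulr_ge0 // mulr_ge0.
have T1 : 1 <= (t / 2)^-1 * enorm (x - y) by rewrite mulrC ler_pdivlMr // mul1r enormB.
have BS : B i <= S by rewrite /S (bigD1 i) // lerDl sumr_ge0.
apply: le_trans (ler_normB _ _) _; have [_ Hi] := HB i.
apply: le_trans (_ : 2 * S <= _); first by have := Hi x Kx; have := Hi y Ky; lra.
apply: le_trans (_ : (1 + 2 * S) * 1 <= _); first by rewrite mulr1 lerDr.
by rewrite ler_wpM2l // addr_ge0 // mulr_ge0.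
Qed.

End holder_norms.

(** * Interior regularity and the quantitative estimate *)

Section interior_regularity.
Context {R : realType} {n : nat}.
Local Notation E := 'rV[R]_(n + n).
Implicit Types (u f : E -> R) (x y z : E) (Omega K : set E).

Lemma C1b_class Omega u z0 (d be U : R) : is_Ck 1 Omega u -> (forall x, enorm (x - z0) <= d -> Omega x) ->
 (forall x, enorm (x - z0) <= d -> `|u x| <= U /\ forall i, `|D i u x| <= U) ->
 (forall x y, enorm (x - z0) <= d -> enorm (y - z0) <= d -> nabla_dist 1 u x y <= U * enorm (x - y) `^ be) -> C1b u z0 d (1 + be) U.
Proof.
move=> [c1 c2] BO H1 H2; split=> [x xd|x y i xd yd].
 have [h1 h2] := H1 x xd; split=> //; first exact: (c1 [::] x isT (BO x xd)).
 by move=> i; exact: (c2 [::] i x isT (BO x xd)).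
by rewrite [1 + be]addrC addrK; exact: le_trans (nabla_dist1 u x y i) (H2 x y xd yd).
Qed.

Lemma local_C11 Omega (al lam be : R) f u x0 : (0 < n)%N -> open Omega -> 0 < al < 1 -> 0 < lam -> holder_class 0 al Omega f ->
 (forall z, Omega z -> lam <= f z) -> psh Omega (EFin \o u) -> MA_weak_solution Omega u f -> beta0 n al < be < 1 ->
 holder_class 1 be Omega u -> Omega x0 ->
 exists C, exists2 rho : R, 0 < rho & forall x y i, enorm (x - x0) <= rho -> enorm (y - x0) <= rho ->
  `|D i u x - D i u y| <= C * enorm (x - y).
Proof.
move=> n0 oO al01 lam0 [[cf _] hf] fl pu ma hb [Cu hu] Ox.
have /nbhs_enormP[r r0 rH] : nbhs x0 Omega by apply: open_nbhs_nbhs.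
pose d := Num.min 1 (r / 2); have d0 : 0 < d by rewrite lt_min ltr01 divr_gt0.
have d1 : d <= 1 by rewrite ge_min lexx.
have dr : d < r by apply: le_lt_trans (_ : d <= r / 2) _; [rewrite ge_min lexx
 orbT|rewrite ltr_pdivrMr // ltr_pMr // ltr1n].
pose B : set E := [set x | enorm (x - x0) <= d].
have cB : compact B by exact: compact_cball.
have BO : B `<=` Omega by move=> x hx; apply: rH; exact: le_lt_trans dr.
have [c1 c2] := Cu.
have [U1 U10 H1] := compact_bound cB (fun x Bx => c1 [::] x isT (BO x Bx)).
have near i := compact_bound cB (fun x Bx => c1 [:: i] x isT (BO x Bx)).
have [U2 HU2] := choice2 near.
have U20 i : 0 <= U2 i by case: (HU2 i).
have [U3 H3] := hu B cB BO.
have [U4 U40 H4] := compact_bound cB (fun x Bx => cf [::] x isT (BO x Bx)).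
have [U5 H5] := hf B cB BO.
pose U := U1 + \sum_i U2 i + `|U3| + U4 + `|U5|.
have S0 : 0 <= \sum_i U2 i by pos.
have [q0 q1 q2 q3 q4] : [/\ 0 <= U, U1 <= U, \sum_i U2 i <= U /\ `|U3| <= U, U4 <= U &
 `|U5| <= U].
 have := normr_ge0 U3; have := normr_ge0 U5; rewrite /U; move: (\sum_i _) `|U3| `|U5|
  U10 U40 S0; clear => *; split; lra.
have d01 : 0 < d <= 1 by rewrite d0.
have [C C0 HC] := local_estimate n0 al01 hb lam0 q0 d01.
exists C, (d / 16); first by pos.
move=> x y i; apply: (HC Omega u f x0 pu ma BO).
- apply: C1b_class Cu BO _ _ => [z hz|z z' hz hz'].
  split=> [|j]; first exact: le_trans (H1 z hz) q1.
  have [_ Hj] := HU2 j; apply: le_trans (Hj z hz) _; apply: le_trans q2.1; by rewrite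
   (bigD1 j) // lerDl sumr_ge0.
 apply: le_trans (H3 z z' hz hz') _; rewrite ler_wpM2r ?powR_ge0 //; exact: le_trans
  (ler_norm _) q2.2.
- move=> z hz; split; last exact: (cf [::] z isT (BO z hz)).
 by apply/andP; split; [apply: fl; exact: BO|exact: le_trans (ler_norm _) (le_trans (H4
  z hz) q3)].
- move=> z z' hz hz'; rewrite -nabla_dist0; apply: le_trans (H5 z z' hz hz') _.
 by rewrite ler_wpM2r ?powR_ge0 //; exact: le_trans (ler_norm _) q4.
Qed.

Lemma quantitative_C11 (al be lam U d : R) : (0 < n)%N -> 0 < al < 1 -> beta0 n al < be < 1 -> 0 < lam -> 0 <= U -> 0 < d <= 1 ->
 exists C : R, forall Omega u f K, (forall z x, K z -> enorm (x - z) <= d -> Omega x) -> is_Ck 1 Omega u -> is_Ck 0 Omega f ->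
  (forall z, Omega z -> lam <= f z) -> psh Omega (EFin \o u) -> MA_weak_solution Omega u f ->
  (holder_norm 1 be Omega u <= U%:E)%E -> (holder_norm 0 al Omega f <= U%:E)%E -> (holder_norm 1 1 K u <= C%:E)%E.
Proof.
move=> n0 al01 hb lam0 U0 d01; have /andP[d0 d1] := d01; have [C C0 HC] :=
 local_estimate n0 al01 hb lam0 U0 d01.
(* Pairs closer than [d / 16] fall under [local_estimate]; for the others the derivatives differ by
   at most [2 * U], while the distance is at least [d / 16]. *)
pose M := #|{: 1.-tuple 'I_(n + n)}|%:R * (C + 2 * U * (16 / d)).
have CU : 0 <= 2 * U * (16 / d) by pos.
exists (U + U + M) => Omega u f K BO Cu [cf _] fl pu ma /holder_normP[h1 h2]
 /holder_normP[h3 h4].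
have KO z : K z -> Omega z by move=> Kz; apply: (BO z z Kz); rewrite subrr enorm0 ltW.
apply: holder_norm1_le => //; first by pos.
 by move=> i x i1 Kx; apply: h1 => //; exact: KO.
move=> x y Kx Ky; rewrite powRr1 ?enorm_ge0 // -mulrA; apply: nabla_dist1_le => [|i].
 by pos.
have [h|h] := leP (enorm (y - x)) (d / 16).
 apply: le_trans (_ : C * enorm (x - y) <= _); last by rewrite ler_wpM2r ?enorm_ge0 //
  lerDl.
 apply: (HC Omega u f x pu ma (fun w => BO x w Kx)) => //; last by rewrite subrr enorm0
  divr_ge0 // ltW.
 - apply: C1b_class Cu (fun w => BO x w Kx) _ _ => [z hz|z z' hz hz'].
   have Oz := BO x z Kx hz; split=> [|j]; first by rewrite -dpart0; exact: h1.
   by apply: le_trans (nabla_norm1 u z j) _; exact: h1.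
  by apply: h2; exact: BO Kx _.
 - move=> z hz; have Oz := BO x z Kx hz; split; last exact: (cf [::] z isT Oz).
  by apply/andP; split; [exact: fl|apply: le_trans (ler_norm _) _; rewrite -dpart0;
   exact: h3].
 - by move=> z z' hz hz'; rewrite -nabla_dist0; apply: h4; exact: BO Kx _.
have Ox := KO x Kx; have Oy := KO y Ky; apply: le_trans (ler_normB _ _) _.
apply: le_trans (_ : 2 * U * ((16 / d) * enorm (x - y)) <= _); last first.
 by rewrite mulrA ler_wpM2r ?enorm_ge0 // lerDr.
apply: le_trans (_ : 2 * U * 1 <= _).
 have a1 := le_trans (nabla_norm1 u x i) (h1 1%N x isT Ox); have a2 := le_trans
  (nabla_norm1 u y i) (h1 1%N y isT Oy).
 by lra.
apply: ler_wpM2l; first by pos.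
by rewrite -ler_pdivrMl ?divr_gt0 // mulr1 invf_div enormB ltW.
Qed.

End interior_regularity.

Theorem theorem3p1 (R : realType) :
 exists C : forall (n : nat) (alpha beta lambda norm_u norm_f : R)
       (dist : \bar R), R,
 forall (n : nat) (Omega : set (Cspace R n)) (alpha lambda beta : R)
    (f u : Cspace R n -> R),
  (0 < n)%N ->
  is_domain Omega ->
  0 < alpha < 1 ->
  0 < lambda ->
  holder_class 0 alpha Omega f ->
  (forall z, Omega z -> lambda <= f z) ->
  psh Omega (EFin \o u) ->
  (forall z, Omega z -> {for z, continuous u}) ->
  MA_weak_solution Omega u f ->
  beta0 n alpha < beta < 1 ->
  holder_class 1 beta Omega u ->
  holder_class 1 1 Omega u /\
  forall K : set (Cspace R n),
   compact (closure K) -> closure K `<=` Omega ->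
   (holder_norm 1 beta Omega u < +oo)%E ->
   (holder_norm 0 alpha Omega f < +oo)%E ->
   (holder_norm 1 1 K u <=
   (C n alpha beta lambda (fine (holder_norm 1 beta Omega u))
     (fine (holder_norm 0 alpha Omega f)) (dist_boundary K Omega))%:E)%E.
Proof.
(* The constant is chosen for each tuple of parameters at once, which is possible because [bound]
   quantifies over all domains, functions and sets with these data. For inadmissible parameters any
   value serves. *)
pose bound (n : nat) (al be lam nu nf : R) (dist : \bar R) (C : R) := (0 < n)%N -> 0 <
 al < 1 -> beta0 n al < be < 1 -> 0 < lam -> (0 < dist)%E -> forall Omega u f (K : set
 (Cspace R n)), open Omega -> K `<=` Omega -> dist_boundary K Omega = dist -> is_Ck 1
 Omega u -> is_Ck 0 Omega f -> (forall z, Omega z -> lam <= f z) -> psh Omega (EFin \o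
 u) -> MA_weak_solution Omega u f -> (holder_norm 1 be Omega u <= nu%:E)%E ->
 (holder_norm 0 al Omega f <= nf%:E)%E -> (holder_norm 1 1 K u <= C%:E)%E.
have ex (p : nat * R * R * R * R * R * \bar R) : exists C, bound p.1.1.1.1.1.1
 p.1.1.1.1.1.2 p.1.1.1.1.2 p.1.1.1.2 p.1.1.2 p.1.2 p.2 C.
 case: p => [[[[[[n al] be] lam] nu] nf] dist] /=; rewrite /bound.
 case: (pselect [/\ (0 < n)%N, 0 < al < 1, beta0 n al < be < 1, 0 < lam & (0 < dist)%E])
  => [[n0 al01 hb lam0 dist0]|no]; last first.
  by exists 0 => *; case: no; split.
 (* The distance may be infinite. Any [d] in (0, 1] strictly below it works, since by
    [ball_sub_dist] the closed balls of radius [d] centred in [K] lie in [Omega]. *)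
 have [d d01 dd] : exists2 d : R, 0 < d <= 1 & (d%:E < dist)%E.
  case: dist dist0 => [t| |] // t0; last by exists 1; rewrite ?ltr01 ?lexx ?ltry.
  rewrite lte_fin in t0; exists (Num.min 1 (t / 2)); first by rewrite lt_min ltr01
   divr_gt0 //= ge_min lexx.
  by rewrite lte_fin gt_min ltr_pdivrMr // ltr_pMr // ltr1n orbT.
 have U0 : 0 <= `|nu| + `|nf| by exact: addr_ge0.
 have [C HC] := @quantitative_C11 R n al be lam _ d n0 al01 hb lam0 U0 d01.
 exists C => _ _ _ _ _ Omega u f K oO KO KE Cu Cf fl pu ma hu hf; apply: (HC Omega u f K
  _ Cu Cf fl pu ma).
 - by move=> z x Kz xz; apply: (@ball_sub_dist _ _ K Omega d z x oO Kz (KO z Kz));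
  rewrite ?KE.
 - by apply: le_trans hu _; rewrite lee_fin; apply: le_trans (ler_norm _) _; rewrite
  lerDl.
 - by apply: le_trans hf _; rewrite lee_fin; apply: le_trans (ler_norm _) _; rewrite
  lerDr.
have [C HC] := choice ex.
exists (fun n al be lam nu nf dist => C (n, al, be, lam, nu, nf, dist)).
move=> n Omega al lam be f u n0 [oO _ _] al01 lam0 hf fl pu _ ma hb hu; have [Cu _] :=
 hu; have [Cf _] := hf.
split.
 split=> // K cK KO; apply: locally_lipschitz_compact => // [x i Kx|x0 Kx0].
  by apply: (Cu.1 [:: i] x isT); exact: KO.
 by apply: (local_C11 n0 oO al01 lam0 hf fl pu ma hb hu); exact: KO.
move=> K cK KO nu nf.
have fin (k : nat) (g : R) (v : Cspace R n -> R) : (holder_norm k g Omega v < +oo)%E ->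
 (holder_norm k g Omega v <= (fine (holder_norm k g Omega v))%:E)%E.
 move=> lt; rewrite fineK // ge0_fin_numE // /holder_norm; apply: adde_ge0; last exact:
  sup_ge0_ge0.
 by apply: sume_ge0 => i _; exact: sup_ge0_ge0.
apply: (HC (n, al, be, lam, fine (holder_norm 1 be Omega u), fine (holder_norm 0 al
 Omega f), dist_boundary K Omega) n0 al01 hb lam0 (dist_boundary_gt0 cK oO KO) Omega u f
 K oO) => //.
- by move=> z Kz; apply: KO; exact: subset_closure.
- exact: fin.
- exact: fin.
Qed.
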